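(* In the block Markov chain asymptotic setting (see context), assume $\lim_{d\to\infty}d\ln(d)^4/n=0$. Then $\|M\|$, with $M:=\sqrt{d/n}\,(\hat N-\mathbb E\hat N)$, converges in probability to $$\mathfrak m:=\inf_{x\in\mathbb R^{2K}_{>0}}\max_{1\le i\le 2K}\Bigl\{\frac1{x_i}+\sum_{j=1}^{2K}c_{i,j}x_j\Bigr\},$$ where $c_{i,j}:=\alpha_i^{-1}\pi_i\mathbf p_{i,j-K}$ if $i\le K<j$; $c_{i,j}:=\alpha_{i-K}^{-1}\pi_j\mathbf p_{j,i-K}$ if $j\le K<i$; and $c_{i,j}:=0$ otherwise.
   Context: Block Markov chain: integers $d\ge K\ge1$, a partition $\mathcal V_1,\dots,\mathcal V_K$ of $\{1,\dots,d\}$ into nonempty sets, and the transition matrix $\mathbf p\in[0,1]^{K\times K}$ of an ergodic Markov chain on $\{1,\dots,K\}$ with equilibrium distribution $\pi$. $(Z_t)_{t=1}^n$ is the Markov chain on $\{1,\dots,d\}$ with $\mathbb P(Z_t=j\mid Z_{t-1}=i)=\mathbf p_{k,m}/\#\mathcal V_m$ for $i\in\mathcal V_k$, $j\in\mathcal V_m$, started in equilibrium ($\mathbb P(Z_1=i)=\pi_k/\#\mathcal V_k$ for $i\in\mathcal V_k$). Sample frequency matrix: $\hat N_{i,j}:=\sum_{t=1}^{n-1}\mathbb 1\{Z_t=i,Z_{t+1}=j\}$. Asymptotic setting: $K$ and $\mathbf p$ are fixed while $n$ and the partition depend on $d\to\infty$, and there are strictly positive rational numbers $\alpha_1,\dots,\alpha_K$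 with $\#\mathcal V_k/d\to\alpha_k$ for every $k$. *)

(* Defs.v *)
From HB Require Import structures.
From mathcomp Require Import all_boot all_order all_algebra.
From mathcomp Require Import all_classical all_reals all_analysis.
Import Order.TTheory GRing.Theory Num.Theory.
Local Open Scope ring_scope.

Section BlockMarkov.
Variable R : realType.

Definition mxpow (K : nat) (p : 'M[R]_K) (m : nat) : 'M[R]_K :=
  iter m (fun A => A *m p) 1%:M.

Definition stochastic (K : nat) (p : 'M[R]_K) : Prop :=
  (forall i j, 0 <= p i j <= 1) /\ (forall i, \sum_j p i j = 1).

Definition irreducible_chain (K : nat) (p : 'M[R]_K) : Prop :=
  forall i j, exists m : nat, 0 < mxpow K p m i j.

Definition aperiodic_chain (K : nat) (p : 'M[R]_K) : Prop :=
  forall i (t : nat), (1 < t)%N ->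
    ~ (forall m : nat, 0 < mxpow K p m i i -> (t %| m)%N).

Definition ergodic_chain (K : nat) (p : 'M[R]_K) : Prop :=
  stochastic K p /\ irreducible_chain K p /\ aperiodic_chain K p.

Definition equilibrium (K : nat) (p : 'M[R]_K) (pi : 'I_K -> R) : Prop :=
  (forall k, 0 <= pi k) /\ (\sum_k pi k = 1) /\
  (forall m, \sum_k pi k * p k m = pi m).

(* The partition V_1..V_K of {1..d} is given by the block map part : 'I_d -> 'I_K,
   V_k = part^{-1}(k). *)
Definition block_size (K d : nat) (part : 'I_d -> 'I_K) (k : 'I_K) : nat :=
  #|[set i | part i == k]|.

Definition block_trans (K d : nat) (part : 'I_d -> 'I_K) (p : 'M[R]_K)
  (i j : 'I_d) : R :=
  p (part i) (part j) / (block_size K d part (part j))%:R.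

Definition block_init (K d : nat) (part : 'I_d -> 'I_K) (pi : 'I_K -> R)
  (i : 'I_d) : R :=
  pi (part i) / (block_size K d part (part i))%:R.

(* Probability that (Z_1, ..., Z_n) = z  (time t+1 is the ordinal t). *)
Definition path_prob (K d n : nat) (part : 'I_d -> 'I_K) (p : 'M[R]_K)
  (pi : 'I_K -> R) (z : {ffun 'I_n -> 'I_d}) : R :=
  (\prod_(s : 'I_n | val s == 0%N) block_init K d part pi (z s)) *
  \prod_(s : 'I_n) \prod_(t : 'I_n | val t == (val s).+1)
      block_trans K d part p (z s) (z t).

Definition Nhat (d n : nat) (z : {ffun 'I_n -> 'I_d}) : 'M[R]_d :=
  \matrix_(i, j) \sum_(s : 'I_n) \sum_(t : 'I_n | val t == (val s).+1)
      ((z s == i) && (z t == j))%:R.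

Definition prob_event (K d n : nat) (part : 'I_d -> 'I_K) (p : 'M[R]_K)
  (pi : 'I_K -> R) (E : pred {ffun 'I_n -> 'I_d}) : R :=
  \sum_(z | E z) path_prob K d n part p pi z.

Definition ENhat (K d n : nat) (part : 'I_d -> 'I_K) (p : 'M[R]_K)
  (pi : 'I_K -> R) : 'M[R]_d :=
  \sum_(z : {ffun 'I_n -> 'I_d}) path_prob K d n part p pi z *: Nhat d n z.

Definition Mmat (K d n : nat) (part : 'I_d -> 'I_K) (p : 'M[R]_K)
  (pi : 'I_K -> R) (z : {ffun 'I_n -> 'I_d}) : 'M[R]_d :=
  Num.sqrt (d%:R / n%:R) *: (Nhat d n z - ENhat K d n part p pi).

Definition eucl_norm (d : nat) (x : 'cV[R]_d) : R :=
  Num.sqrt (\sum_i x i 0 ^+ 2).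

Definition opnorm (d : nat) (A : 'M[R]_d) : R :=
  sup [set r : R | exists x : 'cV[R]_d, eucl_norm d x <= 1 /\ r = eucl_norm d (A *m x)].

Definition ccoef (K : nat) (alpha : 'I_K -> R) (p : 'M[R]_K) (pi : 'I_K -> R)
  (i j : 'I_(K + K)) : R :=
  match fintype.split i, fintype.split j with
  | inl a, inr b => (alpha a)^-1 * pi a * p a b
  | inr a, inl b => (alpha a)^-1 * pi b * p b a
  | _, _ => 0
  end.

(* The limit frak m. The max of the 2K positive values is taken with initial 0. *)
Definition frak_m (K : nat) (alpha : 'I_K -> R) (p : 'M[R]_K) (pi : 'I_K -> R) : R :=
  inf [set r : R | exists x : 'I_(K + K) -> R, (forall i, 0 < x i) /\
       r = \big[Num.max/0]_(i < K + K)
             ((x i)^-1 + \sum_(j < K + K) ccoef K alpha p pi i j * x j)].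

End BlockMarkov.

Arguments mxpow {R K} p m.
Arguments stochastic {R K} p.
Arguments irreducible_chain {R K} p.
Arguments aperiodic_chain {R K} p.
Arguments ergodic_chain {R K} p.
Arguments equilibrium {R K} p pi.
Arguments block_size {K d} part k.
Arguments block_trans {R K d} part p i j.
Arguments block_init {R K d} part pi i.
Arguments path_prob {R K d} n part p pi z.
Arguments Nhat {R d n} z.
Arguments prob_event {R K d} n part p pi E.
Arguments ENhat {R K d} n part p pi.
Arguments Mmat {R K d} n part p pi z.
Arguments eucl_norm {R d} x.
Arguments opnorm {R d} A.
Arguments ccoef {R K} alpha p pi i j.
Arguments frak_m {R K} alpha p pi.

(* Main.v *)
Require Import Defs.
From HB Require Import structures.
From mathcomp Require Import all_boot all_order all_algebra.
From mathcomp Require Import all_classical all_reals all_analysis.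
From mathcomp Require Import ring lra zify.
Import Order.TTheory GRing.Theory Num.Theory numFieldNormedType.Exports.
Set Implicit Arguments.
Unset Strict Implicit.
Unset Printing Implicit Defensive.
Local Open Scope classical_set_scope.
Local Open Scope ring_scope.

(** Proof idea.  Condition on the sequence of clusters: the states Z_t are then independent,
Z_t being uniform on the current block.  The hermitization of the conditionally centred
matrix is a sum over transitions.  Deleting every L-th transition turns it into a sum of
independent small blocks, and the deleted transitions form another, sparse, such sum whose
norm is small for large L.  For the main part H, let tau_I(H^(2k)) be the average of the
diagonal entries of H^(2k) over block I.  Expanding to second order in one block of
transitions gives
   E tau_I(H^(2k+2)) = sum_J c_IJ sum_(a+b=k) E tau_J(H^(2a)) E tau_I(H^(2b)) + error,
for k up to a multiple of ln d.  If 1/x_I + sum_J c_IJ x_J <= lam then induction bounds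
sum_k E tau_I(H^(2k)) lam^(-2k-1) by x_I, hence the norm by lam up to o(1) (Markov's
inequality for the trace).  Conversely the moments converge for fixed k and concentrate, and
if they were all at most lam^(2k) then x_I = sum_k m_k^I z^(-2k-1) would show that the
infimum is at most any z > lam.  The directions of the block means, which H does not
centre, are treated separately: on them the powers of H also obey the recursion.  Finally
the transition counts of the cluster chain have variance O(n), by Poisson's equation, so the
conditional centring and the true one differ by a matrix of norm o(1). *)

(** * Euclidean norm and operator norm *)

Section LinAlg.
Variables (R : realType).
Local Notation nrm := eucl_norm.

(** The obstacle is the length of the powers. Moments of order [m] of size [ln d] are needed, and
    bounding the effect of one block of transitions by operator norms would lose a factor [d],
    because a trace is [d] times a block average. The remedy is delocalisation: the vectors of a
    block are independent of the matrix without that block, so the growth of their iterates is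
    governed by block averages, and log-convexity in the exponent spreads this over all shorter
    powers ([Gam], [deloc]). All errors are then relative and of size [eps m], that is
    [r * m ^ 2 + m ^ 3 / sqrt d] with [r = sqrt (d / n)]. With [m] of order [ln d], the first term
    vanishes exactly when [d * ln d ^ 4 / n] does; this is the origin of the fourth power. Each step
    of the recursion removes a block, so the bounds must hold for all subfamilies of transitions at
    once. The difference between the full matrix [HF] and its compression [HP] has bounded rank and
    norm of order one. It cannot be dropped, which is why the block means need a recursion of their
    own; a fixed power suffices there, since polynomial factors disappear under a high root. *)

Definition dot n (x y : 'cV[R]_n) : R := \sum_i x i 0 * y i 0.

Lemma dotC n (x y : 'cV[R]_n) : dot x y = dot y x.
Proof. by apply: eq_bigr => i _; rewrite mulrC. Qed.

Lemma dotDl n (x y z : 'cV[R]_n) : dot (x + y) z = dot x z + dot y z.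
Proof. by rewrite /dot -big_split; apply: eq_bigr => i _; rewrite mxE mulrDl. Qed.

Lemma dotZl n a (x z : 'cV[R]_n) : dot (a *: x) z = a * dot x z.
Proof. by rewrite /dot mulr_sumr; apply: eq_bigr => i _; rewrite mxE mulrA. Qed.

Lemma dotDr n (x y z : 'cV[R]_n) : dot z (x + y) = dot z x + dot z y.
Proof. by rewrite dotC dotDl !(dotC z). Qed.

Lemma dotZr n a (x z : 'cV[R]_n) : dot z (a *: x) = a * dot z x.
Proof. by rewrite dotC dotZl dotC. Qed.

Lemma dotNl n (x z : 'cV[R]_n) : dot (- x) z = - dot x z.
Proof. by rewrite -scaleN1r dotZl mulN1r. Qed.

Lemma dotNr n (x z : 'cV[R]_n) : dot z (- x) = - dot z x.
Proof. by rewrite dotC dotNl dotC. Qed.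

Lemma dotBl n (x y z : 'cV[R]_n) : dot (x - y) z = dot x z - dot y z.
Proof. by rewrite dotDl dotNl. Qed.

Lemma dotBr n (x y z : 'cV[R]_n) : dot z (x - y) = dot z x - dot z y.
Proof. by rewrite dotDr dotNr. Qed.

Lemma dot0l n (z : 'cV[R]_n) : dot 0 z = 0.
Proof. by rewrite -(scale0r 0) dotZl mul0r. Qed.

Lemma dot0r n (z : 'cV[R]_n) : dot z 0 = 0.
Proof. by rewrite dotC dot0l. Qed.

Lemma dot_suml n (I : Type) (s : seq I) P (F : I -> 'cV[R]_n) z :
  dot (\sum_(i <- s | P i) F i) z = \sum_(i <- s | P i) dot (F i) z.
Proof.
apply: (big_morph (fun x => dot x z)); last exact: dot0l.
by move=> x y; rewrite dotDl.
Qed.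

Lemma dot_sumr n (I : Type) (s : seq I) P (F : I -> 'cV[R]_n) z :
  dot z (\sum_(i <- s | P i) F i) = \sum_(i <- s | P i) dot z (F i).
Proof. by rewrite dotC dot_suml; apply: eq_bigr => i _; rewrite dotC. Qed.

Lemma dot_mulmx n m (A : 'M[R]_(n, m)) x y : dot (A *m x) y = dot x (A^T *m y).
Proof.
have dE k (u v : 'cV[R]_k) : dot u v = (u^T *m v) 0 0.
  by rewrite mxE; apply: eq_bigr => i _; rewrite mxE.
by rewrite !dE trmx_mul mulmxA.
Qed.

Lemma dot_ge0 n (x : 'cV[R]_n) : 0 <= dot x x.
Proof. by apply: sumr_ge0 => i _; rewrite -expr2 sqr_ge0. Qed.

Lemma nrmE n (x : 'cV[R]_n) : nrm x = Num.sqrt (dot x x).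
Proof. by rewrite /eucl_norm; congr Num.sqrt; apply: eq_bigr => i _; rewrite expr2. Qed.

Lemma nrm_sqr n (x : 'cV[R]_n) : nrm x ^+ 2 = dot x x.
Proof. by rewrite nrmE sqr_sqrtr // dot_ge0. Qed.

Lemma nrm_ge0 n (x : 'cV[R]_n) : 0 <= nrm x.
Proof. by rewrite nrmE sqrtr_ge0. Qed.

Lemma nrm0 n : nrm (0 : 'cV[R]_n) = 0.
Proof. by rewrite nrmE dot0l sqrtr0. Qed.

Lemma nrm_eq0 n (x : 'cV[R]_n) : nrm x = 0 -> x = 0.
Proof.
move=> h; have : dot x x = 0 by rewrite -nrm_sqr h expr0n.
move/eqP; rewrite psumr_eq0; last by move=> i _; rewrite -expr2 sqr_ge0.
move/allP => hx; apply/matrixP => i j; rewrite ord1 mxE.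
by have := hx i (mem_index_enum _); rewrite -expr2 sqrf_eq0 => /eqP.
Qed.

Lemma le_sqr2 (x y : R) : 0 <= y -> x ^+ 2 <= y ^+ 2 -> x <= y.
Proof. move=> y0 h; rewrite leNgt; apply/negP => h'; nra. Qed.

Lemma dot_sqr_le n (x y : 'cV[R]_n) : dot x y ^+ 2 <= dot x x * dot y y.
Proof.
have [/eqP h|h] := boolP (nrm y == 0).
  by rewrite (nrm_eq0 h) !dot0r expr0n mulr0.
have hy : 0 < dot y y by rewrite -nrm_sqr exprn_gt0 // lt_neqAle eq_sym h nrm_ge0.
have := dot_ge0 (dot y y *: x - dot x y *: y).
rewrite dotBl !dotBr !dotZl !dotZr (dotC y x) => h1.
nra.
Qed.

Lemma dot_le n (x y : 'cV[R]_n) : `|dot x y| <= nrm x * nrm y.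
Proof.
apply: le_sqr2; first by rewrite mulr_ge0 ?nrm_ge0.
by rewrite -normrX ger0_norm ?sqr_ge0 // exprMn !nrm_sqr dot_sqr_le.
Qed.

Lemma dot_le1 n (x y : 'cV[R]_n) a b : nrm x <= a -> nrm y <= b -> `|dot x y| <= a * b.
Proof. by move=> hx hy; apply: (le_trans (dot_le x y)); apply: ler_pM; rewrite ?nrm_ge0. Qed.

Lemma nrmD n (x y : 'cV[R]_n) : nrm (x + y) <= nrm x + nrm y.
Proof.
apply: le_sqr2; first by rewrite addr_ge0 ?nrm_ge0.
rewrite nrm_sqr dotDl !dotDr -!nrm_sqr (dotC y x).
have := le_trans (ler_norm _) (dot_le x y); nra.
Qed.

Lemma nrmZ n a (x : 'cV[R]_n) : nrm (a *: x) = `|a| * nrm x.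
Proof.
rewrite !nrmE dotZl dotZr mulrA -expr2 sqrtrM ?sqr_ge0 //.
by rewrite sqrtr_sqr.
Qed.

Lemma nrmN n (x : 'cV[R]_n) : nrm (- x) = nrm x.
Proof. by rewrite -scaleN1r nrmZ normrN1 mul1r. Qed.

Lemma nrmB n (x y : 'cV[R]_n) : nrm (x - y) <= nrm x + nrm y.
Proof. by rewrite (le_trans (nrmD _ _)) // nrmN. Qed.

Lemma nrm_sum n (I : Type) (s : seq I) (P : pred I) (F : I -> 'cV[R]_n) :
  nrm (\sum_(i <- s | P i) F i) <= \sum_(i <- s | P i) nrm (F i).
Proof.
elim/big_rec2: _ => [|i y1 y2 _ h]; first by rewrite nrm0.
by apply: (le_trans (nrmD _ _)); rewrite lerD2l.
Qed.

Definition bvec n (l : 'I_n) : 'cV[R]_n := delta_mx l 0.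

Lemma dot_bvecl n (l : 'I_n) x : dot (bvec l) x = x l 0.
Proof.
rewrite /dot (bigD1 l) //= mxE !eqxx mul1r big1 ?addr0 // => i hi.
by rewrite mxE (negbTE hi) mul0r.
Qed.

Lemma dot_bvecr n (l : 'I_n) x : dot x (bvec l) = x l 0.
Proof. by rewrite dotC dot_bvecl. Qed.

Lemma vec_sum_bvec n (x : 'cV[R]_n) : x = \sum_l x l 0 *: bvec l.
Proof.
apply/matrixP => i j; rewrite ord1 summxE (bigD1 i) //= !mxE !eqxx mulr1 big1 ?addr0 //.
by move=> k hk; rewrite !mxE eq_sym (negbTE hk) mulr0.
Qed.

Lemma sum_CS (I : finType) (P : pred I) (F G : I -> R) :
  (\sum_(i | P i) F i * G i) ^+ 2 <= (\sum_(i | P i) F i ^+ 2) * (\sum_(i | P i) G i ^+ 2).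
Proof.
set A := \sum_(i | P i) F i ^+ 2; set B := \sum_(i | P i) F i * G i.
set C := \sum_(i | P i) G i ^+ 2.
have key s t : 0 <= s ^+ 2 * A - 2 * (s * t) * B + t ^+ 2 * C.
  have -> : s ^+ 2 * A - 2 * (s * t) * B + t ^+ 2 * C =
     \sum_(i | P i) (s * F i - t * G i) ^+ 2.
    rewrite /A /B /C !mulr_sumr -sumrN -!big_split /=; apply: eq_bigr => i _; ring.
  by apply: sumr_ge0 => i _; apply: sqr_ge0.
have A0 : 0 <= A by apply: sumr_ge0 => i _; apply: sqr_ge0.
have C0 : 0 <= C by apply: sumr_ge0 => i _; apply: sqr_ge0.
have [hC|hC] := ltrP 0 C.
  by have := key C B; nra.
have C00 : C = 0 by apply/eqP; rewrite eq_le hC C0.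
rewrite C00 mulr0.
(* With [C = 0], [key B (1 + A)] reads [- B ^+ 2 * (A + 2) >= 0], which forces [B = 0]. *)
have := key 1 (B * (1 + 1 + A)%R); have := key B (1+A); rewrite C00 => h1 h2.
have [-> //|B0] := eqVneq B 0; first by rewrite expr0n.
have B2 : 0 < B ^+ 2 by rewrite lt_neqAle sqr_ge0 eq_sym sqrf_eq0 B0.
nra.
Qed.

(** The Frobenius bound. It makes the supremum in [opnorm] finite and later compares the norm of a
    power with a trace. *)
Lemma nrm_frob n (A : 'M[R]_n) (x : 'cV[R]_n) :
  nrm (A *m x) ^+ 2 <= (\sum_l nrm (A *m bvec l) ^+ 2) * nrm x ^+ 2.
Proof.
have h1 : nrm (A *m x) <= \sum_l `|x l 0| * nrm (A *m bvec l).
  rewrite {1}(vec_sum_bvec x) mulmx_sumr; apply: (le_trans (nrm_sum _ _ _)).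
  by apply: ler_sum => l _; rewrite -scalemxAr nrmZ.
have h2 : nrm (A *m x) ^+ 2 <= (\sum_l `|x l 0| * nrm (A *m bvec l)) ^+ 2.
  rewrite ler_sqr ?nnegrE ?nrm_ge0 //; apply: sumr_ge0 => l _.
  by rewrite mulr_ge0 ?nrm_ge0.
apply: (le_trans h2); apply: (le_trans (sum_CS _ _ _)); rewrite mulrC.
rewrite (_ : \sum_i `|x i 0| ^+ 2 = nrm x ^+ 2) //.
by rewrite nrm_sqr; apply: eq_bigr => i _; rewrite -normrX ger0_norm ?sqr_ge0.
Qed.

Lemma opnorm_set n (A : 'M[R]_n) :
  has_sup [set r : R | exists x : 'cV[R]_n, nrm x <= 1 /\ r = nrm (A *m x)].
Proof.
split; first by exists 0, 0; rewrite mulmx0 nrm0; split.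
exists (1 + \sum_l nrm (A *m bvec l) ^+ 2) => _ [x [hx ->]].
have h := nrm_frob A x.
have h0 : 0 <= \sum_l nrm (A *m bvec l) ^+ 2 by apply: sumr_ge0 => l _; apply: sqr_ge0.
have hx0 := nrm_ge0 x; have hA := nrm_ge0 (A *m x).
have : nrm x ^+ 2 <= 1 by nra.
nra.
Qed.

Lemma opnorm_le n (A : 'M[R]_n) c :
  (forall x, nrm x <= 1 -> nrm (A *m x) <= c) -> opnorm A <= c.
Proof.
move=> h; apply: ge_sup; first by exists 0, 0; rewrite mulmx0 nrm0.
by move=> _ [x [hx ->]]; apply: h.
Qed.

Lemma opnorm_ub n (A : 'M[R]_n) x : nrm x <= 1 -> nrm (A *m x) <= opnorm A.
Proof.
move=> h; apply: (ub_le_sup (proj2 (opnorm_set A))).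
by exists x.
Qed.

Lemma opnorm_ge0 n (A : 'M[R]_n) : 0 <= opnorm A.
Proof. by have := @opnorm_ub n A 0; rewrite mulmx0 nrm0; apply. Qed.

Lemma opnormP n (A : 'M[R]_n) x : nrm (A *m x) <= opnorm A * nrm x.
Proof.
have [/eqP h|h] := boolP (nrm x == 0).
  by rewrite (nrm_eq0 h) mulmx0 nrm0 mulr0.
have hx : 0 < nrm x by rewrite lt_neqAle eq_sym h nrm_ge0.
have : nrm (A *m ((nrm x)^-1 *: x)) <= opnorm A.
  by apply: opnorm_ub; rewrite nrmZ ger0_norm ?invr_ge0 ?nrm_ge0 // mulVf.
rewrite -scalemxAr nrmZ ger0_norm ?invr_ge0 ?nrm_ge0 //.
by rewrite mulrC ler_pdivrMr.
Qed.

Lemma opnormP1 n (A : 'M[R]_n) x a b : opnorm A <= a -> nrm x <= b -> nrm (A *m x) <= a * b.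
Proof.
move=> ha hb; apply: (le_trans (opnormP A x)); apply: ler_pM => //; rewrite ?nrm_ge0 ?opnorm_ge0 //.
Qed.

Lemma opnormD n (A B : 'M[R]_n) : opnorm (A + B) <= opnorm A + opnorm B.
Proof.
apply: opnorm_le => x hx; rewrite mulmxDl; apply: (le_trans (nrmD _ _)).
by apply: lerD; apply: opnorm_ub.
Qed.

End LinAlg.
(** * Powers of a symmetric matrix *)

Section Powers.
Variables (R : realType).
Local Notation nrm := eucl_norm.

Definition pw n (H : 'M[R]_n) k (x : 'cV[R]_n) := iter k (mulmx H) x.

Lemma pwS n (H : 'M[R]_n) k x : pw H k.+1 x = H *m pw H k x.
Proof. by []. Qed.

Lemma pwSr n (H : 'M[R]_n) k x : pw H k.+1 x = pw H k (H *m x).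
Proof. exact: iterSr. Qed.

Lemma pwD n (H : 'M[R]_n) a b x : pw H (a + b) x = pw H a (pw H b x).
Proof. exact: iterD. Qed.

Lemma pw_add n (H : 'M[R]_n) k x y : pw H k (x + y) = pw H k x + pw H k y.
Proof. by elim: k => //= k ->; rewrite mulmxDr. Qed.

Lemma pwZ n (H : 'M[R]_n) k a x : pw H k (a *: x) = a *: pw H k x.
Proof. by elim: k => //= k ->; rewrite scalemxAr. Qed.

Lemma pw0 n (H : 'M[R]_n) k : pw H k 0 = 0.
Proof. by elim: k => //= k ->; rewrite mulmx0. Qed.

Lemma pw_sum n (H : 'M[R]_n) k (I : Type) (s : seq I) P (F : I -> 'cV[R]_n) :
  pw H k (\sum_(i <- s | P i) F i) = \sum_(i <- s | P i) pw H k (F i).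
Proof. by apply: (big_morph (pw H k)); [exact: pw_add | exact: pw0]. Qed.

Lemma dot_sym n (H : 'M[R]_n) x y : H^T = H -> dot (H *m x) y = dot x (H *m y).
Proof. by move=> h; rewrite dot_mulmx h. Qed.

Lemma dot_pw n (H : 'M[R]_n) k x y : H^T = H -> dot (pw H k x) y = dot x (pw H k y).
Proof.
move=> h; elim: k x y => // k IH x y.
by rewrite pwS dot_sym // IH -pwSr.
Qed.

Lemma dot_pwD n (H : 'M[R]_n) a b x y : H^T = H ->
  dot x (pw H (a + b) y) = dot (pw H a x) (pw H b y).
Proof. by move=> h; rewrite pwD dot_pw. Qed.

Lemma nrm_pw n (H : 'M[R]_n) k x : nrm (pw H k x) <= opnorm H ^+ k * nrm x.
Proof.
elim: k => [|k IH]; first by rewrite expr0 mul1r.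
rewrite pwS exprS -mulrA; apply: (le_trans (opnormP _ _)).
by apply: ler_wpM2l => //; apply: opnorm_ge0.
Qed.

Lemma nrm_pw1 n (H : 'M[R]_n) k x a : opnorm H <= a -> nrm x <= 1 -> nrm (pw H k x) <= a ^+ k.
Proof.
move=> ha hx; apply: (le_trans (nrm_pw H k x)); rewrite -[leRHS]mulr1.
apply: ler_pM; rewrite ?exprn_ge0 ?opnorm_ge0 ?nrm_ge0 //.
by apply: lerXn2r; rewrite ?nnegrE ?opnorm_ge0 // (le_trans _ ha) ?opnorm_ge0.
Qed.

(** Cauchy-Schwarz after moving one factor [H] across the inner product. All interpolation between
    exponents rests on it. *)
Lemma pw_logconvex n (H : 'M[R]_n) k x : H^T = H ->
  nrm (pw H k.+1 x) ^+ 2 <= nrm (pw H k x) * nrm (pw H k.+2 x).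
Proof.
move=> h; rewrite nrm_sqr pwS dot_sym // -!pwS.
exact: le_trans (ler_norm _) (dot_le _ _).
Qed.

(** After division by [g ^+ k] the sequence is still log-convex. If it rose above 1 before [N], it
    would keep increasing from there and stay above 1 at [N]. *)
Lemma logconvex_interp (nu : nat -> R) (g : R) N : 0 < g ->
  (forall k, 0 <= nu k) -> (forall k, nu k.+1 ^+ 2 <= nu k * nu k.+2) ->
  nu 0%N <= 1 -> nu N <= g ^+ N -> forall e, (e <= N)%N -> nu e <= g ^+ e.
Proof.
move=> g0 nu0 nul nu1 nuN.
pose mu k := nu k / g ^+ k.
have gk k : 0 < g ^+ k by apply: exprn_gt0.
have mu0 k : 0 <= mu k by rewrite /mu divr_ge0 // ltW.
have mul k : mu k.+1 ^+ 2 <= mu k * mu k.+2.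
  rewrite /mu expr_div_n mulf_div -exprD -exprM.
  rewrite (_ : k + k.+2 = k.+1 * 2)%N; last by lia.
  by rewrite ler_pM2r ?invr_gt0.
have nuE k : nu k = mu k * g ^+ k by rewrite /mu divfK // gt_eqF.
have grow k j : mu k < mu k.+1 -> mu (k + j)%N <= mu (k + j).+1 /\ mu k.+1 <= mu (k + j).+1.
  move=> hk; elim: j => [|j [h1 h2]]; first by rewrite addn0; split=> //; apply: ltW.
  have hp : 0 < mu (k + j).+1 by apply: lt_le_trans h2; apply: le_lt_trans hk.
  have : mu (k + j).+1 <= mu (k + j).+2.
    rewrite -(ler_pM2l hp) -expr2; apply: (le_trans (mul _)).
    by apply: ler_wpM2r.
  by rewrite addnS => h3; split=> //; apply: le_trans h3.
have main e : (e <= N)%N -> mu e <= 1.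
  elim: e => [|e IH] he; first by rewrite /mu expr0 divr1.
  rewrite leNgt; apply/negP => h.
  have hlt : mu e < mu e.+1 by apply: le_lt_trans h; apply: IH; lia.
  have := (grow e (N - e.+1)%N hlt).2.
  rewrite (_ : (e + (N - e.+1)).+1 = N); last by lia.
  move=> h2; have h3 : mu N <= 1 by rewrite /mu ler_pdivrMr // mul1r.
  by move: (lt_le_trans h (le_trans h2 h3)); rewrite ltxx.
by move=> e he; rewrite nuE -[leRHS]mul1r; apply: ler_wpM2r; [exact: ltW|exact: main].
Qed.

(** Successive ratios are nondecreasing, and the first one is at least [nu 1] because
    [nu 0 <= 1]. *)
Lemma logconvex_pow (nu : nat -> R) N :
  (forall k, 0 <= nu k) -> (forall k, nu k.+1 ^+ 2 <= nu k * nu k.+2) ->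
  nu 0%N <= 1 -> nu 1%N ^+ N.+1 <= nu N.+1.
Proof.
move=> nu0 nul nu1.
have step k : nu 1%N * nu k <= nu k.+1.
  elim: k => [|k IH]; first by rewrite -[leRHS]mulr1; apply: ler_wpM2l.
  have := nul k; have h1 := nu0 k; have h2 := nu0 k.+1; have h3 := nu0 k.+2; have h4 := nu0 1%N.
  have [hk|hk] := ltrP 0 (nu k.+1); last first.
    have -> : nu k.+1 = 0 by apply/eqP; rewrite eq_le hk h2.
    by rewrite mulr0.
  move=> h5; have hk0 : 0 < nu k by rewrite lt_neqAle h1 andbT; apply/negP => /eqP E; nra.
  rewrite -(ler_pM2l hk0); apply: le_trans h5; nra.
elim: N => [|N IH]; first by rewrite expr1.
rewrite exprS; apply: le_trans (step _); exact: ler_wpM2l.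
Qed.

Lemma pw_interp n (H : 'M[R]_n) x g N : H^T = H -> 0 < g -> nrm x <= 1 ->
  nrm (pw H N x) <= g ^+ N -> forall e, (e <= N)%N -> nrm (pw H e x) <= g ^+ e.
Proof.
move=> hH g0 hx hN; apply: (@logconvex_interp (fun k => nrm (pw H k x)) g N g0) => //.
- by move=> k; apply: nrm_ge0.
- by move=> k; apply: pw_logconvex.
Qed.

Lemma pw_pow n (H : 'M[R]_n) x N : H^T = H -> nrm x <= 1 ->
  nrm (H *m x) ^+ N.+1 <= nrm (pw H N.+1 x).
Proof.
move=> hH hx; apply: (@logconvex_pow (fun k => nrm (pw H k x)) N) => //.
- by move=> k; apply: nrm_ge0.
- by move=> k; apply: pw_logconvex.
Qed.

Lemma root_ex (a : R) N : 0 <= a -> exists2 g, 0 <= g & g ^+ N.+1 = a.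
Proof.
move=> a0; exists (a `^ (N.+1%:R^-1)); first exact: powR_ge0.
by rewrite -powR_mulrn ?powR_ge0 // -powRrM mulVf ?pnatr_eq0 // powRr1.
Qed.

(** For a symmetric matrix the norm of a power is the power of the norm; [pw_pow] gives the
    direction needed, vector by vector. *)
Lemma opnorm_pow n (H : 'M[R]_n) N c : H^T = H -> 0 <= c ->
  (forall x, nrm x <= 1 -> nrm (pw H N.+1 x) <= c) -> opnorm H ^+ N.+1 <= c.
Proof.
move=> hH c0 h; have [g g0 E] := root_ex N c0; rewrite -E.
apply: lerXn2r; rewrite ?nnegrE ?opnorm_ge0 //; apply: opnorm_le => x hx.
rewrite -(@ler_pXn2r _ N.+1) ?nnegrE ?nrm_ge0 //.
by apply: le_trans (pw_pow N hH hx) _; rewrite E; apply: h.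
Qed.

(** Discrete Duhamel formula: the perturbation is inserted at the step where [H0] gives way to [H].
    The primed version exchanges the two sides. *)
Lemma pw_tele n (H H0 : 'M[R]_n) c z :
  pw H c z = pw H0 c z + \sum_(j < c) pw H (c - j.+1) ((H - H0) *m pw H0 j z).
Proof.
elim: c z => [|c IH] z; first by rewrite big_ord0 addr0.
have -> : pw H c.+1 z = pw H c (H0 *m z) + pw H c ((H - H0) *m z).
  by rewrite pwSr -pw_add mulmxBl addrC subrK.
rewrite {1}IH -pwSr big_ord_recl /= subSS subn0 -addrA; congr (_ + _).
rewrite addrC; congr (_ + _); apply: eq_bigr => i _.
by rewrite -pwSr /bump /= add1n subSS.
Qed.

Lemma pw_tele' n (H H0 : 'M[R]_n) c z :
  pw H c z = pw H0 c z + \sum_(j < c) pw H0 (c - j.+1) ((H - H0) *m pw H j z).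
Proof.
rewrite (pw_tele H0 H c z) -addrA -big_split /= big1 ?addr0 // => j _.
by rewrite -pw_add -mulmxDl subrKA subrr mul0mx pw0.
Qed.

Lemma geom_sum_id (d : R) c :
  1 + \sum_(j < c) d * (1 + d) ^+ (c - j.+1) = (1 + d) ^+ c.
Proof.
rewrite -mulr_sumr.
have -> : \sum_(j < c) (1 + d) ^+ (c - j.+1) = \sum_(j < c) (1 + d) ^+ j.
  by rewrite (reindex_inj rev_ord_inj) /=; apply: eq_bigr => j _; congr (_ ^+ _); have := ltn_ord j; lia.
have := subrX1 (1 + d) c; rewrite (_ : 1 + d - 1 = d); last by rewrite addrC addKr.
by move=> <-; rewrite addrC subrK.
Qed.

(* A perturbation built from vectors that are delocalised for H0 only changes the growth of
   H0-iterates of such vectors by the factor (1 + m r / g)^c. *)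
Lemma growth n (H H0 : 'M[R]_n) (J : finType) (P : pred J) (xs ys : J -> 'cV[R]_n) (r g : R) m N :
  (forall x, (H - H0) *m x = r *: \sum_(j | P j) dot (ys j) x *: xs j) -> (#|P| <= m)%N ->
  0 <= r -> 0 < g -> (forall j, P j -> nrm (ys j) <= 1) ->
  (forall j e, P j -> (e <= N)%N -> nrm (pw H0 e (xs j)) <= g ^+ e) ->
  forall c z, (c <= N)%N -> (forall e, (e <= N)%N -> nrm (pw H0 e z) <= g ^+ e) ->
  nrm (pw H c z) <= g ^+ c * (1 + m%:R * r / g) ^+ c.
Proof.
(* Strong induction for all admissible starting vectors at once: after one insertion of the
   perturbation the iteration restarts from some [xs j], itself admissible, with fewer steps
   left. *)
move=> hS hm r0 g0 hy hx; elim/ltn_ind => c IH z hc hz.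
set d := m%:R * r / g.
have d0 : 0 <= d by rewrite /d divr_ge0 ?mulr_ge0 ?ler0n // ltW.
rewrite (pw_tele H H0); apply: (le_trans (nrmD _ _)).
rewrite -(geom_sum_id d) mulrDr mulr1 mulr_sumr.
apply: lerD; first exact: hz.
apply: (le_trans (nrm_sum _ _ _)); apply: ler_sum => i _.
have hi := ltn_ord i.
rewrite hS pwZ pw_sum nrmZ ger0_norm //.
have step j : P j -> nrm (pw H (c - i.+1) (dot (ys j) (pw H0 i z) *: xs j)) <=
   g ^+ i * (g ^+ (c - i.+1) * (1 + d) ^+ (c - i.+1)).
  move=> hj; rewrite pwZ nrmZ; apply: ler_pM; rewrite ?nrm_ge0 ?normr_ge0 //.
    rewrite -[leRHS]mul1r; apply: dot_le1; [exact: hy | apply: hz; lia].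
  apply: IH; try lia; move=> e he; exact: hx.
have -> : g ^+ c * (d * (1 + d) ^+ (c - i.+1)) =
   r * (m%:R * (g ^+ i * (g ^+ (c - i.+1) * (1 + d) ^+ (c - i.+1)))).
  have -> : g ^+ c = g * (g ^+ i * g ^+ (c - i.+1)).
    by rewrite -exprD -exprS; congr (_ ^+ _); lia.
  have -> : g * (g ^+ i * g ^+ (c - i.+1)) * (d * (1 + d) ^+ (c - i.+1)) =
    (g * d) * (g ^+ i * (g ^+ (c - i.+1) * (1 + d) ^+ (c - i.+1))) by ring.
  have -> : g * d = r * m%:R by rewrite /d; field; rewrite gt_eqF.
  by rewrite -!mulrA.
apply: ler_wpM2l => //; apply: (le_trans (nrm_sum _ _ _)).
apply: (@le_trans _ _ (\sum_(j | P j) (g ^+ i * (g ^+ (c - i.+1) * (1 + d) ^+ (c - i.+1))))).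
  by apply: ler_sum => j; apply: step.
rewrite (eq_bigl (mem P)) // sumr_const mulr_natl; apply: ler_wpMn2l => //.
have g0' := ltW g0; have d1 : 0 <= 1 + d by lra.
by rewrite !mulr_ge0 // exprn_ge0.
Qed.

(** The inductive form is [(1 + d) ^+ k * (1 - d * k) <= 1]. *)
Lemma pow_1d_le2 (d : R) c : 0 <= d -> d * c%:R <= 1 / 2 -> (1 + d) ^+ c <= 2.
Proof.
move=> d0; have H k : d * k%:R <= 1 / 2 -> (1 + d) ^+ k * (1 - d * k%:R) <= 1.
  elim: k => [|k IH]; first by rewrite expr0 mulr0 subr0 mulr1.
  rewrite -natr1 => h; have hk : d * k%:R <= 1/2 by nra.
  have h1 := IH hk; rewrite exprSr.
  have h2 : 0 <= (1 + d) ^+ k by apply: exprn_ge0; lra.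
  have h3 : 0 <= (k%:R : R) by [].
  have h4 : (1 + d) * (1 - d * (k%:R + 1)) <= 1 - d * k%:R by nra.
  apply: le_trans h1; rewrite -mulrA; exact: ler_wpM2l.
move=> h; have h1 := H c h; have h2 : 0 <= (1 + d) ^+ c by apply: exprn_ge0; lra.
nra.
Qed.

Lemma sum_cst_le (I : finType) (A : {pred I}) (c : R) m : 0 <= c -> (#|A| <= m)%N ->
  \sum_(i in A) c <= m%:R * c.
Proof. by move=> c0 h; rewrite sumr_const mulr_natl; apply: ler_wpMn2l. Qed.

Lemma sum_ord_cst m (c : R) : \sum_(j < m) c = m%:R * c.
Proof. by rewrite sumr_const card_ord mulr_natl. Qed.

Lemma pw_mx n (H : 'M[R]_n) k : exists A : 'M[R]_n, forall x, pw H k x = A *m x.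
Proof.
elim: k => [|k [A hA]]; first by exists 1%:M => x; rewrite mul1mx.
by exists (H *m A) => x; rewrite pwS hA mulmxA.
Qed.

Lemma nrm_pw_frob n (H : 'M[R]_n) k x :
  nrm (pw H k x) ^+ 2 <= (\sum_l nrm (pw H k (bvec R l)) ^+ 2) * nrm x ^+ 2.
Proof.
have [A hA] := pw_mx H k; rewrite hA; apply: (le_trans (nrm_frob _ _)).
by rewrite le_eqVlt; apply/orP; left; apply/eqP; congr (_ * _); apply: eq_bigr => l _; rewrite hA.
Qed.
End Powers.
(** * Finite product measures *)

Section Prob.
Variables (R : realType) (X V : finType) (mu : X -> V -> R).
Hypothesis mu_ge0 : forall s v, 0 <= mu s v.
Hypothesis mu_sum : forall s, \sum_v mu s v = 1.
Local Notation Om := {ffun X -> V}.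

Definition wt (w : Om) : R := \prod_s mu s (w s).
Definition Ex (f : Om -> R) : R := \sum_w wt w * f w.
Definition Ex2 (F : Om -> Om -> R) : R := Ex (fun w => Ex (F w)).

Lemma wt_ge0 w : 0 <= wt w.
Proof. by apply: prodr_ge0. Qed.

Lemma eq_Ex f g : f =1 g -> Ex f = Ex g.
Proof. by move=> h; apply: eq_bigr => w _; rewrite h. Qed.

Lemma Ex_marg s (phi : V -> R) : Ex (fun w => phi (w s)) = \sum_v mu s v * phi v.
Proof.
transitivity (\sum_(w : Om) \prod_t (mu t (w t) * (if t == s then phi (w t) else 1))).
  apply: eq_bigr => w _; rewrite big_split /=; congr (_ * _).
  by rewrite -big_mkcond /= big_pred1_eq.
rewrite -(bigA_distr_bigA (fun t v => mu t v * (if t == s then phi v else 1))) (bigD1 s) //= eqxx [X in _ * X]big1 ?mulr1 //.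
move=> t ht; rewrite -[RHS](mu_sum t); apply: eq_bigr => v _.
by rewrite (negbTE ht) mulr1.
Qed.

Lemma Ex_cst c : Ex (fun _ => c) = c.
Proof.
rewrite /Ex -mulr_suml -(bigA_distr_bigA mu) big1 ?mul1r //.
Qed.

Lemma ExD f g : Ex (fun w => f w + g w) = Ex f + Ex g.
Proof. by rewrite /Ex -big_split; apply: eq_bigr => w _; rewrite mulrDr. Qed.

Lemma ExZ c f : Ex (fun w => c * f w) = c * Ex f.
Proof. by rewrite /Ex mulr_sumr; apply: eq_bigr => w _; rewrite mulrCA. Qed.

Lemma ExZr c f : Ex (fun w => f w * c) = Ex f * c.
Proof. by rewrite mulrC -ExZ; apply: eq_Ex => w; rewrite mulrC. Qed.

Lemma ExN f : Ex (fun w => - f w) = - Ex f.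
Proof. by rewrite -mulN1r -ExZ; apply: eq_Ex => w; rewrite mulN1r. Qed.

Lemma ExB f g : Ex (fun w => f w - g w) = Ex f - Ex g.
Proof. by rewrite ExD ExN. Qed.

Lemma Ex_sum (I : Type) (s : seq I) P (F : I -> Om -> R) :
  Ex (fun w => \sum_(i <- s | P i) F i w) = \sum_(i <- s | P i) Ex (F i).
Proof.
rewrite /Ex exchange_big /=; apply: eq_bigr => w _.
by rewrite mulr_sumr.
Qed.

Lemma Ex_le f g : (forall w, f w <= g w) -> Ex f <= Ex g.
Proof. by move=> h; apply: ler_sum => w _; apply: ler_wpM2l => //; apply: wt_ge0. Qed.

Lemma Ex_ge0 f : (forall w, 0 <= f w) -> 0 <= Ex f.
Proof. by move=> h; apply: sumr_ge0 => w _; rewrite mulr_ge0 ?wt_ge0. Qed.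

Lemma Ex_abs f : `|Ex f| <= Ex (fun w => `|f w|).
Proof.
apply: (le_trans (ler_norm_sum _ _ _)); apply: ler_sum => w _.
by rewrite normrM ger0_norm ?wt_ge0.
Qed.

Lemma Ex_CS f g : Ex (fun w => f w * g w) ^+ 2 <= Ex (fun w => f w ^+ 2) * Ex (fun w => g w ^+ 2).
Proof.
have := @sum_CS R Om predT (fun w => Num.sqrt (wt w) * f w) (fun w => Num.sqrt (wt w) * g w).
have E h k : \sum_w Num.sqrt (wt w) * h w * (Num.sqrt (wt w) * k w) = Ex (fun w => h w * k w).
  apply: eq_bigr => w _; rewrite -{3}(sqr_sqrtr (wt_ge0 w)); ring.
rewrite E; congr (_ <= _ * _).
- by rewrite -[RHS](E f f) //; apply: eq_bigr => w _; rewrite expr2.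
- by rewrite -[RHS](E g g) //; apply: eq_bigr => w _; rewrite expr2.
Qed.

Definition mix (B : pred X) (w w' : Om) : Om := [ffun s => if B s then w' s else w s].
Definition upd (w : Om) s v : Om := [ffun t => if t == s then v else w t].

Lemma mixK B w w' : mix B (mix B w w') (mix B w' w) = w.
Proof. by apply/ffunP => s; rewrite !ffunE; case: (B s). Qed.

Lemma Ex2E F : Ex2 F = \sum_(p : Om * Om) wt p.1 * wt p.2 * F p.1 p.2.
Proof.
rewrite -(pair_bigA _ (fun w w' => wt w * wt w' * F w w')) /=.
by apply: eq_bigr => w _; rewrite /Ex mulr_sumr; apply: eq_bigr => w' _; rewrite mulrA.
Qed.

(** Exchanging a set of coordinates between two independent copies preserves their joint law; the
    exchange is an involution and permutes the weights. *)
Lemma Ex2_swap B F : Ex2 F = Ex2 (fun w w' => F (mix B w w') (mix B w' w)).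
Proof.
rewrite !Ex2E; pose sw (p : Om * Om) := (mix B p.1 p.2, mix B p.2 p.1).
have swK : involutive sw by case=> w w'; rewrite /sw /= !mixK.
rewrite (reindex_inj (inv_inj swK)) /=; apply: eq_bigr => -[w w'] _ /=; congr (_ * _).
rewrite /wt -!big_split; apply: eq_bigr => s _; rewrite !ffunE.
by case: (B s) => //=; rewrite mulrC.
Qed.

Lemma eq_Ex2 F G : (forall w w', F w w' = G w w') -> Ex2 F = Ex2 G.
Proof. by move=> h; apply: eq_Ex => w; apply: eq_Ex. Qed.

Lemma Ex2_le F G : (forall w w', F w w' <= G w w') -> Ex2 F <= Ex2 G.
Proof. by move=> h; apply: Ex_le => w; apply: Ex_le. Qed.

Lemma Ex2_abs F : `|Ex2 F| <= Ex2 (fun w w' => `|F w w'|).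
Proof. by apply: (le_trans (Ex_abs _)); apply: Ex_le => w; apply: Ex_abs. Qed.

Lemma Ex2D F G : Ex2 (fun w w' => F w w' + G w w') = Ex2 F + Ex2 G.
Proof. by rewrite /Ex2 -ExD; apply: eq_Ex => w; apply: ExD. Qed.

Lemma Ex2Z c F : Ex2 (fun w w' => c * F w w') = c * Ex2 F.
Proof. by rewrite /Ex2 -ExZ; apply: eq_Ex => w; apply: ExZ. Qed.

Lemma Ex2N F : Ex2 (fun w w' => - F w w') = - Ex2 F.
Proof. by rewrite -mulN1r -Ex2Z; apply: eq_Ex2 => w w'; rewrite mulN1r. Qed.

Lemma Ex2_sum (I : Type) (s : seq I) P (F : I -> Om -> Om -> R) :
  Ex2 (fun w w' => \sum_(i <- s | P i) F i w w') = \sum_(i <- s | P i) Ex2 (F i).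
Proof. by rewrite /Ex2 -Ex_sum; apply: eq_Ex => w; apply: Ex_sum. Qed.

Lemma Ex2_fst f : Ex2 (fun w _ => f w) = Ex f.
Proof. by apply: eq_Ex => w; apply: Ex_cst. Qed.

Lemma Ex2_cst c : Ex2 (fun _ _ => c) = c.
Proof. by rewrite Ex2_fst Ex_cst. Qed.

Lemma Ex2_mix B f : Ex2 (fun w w' => f (mix B w w')) = Ex f.
Proof. by rewrite -[RHS]Ex2_fst [RHS](Ex2_swap B). Qed.

Lemma Ex2_prod f g : Ex2 (fun w w' => f w * g w') = Ex f * Ex g.
Proof. by rewrite -ExZr; apply: eq_Ex => w; rewrite ExZ. Qed.

(** Resampling a single coordinate. This is the form in which conditional expectations are taken
    throughout. *)
Lemma Ex_upd s f : Ex f = Ex (fun w => \sum_v mu s v * f (upd w s v)).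
Proof.
rewrite -(Ex2_mix (pred1 s)); apply: eq_Ex => w.
rewrite -(Ex_marg s (fun v => f (upd w s v))); apply: eq_Ex => w'.
by congr f; apply/ffunP => t; rewrite !ffunE /=; case: eqP => // ->.
Qed.

Lemma Ex2_upd1 s F : Ex2 F = Ex2 (fun w w' => \sum_v mu s v * F (upd w s v) w').
Proof.
rewrite /Ex2 (Ex_upd s); apply: eq_Ex => w; rewrite Ex_sum.
by apply: eq_bigr => v _; rewrite ExZ.
Qed.

Definition Pr (A : Om -> bool) : R := Ex (fun w => (A w)%:R).

Lemma Pr_sub (A B : Om -> bool) : (forall w, A w -> B w) -> Pr A <= Pr B.
Proof. by move=> h; apply: Ex_le => w; rewrite ler_nat; case E: (A w) => //; rewrite h. Qed.

Lemma Pr_le1 A : Pr A <= 1.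
Proof. by rewrite -(Ex_cst 1); apply: Ex_le => w; rewrite lern1 leq_b1. Qed.

Lemma Pr_U (A B : Om -> bool) : Pr (fun w => A w || B w) <= Pr A + Pr B.
Proof. by rewrite /Pr -ExD; apply: Ex_le => w; rewrite -natrD ler_nat; case: (A w); case: (B w). Qed.

Section Cov.
Variables (g : X -> nat) (m : nat).
Hypothesis hg : forall s, (g s < m)%N.
Definition inblk i : pred X := fun s => g s == i.
(** Interpolates between two independent copies one block at a time, as in a Lindeberg
    replacement. *)
Definition hyb i (w w' : Om) := mix (fun s => (g s < i)%N) w w'.
Definition indep_blk i (f : Om -> R) := forall w w', f (mix (inblk i) w w') = f w.

Lemma hyb0 w w' : hyb 0 w w' = w.
Proof. by apply/ffunP => s; rewrite ffunE. Qed.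

Lemma hybm w w' : hyb m w w' = w'.
Proof. by apply/ffunP => s; rewrite ffunE hg. Qed.

Lemma hybS i w w' : hyb i.+1 w w' = mix (inblk i) (hyb i w w') w'.
Proof.
apply/ffunP => s; rewrite !ffunE /inblk (ltnS (g s)) (leq_eqVlt (g s) i).
by case: eqP.
Qed.

Lemma hyb_swap i w w' :
  hyb i (mix (inblk i) w w') (mix (inblk i) w' w) = hyb i.+1 w w'.
Proof.
apply/ffunP => s; rewrite !ffunE /inblk (ltnS (g s)) (leq_eqVlt (g s) i).
by case: eqP => //= ->; rewrite ltnn.
Qed.

Lemma hyb_swapS i w w' :
  hyb i.+1 (mix (inblk i) w w') (mix (inblk i) w' w) = hyb i w w'.
Proof.
apply/ffunP => s; rewrite !ffunE /inblk (ltnS (g s)) (leq_eqVlt (g s) i).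
by case: eqP => //= ->; rewrite ltnn.
Qed.

Lemma Ex2_hyb i f : Ex2 (fun w w' => f (hyb i w w')) = Ex f.
Proof. exact: Ex2_mix. Qed.

(** The covariance is [E f(w) (h(w) - h(w'))] for an independent copy [w'], telescoped along the
    hybrids. In the term of block [i], [f] may be centred by the part [f_ i] that ignores the block,
    and both values of [h] by [h_ i], on which the two hybrids agree. A product of two influences
    remains. *)
Lemma cov_le (f h : Om -> R) (f_ h_ : nat -> Om -> R) :
  (forall i, indep_blk i (f_ i)) -> (forall i, indep_blk i (h_ i)) ->
  `|Ex (fun w => f w * h w) - Ex f * Ex h| <=
  \sum_(i < m) Ex2 (fun w w' => `|f w - f_ i w| *
     (`|h (hyb i w w') - h_ i (hyb i w w')| + `|h (hyb i.+1 w w') - h_ i (hyb i.+1 w w')|)).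
Proof.
move=> hf hh.
have -> : Ex (fun w => f w * h w) - Ex f * Ex h =
   Ex2 (fun w w' => \sum_(i < m) f w * (h (hyb i w w') - h (hyb i.+1 w w'))).
  rewrite -Ex2_prod -Ex2_fst -Ex2N -Ex2D; apply: eq_Ex2 => w w'.
  rewrite -mulr_sumr -mulrN -mulrDr; congr (_ * _).
  rewrite -(big_mkord xpredT (fun i => h (hyb i w w') - h (hyb i.+1 w w'))).
  rewrite (eq_bigr (fun i => - (h (hyb i.+1 w w') - h (hyb i w w')))); last by move=> i _; rewrite opprB.
  by rewrite sumrN telescope_sumr // hyb0 hybm opprB.
rewrite Ex2_sum; apply: (le_trans (ler_norm_sum _ _ _)); apply: ler_sum => i _.
(* Swapping block [i] between the copies fixes [f_ i] and exchanges the two hybrids, so this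
   expectation equals its own negative. *)
have zero : Ex2 (fun w w' => f_ i w * (h (hyb i w w') - h (hyb i.+1 w w'))) = 0.
  have E : Ex2 (fun w w' => f_ i w * (h (hyb i w w') - h (hyb i.+1 w w'))) =
         - Ex2 (fun w w' => f_ i w * (h (hyb i w w') - h (hyb i.+1 w w'))).
    rewrite {1}(Ex2_swap (inblk i)) -Ex2N; apply: eq_Ex2 => w w'.
    by rewrite hf hyb_swap hyb_swapS -mulrN opprB.
  lra.
rewrite -[X in `|X|](subr0 _) -{1}zero -Ex2N -Ex2D.
apply: (le_trans (Ex2_abs _)); apply: Ex2_le => w w'.
rewrite -mulrBl normrM; apply: ler_wpM2l => //.
have -> : h (hyb i w w') - h (hyb i.+1 w w') =
   (h (hyb i w w') - h_ i (hyb i w w')) - (h (hyb i.+1 w w') - h_ i (hyb i.+1 w w')).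
  by rewrite (hybS i w w') hh; ring.
exact: ler_normB.
Qed.
End Cov.
End Prob.

(** * Block averages and block-centred vectors in the space of the hermitization *)

Section Blocks.
Variables (R : realType) (K d : nat) (part : 'I_d -> 'I_K).
Local Notation nrm := eucl_norm.

(** The left half of the indices stands for rows of the original matrix and the right half for
    columns, so each cluster gives two blocks. *)
Definition blk (l : 'I_(d + d)) : 'I_(K + K) :=
  match fintype.split l with inl j => lshift K (part j) | inr j => rshift K (part j) end.
Definition bsz (I : 'I_(K + K)) : R :=
  match fintype.split I with inl k => (block_size part k)%:R | inr k => (block_size part k)%:R end.
Definition avg (I : 'I_(K + K)) (phi : 'I_(d + d) -> R) : R :=
  (\sum_(l | blk l == I) phi l) / bsz I.
(** Normalised to total mass 1, not to length 1: this is the mean of a basis vector with uniform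
    index in the block, so [wvec] is the centred basis vector. *)
Definition uvec (I : 'I_(K + K)) : 'cV[R]_(d + d) := (bsz I)^-1 *: \sum_(l | blk l == I) bvec R l.
Definition wvec (l : 'I_(d + d)) : 'cV[R]_(d + d) := bvec R l - uvec (blk l).

Lemma splitl m n (i : 'I_m) : fintype.split (lshift n i) = inl i.
Proof. exact: (unsplitK (inl i)). Qed.
Lemma splitr m n (i : 'I_n) : fintype.split (rshift m i) = inr i.
Proof. exact: (unsplitK (inr i)). Qed.

Lemma blkl j : blk (lshift d j) = lshift K (part j).
Proof. by rewrite /blk splitl. Qed.
Lemma blkr j : blk (rshift d j) = rshift K (part j).
Proof. by rewrite /blk splitr. Qed.
Lemma bszl k : bsz (lshift K k) = (block_size part k)%:R.
Proof. by rewrite /bsz splitl. Qed.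
Lemma bszr k : bsz (rshift K k) = (block_size part k)%:R.
Proof. by rewrite /bsz splitr. Qed.

Lemma bsz_ge0 I : 0 <= bsz I.
Proof. by rewrite /bsz; case: fintype.split => k; rewrite ler0n. Qed.

Lemma bsz_le I : bsz I <= d%:R.
Proof.
rewrite /bsz; case: fintype.split => k; rewrite ler_nat /block_size;
by apply: (leq_trans (max_card _)); rewrite card_ord.
Qed.

Lemma lr_neq (m n : nat) (i : 'I_m) (j : 'I_n) : (lshift n i == rshift m j) = false.
Proof. by apply/eqP => /(congr1 (@fintype.split m n)); rewrite splitl splitr. Qed.

Lemma sum_blkl k (phi : 'I_(d + d) -> R) :
  \sum_(l | blk l == lshift K k) phi l = \sum_(j | part j == k) phi (lshift d j).
Proof.
rewrite big_split_ord /= [X in _ + X]big1 ?addr0; last first.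
  by move=> j; rewrite blkr eq_sym lr_neq.
by apply: eq_bigl => j; rewrite blkl (inj_eq (@lshift_inj _ _)).
Qed.

Lemma sum_blkr k (phi : 'I_(d + d) -> R) :
  \sum_(l | blk l == rshift K k) phi l = \sum_(j | part j == k) phi (rshift d j).
Proof.
rewrite big_split_ord /= [X in X + _]big1 ?add0r; last first.
  by move=> j; rewrite blkl lr_neq.
by apply: eq_bigl => j; rewrite blkr (inj_eq (@rshift_inj _ _)).
Qed.

Lemma bszE I : bsz I = \sum_(l | blk l == I) 1.
Proof.
rewrite /bsz; case: fintype.splitP => k hk.
  have -> : I = lshift K k by apply: val_inj.
  rewrite sum_blkl /block_size -sum1_card natr_sum; apply: eq_bigl => j; rewrite inE //.
have -> : I = rshift K k by apply: val_inj.
rewrite sum_blkr /block_size -sum1_card natr_sum; apply: eq_bigl => j; rewrite inE //.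
Qed.

Hypothesis bsz_gt0 : forall I, 0 < bsz I.

Lemma avg_cst I c : avg I (fun=> c) = c.
Proof.
have -> : (fun=> c) = (fun _ : 'I_(d + d) => c * 1) by apply/funext => l; rewrite mulr1.
by rewrite /avg -mulr_sumr -bszE mulfK ?gt_eqF.
Qed.

Lemma eq_avg I phi psi : (forall l, blk l = I -> phi l = psi l) -> avg I phi = avg I psi.
Proof. by move=> h; congr (_ / _); apply: eq_bigr => l /eqP; apply: h. Qed.

Lemma avgD I phi psi : avg I (fun l => phi l + psi l) = avg I phi + avg I psi.
Proof. by rewrite /avg big_split mulrDl. Qed.

Lemma avgZ I c phi : avg I (fun l => c * phi l) = c * avg I phi.
Proof. by rewrite /avg -mulr_sumr mulrA. Qed.

Lemma avgZr I c phi : avg I (fun l => phi l * c) = avg I phi * c.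
Proof. by rewrite mulrC -avgZ; apply: eq_avg => l _; rewrite mulrC. Qed.

Lemma avg_le I phi psi : (forall l, blk l = I -> phi l <= psi l) -> avg I phi <= avg I psi.
Proof.
move=> h; apply: ler_wpM2r; first by rewrite invr_ge0 bsz_ge0.
by apply: ler_sum => l /eqP; apply: h.
Qed.

Lemma avg_ge0 I phi : (forall l, 0 <= phi l) -> 0 <= avg I phi.
Proof. by move=> h; rewrite divr_ge0 ?bsz_ge0 //; apply: sumr_ge0. Qed.

Lemma avg_abs I phi : `|avg I phi| <= avg I (fun l => `|phi l|).
Proof.
rewrite /avg normrM (ger0_norm (x := _^-1)) ?invr_ge0 ?bsz_ge0 //.
by apply: ler_wpM2r; rewrite ?invr_ge0 ?bsz_ge0 // ler_norm_sum.
Qed.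

Lemma avg_sum I (J : Type) (s : seq J) P (F : J -> 'I_(d + d) -> R) :
  avg I (fun l => \sum_(j <- s | P j) F j l) = \sum_(j <- s | P j) avg I (F j).
Proof. by rewrite /avg exchange_big mulr_suml. Qed.

Lemma sum_blkE I phi : \sum_(l | blk l == I) phi l = bsz I * avg I phi.
Proof. by rewrite /avg mulrC divfK ?gt_eqF. Qed.

Lemma dot_u I y : dot (uvec I) y = avg I (fun l => y l 0).
Proof.
rewrite /uvec dotZl dot_suml /avg mulrC; congr (_ / _).
by apply: eq_bigr => l _; rewrite dot_bvecl.
Qed.

Lemma uvecE I l : uvec I l 0 = (blk l == I)%:R / bsz I.
Proof.
rewrite /uvec mxE summxE mulrC; congr (_ / _).
case: eqP => [h|h].
  rewrite (bigD1 l) /= ?h // mxE !eqxx big1 ?addr0 // => l' /andP[_ hl'].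
  by rewrite mxE eq_sym (negbTE hl').
rewrite big1 // => l' /eqP hl'; rewrite mxE; case: eqP => // E; by rewrite E hl' in h.
Qed.

Lemma dot_uu I J : dot (uvec I) (uvec J) = (I == J)%:R / bsz I.
Proof.
rewrite dot_u (@eq_avg _ _ (fun _ => (I == J)%:R / bsz J)); last by move=> l hl; rewrite uvecE hl.
by rewrite avg_cst; case: eqP => [->|_] //; rewrite !mul0r.
Qed.

Lemma nrm_u I : nrm (uvec I) ^+ 2 = (bsz I)^-1.
Proof. by rewrite nrm_sqr dot_uu eqxx mul1r. Qed.

Lemma dot_w l y : dot (wvec l) y = y l 0 - dot (uvec (blk l)) y.
Proof. by rewrite dotBl dot_bvecl. Qed.

Lemma dot_wu l I : dot (wvec l) (uvec I) = 0.
Proof.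
rewrite dot_w uvecE dot_uu; case: eqP => [<-|_]; first by rewrite subrr.
by rewrite !mul0r subr0.
Qed.

Lemma wvecE l l' : wvec l l' 0 = (l' == l)%:R - (blk l' == blk l)%:R / bsz (blk l).
Proof. by rewrite -dot_bvecr dotBl !dot_bvecr uvecE mxE andbT. Qed.

Lemma nrm_w l : nrm (wvec l) <= 1.
Proof.
apply: le_sqr2 => //; rewrite nrm_sqr dot_w [in X in _ - X]dotC dot_wu subr0 wvecE !eqxx expr1n.
by rewrite gerBl mul1r invr_ge0 bsz_ge0.
Qed.

Lemma sum_w I y : \sum_(l | blk l == I) dot (wvec l) y = 0.
Proof.
rewrite (eq_bigr (fun l => y l 0 - dot (uvec I) y)); last by move=> l /eqP <-; rewrite dot_w.
rewrite big_split /= sum_blkE -dot_u sumrN.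
by rewrite sum_blkE avg_cst subrr.
Qed.

Lemma avg_w I y : avg I (fun l => dot (wvec l) y) = 0.
Proof. by rewrite /avg sum_w mul0r. Qed.

(** The quadratic form of the orthogonal projection onto the vectors supported on block [I] with
    zero sum, as [PBE] shows. *)
Definition PB I x y := \sum_(l | blk l == I) dot (wvec l) x * dot (wvec l) y.

Lemma PBE I x y : PB I x y =
  \sum_(l | blk l == I) x l 0 * y l 0 - bsz I * (dot (uvec I) x * dot (uvec I) y).
Proof.
rewrite /PB (eq_bigr (fun l => x l 0 * y l 0 - dot (uvec I) x * y l 0
    + (dot (uvec I) x * dot (uvec I) y - dot (uvec I) y * x l 0))); last first.
  by move=> l /eqP <-; rewrite !dot_w; ring.
rewrite !big_split /= !sumrN -!mulr_sumr !sum_blkE avg_cst -!dot_u; ring.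
Qed.

Lemma PBw I l y : PB I (wvec l) y = if blk l == I then dot (wvec l) y else 0.
Proof.
rewrite PBE [dot _ (wvec l)]dotC dot_wu mul0r mulr0 subr0.
case: ifP => h.
  rewrite /dot [RHS](bigID (fun i => blk i == I)) /= [X in _ + X]big1 ?addr0 // => l' hl'.
  rewrite wvecE (eqP h) (negbTE hl') mul0r subr0; case: eqP => [E|_]; last by rewrite mul0r.
  by rewrite E h in hl'.
apply: big1 => l' /eqP hl'; rewrite wvecE hl' [I == _]eq_sym h mul0r subr0.
by case: eqP => [E|_]; rewrite ?mul0r // -E hl' eqxx in h *.
Qed.

Lemma PB_self I y : PB I y y <= \sum_(l | blk l == I) y l 0 ^+ 2.
Proof.
rewrite PBE (eq_bigr (fun l => y l 0 ^+ 2)); last by move=> l _; rewrite expr2.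
by rewrite gerBl mulr_ge0 ?bsz_ge0 // -expr2 sqr_ge0.
Qed.

(** A Bessel inequality: the [wvec] are not orthogonal, but they are the projections of an
    orthonormal basis. *)
Lemma sum_w_sqr y : \sum_l dot (wvec l) y ^+ 2 <= nrm y ^+ 2.
Proof.
rewrite (partition_big blk predT) //= nrm_sqr.
rewrite /dot (eq_bigr (fun l => y l 0 ^+ 2)); last by move=> l _; rewrite expr2.
rewrite [leRHS](partition_big blk predT) //=; apply: ler_sum => I _.
have := PB_self I y; rewrite /PB.
by rewrite (eq_bigr (fun l => dot (wvec l) y ^+ 2)) // => l _; rewrite expr2.
Qed.

Lemma PB_le I x y : `|PB I x y| <= nrm x * nrm y.
Proof.
apply: le_sqr2; first by rewrite mulr_ge0 ?nrm_ge0.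
rewrite -normrX ger0_norm ?sqr_ge0 //; apply: (le_trans (sum_CS _ _ _)).
have h z : \sum_(l | blk l == I) dot (wvec l) z ^+ 2 <= nrm z ^+ 2.
  apply: le_trans (sum_w_sqr z); rewrite [leRHS](bigID (fun l => blk l == I)) /= lerDl.
  by apply: sumr_ge0 => l _; apply: sqr_ge0.
by rewrite exprMn; apply: ler_pM => //; apply: sumr_ge0 => l _; apply: sqr_ge0.
Qed.

(** The two sides of the bipartite structure; a hermitized matrix exchanges them. *)
Definition isL (x : 'cV[R]_(d + d)) := forall j, x (rshift d j) 0 = 0.
Definition isR (x : 'cV[R]_(d + d)) := forall j, x (lshift d j) 0 = 0.

Lemma dot_LR x y : isL x -> isR y -> dot x y = 0.
Proof.
move=> hx hy; rewrite /dot big_split_ord /= !big1 ?addr0 // => j _.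
  by rewrite hx mul0r.
by rewrite hy mulr0.
Qed.

Lemma w_isL j : isL (wvec (lshift d j)).
Proof.
move=> j'; rewrite wvecE blkl blkr eq_sym lr_neq [_ == lshift _ _]eq_sym lr_neq.
by rewrite mul0r subrr.
Qed.

Lemma w_isR j : isR (wvec (rshift d j)).
Proof. by move=> j'; rewrite wvecE blkl blkr !lr_neq mul0r subrr. Qed.

Lemma isL_sum (I : Type) (s : seq I) (P : pred I) F : (forall i, P i -> isL (F i)) -> isL (\sum_(i <- s | P i) F i).
Proof. by move=> h j; rewrite summxE big1 // => i hi; apply: h. Qed.
Lemma isR_sum (I : Type) (s : seq I) (P : pred I) F : (forall i, P i -> isR (F i)) -> isR (\sum_(i <- s | P i) F i).
Proof. by move=> h j; rewrite summxE big1 // => i hi; apply: h. Qed.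
Lemma isLZ a x : isL x -> isL (a *: x).
Proof. by move=> h j; rewrite mxE h mulr0. Qed.
Lemma isRZ a x : isR x -> isR (a *: x).
Proof. by move=> h j; rewrite mxE h mulr0. Qed.
Lemma isLD x y : isL x -> isL y -> isL (x + y).
Proof. by move=> h1 h2 j; rewrite mxE h1 h2 addr0. Qed.
Lemma isRD x y : isR x -> isR y -> isR (x + y).
Proof. by move=> h1 h2 j; rewrite mxE h1 h2 addr0. Qed.
End Blocks.
(** * The limiting moments *)

Section Mseq.
Variables (R : realType) (N : nat).
Implicit Types (c : 'I_N -> 'I_N -> R).

(* x_I = sum_k (ms k I) z^(-2k-1) is the formal solution of 1/x_I + sum_J c_IJ x_J = z. *)
Fixpoint mtab c k : nat -> 'I_N -> R :=
  if k is k'.+1 then fun j I => if (j <= k')%N then mtab c k' j I else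
    \sum_J c I J * (\sum_(a < k) mtab c k' a J * mtab c k' (k' - a)%N I)
  else fun _ _ => 1.
Definition ms c k := mtab c k k.

Lemma mtabE c k j : (j <= k)%N -> mtab c k j = ms c j.
Proof.
elim: k => [|k IH] hj; first by have -> : j = 0%N by lia.
have [->//|h] := eqVneq j k.+1.
have hj' : (j <= k)%N by lia.
by rewrite -IH //; apply/funext => I /=; rewrite hj'.
Qed.

Lemma ms0 c I : ms c 0 I = 1. Proof. by []. Qed.

Lemma msS c k I : ms c k.+1 I = \sum_J c I J * (\sum_(a < k.+1) ms c a J * ms c (k - a)%N I).
Proof.
rewrite /ms /= ltnn; apply: eq_bigr => J _; congr (_ * _); apply: eq_bigr => a _.
by rewrite !mtabE // ?leq_subr // -ltnS.
Qed.

Lemma ms_ind c (P : nat -> Prop) : P 0%N -> (forall k, (forall j, (j <= k)%N -> P j) -> P k.+1) -> forall k, P k.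
Proof.
move=> P0 PS; elim/ltn_ind => -[//|k] IH; apply: PS => j hj; apply: IH; lia.
Qed.

Lemma ms_ge0 c : (forall I J, 0 <= c I J) -> forall k I, 0 <= ms c k I.
Proof.
move=> c0; apply: (ms_ind c) => [I|k IH I]; first by rewrite ms0.
rewrite msS; apply: sumr_ge0 => J _; apply: mulr_ge0 => //; apply: sumr_ge0 => a _.
have := ltn_ord a; rewrite ltnS => ha; apply: mulr_ge0; apply: IH => //; exact: leq_subr.
Qed.

Lemma ms_scale c t k I : ms (fun I J => t * c I J) k I = t ^+ k * ms c k I.
Proof.
move: k I; apply: (ms_ind c) => [I|k IH I]; first by rewrite !ms0 expr0 mulr1.
rewrite !msS mulr_sumr; apply: eq_bigr => J _.
rewrite exprS -!mulrA; congr (t * _); rewrite mulrCA; congr (c I J * _).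
rewrite mulr_sumr; apply: eq_bigr => a _; have := ltn_ord a; rewrite ltnS => ha.
have E : t ^+ k = t ^+ a * t ^+ (k - a) by rewrite -exprD subnKC.
rewrite !IH ?leq_subr // E; ring.
Qed.

Lemma cauchy_tri (f h : nat -> R) m :
  \sum_(k < m) \sum_(a < k.+1) f a * h (k - a)%N = \sum_(a < m) \sum_(b < m - a) f a * h b.
Proof.
elim: m => [|m IH]; first by rewrite !big_ord0.
rewrite big_ord_recr /= IH [RHS]big_ord_recr /= [X in _ + X = _]big_ord_recr /= addrA; congr (_ + _).
  rewrite -big_split /=; apply: eq_bigr => a _; have ha := ltn_ord a.
  have -> : (m.+1 - a = (m - a).+1)%N by clear - ha; lia.
  by rewrite big_ord_recr.
by rewrite subSn // subnn big_ord1.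
Qed.

Lemma sum_ord_mono (h : nat -> R) m m' : (m <= m')%N -> (forall k, 0 <= h k) ->
  \sum_(k < m) h k <= \sum_(k < m') h k.
Proof.
move=> mm h0; rewrite -(big_mkord xpredT h) -(big_mkord xpredT h).
rewrite [leRHS](big_cat_nat (n := m)) //= lerDl; exact: sumr_ge0.
Qed.

(** The triangle [a + b < m] lies in the square of side [m]. *)
Lemma cauchy_le (f h : nat -> R) m : (forall k, 0 <= f k) -> (forall k, 0 <= h k) ->
  \sum_(k < m) \sum_(a < k.+1) f a * h (k - a)%N <= (\sum_(a < m) f a) * (\sum_(b < m) h b).
Proof.
move=> f0 h0; rewrite cauchy_tri mulr_suml; apply: ler_sum => a _; rewrite -mulr_sumr.
by apply: ler_wpM2l => //; apply: sum_ord_mono => //; apply: leq_subr.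
Qed.

(** The square of side [m] lies in the triangle [a + b < m + m]. *)
Lemma cauchy_ge (f h : nat -> R) m : (forall k, 0 <= f k) -> (forall k, 0 <= h k) ->
  (\sum_(a < m) f a) * (\sum_(b < m) h b) <= \sum_(k < m + m) \sum_(a < k.+1) f a * h (k - a)%N.
Proof.
move=> f0 h0; rewrite cauchy_tri mulr_suml.
apply: (@le_trans _ _ (\sum_(a < m) \sum_(b < m + m - a) f a * h b)).
  apply: ler_sum => a _; rewrite -mulr_sumr; apply: ler_wpM2l => //.
  by apply: sum_ord_mono => //; have := ltn_ord a; lia.
apply: (@sum_ord_mono (fun a => \sum_(b < m + m - a) f a * h b)); first exact: leq_addr.
by move=> k; apply: sumr_ge0 => b _; apply: mulr_ge0.
Qed.

Lemma pow_small (rho eta : R) : 0 <= rho -> rho < 1 -> 0 < eta -> exists n, rho ^+ n <= eta.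
Proof.
move=> r0 r1 e0; have : (fun n => rho ^+ n) @ \oo --> (0 : R).
  by apply: cvg_expr; rewrite ger0_norm.
move/cvgrPdist_lt => /(_ _ e0) [n _ /(_ n (leqnn n))] /=.
by rewrite sub0r normrN ger0_norm ?exprn_ge0 // => /ltW h; exists n.
Qed.

Lemma geom_le (rho : R) m : 0 <= rho -> rho < 1 -> \sum_(k < m) rho ^+ k <= (1 - rho)^-1.
Proof.
move=> r0 r1; have r2 : 0 < 1 - rho by rewrite subr_gt0.
rewrite -[leRHS]mul1r ler_pdivlMr //; have := subrX1 rho m.
have : 0 <= rho ^+ m by apply: exprn_ge0.
set S := \sum_(k < m) _; nra.
Qed.

(** Truncating the series that formally solves the fixed point equation at [l1] gives a feasible
    point. The truncation error is a geometric tail, paid for by the gap between [l1] and [l2]. *)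
Lemma frak_feasible c lam l1 : (forall I J, 0 <= c I J) -> 0 < lam -> lam < l1 ->
  (forall k I, ms c k I <= lam ^+ (k + k)) ->
  forall l2, l1 < l2 -> exists x : 'I_N -> R, (forall I, 0 < x I) /\
    forall I, (x I)^-1 + \sum_J c I J * x J <= l2.
Proof.
move=> c0 lam0 l1p hm l2 l12; have l10 : 0 < l1 by apply: lt_trans l1p.
pose L := l1^-1; have L0 : 0 < L by rewrite invr_gt0.
pose rho := (lam * L) ^+ 2.
have lL : lam * L < 1 by rewrite /L ltr_pdivrMr // mul1r.
have lL0 : 0 <= lam * L by rewrite mulr_ge0 // ltW.
have r0 : 0 <= rho by apply: sqr_ge0.
have r1 : rho < 1 by rewrite /rho expr_lt1.
(* The term [ms c k I * l1 ^ (- 2 k - 1)] of the series; it decays at least like [rho ^+ k]. *)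
pose f I k := ms c k I * (L * (L ^+ k * L ^+ k)).
have Lk k : 0 <= L ^+ k by rewrite exprn_ge0 // ltW.
have f0 I k : 0 <= f I k by rewrite !mulr_ge0 ?ms_ge0 // ltW.
have fle I k : f I k <= L * rho ^+ k.
  rewrite /f mulrCA; apply: ler_wpM2l; first exact: ltW.
  rewrite /rho -exprM mulnC exprM -exprMn.
  have -> : (lam * L) ^+ k ^+ 2 = lam ^+ (k + k) * (L ^+ k * L ^+ k) by rewrite exprMn exprD; ring.
  by rewrite exprMn; apply: ler_wpM2r; rewrite ?mulr_ge0.
have fS I k : f I k.+1 = L * \sum_J c I J * (\sum_(a < k.+1) f J a * f I (k - a)%N).
  rewrite /f msS mulr_suml mulr_sumr; apply: eq_bigr => J _; rewrite -mulrA [RHS]mulrCA; congr (_ * _).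
  rewrite mulr_suml mulr_sumr; apply: eq_bigr => a _; have := ltn_ord a; rewrite ltnS => ha.
  have E : L ^+ k = L ^+ a * L ^+ (k - a) by rewrite -exprD subnKC.
  rewrite !exprS E; ring.
pose G m I := \sum_(k < m) f I k.
(* The fixed point equation becomes an inequality because a product of partial sums of length [m] is
   covered by the convolution up to [m + m]; hence the longer sum on the right. *)
have fix_ m I : (0 < m)%N -> 1 + \sum_J c I J * G m J * G m I <= l1 * G (m + m).+1 I.
  move=> m0; rewrite {3}/G big_ord_recl mulrDr; apply: lerD.
    by rewrite /f ms0 !expr0 !mulr1 mul1r mulfV // gt_eqF.
  apply: (@le_trans _ _ (\sum_J c I J * \sum_(k < m + m) \sum_(a < k.+1) f J a * f I (k - a)%N)).
    by apply: ler_sum => J _; rewrite -mulrA; apply: ler_wpM2l => //; apply: cauchy_ge.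
  rewrite le_eqVlt; apply/orP; left; apply/eqP.
  under [in RHS]eq_bigr => k _ do rewrite lift0 fS.
  rewrite -mulr_sumr mulrA mulfV ?gt_eqF // mul1r exchange_big /=.
  by apply: eq_bigr => J _; rewrite mulr_sumr.
have tail m I : G (m + m).+1 I <= G m I + L * (rho ^+ m * (1 - rho)^-1).
  rewrite /G (_ : (m + m).+1 = (m + m.+1)%N); last by lia.
  rewrite big_split_ord /= lerD2l.
  apply: (@le_trans _ _ (\sum_(i < m.+1) L * (rho ^+ m * rho ^+ i))).
    by apply: ler_sum => i _; rewrite -exprD; apply: fle.
  rewrite -mulr_sumr -mulr_sumr; apply: ler_wpM2l; first exact: ltW.
  by apply: ler_wpM2l; [exact: exprn_ge0|exact: geom_le].
have eta0 : 0 < (l2 - l1) * (1 - rho) / l1 by rewrite !divr_gt0 // mulr_gt0 // subr_gt0.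
have [m0 hm0] := pow_small r0 r1 eta0.
pose m := m0.+1.
have hmm : rho ^+ m <= (l2 - l1) * (1 - rho) / l1.
  by apply: le_trans hm0; rewrite exprS; apply: ler_piMl; [exact: exprn_ge0|exact: ltW].
have GL I : L <= G m I.
  rewrite /G big_ord_recl /f ms0 !expr0 !mulr1 mul1r lerDl; apply: sumr_ge0 => k _; exact: f0.
have Gp I : 0 < G m I by apply: lt_le_trans (GL I).
exists (G m); split=> // I.
rewrite -(ler_pM2r (Gp I)) mulrDl mulVf ?gt_eqF // mulr_suml.
apply: (le_trans (fix_ m I (ltn0Sn _))).
have l1L : l1 * L = 1 by rewrite mulfV // gt_eqF.
apply: (@le_trans _ _ (l1 * (G m I + L * (rho ^+ m * (1 - rho)^-1)))).
  by apply: ler_wpM2l; [exact: ltW|exact: tail].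
rewrite mulrDr mulrA l1L mul1r.
have h1 : rho ^+ m / (1 - rho) <= (l2 - l1) * L.
  by rewrite ler_pdivrMr ?subr_gt0 // mulrAC.
have h2 : (l2 - l1) * L <= (l2 - l1) * G m I by apply: ler_wpM2l => //; rewrite subr_ge0 ltW.
have -> : l2 * G m I = l1 * G m I + (l2 - l1) * G m I by ring.
by rewrite lerD2l; apply: le_trans h2.
Qed.
End Mseq.
(** * Sums of independent matrices *)

Section SumA.
Variables (R : realType) (X V : finType) (mu : X -> V -> R).
Hypothesis mu0 : forall s v, 0 <= mu s v.
Hypothesis mu1 : forall s, \sum_v mu s v = 1.
Variables (g : X -> nat) (m : nat).
Hypothesis hg : forall s, (g s < m)%N.
Local Notation Om := {ffun X -> V}.
Local Notation Ex := (Ex mu).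
Local Notation Ex2 := (Ex2 mu).
Local Notation nrm := eucl_norm.

(** Independence of what block [i] determines and what ignores it, written with a second copy so
    that no conditional expectation is needed. *)
Lemma Ex_ind (S S' : Type) i (F : S -> S' -> R) (a : Om -> S) (b : Om -> S') :
  (forall w w', a (mix (inblk g i) w w') = a w) -> (forall w w', b (mix (inblk g i) w w') = b w') ->
  Ex (fun w => F (a w) (b w)) = Ex2 (fun w w' => F (a w) (b w')).
Proof.
move=> ha hb; rewrite -(Ex2_mix mu1 (inblk g i)); apply: eq_Ex2 => w w'.
by rewrite ha hb.
Qed.

Lemma ler_dist_pow (a b M : R) n : 0 <= a -> 0 <= b -> a <= M -> b <= M ->
  `|a ^+ n.+1 - b ^+ n.+1| <= n.+1%:R * `|a - b| * M ^+ n.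
Proof.
move=> a0 b0 aM bM; have M0 := le_trans a0 aM.
rewrite subrXX normrM [_%:R * _]mulrC -mulrA; apply: ler_wpM2l; first exact: normr_ge0.
apply: (le_trans (ler_norm_sum _ _ _)); rewrite -sum_ord_cst; apply: ler_sum => i _.
have E : M ^+ n = M ^+ (n - i) * M ^+ i by rewrite -exprD subnK // -ltnS.
rewrite /= normrM !normrX !ger0_norm // E.
by apply: ler_pM; rewrite ?exprn_ge0 //; apply: lerXn2r; rewrite ?nnegrE.
Qed.

Section Vec.
Variables (D : nat) (q : Om -> 'cV[R]_D) (q0 : nat -> Om -> 'cV[R]_D) (s : R).
Let dq i w := q w - q0 i w.
Hypothesis q_sum : forall w, q w = \sum_(i < m) dq i w.
Hypothesis q0_ind : forall i w w', q0 i (mix (inblk g i) w w') = q0 i w.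
Hypothesis dq_ind : forall i w w', dq i (mix (inblk g i) w w') = dq i w'.
Hypothesis dq_mean : forall i x, Ex (fun w => dot x (dq i w)) = 0.
Hypothesis dq_le : forall i w, nrm (dq i w) <= s.

(** Replacing [q] by [q0 i] makes the leading term centred given the other blocks; both
    replacements, in the inner product and in the power, cost a second factor [s]. *)
Lemma vec_pt i w p : dot (q w) (dq i w) * nrm (q w) ^+ p.+2 <=
  dot (q0 i w) (dq i w) * nrm (q0 i w) ^+ p.+2 + p.+3%:R * (s ^+ 2 * (nrm (q w) + s) ^+ p.+2).
Proof.
have s0 : 0 <= s by apply: le_trans (nrm_ge0 _) (dq_le i w).
set M := nrm (q w) + s.
have qM : nrm (q w) <= M by rewrite lerDl.
have q0E : q0 i w = q w - dq i w by rewrite /dq subKr.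
have q0M : nrm (q0 i w) <= M by rewrite q0E; apply: (le_trans (nrmB _ _)); rewrite lerD2l.
have M0 : 0 <= M by apply: le_trans qM; apply: nrm_ge0.
have dd : `|nrm (q w) - nrm (q0 i w)| <= s.
  rewrite ler_norml; apply/andP; split.
    rewrite lerBrDl -lerBrDr opprK q0E; apply: (le_trans (nrmB _ _)); by rewrite lerD2l.
  rewrite lerBlDl addrC; have {1}-> : q w = dq i w + q0 i w by rewrite /dq subrK.
  by apply: (le_trans (nrmD _ _)); rewrite lerD2r.
have E : dot (q w) (dq i w) = dot (q0 i w) (dq i w) + nrm (dq i w) ^+ 2.
  by rewrite nrm_sqr -dotDl addrC /dq subrK.
have h1 : nrm (dq i w) ^+ 2 * nrm (q w) ^+ p.+2 <= s ^+ 2 * M ^+ p.+2.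
  by apply: ler_pM; rewrite ?exprn_ge0 ?nrm_ge0 //; apply: lerXn2r; rewrite ?nnegrE ?nrm_ge0.
have h2 : dot (q0 i w) (dq i w) * (nrm (q w) ^+ p.+2 - nrm (q0 i w) ^+ p.+2) <= p.+2%:R * (s ^+ 2 * M ^+ p.+2).
  apply: (le_trans (ler_norm _)); rewrite normrM.
  have -> : p.+2%:R * (s ^+ 2 * M ^+ p.+2) = (M * s) * (p.+2%:R * s * M ^+ p.+1) by rewrite [M ^+ p.+2]exprS; ring.
  apply: ler_pM => //; first exact: dot_le1.
  apply: (le_trans (ler_dist_pow _ (nrm_ge0 _) (nrm_ge0 _) qM q0M)).
  by apply: ler_wpM2r; rewrite ?exprn_ge0 //; apply: ler_wpM2l.
have E3 : p.+3%:R = p.+2%:R + 1 :> R by rewrite natr1.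
rewrite E3 E mulrDl [(_ + 1) * _]mulrDl mul1r.
rewrite mulrBr in h2; lra.
Qed.

(** Exactly the constants that close the induction of [vec_moment]; only their independence of the
    number of blocks matters. *)
Fixpoint qmom (Cv : R) p : R := if p is p'.+1 then Cv * ((p' + p').+1%:R * (4 ^+ p' * (qmom Cv p' + 1))) else 1.

Lemma qmom_ge0 Cv p : 0 <= Cv -> 0 <= qmom Cv p.
Proof. by move=> h; elim: p => //= p IH; rewrite !mulr_ge0 ?exprn_ge0 ?addr_ge0. Qed.

Lemma pow_add_le (a b : R) n : 0 <= a -> 0 <= b -> (a + b) ^+ n <= 2 ^+ n * (a ^+ n + b ^+ n).
Proof.
move=> a0 b0; wlog ab : a b a0 b0 / a <= b.
  move=> h; have [/h|/ltW/h] := lerP a b; first exact.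
  by rewrite addrC [b ^+ _ + _]addrC; apply.
apply: (@le_trans _ _ ((2 * b) ^+ n)).
  by apply: lerXn2r; rewrite ?nnegrE ?addr_ge0 ?mulr_ge0 //; lra.
by rewrite exprMn; apply: ler_wpM2l; rewrite ?exprn_ge0 // lerDr exprn_ge0.
Qed.

(** A Rosenthal-type bound. One factor [q] is expanded over the blocks, the centred leading terms
    vanish, and the [m] errors of size [s ^+ 2] add up to [Cv] times the previous moment. *)
Lemma vec_moment Cv : 0 <= s -> s <= 1 -> m%:R * s ^+ 2 <= Cv ->
  forall p, Ex (fun w => nrm (q w) ^+ (p + p)) <= qmom Cv p.
Proof.
move=> s0 s1 hC; have C0 : 0 <= Cv by apply: le_trans hC; rewrite mulr_ge0 ?sqr_ge0.
elim=> [|p IH]; first by rewrite -(Ex_cst mu1 (qmom Cv 0)); apply: Ex_le => // w; rewrite expr0.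
have E w : nrm (q w) ^+ (p.+1 + p.+1) = \sum_(i < m) dot (q w) (dq i w) * nrm (q w) ^+ (p + p).
  rewrite -mulr_suml -dot_sumr -q_sum -nrm_sqr -exprD; congr (_ ^+ _); lia.
rewrite (eq_Ex mu E) Ex_sum.
have zero i : Ex (fun w => dot (q0 i w) (dq i w) * nrm (q0 i w) ^+ (p + p)) = 0.
  rewrite (@Ex_ind _ _ i (fun x y => dot x y * nrm x ^+ (p + p)) (q0 i) (dq i)) //.
  rewrite -[RHS](Ex_cst mu1 0); apply: eq_Ex => w; rewrite ExZr.
  by rewrite dq_mean mul0r.
have pt i w : dot (q w) (dq i w) * nrm (q w) ^+ (p + p) <=
  dot (q0 i w) (dq i w) * nrm (q0 i w) ^+ (p + p) + (p + p).+1%:R * (s ^+ 2 * (nrm (q w) + s) ^+ (p + p)).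
  case: (p) => [|p']; last by rewrite addSn addnS; apply: vec_pt.
  rewrite !expr0 !mulr1 mul1r -lerBlDl -dotBl -/(dq i w) -nrm_sqr.
  by apply: lerXn2r; rewrite ?nnegrE ?nrm_ge0.
apply: (@le_trans _ _ (\sum_(i < m) s ^+ 2 * ((p + p).+1%:R * (4 ^+ p * (qmom Cv p + 1))))).
  apply: ler_sum => i _; apply: (le_trans (Ex_le mu0 (pt i))).
  rewrite ExD zero add0r ExZ ExZ mulrCA; apply: ler_wpM2l; first exact: sqr_ge0.
  apply: ler_wpM2l => //.
  apply: (@le_trans _ _ (Ex (fun w => 4 ^+ p * (nrm (q w) ^+ (p + p) + 1)))).
    apply: Ex_le => // w; apply: (le_trans (pow_add_le _ (nrm_ge0 _) s0)).
    have -> : 4 ^+ p = 2 ^+ (p + p) :> R by rewrite exprD -exprMn; congr (_ ^+ _); ring.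
    by apply: ler_wpM2l; rewrite ?exprn_ge0 // lerD2l exprn_ile1.
  rewrite ExZ ExD Ex_cst //; apply: ler_wpM2l; rewrite ?exprn_ge0 //.
  by rewrite lerD2r.
rewrite sum_ord_cst mulrA /=; apply: ler_wpM2r => //.
by rewrite !mulr_ge0 ?exprn_ge0 ?addr_ge0 ?qmom_ge0.
Qed.
End Vec.

Section Mat.
Variables (D : nat) (H : Om -> 'M[R]_D) (H0 : nat -> Om -> 'M[R]_D) (s v : R).
Let S i w := H w - H0 i w.
Hypothesis H_sum : forall w, H w = \sum_(i < m) S i w.
Hypothesis H_sym : forall w, (H w)^T = H w.
Hypothesis H0_ind : forall i w w', H0 i (mix (inblk g i) w w') = H0 i w.
Hypothesis S_ind : forall i w w', S i (mix (inblk g i) w w') = S i w'.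
Hypothesis S_mean : forall i x y, Ex (fun w => dot x (S i w *m y)) = 0.
Hypothesis S_var : forall i x, Ex (fun w => nrm (S i w *m x) ^+ 2) <= v * nrm x ^+ 2.
Hypothesis S_le : forall i w, opnorm (S i w) <= s.
Hypothesis H0_sym : forall i w, (H0 i w)^T = H0 i w.
Hypothesis s1 : s <= 1.
Hypothesis s0 : 0 <= s.
Hypothesis v0 : 0 <= v.
(** The added 1 absorbs the block, whose norm is at most [s <= 1]. So [th i] dominates the norms of
    both [H] and [H0 i] and still does not depend on block [i]. *)
Let th i w := opnorm (H0 i w) + 1.

Lemma th_ge1 i w : 1 <= th i w. Proof. by rewrite lerDr opnorm_ge0. Qed.
Lemma th_ge0 i w : 0 <= th i w. Proof. exact: le_trans (th_ge1 i w). Qed.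
Lemma H_th i w : opnorm (H w) <= th i w.
Proof.
have -> : H w = H0 i w + S i w by rewrite /S addrC subrK.
by apply: (le_trans (opnormD _ _)); rewrite lerD2l (le_trans (S_le _ _)).
Qed.
Lemma H0_th i w : opnorm (H0 i w) <= th i w. Proof. by rewrite lerDl. Qed.

Lemma S_sym i w : (S i w)^T = S i w.
Proof. by rewrite /S linearB /= H_sym H0_sym. Qed.

Lemma pwH_th i w k x : nrm (pw (H w) k x) <= th i w ^+ k * nrm x.
Proof.
apply: (le_trans (nrm_pw _ _ _)); apply: ler_wpM2r; first exact: nrm_ge0.
by apply: lerXn2r; rewrite ?nnegrE ?opnorm_ge0 ?th_ge0 ?H_th.
Qed.
Lemma pwH0_th i w k x : nrm (pw (H0 i w) k x) <= th i w ^+ k * nrm x.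
Proof.
apply: (le_trans (nrm_pw _ _ _)); apply: ler_wpM2r; first exact: nrm_ge0.
by apply: lerXn2r; rewrite ?nnegrE ?opnorm_ge0 ?th_ge0 ?H0_th.
Qed.

Lemma Ex_SS i x z : Ex (fun w => nrm (S i w *m x) * nrm (S i w *m z)) <= v * (nrm x * nrm z).
Proof.
apply: le_sqr2; first by rewrite !mulr_ge0 ?nrm_ge0.
apply: (le_trans (Ex_CS mu0 _ _)).
have -> : (v * (nrm x * nrm z)) ^+ 2 = (v * nrm x ^+ 2) * (v * nrm z ^+ 2) by ring.
by apply: ler_pM; rewrite ?S_var //; apply: Ex_ge0 => // w; apply: sqr_ge0.
Qed.

Lemma SfS_le i x z (f : 'cV[R]_D -> 'cV[R]_D) c : 0 <= c -> (forall y, nrm (f y) <= c * nrm y) ->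
  `|Ex (fun w => dot x (S i w *m f (S i w *m z)))| <= v * c * (nrm x * nrm z).
Proof.
move=> c0 hf; apply: (le_trans (Ex_abs mu0 _)).
apply: (@le_trans _ _ (Ex (fun w => c * (nrm (S i w *m x) * nrm (S i w *m z))))).
  apply: Ex_le => // w; rewrite -dot_sym ?S_sym //; apply: (le_trans (dot_le _ _)).
  by rewrite mulrCA; apply: ler_wpM2l; rewrite ?nrm_ge0.
by rewrite ExZ (mulrC v) -mulrA; apply: ler_wpM2l => //; apply: Ex_SS.
Qed.

(** The second-order contribution of block [i], with the matrix [G] frozen and the block averaged on
    its own. *)
Definition phi i (G : 'M[R]_D) a x z := Ex (fun w' => dot x (S i w' *m pw G a (S i w' *m z))).

Lemma pw_diff i w a y : nrm (pw (H w) a y - pw (H0 i w) a y) <= s * (a%:R * th i w ^+ a) * nrm y.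
Proof.
rewrite (pw_tele (H w) (H0 i w)) [X in X - _]addrC addrK -/(S i w).
apply: (le_trans (nrm_sum _ _ _)).
have -> : s * (a%:R * th i w ^+ a) * nrm y = a%:R * (th i w ^+ a * (s * nrm y)) by ring.
rewrite -sum_ord_cst; apply: ler_sum => j _; have hj := ltn_ord j.
apply: (le_trans (pwH_th i _ _ _)).
apply: (@le_trans _ _ (th i w ^+ (a - j.+1) * (s * (th i w ^+ j * nrm y)))).
  apply: ler_wpM2l; first by rewrite exprn_ge0 ?th_ge0.
  by apply: opnormP1; rewrite ?S_le // pwH0_th.
have -> : th i w ^+ (a - j.+1) * (s * (th i w ^+ j * nrm y)) = th i w ^+ (a - j.+1 + j) * (s * nrm y).
  by rewrite exprD; ring.
apply: ler_wpM2r; first by rewrite mulr_ge0 ?nrm_ge0.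
by apply: ler_weXn2l; [exact: th_ge1|lia].
Qed.

(** The matrix occurs twice, in the middle power and in the vector on the right; the two
    replacements are the two summands of the bound. *)
Lemma phi_diff i w a j x y : nrm x <= 1 -> nrm y <= 1 ->
  `|phi i (H0 i w) a x (pw (H0 i w) j y) - phi i (H w) a x (pw (H w) j y)| <=
  v * s * ((a + j)%:R * th i w ^+ (a + j)).
Proof.
move=> hx hy; have t0 := th_ge0 i w; have tp n := exprn_ge0 n t0.
set z0 := pw (H0 i w) j y; set z := pw (H w) j y.
have -> : phi i (H0 i w) a x z0 - phi i (H w) a x z =
   - Ex (fun w' => dot x (S i w' *m (pw (H w) a (S i w' *m z0) - pw (H0 i w) a (S i w' *m z0))))
   - Ex (fun w' => dot x (S i w' *m pw (H w) a (S i w' *m (z - z0)))).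
  rewrite /phi -ExB -ExN -ExB; apply: eq_Ex => w'.
  have pB (G : 'M[R]_D) b u u' : pw G b (u - u') = pw G b u - pw G b u'.
    by rewrite pw_add -scaleN1r pwZ scaleN1r.
  by rewrite !mulmxBr pB !mulmxBr !dotBr; ring.
apply: (le_trans (ler_normB _ _)); rewrite normrN natrD mulrDl mulrDr.
apply: lerD.
  apply: (le_trans (@SfS_le i x z0 _ (s * (a%:R * th i w ^+ a)) _ (fun u => pw_diff i w a u))).
    by rewrite !mulr_ge0.
  have -> : v * s * (a%:R * th i w ^+ (a + j)) = v * (s * (a%:R * th i w ^+ a)) * (1 * (th i w ^+ j * 1)) by rewrite exprD; ring.
  apply: ler_wpM2l; first by rewrite !mulr_ge0.
  apply: ler_pM; rewrite ?nrm_ge0 //; apply: (le_trans (pwH0_th i _ _ _)); exact: ler_wpM2l.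
apply: (le_trans (@SfS_le i x (z - z0) (pw (H w) a) _ (tp a) (fun u => pwH_th i w a u))).
have -> : v * s * (j%:R * th i w ^+ (a + j)) = v * th i w ^+ a * (1 * (s * (j%:R * th i w ^+ j) * 1)) by rewrite exprD; ring.
apply: ler_wpM2l; first by rewrite mulr_ge0.
apply: ler_pM; rewrite ?nrm_ge0 //; apply: (le_trans (pw_diff _ _ _ _)).
by apply: ler_wpM2l => //; rewrite !mulr_ge0.
Qed.

(** Two successive Duhamel expansions. Only the third-order term still contains the full [H],
    between two factors [S i]. *)
Lemma S_tele i w k x y : dot x (S i w *m pw (H w) k y) = dot x (S i w *m pw (H0 i w) k y)
  + \sum_(j < k) dot x (S i w *m pw (H0 i w) (k - j.+1) (S i w *m pw (H0 i w) j y))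
  + \sum_(j < k) \sum_(l < j) dot x (S i w *m pw (H0 i w) (k - j.+1) (S i w *m
       pw (H w) (j - l.+1) (S i w *m pw (H0 i w) l y))).
Proof.
rewrite {1}(pw_tele' (H w) (H0 i w)) -/(S i w) mulmxDr dotDr -addrA; congr (_ + _).
rewrite mulmx_sumr dot_sumr -big_split /=; apply: eq_bigr => j _.
rewrite {1}(pw_tele (H w) (H0 i w)) -/(S i w) mulmxDr pw_add mulmxDr dotDr; congr (_ + _).
by rewrite mulmx_sumr pw_sum mulmx_sumr dot_sumr.
Qed.

Variables (P : nat) (Mo : R).
Hypothesis hMo : forall i, Ex (fun w => th i w ^+ P) <= Mo.

Lemma Ex_th i p : (p <= P)%N -> Ex (fun w => th i w ^+ p) <= Mo.
Proof.
move=> h; apply: le_trans (hMo i); apply: Ex_le => // w.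
by apply: ler_weXn2l => //; apply: th_ge1.
Qed.

Lemma Mo_ge0 : 0 <= Mo.
Proof. by apply: le_trans (hMo 0%N); apply: Ex_ge0 => // w; rewrite exprn_ge0 ?th_ge0. Qed.

(** The middle factor [S i] is bounded by its norm [s], the two outer ones by their variance [v];
    all powers are bounded through [th i], so these variances decouple from the rest. *)
Lemma Ex_third_le i k j l x y : (l < j)%N -> (j < k)%N -> (k <= P)%N -> nrm x <= 1 -> nrm y <= 1 ->
  `|Ex (fun w => dot x (S i w *m pw (H0 i w) (k - j.+1) (S i w *m
       pw (H w) (j - l.+1) (S i w *m pw (H0 i w) l y))))| <= v * s * Mo.
Proof.
move=> lj jk kP hx hy; apply: (le_trans (Ex_abs mu0 _)).
have tp n i' w : 0 <= th i' w ^+ n by rewrite exprn_ge0 ?th_ge0.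
apply: (@le_trans _ _ (Ex (fun w => s * (th i w ^+ (k - l - 2) * (nrm (S i w *m x) * nrm (S i w *m pw (H0 i w) l y)))))).
  apply: Ex_le => // w; rewrite -dot_sym ?S_sym //; apply: (le_trans (dot_le _ _)).
  have -> : s * (th i w ^+ (k - l - 2) * (nrm (S i w *m x) * nrm (S i w *m pw (H0 i w) l y))) =
    nrm (S i w *m x) * (th i w ^+ (k - j.+1) * (s * (th i w ^+ (j - l.+1) * nrm (S i w *m pw (H0 i w) l y)))).
    have -> : (k - l - 2 = (k - j.+1) + (j - l.+1))%N by lia.
    by rewrite exprD; ring.
  apply: ler_wpM2l; first exact: nrm_ge0.
  apply: (le_trans (pwH0_th i _ _ _)); apply: ler_wpM2l => //.
  by apply: opnormP1; rewrite ?S_le // pwH_th.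
rewrite ExZ -mulrA [v * (s * _)]mulrCA; apply: ler_wpM2l => //.
rewrite (@Ex_ind _ _ i (fun G T => (opnorm G + 1) ^+ (k - l - 2) * (nrm (T *m x) * nrm (T *m pw G l y))) (H0 i) (S i)) //.
apply: (@le_trans _ _ (Ex (fun w => v * th i w ^+ (k - 2)))).
  apply: Ex_le => // w; rewrite ExZ.
  apply: (@le_trans _ _ (th i w ^+ (k - l - 2) * (v * (1 * (th i w ^+ l * 1))))).
    apply: ler_wpM2l; first exact: (tp _ i w).
    apply: (le_trans (Ex_SS i _ _)); apply: ler_wpM2l => //.
    apply: ler_pM; rewrite ?nrm_ge0 //; apply: (le_trans (pwH0_th i _ _ _)); exact: ler_wpM2l.
  have -> : (k - 2 = (k - l - 2) + l)%N by lia.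
  by rewrite exprD le_eqVlt; apply/orP; left; apply/eqP; ring.
by rewrite ExZ; apply: ler_wpM2l => //; apply: Ex_th; lia.
Qed.

(* Second-order expansion: the first-order terms have mean zero, the third-order ones cost a
   factor [s], and replacing [H0 i] by [H] in the second-order ones costs another [s]. *)
Lemma second_order k x y : (k <= P)%N -> nrm x <= 1 -> nrm y <= 1 ->
  `|Ex (fun w => dot x (pw (H w) k.+1 y)) -
    \sum_(j < k) Ex (fun w => \sum_(i < m) phi i (H w) (k - j.+1) x (pw (H w) j y))| <=
  m%:R * (k%:R * (k%:R * (2 * (v * s * Mo)))).
Proof.
move=> kP hx hy.
have hsum w : dot x (pw (H w) k.+1 y) = \sum_(i < m) dot x (S i w *m pw (H w) k y).
  by rewrite pwS {1}H_sum mulmx_suml dot_sumr.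
rewrite (eq_Ex mu hsum) Ex_sum.
have -> : \sum_(j < k) Ex (fun w => \sum_(i < m) phi i (H w) (k - j.+1) x (pw (H w) j y)) =
  \sum_(i < m) \sum_(j < k) Ex (fun w => phi i (H w) (k - j.+1) x (pw (H w) j y)).
  by rewrite [RHS]exchange_big /=; apply: eq_bigr => j _; rewrite Ex_sum.
rewrite -sumrB; apply: (le_trans (ler_norm_sum _ _ _)); rewrite -sum_ord_cst; apply: ler_sum => i _.
have Mo0 := Mo_ge0.
have first : Ex (fun w => dot x (S i w *m pw (H0 i w) k y)) = 0.
  rewrite (@Ex_ind _ _ i (fun G T => dot x (T *m pw G k y)) (H0 i) (S i)) //.
  by rewrite -[RHS](Ex_cst mu1 0); apply: eq_Ex => w; apply: S_mean.
have sec j : Ex (fun w => dot x (S i w *m pw (H0 i w) (k - j.+1) (S i w *m pw (H0 i w) j y))) =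
   Ex (fun w => phi i (H0 i w) (k - j.+1) x (pw (H0 i w) j y)).
  by rewrite (@Ex_ind _ _ i (fun G T => dot x (T *m pw G (k - j.+1) (T *m pw G j y))) (H0 i) (S i)).
rewrite (eq_Ex mu (fun w => S_tele i w k x y)) ExD ExD first add0r !Ex_sum.
under eq_bigr => j _ do rewrite sec.
rewrite [X in _ + X - _](eq_bigr (fun j : 'I_k => \sum_(l < j) Ex (fun w => dot x (S i w *m pw (H0 i w) (k - j.+1) (S i w *m
       pw (H w) (j - l.+1) (S i w *m pw (H0 i w) l y)))))); last by move=> j _; rewrite Ex_sum.
rewrite addrAC -sumrB -big_split /=.
apply: (le_trans (ler_norm_sum _ _ _)); rewrite -sum_ord_cst; apply: ler_sum => j _; have hj := ltn_ord j.
have -> : k%:R * (2 * (v * s * Mo)) = k%:R * (v * s * Mo) + k%:R * (v * s * Mo) by ring.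
apply: (le_trans (ler_normD _ _)); apply: lerD.
  rewrite -ExB; apply: (le_trans (Ex_abs mu0 _)).
  apply: (@le_trans _ _ (Ex (fun w => v * s * (k%:R * th i w ^+ k)))).
    apply: Ex_le => // w; apply: (le_trans (phi_diff _ _ _ _ hx hy)).
    apply: ler_wpM2l; first by rewrite mulr_ge0.
    apply: ler_pM; rewrite ?exprn_ge0 ?th_ge0 //; first by rewrite ler_nat; lia.
    by apply: ler_weXn2l; [exact: th_ge1|lia].
  rewrite ExZ ExZ mulrCA; apply: ler_wpM2l => //; apply: ler_wpM2l; first exact: mulr_ge0.
  exact: Ex_th.
apply: (le_trans (ler_norm_sum _ _ _)).
apply: (@le_trans _ _ (\sum_(l < j) v * s * Mo)).
  by apply: ler_sum => l _; apply: Ex_third_le => //; exact: ltn_ord.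
rewrite sum_ord_cst; apply: ler_wpM2r; first by rewrite !mulr_ge0.
by rewrite ler_nat ltnW.
Qed.
End Mat.

(** An Efron-Stein bound: [cov_le] with both functions equal. With [a = (f - f_ i) ^+ 2], each block
    contributes one mean of [a] and twice half of one, hence [2 * e]. *)
Lemma variance_le (f : Om -> R) (f_ : nat -> Om -> R) e :
  (forall i, indep_blk g i (f_ i)) -> (forall i, Ex (fun w => (f w - f_ i w) ^+ 2) <= e) ->
  Ex (fun w => (f w - Ex f) ^+ 2) <= m%:R * (2 * e).
Proof.
move=> hf he.
have -> : Ex (fun w => (f w - Ex f) ^+ 2) = Ex (fun w => f w * f w) - Ex f * Ex f.
  have E c w : (f w - c) ^+ 2 = f w * f w + (- (2 * c)) * f w + c * c by ring.
  rewrite (eq_Ex mu (E (Ex f))).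
  have E2 c : Ex (fun w => f w * f w + (- (2 * c)) * f w + c * c) = Ex (fun w => f w * f w) + (- (2 * c)) * Ex f + c * c.
    by rewrite ExD ExD ExZ Ex_cst.
  by rewrite E2; ring.
apply: (le_trans (ler_norm _)); have C := @cov_le _ _ _ mu mu0 mu1 g m hg f f f_ f_ hf hf; refine (le_trans C _) => {C}.
rewrite -sum_ord_cst; apply: ler_sum => i _.
pose a w := (f w - f_ i w) ^+ 2.
apply: (@le_trans _ _ (Ex2 (fun w w' => a w + (1 / 2 * a (hyb g i w w') + 1 / 2 * a (hyb g i.+1 w w'))))).
  apply: Ex2_le => // w w'; rewrite /a -!(real_normK (num_real (f _ - _))).
  set A := `|_|; set B := `|_|; set C := `|_|.
  have := sqr_ge0 (A - B); have := sqr_ge0 (A - C); rewrite !sqrrB; lra.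
rewrite !Ex2D !Ex2Z (Ex2_fst mu1 a) (Ex2_hyb mu1 g i a) (Ex2_hyb mu1 g i.+1 a).
have := he i; rewrite -/a; lra.
Qed.
End SumA.
(** * The conditional model *)

Section Model.
Variables (R : realType) (K d n : nat) (part : 'I_d -> 'I_K) (sig : 'I_n -> 'I_K).
Variables (nx : 'I_n -> 'I_n) (g : 'I_n -> nat) (r kap : R) (ell : nat).
Local Notation nrm := eucl_norm.
Local Notation Om := {ffun 'I_n -> 'I_d}.
Local Notation bsz := (bsz R part).
Local Notation blk := (blk part).
Local Notation avg := (avg part).
Local Notation wvec := (wvec R part).
Local Notation uvec := (uvec R part).

(* A transition is indexed by its starting time.  The map g cuts time into blocks; the
   transitions of T stay inside a block, so distinct blocks involve independent states. *)
Definition good (T : {set 'I_n}) :=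
  (forall s, s \in T -> val (nx s) = s.+1 /\ g (nx s) = g s) /\
  forall i, (#|[set s in T | g s == i]| <= ell)%N.
Definition cond_law (s : 'I_n) (z : 'I_d) : R := (part z == sig s)%:R / (block_size part (sig s))%:R.
Definition Ab (s : 'I_n) : 'I_(K + K) := lshift K (sig s).
Definition Bb (s : 'I_n) : 'I_(K + K) := rshift K (sig (nx s)).
Definition av (s : 'I_n) (w : Om) := wvec (lshift d (w s)).
Definition bv (s : 'I_n) (w : Om) := wvec (rshift d (w (nx s))).
(** Only centred vectors occur: this is the compression of the conditionally centred hermitization
    to the orthogonal complement of the block means. In a single transition both vectors are centred
    and independent, which makes the recursion close. *)
Definition HP (T : {set 'I_n}) (w : Om) : 'M[R]_(d + d) :=
  r *: \sum_(s in T) (av s w *m (bv s w)^T + bv s w *m (av s w)^T).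
Definition Tb (T : {set 'I_n}) i := [set s in T | g s == i].
Definition T0 (T : {set 'I_n}) i := [set s in T | g s != i].
(* The coefficients c_{i,j} restricted to the transitions of T: the expected squared mass
   that row I of the hermitized matrix sends to block J. *)
Definition chat (T : {set 'I_n}) (I J : 'I_(K + K)) : R :=
  r ^+ 2 / bsz I * \sum_(s in T) (((Ab s == I) && (Bb s == J))%:R + ((Bb s == I) && (Ab s == J))%:R).
Definition tau (I : 'I_(K + K)) (H : 'M[R]_(d + d)) k : R := avg I (fun l => dot (wvec l) (pw H k (wvec l))).
(** For [H = HP T w] and [k > 0] this is the trace of [H ^ (2 k)], since [HP] kills the block
    means. *)
Definition Wk (H : 'M[R]_(d + d)) k : R := \sum_l nrm (pw H k (wvec l)) ^+ 2.

Hypothesis d_gt0 : (0 < d)%N.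
Hypothesis hkap : forall I, d%:R <= kap * bsz I.
Hypothesis r_ge0 : 0 <= r.
Hypothesis nr2 : n%:R * r ^+ 2 <= d%:R.
Hypothesis g_lt : forall s, (g s < n)%N.
Local Notation mu := cond_law.
Local Notation Ex := (Ex mu).
Local Notation Ex2 := (Ex2 mu).
Local Notation Pr := (Pr mu).

Lemma dR_gt0 : 0 < d%:R :> R.
Proof. by rewrite ltr0n. Qed.

Lemma bsz_gt0 I : 0 < bsz I.
Proof.
rewrite lt_neqAle bsz_ge0 andbT; apply/eqP => E.
by have := hkap I; rewrite -E mulr0 leNgt dR_gt0.
Qed.
Hint Resolve bsz_gt0 : core.

Lemma kap_gt0 I : bsz I = bsz I -> 0 < kap.
Proof.
move=> _; have := lt_le_trans dR_gt0 (hkap I); rewrite pmulr_lgt0 //.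
Qed.

Lemma kap_ge0 : 0 <= kap.
Proof. exact/ltW/(kap_gt0 (erefl (bsz (lshift K (part (Ordinal d_gt0)))))). Qed.

Lemma bszV_le I : (bsz I)^-1 <= kap / d%:R.
Proof. by rewrite ler_pdivlMr ?dR_gt0 // mulrC ler_pdivrMr // hkap. Qed.

Lemma cond_law_ge0 s z : 0 <= mu s z.
Proof. by rewrite /cond_law divr_ge0. Qed.

Lemma cond_law_avgl s phi : \sum_z mu s z * phi (lshift d z) = avg (Ab s) phi.
Proof.
rewrite /avg /Ab sum_blkl bszl [in RHS]big_mkcond mulr_suml; apply: eq_bigr => z _.
by rewrite /cond_law; case: (_ == _); rewrite ?mul1r ?mul0r // mulrC.
Qed.

Lemma cond_law_avgr s phi : \sum_z mu s z * phi (rshift d z) = avg (rshift K (sig s)) phi.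
Proof.
rewrite /avg sum_blkr bszr [in RHS]big_mkcond mulr_suml; apply: eq_bigr => z _.
by rewrite /cond_law; case: (_ == _); rewrite ?mul1r ?mul0r // mulrC.
Qed.

Lemma cond_law_sum s : \sum_z mu s z = 1.
Proof.
rewrite -(avg_cst bsz_gt0 (Ab s) 1) -cond_law_avgl; apply: eq_bigr => z _.
by rewrite mulr1.
Qed.

Let mu0 := cond_law_ge0.
Let mu1 := cond_law_sum.

Lemma wt_supp w : wt mu w != 0 -> forall s, part (w s) = sig s.
Proof.
move=> h s; apply/eqP; apply: contraNT h => /negbTE h.
by rewrite /wt (bigD1 s) //= /cond_law h !mul0r.
Qed.

Lemma Ex_supp (f f' : Om -> R) : (forall w : Om, (forall s, part (w s) = sig s) -> f w = f' w) -> Ex f = Ex f'.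
Proof.
move=> h; apply: eq_bigr => w _; have [->|/wt_supp hw] := eqVneq (wt mu w) 0.
  by rewrite !mul0r.
by rewrite h.
Qed.

Lemma Ex_le_supp (f f' : Om -> R) : (forall w : Om, (forall s, part (w s) = sig s) -> f w <= f' w) -> Ex f <= Ex f'.
Proof.
move=> h; apply: ler_sum => w _; have [->|/wt_supp hw] := eqVneq (wt mu w) 0.
  by rewrite !mul0r.
by apply: ler_wpM2l; rewrite ?wt_ge0 // h.
Qed.

(** [G] packs everything that stays frozen while the state at time [t] is averaged. Only its
    invariance under an update at [t] is required, so a matrix and several other states can travel
    together in a tuple. *)
Lemma Ex_G1 (S : Type) t (F : 'I_d -> S -> R) (G : Om -> S) :
  (forall w v, G (upd w t v) = G w) ->
  Ex (fun w => F (w t) (G w)) = Ex (fun w => \sum_v mu t v * F v (G w)).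
Proof.
move=> h; rewrite (Ex_upd mu1 t); apply: eq_Ex => w; apply: eq_bigr => v _.
by rewrite h /upd ffunE eqxx.
Qed.

Lemma Ex_G2 (S : Type) t t' (F : 'I_d -> 'I_d -> S -> R) (G : Om -> S) : t != t' ->
  (forall w v, G (upd w t v) = G w) -> (forall w v, G (upd w t' v) = G w) ->
  Ex (fun w => F (w t) (w t') (G w)) = Ex (fun w => \sum_v mu t v * \sum_v' mu t' v' * F v v' (G w)).
Proof.
move=> tt h h'.
rewrite (@Ex_G1 (('I_d) * S)%type t (fun v p => F v p.1 p.2) (fun w => (w t', G w))); last first.
  by move=> w v; rewrite h /upd ffunE eq_sym (negbTE tt).
rewrite (@Ex_G1 S t' (fun v' p => \sum_v mu t v * F v v' p) G) //.
apply: eq_Ex => w; under eq_bigr => v' _ do rewrite mulr_sumr.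
rewrite exchange_big /=; apply: eq_bigr => v _; rewrite mulr_sumr.
by apply: eq_bigr => v' _; rewrite mulrCA.
Qed.

Lemma HPx T w x : HP T w *m x = r *: \sum_(s in T) (dot (bv s w) x *: av s w + dot (av s w) x *: bv s w).
Proof.
have dE (u v : 'cV[R]_(d + d)) : u^T *m v = (dot u v)%:M.
  rewrite [LHS]mx11_scalar; congr (_%:M); rewrite mxE; apply: eq_bigr => i _; by rewrite mxE.
rewrite /HP -scalemxAl mulmx_suml; congr (_ *: _); apply: eq_bigr => s _.
by rewrite mulmxDl -!mulmxA !dE !mul_mx_scalar.
Qed.

Lemma HP_sym T w : (HP T w)^T = HP T w.
Proof.
rewrite /HP linearZ /= linear_sum /=; congr (_ *: _); apply: eq_bigr => s _.
by rewrite linearD /= !trmx_mul !trmxK addrC.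
Qed.

Lemma HP_u T w I : HP T w *m uvec I = 0.
Proof.
by rewrite HPx big1 ?scaler0 // => s _; rewrite !dot_wu // !scale0r addr0.
Qed.

Lemma HP_agree (T : {set 'I_n}) (w w' : Om) : (forall s, s \in T -> w s = w' s /\ w (nx s) = w' (nx s)) -> HP T w = HP T w'.
Proof.
move=> h; congr (_ *: _); apply: eq_bigr => s /h[h1 h2].
by rewrite /av /bv h1 h2.
Qed.

Lemma good_sub (T T' : {set 'I_n}) : T' \subset T -> good T -> good T'.
Proof.
move=> /fintype.subsetP hT [h1 h2]; split; first by move=> s /hT; apply: h1.
move=> i; apply: leq_trans (h2 i); apply: subset_leq_card.
by apply/fintype.subsetP => s; rewrite !inE => /andP[/hT -> ->].
Qed.

Lemma T0_sub T i : T0 T i \subset T.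
Proof. by apply/fintype.subsetP => s; rewrite inE => /andP[]. Qed.

Lemma good_T0 T i : good T -> good (T0 T i).
Proof. exact/good_sub/T0_sub. Qed.

Lemma HP_T0_upd T i w t v : good T -> g t = i -> HP (T0 T i) (upd w t v) = HP (T0 T i) w.
Proof.
move=> [hT _] ht; apply: HP_agree => s; rewrite inE => /andP[sT gs].
have [_ gn] := hT s sT; rewrite !ffunE; split.
  by case: eqP => // E; rewrite E ht eqxx in gs.
by case: eqP => // E; rewrite -gn E ht eqxx in gs.
Qed.

Lemma HP_T0_mix T i w w' : good T -> HP (T0 T i) (mix (inblk g i) w w') = HP (T0 T i) w.
Proof.
move=> [hT _]; apply: HP_agree => s; rewrite inE => /andP[sT gs].
have [_ gn] := hT s sT; rewrite !ffunE /inblk gn (negbTE gs); by split.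
Qed.

Lemma HP_split T i w x : (HP T w - HP (T0 T i) w) *m x =
  r *: \sum_(s in Tb T i) (dot (bv s w) x *: av s w + dot (av s w) x *: bv s w).
Proof.
rewrite mulmxBl !HPx -scalerBr; congr (_ *: _).
rewrite (bigID (fun s => g s == i)) /=.
rewrite (eq_bigl (fun s => s \in Tb T i)) => [|s]; last by rewrite inE.
rewrite [X in _ + X - _](eq_bigl (fun s => s \in T0 T i)) => [|s]; last by rewrite inE.
by rewrite addrK.
Qed.

Lemma nrm_av s w : nrm (av s w) <= 1.
Proof. exact: nrm_w. Qed.
Lemma nrm_bv s w : nrm (bv s w) <= 1.
Proof. exact: nrm_w. Qed.

Lemma HP_LR T w x : isL x -> isR (HP T w *m x).
Proof.
move=> hx; rewrite HPx; apply: isRZ; apply: isR_sum => s _; apply: isRD; last exact/isRZ/w_isR.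
by move=> j; rewrite dotC (dot_LR hx) ?scale0r ?mxE //; exact: w_isR.
Qed.

Lemma HP_RL T w x : isR x -> isL (HP T w *m x).
Proof.
move=> hx; rewrite HPx; apply: isLZ; apply: isL_sum => s _; apply: isLD; first exact/isLZ/w_isL.
by move=> j; rewrite (dot_LR _ hx) ?scale0r ?mxE //; exact: w_isL.
Qed.

(** The matrix exchanges the two sides of the bipartite structure, so an odd power maps each [wvec]
    to the opposite side. *)
Lemma tau_odd T w I k : odd k -> tau I (HP T w) k = 0.
Proof.
have LR x : isL x -> forall m, if odd m then isR (pw (HP T w) m x) else isL (pw (HP T w) m x).
  move=> hx; elim=> [|m]; rewrite //=; case: (odd m) => /= h; [exact: HP_RL|exact: HP_LR].
have RL x : isR x -> forall m, if odd m then isL (pw (HP T w) m x) else isR (pw (HP T w) m x).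
  move=> hx; elim=> [|m]; rewrite //=; case: (odd m) => /= h; [exact: HP_LR|exact: HP_RL].
move=> hk; rewrite /tau (@eq_avg _ _ _ _ _ _ (fun=> 0)) ?avg_cst // => l _.
rewrite -(splitK l); case: (fintype.split l) => j /=.
  by rewrite (dot_LR (w_isL _ _ _)) //; have := LR _ (w_isL R part j) k; rewrite hk.
by rewrite dotC (dot_LR _ (w_isR _ _ _)) //; have := RL _ (w_isR R part j) k; rewrite hk.
Qed.

Lemma tau_ev I T w k : tau I (HP T w) (k + k) = avg I (fun l => nrm (pw (HP T w) k (wvec l)) ^+ 2).
Proof.
by apply: eq_avg => l _; rewrite dot_pwD ?HP_sym // nrm_sqr.
Qed.

Lemma WkE T w k : Wk (HP T w) k = \sum_I bsz I * tau I (HP T w) (k + k).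
Proof.
rewrite /Wk (partition_big blk predT) //=; apply: eq_bigr => I _.
by rewrite tau_ev -sum_blkE.
Qed.

Lemma tau_ev_ge0 I T w k : 0 <= tau I (HP T w) (k + k).
Proof. by rewrite tau_ev; apply: avg_ge0 => l; apply: sqr_ge0. Qed.

Lemma Wk_ge0 H k : 0 <= Wk H k.
Proof. by apply: sumr_ge0 => l _; apply: sqr_ge0. Qed.

(** The trace bound. It needs a positive power: on basis vectors [HP] can replace [bvec] by [wvec]
    only after one application. *)
Lemma opn_W T w N : opnorm (HP T w) ^+ (N.+1 + N.+1) <= Wk (HP T w) N.+1.
Proof.
rewrite exprD -expr2 -(sqr_sqrtr (Wk_ge0 (HP T w) N.+1)).
rewrite ler_sqr ?nnegrE ?exprn_ge0 ?opnorm_ge0 ?sqrtr_ge0 //.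
apply: opnorm_pow; rewrite ?HP_sym ?sqrtr_ge0 // => x hx.
apply: le_sqr2; rewrite ?sqrtr_ge0 // (sqr_sqrtr (Wk_ge0 _ _)).
apply: (le_trans (nrm_pw_frob _ _ _)).
have -> : \sum_l nrm (pw (HP T w) N.+1 (bvec R l)) ^+ 2 = Wk (HP T w) N.+1.
  apply: eq_bigr => l _; congr (nrm _ ^+ 2).
  by rewrite !pwSr; congr (pw _ _ _); rewrite mulmxBr HP_u subr0.
rewrite -[leRHS]mulr1; apply: ler_wpM2l; first exact: Wk_ge0.
by rewrite expr_le1 ?nrm_ge0.
Qed.

Lemma Wk_ub T w j : Wk (HP T w) j <= (d + d)%:R * opnorm (HP T w) ^+ (j + j).
Proof.
have -> : (d + d)%:R * opnorm (HP T w) ^+ (j + j) = \sum_(l < d + d) opnorm (HP T w) ^+ (j + j).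
  by rewrite sumr_const card_ord mulr_natl.
apply: ler_sum => l _; rewrite exprD -expr2 ler_sqr ?nnegrE ?exprn_ge0 ?opnorm_ge0 ?nrm_ge0 //.
by apply: nrm_pw1; rewrite ?nrm_w.
Qed.

Lemma Wk_mono T w N j : Wk (HP T w) (j + N) <= opnorm (HP T w) ^+ (j + j) * Wk (HP T w) N.
Proof.
rewrite /Wk mulr_sumr; apply: ler_sum => l _; rewrite pwD exprD -expr2 -exprMn.
rewrite ler_sqr ?nnegrE ?mulr_ge0 ?exprn_ge0 ?opnorm_ge0 ?nrm_ge0 //; exact: nrm_pw.
Qed.

(** The smaller index is bounded by the dimension times a power of the norm, the larger one by the
    middle trace times a power of the norm; together these powers make [2 * N] and are absorbed by
    [opn_W]. *)
Lemma Wk_prod T w N i j : (i + j = N + N)%N -> Wk (HP T w) i * Wk (HP T w) j <= (d + d)%:R * Wk (HP T w) N ^+ 2.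
Proof.
wlog ij : i j / (i <= j)%N.
  move=> h E; have [/h|/ltnW/h] := leqP i j; first exact.
  by rewrite mulrC; apply; rewrite addnC.
have W0 := Wk_ge0 (HP T w) N; have Wj := Wk_ge0 (HP T w) j; have o0 := opnorm_ge0 (HP T w).
case: N W0 => [|N] W0 E.
  have -> : i = 0%N by lia.
  have -> : j = 0%N by lia.
  rewrite expr2 mulrA ler_wpM2r // ler_peMl // ler1n; lia.
set h := opnorm (HP T w).
apply: (@le_trans _ _ ((d + d)%:R * h ^+ (i + i) * (h ^+ ((j - N.+1) + (j - N.+1)) * Wk (HP T w) N.+1))).
  apply: ler_pM; rewrite ?Wk_ge0 // ?Wk_ub //.
  have {1}-> : (j = (j - N.+1) + N.+1)%N by lia.
  exact: Wk_mono.
rewrite -!mulrA; apply: ler_wpM2l; first by rewrite ler0n.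
rewrite mulrA -exprD expr2; apply: ler_wpM2r => //.
have -> : (i + i + (j - N.+1 + (j - N.+1)) = N.+1 + N.+1)%N by lia.
exact: opn_W.
Qed.

Variable g0 : R.
Hypothesis g0_gt0 : 0 < g0.

(** The [2 N]-th power of a local growth rate: how much the matrix without block [i] stretches the
    vectors of block [i]. These vectors are independent of that matrix, so the mean of [Gam]
    involves block averages and not norms. The floor [g0] keeps the rate away from 0, so that it can
    be divided by. *)
Definition Gam T i N w : R := g0 ^+ (N + N) +
  \sum_(s in Tb T i) (nrm (pw (HP (T0 T i) w) N (av s w)) ^+ 2 + nrm (pw (HP (T0 T i) w) N (bv s w)) ^+ 2).

Lemma Gam_ge T i N w : g0 ^+ (N + N) <= Gam T i N w.
Proof. by rewrite lerDl; apply: sumr_ge0 => s _; rewrite addr_ge0 ?sqr_ge0. Qed.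

Lemma Gam_ge0 T i N w : 0 <= Gam T i N w.
Proof. by apply: le_trans (Gam_ge _ _ _ _); rewrite exprn_ge0 // ltW. Qed.

Lemma card_Tb T i : good T -> (#|Tb T i| <= ell)%N.
Proof. by case=> _; apply. Qed.

Definition fam T i w : set 'cV[R]_(d + d) := [set x | exists2 s, s \in Tb T i & x = av s w \/ x = bv s w].

Lemma fam_av T i w s : s \in Tb T i -> fam T i w (av s w).
Proof. by move=> h; exists s => //; left. Qed.
Lemma fam_bv T i w s : s \in Tb T i -> fam T i w (bv s w).
Proof. by move=> h; exists s => //; right. Qed.
Lemma fam_nrm T i w x : fam T i w x -> nrm x <= 1.
Proof. by case=> s _ [->|->]; [exact: nrm_av|exact: nrm_bv]. Qed.

(** The root [y] of [Gam] controls the iterates at the top exponent, log-convexity carries this down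
    to every smaller exponent, and [growth] transfers it to the full matrix at the cost of a factor
    2. *)
Lemma deloc T i N w : good T -> (2 * ell)%:R * r / g0 * N.+1%:R <= 1 / 2 ->
  exists y, [/\ g0 <= y, y ^+ (N.+1 + N.+1) = Gam T i N.+1 w,
   (forall x e, fam T i w x -> (e <= N.+1)%N -> nrm (pw (HP (T0 T i) w) e x) <= y ^+ e) &
   (forall x e, fam T i w x -> (e <= N.+1)%N -> nrm (pw (HP T w) e x) <= 2 * y ^+ e)].
Proof.
move=> gT small; have [y y0] := root_ex (N + N.+1) (Gam_ge0 T i N.+1 w).
rewrite -addSn => yE.
have g0y : g0 <= y.
  rewrite -(@ler_pXn2r _ (N.+1 + N.+1)) ?nnegrE ?(ltW g0_gt0) //.
  by rewrite yE Gam_ge.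
have yp : 0 < y by apply: lt_le_trans g0y.
have H0 x e : fam T i w x -> (e <= N.+1)%N -> nrm (pw (HP (T0 T i) w) e x) <= y ^+ e.
  move=> hx; apply: (pw_interp _ yp (fam_nrm hx)); first exact: HP_sym.
  apply: le_sqr2; first exact: exprn_ge0.
  rewrite -exprM muln2 -addnn yE /Gam; case: hx => s hs hx.
  rewrite (bigD1 s) //= addrA -addrA -[leLHS]add0r.
  have t1 := sqr_ge0 (nrm (pw (HP (T0 T i) w) N.+1 (av s w))).
  have t2 := sqr_ge0 (nrm (pw (HP (T0 T i) w) N.+1 (bv s w))).
  have t3 : 0 <= g0 ^+ (N.+1 + N.+1) by rewrite exprn_ge0 // ltW.
  have t4 : 0 <= \sum_(i0 in Tb T i | i0 != s)
    (nrm (pw (HP (T0 T i) w) N.+1 (av i0 w)) ^+ 2 + nrm (pw (HP (T0 T i) w) N.+1 (bv i0 w)) ^+ 2).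
    by apply: sumr_ge0 => s' _; rewrite addr_ge0 ?sqr_ge0.
  by case: hx => ->; lra.
exists y; split=> //.
move=> x e hx he.
(* Each transition of the block contributes two rank-one terms; the boolean selects one of them,
   which is where [2 * ell] comes from. *)
pose P := [pred p : 'I_n * bool | p.1 \in Tb T i].
pose xs (p : 'I_n * bool) := if p.2 then av p.1 w else bv p.1 w.
pose ys (p : 'I_n * bool) := if p.2 then bv p.1 w else av p.1 w.
have G := @growth R (d + d) (HP T w) (HP (T0 T i) w) _ P xs ys r y (2 * ell) N.+1.
apply: (le_trans (G _ _ r_ge0 yp _ _ e x he _)).
- move=> z; rewrite HP_split; congr (_ *: _).
  transitivity (\sum_(s in Tb T i) \sum_(b : bool) dot (ys (s, b)) z *: xs (s, b)).
    by apply: eq_bigr => s _; rewrite big_bool /xs /ys /=.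
  rewrite (pair_big_dep (fun s => s \in Tb T i) (fun _ _ => true) (fun s b => dot (ys (s, b)) z *: xs (s, b))) /=.
  by apply: eq_big; case=> s b //=; rewrite ?andbT.
- rewrite (eq_card (B := predX (mem (Tb T i)) (mem predT))); last first.
    by case=> s b; rewrite !inE andbT.
  by rewrite cardX card_bool mulnC leq_mul2l card_Tb.
- by case=> s b /= _; rewrite /ys /=; case: b; [exact: nrm_bv|exact: nrm_av].
- case=> s b e' /= hs; apply: H0; rewrite /xs /=.
  by case: b; [exact: fam_av|exact: fam_bv].
- by move=> e' he'; apply: H0.
rewrite mulrC; apply: ler_wpM2r; first exact: exprn_ge0.
have dd : 0 <= (2 * ell)%:R * r / y by rewrite divr_ge0 ?mulr_ge0.
apply: pow_1d_le2 => //; apply: le_trans small.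
apply: ler_pM => //.
  by rewrite ler_wpM2l ?mulr_ge0 // lef_pV2 ?posrE.
by rewrite ler_nat.
Qed.

Lemma half_split (e m : nat) : (e <= m + m)%N ->
  exists a b, [/\ e = (a + b)%N, (a <= m)%N & (b <= m)%N].
Proof. by move=> h; exists e./2, (e - e./2)%N; split; lia. Qed.

Lemma S_expand T i w x z c :
  dot x (pw (HP T w) c ((HP T w - HP (T0 T i) w) *m z)) =
  r * \sum_(s in Tb T i) (dot (bv s w) z * dot x (pw (HP T w) c (av s w)) +
                          dot (av s w) z * dot x (pw (HP T w) c (bv s w))).
Proof.
rewrite HP_split pwZ dotZr pw_sum dot_sumr; congr (_ * _); apply: eq_bigr => s _.
by rewrite pw_add !pwZ dotDr !dotZr.
Qed.

(** The influence of one block on a block average is of order [r / d]: the perturbation has small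
    rank, so the average over [J] collapses into the form [PB], bounded by two norms, and the
    normalisation [(bsz J)^-1] survives. *)
Lemma tau_diff T i w J N : good T -> (2 * ell)%:R * r / g0 * N.+1%:R <= 1 / 2 ->
  `|tau J (HP T w) N.+2 - tau J (HP (T0 T i) w) N.+2| <=
  4 * (N.+2%:R * ell%:R * r * kap) / d%:R * Num.sqrt (Gam T i N.+1 w).
Proof.
move=> gT small; have [y [g0y yE H0 H1]] := deloc i w gT small.
have y0 : 0 <= y by apply: le_trans g0y; apply: ltW.
have -> : Num.sqrt (Gam T i N.+1 w) = y ^+ N.+1.
  by rewrite -yE exprD -expr2 sqrtr_sqr ger0_norm // exprn_ge0.
have -> : tau J (HP T w) N.+2 - tau J (HP (T0 T i) w) N.+2 =
  (bsz J)^-1 * (r * \sum_(j < N.+2) \sum_(s in Tb T i)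
     (PB part J (pw (HP (T0 T i) w) j (bv s w)) (pw (HP T w) (N.+2 - j.+1) (av s w)) +
      PB part J (pw (HP (T0 T i) w) j (av s w)) (pw (HP T w) (N.+2 - j.+1) (bv s w)))).
  rewrite /tau /avg -mulrBl mulrC; congr (_ * _); rewrite -sumrB.
  rewrite (eq_bigr (fun l => \sum_(j < N.+2) r * \sum_(s in Tb T i)
      (dot (bv s w) (pw (HP (T0 T i) w) j (wvec l)) * dot (wvec l) (pw (HP T w) (N.+2 - j.+1) (av s w)) +
       dot (av s w) (pw (HP (T0 T i) w) j (wvec l)) * dot (wvec l) (pw (HP T w) (N.+2 - j.+1) (bv s w))))); last first.
    move=> l _; rewrite -dotBr (pw_tele (HP T w) (HP (T0 T i) w)) [X in dot _ X]addrC addKr dot_sumr.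
    by apply: eq_bigr => j _; rewrite S_expand.
  rewrite exchange_big /= mulr_sumr; apply: eq_bigr => j _.
  rewrite -mulr_sumr; congr (_ * _); rewrite exchange_big /=; apply: eq_bigr => s _.
  rewrite big_split /= /PB; congr (_ + _); apply: eq_bigr => l _; congr (_ * _).
    by rewrite -dot_pw ?HP_sym // dotC.
  by rewrite -dot_pw ?HP_sym // dotC.
rewrite normrM (ger0_norm (x := _^-1)) ?invr_ge0 ?bsz_ge0 //.
have step (j : 'I_N.+2) : `|\sum_(s in Tb T i)
     (PB part J (pw (HP (T0 T i) w) j (bv s w)) (pw (HP T w) (N.+2 - j.+1) (av s w)) +
      PB part J (pw (HP (T0 T i) w) j (av s w)) (pw (HP T w) (N.+2 - j.+1) (bv s w)))| <=
   ell%:R * (4 * y ^+ N.+1).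
  apply: (le_trans (ler_norm_sum _ _ _)).
  apply: (@le_trans _ _ (\sum_(s in Tb T i) 4 * y ^+ N.+1)); last first.
    by apply: sum_cst_le; [rewrite mulr_ge0 // exprn_ge0 | exact: card_Tb].
  have hj := ltn_ord j.
  have E : y ^+ N.+1 = y ^+ j * y ^+ (N.+2 - j.+1) by rewrite -exprD; congr (_ ^+ _); lia.
  have bnd x x' : fam T i w x -> fam T i w x' ->
    `|PB part J (pw (HP (T0 T i) w) j x) (pw (HP T w) (N.+2 - j.+1) x')| <= 2 * y ^+ N.+1.
    move=> hx hx'; apply: (le_trans (PB_le bsz_gt0 _ _ _)).
    rewrite E mulrCA; apply: ler_pM; rewrite ?nrm_ge0 //; [apply: H0|apply: H1] => //; lia.
  apply: ler_sum => s hs; apply: (le_trans (ler_normD _ _)).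
  have := bnd _ _ (fam_bv w hs) (fam_av w hs); have := bnd _ _ (fam_av w hs) (fam_bv w hs); lra.
have tot : `|r * \sum_(j < N.+2) \sum_(s in Tb T i)
     (PB part J (pw (HP (T0 T i) w) j (bv s w)) (pw (HP T w) (N.+2 - j.+1) (av s w)) +
      PB part J (pw (HP (T0 T i) w) j (av s w)) (pw (HP T w) (N.+2 - j.+1) (bv s w)))| <=
   r * (N.+2%:R * (ell%:R * (4 * y ^+ N.+1))).
  rewrite normrM ger0_norm //; apply: ler_wpM2l => //.
  apply: (le_trans (ler_norm_sum _ _ _)).
  apply: (@le_trans _ _ (\sum_(j < N.+2) ell%:R * (4 * y ^+ N.+1))).
    by apply: ler_sum => j _; apply: step.
  by rewrite sum_ord_cst.
have -> : 4 * (N.+2%:R * ell%:R * r * kap) / d%:R * y ^+ N.+1 =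
  kap / d%:R * (r * (N.+2%:R * (ell%:R * (4 * y ^+ N.+1)))) by ring.
apply: ler_pM; rewrite ?invr_ge0 ?bsz_ge0 ?normr_ge0 ?bszV_le //.
Qed.

(** One transition [s] of the block inserted between the two vectors of [t]. Together with [t]
    itself this is second order in the block. *)
Definition second T i w s t j c : R :=
  dot (bv s w) (pw (HP (T0 T i) w) j (bv t w)) * dot (av t w) (pw (HP (T0 T i) w) c (av s w)) +
  dot (av s w) (pw (HP (T0 T i) w) j (bv t w)) * dot (av t w) (pw (HP (T0 T i) w) c (bv s w)).

(** Two insertions beyond the leading term leave the total exponent [m - 2 = 2 N + 1], one less than
    in [Gam]; the missing factor is paid by dividing by [g0]. Exponents up to [2 (N + 1)] are split
    between the two sides of the inner product. *)
Lemma expand2 T t w N i m : good T -> t \in T -> (2 * ell)%:R * r / g0 * N.+1%:R <= 1 / 2 ->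
  i = g t -> m = (N.+1 + N.+1).+1 ->
  `|dot (av t w) (pw (HP T w) m (bv t w)) - dot (av t w) (pw (HP (T0 T i) w) m (bv t w))
    - r * \sum_(j < m) \sum_(s in Tb T i) second T i w s t j (m - j.+1)| <=
  16 * (m%:R * ell%:R * r) ^+ 2 * (Gam T i N.+1 w / g0).
Proof.
move=> gT tT small iE mE; have [y [g0y yE H0 H1]] := deloc i w gT small.
have yp : 0 < y by apply: lt_le_trans g0y.
have y0 := ltW yp.
have ti : t \in Tb T i by rewrite inE tT iE /=.
have D0 x x' e : fam T i w x -> fam T i w x' -> (e <= N.+1 + N.+1)%N ->
  `|dot x (pw (HP (T0 T i) w) e x')| <= y ^+ e.
  move=> hx hx' he; have [a [b [-> h1 h2]]] := half_split he.
  by rewrite dot_pwD ?HP_sym // exprD; apply: dot_le1; apply: H0.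
have D1 x x' e : fam T i w x -> fam T i w x' -> (e <= N.+1 + N.+1)%N ->
  `|dot x (pw (HP T w) e x')| <= 4 * y ^+ e.
  move=> hx hx' he; have [a [b [-> h1 h2]]] := half_split he.
  rewrite dot_pwD ?HP_sym // exprD.
  have -> : 4 * (y ^+ a * y ^+ b) = (2 * y ^+ a) * (2 * y ^+ b) by ring.
  by apply: dot_le1; apply: H1.
have D2 x z c : fam T i w x -> fam T i w z -> (c <= N.+1 + N.+1)%N ->
  `|dot x (pw (HP T w) c z) - dot x (pw (HP (T0 T i) w) c z)| <= 8 * (m%:R * ell%:R * r) * y ^+ c.-1.
  move=> hx hz hc.
  rewrite (pw_tele (HP T w) (HP (T0 T i) w)) dotDr addrC addKr dot_sumr.
  apply: (le_trans (ler_norm_sum _ _ _)).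
  apply: (@le_trans _ _ (\sum_(j < c) r * (ell%:R * (8 * y ^+ c.-1)))).
    apply: ler_sum => j _; rewrite S_expand // normrM ger0_norm //; apply: ler_wpM2l => //.
    apply: (le_trans (ler_norm_sum _ _ _)).
    apply: (@le_trans _ _ (\sum_(s in Tb T i) 8 * y ^+ c.-1)); last first.
      by apply: sum_cst_le; [rewrite mulr_ge0 // exprn_ge0 | exact: card_Tb].
    have hj := ltn_ord j.
    have [j1 j2 j3] : [/\ (j <= N.+1 + N.+1)%N, (c - j.+1 <= N.+1 + N.+1)%N & c.-1 = (j + (c - j.+1))%N].
      by clear - hj hc; split; lia.
    have E : 8 * y ^+ c.-1 = y ^+ j * (4 * y ^+ (c - j.+1)) + y ^+ j * (4 * y ^+ (c - j.+1)).
      rewrite j3 exprD; ring.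
    apply: ler_sum => s hs; apply: (le_trans (ler_normD _ _)); rewrite E !normrM.
    have fa := fam_av w hs; have fb := fam_bv w hs.
    by apply: lerD; (apply: ler_pM => //; [exact: D0 | exact: D1]).
  rewrite sum_ord_cst.
  have -> : 8 * (m%:R * ell%:R * r) * y ^+ c.-1 = m%:R * (r * (ell%:R * (8 * y ^+ c.-1))) by ring.
  apply: ler_wpM2r; last by rewrite ler_nat; clear - hc mE; lia.
  by rewrite !mulr_ge0 // exprn_ge0.
have -> : dot (av t w) (pw (HP T w) m (bv t w)) - dot (av t w) (pw (HP (T0 T i) w) m (bv t w))
    - r * \sum_(j < m) \sum_(s in Tb T i) second T i w s t j (m - j.+1) =
  \sum_(j < m) r * \sum_(s in Tb T i)
   (dot (bv s w) (pw (HP (T0 T i) w) j (bv t w)) *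
     (dot (av t w) (pw (HP T w) (m - j.+1) (av s w)) - dot (av t w) (pw (HP (T0 T i) w) (m - j.+1) (av s w))) +
    dot (av s w) (pw (HP (T0 T i) w) j (bv t w)) *
     (dot (av t w) (pw (HP T w) (m - j.+1) (bv s w)) - dot (av t w) (pw (HP (T0 T i) w) (m - j.+1) (bv s w)))).
  rewrite {1}(pw_tele (HP T w) (HP (T0 T i) w) m) dotDr [X in X - _ - _]addrC addrK dot_sumr mulr_sumr -sumrB.
  apply: eq_bigr => j _; rewrite S_expand // -mulrBr -sumrB; congr (_ * _).
  by apply: eq_bigr => s _; rewrite /second; ring.
apply: (le_trans (ler_norm_sum _ _ _)).
have yG : y ^+ (N + N).+1 <= Gam T i N.+1 w / g0.
  rewrite ler_pdivlMr // -yE addSn addnS [leRHS]exprSr; apply: ler_wpM2l => //.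
  exact: exprn_ge0.
apply: (@le_trans _ _ (\sum_(j < m) r * (ell%:R * (16 * (m%:R * ell%:R * r) * y ^+ (N + N).+1)))).
  apply: ler_sum => j _; rewrite normrM ger0_norm //; apply: ler_wpM2l => //.
  apply: (le_trans (ler_norm_sum _ _ _)).
  apply: (@le_trans _ _ (\sum_(s in Tb T i) 16 * (m%:R * ell%:R * r) * y ^+ (N + N).+1)); last first.
    by apply: sum_cst_le; [rewrite !mulr_ge0 // exprn_ge0 | exact: card_Tb].
  have hj := ltn_ord j.
  (* At exponent 0 the difference vanishes; the exponent count below relies on a true
     predecessor. *)
  have [cE|c0] := eqVneq (m - j.+1)%N 0%N.
    apply: ler_sum => s hs; rewrite cE /= !subrr !mulr0 addr0 normr0.
    by rewrite !mulr_ge0 // exprn_ge0.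
  have [j1 j2 j3] : [/\ (j <= N.+1 + N.+1)%N, (m - j.+1 <= N.+1 + N.+1)%N & (N + N).+1 = (j + (m - j.+1).-1)%N].
    by clear - hj mE c0; split; lia.
  have E : 16 * (m%:R * ell%:R * r) * y ^+ (N + N).+1 =
    y ^+ j * (8 * (m%:R * ell%:R * r) * y ^+ (m - j.+1).-1) + y ^+ j * (8 * (m%:R * ell%:R * r) * y ^+ (m - j.+1).-1).
    rewrite j3 exprD; ring.
  apply: ler_sum => s hs; apply: (le_trans (ler_normD _ _)); rewrite E !normrM.
  have fa := fam_av w hs; have fb := fam_bv w hs.
  have fta := fam_av w ti; have ftb := fam_bv w ti.
  by apply: lerD; (apply: ler_pM => //; [exact: D0 | exact: D2]).
rewrite sum_ord_cst.
have -> : 16 * (m%:R * ell%:R * r) ^+ 2 * (Gam T i N.+1 w / g0) =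
  m%:R * (r * (ell%:R * (16 * (m%:R * ell%:R * r) * (Gam T i N.+1 w / g0)))) by ring.
by rewrite !ler_wpM2l // !mulr_ge0.
Qed.
Lemma nx_neq T s : good T -> s \in T -> nx s != s.
Proof.
by case=> h _ /h[E _]; apply/eqP => E2; move: E; rewrite E2 => /eqP; rewrite -[X in X == _]addn0 -addn1 eqn_add2l.
Qed.

(** Averaging over the state at time [t], on which only [av t] depends. *)
Lemma Ex_first T t m : good T -> t \in T ->
  Ex (fun w => dot (av t w) (pw (HP (T0 T (g t)) w) m (bv t w))) = 0.
Proof.
move=> gT tT; have nt := nx_neq gT tT.
rewrite (@Ex_G1 ('M[R]_(d + d) * 'I_d)%type t
  (fun v p => dot (wvec (lshift d v)) (pw p.1 m (wvec (rshift d p.2))))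
  (fun w => (HP (T0 T (g t)) w, w (nx t)))); last first.
  by move=> w v; rewrite HP_T0_upd // /upd ffunE (negbTE nt).
rewrite -[RHS](Ex_cst mu1 0); apply: eq_Ex => w.
by rewrite (cond_law_avgl t (fun l => dot (wvec l) _)) avg_w.
Qed.

(** Some state always occurs in a single vector. In general it is the one at time [t]; if [s] ends
    where [t] starts, that state is shared by [bv s] and [av t], and the endpoint of [t] is averaged
    instead. *)
Lemma Ex_second_neq T s t j c : good T -> t \in T -> s \in T -> s != t -> g s = g t ->
  Ex (fun w => second T (g t) w s t j c) = 0.
Proof.
move=> gT tT sT st gst; have nt := nx_neq gT tT; have ns := nx_neq gT sT.
have [h _] := gT; have [vt gnt] := h t tT; have [vs gns] := h s sT.
rewrite -[RHS](Ex_cst mu1 0) /second; have [E|nst] := eqVneq (nx s) t.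
  have nts : nx t != s.
    apply/eqP => E2; move: vt vs; rewrite E2 E /= => -> /eqP.
    by rewrite -[X in X == _]addn0 -(addn2 t) eqn_add2l.
  rewrite (@Ex_G1 ('M[R]_(d + d) * ('I_d * 'I_d * 'I_d))%type (nx t)
   (fun v p => dot (wvec (rshift d p.2.1.2)) (pw p.1 j (wvec (rshift d v))) * dot (wvec (lshift d p.2.2)) (pw p.1 c (wvec (lshift d p.2.1.1)))
    + dot (wvec (lshift d p.2.1.1)) (pw p.1 j (wvec (rshift d v))) * dot (wvec (lshift d p.2.2)) (pw p.1 c (wvec (rshift d p.2.1.2))))
   (fun w => (HP (T0 T (g t)) w, (w s, w (nx s), w t)))); last first.
    by move=> w v; rewrite HP_T0_upd // /upd !ffunE E eq_sym (negbTE nts) eq_sym (negbTE nt).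
  apply: eq_Ex => w /=; set H := HP _ _.
  have Hs : H^T = H by apply: HP_sym.
  pose uhat_mean l := dot (wvec l) (pw H j (wvec (rshift d (w (nx s))))) * dot (wvec (lshift d (w t))) (pw H c (wvec (lshift d (w s))))
    + dot (wvec l) (pw H j (wvec (lshift d (w s)))) * dot (wvec (lshift d (w t))) (pw H c (wvec (rshift d (w (nx s))))).
  rewrite (eq_bigr (fun v => mu (nx t) v * uhat_mean (rshift d v))).
    by rewrite (cond_law_avgr (nx t)) /uhat_mean avgD !avgZr !avg_w // !mul0r addr0.
  have sw x y : dot x (pw H j y) = dot y (pw H j x) by rewrite -dot_pw // dotC.
  by move=> v _; rewrite /uhat_mean (sw (wvec (rshift d (w (nx s))))) (sw (wvec (lshift d (w s)))).
rewrite (@Ex_G1 ('M[R]_(d + d) * ('I_d * 'I_d * 'I_d))%type t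
   (fun v p => dot (wvec (rshift d p.2.1.2)) (pw p.1 j (wvec (rshift d p.2.2))) * dot (wvec (lshift d v)) (pw p.1 c (wvec (lshift d p.2.1.1)))
    + dot (wvec (lshift d p.2.1.1)) (pw p.1 j (wvec (rshift d p.2.2))) * dot (wvec (lshift d v)) (pw p.1 c (wvec (rshift d p.2.1.2))))
   (fun w => (HP (T0 T (g t)) w, (w s, w (nx s), w (nx t))))); last first.
  by move=> w v; rewrite HP_T0_upd // /upd !ffunE (negbTE st) (negbTE nst) (negbTE nt).
apply: eq_Ex => w /=; set H := HP _ _.
rewrite (cond_law_avgl t (fun l => _ * dot (wvec l) _ + _ * dot (wvec l) _)).
by rewrite avgD !avgZ !avg_w // !mulr0 addr0.
Qed.

(** The crossed pairing in the second-order term with [s = t]; the uncrossed pairing gives the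
    product of two block averages. *)
Definition rem (H : 'M[R]_(d + d)) I J j c : R :=
  avg I (fun l => avg J (fun l' => dot (wvec l) (pw H j (wvec l')) * dot (wvec l) (pw H c (wvec l')))).

Lemma Ex_second_eq T t j c : good T -> t \in T ->
  Ex (fun w => second T (g t) w t t j c) =
  Ex (fun w => tau (Bb t) (HP (T0 T (g t)) w) j * tau (Ab t) (HP (T0 T (g t)) w) c)
  + Ex (fun w => rem (HP (T0 T (g t)) w) (Ab t) (Bb t) j c).
Proof.
move=> gT tT; have nt := nx_neq gT tT; have [h _] := gT; have [_ gnt] := h t tT.
rewrite /second (@Ex_G2 _ t (nx t)
  (fun v v' H => dot (wvec (rshift d v')) (pw H j (wvec (rshift d v'))) * dot (wvec (lshift d v)) (pw H c (wvec (lshift d v)))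
   + dot (wvec (lshift d v)) (pw H j (wvec (rshift d v'))) * dot (wvec (lshift d v)) (pw H c (wvec (rshift d v'))))
  (fun w => HP (T0 T (g t)) w)); first last.
- by move=> w v; rewrite HP_T0_upd.
- by move=> w v; rewrite HP_T0_upd.
- by rewrite eq_sym.
rewrite -ExD; apply: eq_Ex => w; set H := HP _ _.
have E v : \sum_v' mu (nx t) v' *
  (dot (wvec (rshift d v')) (pw H j (wvec (rshift d v'))) * dot (wvec (lshift d v)) (pw H c (wvec (lshift d v)))
   + dot (wvec (lshift d v)) (pw H j (wvec (rshift d v'))) * dot (wvec (lshift d v)) (pw H c (wvec (rshift d v')))) =
  tau (Bb t) H j * dot (wvec (lshift d v)) (pw H c (wvec (lshift d v))) +
  avg (Bb t) (fun l' => dot (wvec (lshift d v)) (pw H j (wvec l')) * dot (wvec (lshift d v)) (pw H c (wvec l'))).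
  rewrite (cond_law_avgr (nx t) (fun l' => dot (wvec l') (pw H j (wvec l')) * _ + dot (wvec (lshift d v)) (pw H j (wvec l')) * dot (wvec (lshift d v)) (pw H c (wvec l')))).
  by rewrite avgD avgZr.
under eq_bigr => v _ do rewrite E.
rewrite (cond_law_avgl t (fun l => tau (Bb t) H j * dot (wvec l) (pw H c (wvec l)) +
  avg (Bb t) (fun l' => dot (wvec l) (pw H j (wvec l')) * dot (wvec l) (pw H c (wvec l'))))).
by rewrite avgD avgZ.
Qed.

(** Cauchy-Schwarz over all pairs bounds the double sum by two traces, about [sqrt d] times one
    trace. After division by two block sizes a factor [1 / sqrt d] remains relative to a block
    average. *)
Lemma rem_le T w I J j c N : (j + c = N + N)%N ->
  `|rem (HP T w) I J j c| <= (kap / d%:R) ^+ 2 * (Num.sqrt (d + d)%:R * Wk (HP T w) N).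
Proof.
move=> jc; set H := HP T w.
have k0 := kap_gt0 (erefl (bsz I)).
pose F l l' := dot (wvec l) (pw H j (wvec l')); pose G l l' := dot (wvec l) (pw H c (wvec l')).
have -> : rem H I J j c = (bsz I)^-1 * ((bsz J)^-1 *
   \sum_(p | (blk p.1 == I) && (blk p.2 == J)) F p.1 p.2 * G p.1 p.2).
  rewrite /rem /avg [LHS]mulrC; congr (_ * _).
  rewrite -(pair_big_dep (fun l => blk l == I) (fun _ l' => blk l' == J) (fun l l' => F l l' * G l l')) /=.
  rewrite mulr_sumr; apply: eq_bigr => l _; by rewrite mulrC.
have S2 m : \sum_(p | (blk p.1 == I) && (blk p.2 == J)) dot (wvec p.1) (pw H m (wvec p.2)) ^+ 2 <= Wk H m.
  rewrite -(pair_big_dep (fun l => blk l == I) (fun _ l' => blk l' == J) (fun l l' => dot (wvec l) (pw H m (wvec l')) ^+ 2)) /=.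
  rewrite exchange_big /= /Wk [leRHS](bigID (fun l => blk l == J)) /= -[leLHS]addr0.
  apply: lerD; last by apply: sumr_ge0 => l _; apply: sqr_ge0.
  apply: ler_sum => l' _; apply: le_trans (sum_w_sqr bsz_gt0 _).
  rewrite [leRHS](bigID (fun l => blk l == I)) /= lerDl; apply: sumr_ge0 => l _; apply: sqr_ge0.
have CS : `|\sum_(p | (blk p.1 == I) && (blk p.2 == J)) F p.1 p.2 * G p.1 p.2| <= Num.sqrt (d + d)%:R * Wk H N.
  apply: le_sqr2; first by rewrite mulr_ge0 ?sqrtr_ge0 ?Wk_ge0.
  rewrite -normrX ger0_norm ?sqr_ge0 // exprMn sqr_sqrtr ?ler0n //.
  apply: le_trans (Wk_prod T w jc); apply: (le_trans (sum_CS _ _ _)).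
  have S0 f : 0 <= \sum_(p : 'I_(d + d) * 'I_(d + d) | (blk p.1 == I) && (blk p.2 == J)) f p ^+ 2 :> R.
    by apply: sumr_ge0 => p _; apply: sqr_ge0.
  by apply: ler_pM; [exact: S0 | exact: S0 | exact: S2 | exact: S2].
rewrite !normrM !(ger0_norm (x := _^-1)) ?invr_ge0 ?bsz_ge0 // mulrA expr2.
apply: ler_pM; rewrite ?mulr_ge0 ?invr_ge0 ?bsz_ge0 //.
by apply: ler_pM; rewrite ?invr_ge0 ?bsz_ge0 ?bszV_le.
Qed.

Lemma Ex_av T i s N : good T -> s \in Tb T i ->
  Ex (fun w => nrm (pw (HP (T0 T i) w) N (av s w)) ^+ 2) = Ex (fun w => tau (Ab s) (HP (T0 T i) w) (N + N)).
Proof.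
move=> gT; rewrite inE => /andP[sT /eqP si].
rewrite (@Ex_G1 _ s (fun v H => nrm (pw H N (wvec (lshift d v))) ^+ 2) (fun w => HP (T0 T i) w)); last first.
  by move=> w v; rewrite HP_T0_upd.
by apply: eq_Ex => w; rewrite tau_ev (cond_law_avgl s (fun l => nrm (pw _ N (wvec l)) ^+ 2)).
Qed.

Lemma Ex_bv T i s N : good T -> s \in Tb T i ->
  Ex (fun w => nrm (pw (HP (T0 T i) w) N (bv s w)) ^+ 2) = Ex (fun w => tau (Bb s) (HP (T0 T i) w) (N + N)).
Proof.
move=> gT; rewrite inE => /andP[sT /eqP si].
have [h _] := gT; have [_ gn] := h s sT.
rewrite (@Ex_G1 _ (nx s) (fun v H => nrm (pw H N (wvec (rshift d v))) ^+ 2) (fun w => HP (T0 T i) w)); last first.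
  by move=> w v; rewrite HP_T0_upd // gn.
by apply: eq_Ex => w; rewrite tau_ev (cond_law_avgr (nx s) (fun l => nrm (pw _ N (wvec l)) ^+ 2)).
Qed.

(** This is where delocalisation pays: averaging the states of the block turns the local growth into
    block averages of the same power, with no factor [d]. *)
Lemma Ex_Gam T i N B : good T ->
  (\sum_I Ex (fun w => tau I (HP (T0 T i) w) (N + N)) <= B) ->
  Ex (Gam T i N) <= g0 ^+ (N + N) + (2 * ell)%:R * B.
Proof.
move=> gT hB; rewrite /Gam ExD Ex_cst // lerD2l Ex_sum.
have hI I : Ex (fun w => tau I (HP (T0 T i) w) (N + N)) <= B.
  apply: le_trans hB; rewrite (bigD1 I) //= lerDl; apply: sumr_ge0 => J _.
  by apply: Ex_ge0 => // w; apply: tau_ev_ge0.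
have B0 : 0 <= B.
  by apply: le_trans hB; apply: sumr_ge0 => J _; apply: Ex_ge0 => // w; apply: tau_ev_ge0.
apply: (@le_trans _ _ (\sum_(s in Tb T i) 2 * B)).
  apply: ler_sum => s hs; rewrite ExD Ex_av // Ex_bv //.
  have := hI (Ab s); have := hI (Bb s); lra.
have -> : (2 * ell)%:R * B = ell%:R * (2 * B) by rewrite natrM; ring.
by apply: sum_cst_le; [rewrite mulr_ge0|exact: card_Tb].
Qed.

(** Peeling off one factor of the matrix reduces a block average to contributions of single
    transitions, the starting point of the recursion. *)
Lemma tau_step T w I p : bsz I * tau I (HP T w) p.+1 =
  r * \sum_(s in T) ((blk (lshift d (w s)) == I)%:R + (blk (rshift d (w (nx s))) == I)%:R) *
      dot (av s w) (pw (HP T w) p (bv s w)).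
Proof.
rewrite /tau -sum_blkE //.
rewrite (eq_bigr (fun l => r * \sum_(s in T) (dot (bv s w) (pw (HP T w) p (wvec l)) * dot (wvec l) (av s w) +
   dot (av s w) (pw (HP T w) p (wvec l)) * dot (wvec l) (bv s w)))); last first.
  move=> l _; rewrite pwS HPx dotZr dot_sumr; congr (_ * _); apply: eq_bigr => s _.
  by rewrite dotDr !dotZr.
rewrite -mulr_sumr exchange_big /=; congr (_ * _); apply: eq_bigr => s _.
rewrite big_split /=.
have E x y : \sum_(l | blk l == I) dot x (pw (HP T w) p (wvec l)) * dot (wvec l) y = PB part I y (pw (HP T w) p x).
  by apply: eq_bigr => l _; rewrite mulrC; congr (_ * _); rewrite -dot_pw ?HP_sym // dotC.
rewrite !E /av /bv !PBw // mulrDl.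
have -> : dot (wvec (rshift d (w (nx s)))) (pw (HP T w) p (wvec (lshift d (w s)))) =
  dot (wvec (lshift d (w s))) (pw (HP T w) p (wvec (rshift d (w (nx s))))).
  by rewrite -dot_pw ?HP_sym // dotC.
by do 2 case: (_ == I); rewrite ?mul1r ?mul0r.
Qed.

Lemma Ex_tau_step T I p : bsz I * Ex (fun w => tau I (HP T w) p.+1) =
  r * \sum_(s in T) ((Ab s == I)%:R + (Bb s == I)%:R) * Ex (fun w => dot (av s w) (pw (HP T w) p (bv s w))).
Proof.
rewrite -ExZ (eq_Ex mu (fun w => tau_step T w I p)) ExZ Ex_sum; congr (_ * _).
apply: eq_bigr => s _; rewrite -ExZ; apply: Ex_supp => w hw.
by rewrite blkl blkr !hw.
Qed.
Lemma avg_Wk I H N : avg I (fun l => nrm (pw H N (wvec l)) ^+ 2) <= kap / d%:R * Wk H N.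
Proof.
rewrite /avg mulrC; apply: ler_pM; rewrite ?invr_ge0 ?bsz_ge0 ?bszV_le //.
  by apply: sumr_ge0 => l _; apply: sqr_ge0.
rewrite /Wk [leRHS](bigID (fun l => blk l == I)) /= lerDl.
by apply: sumr_ge0 => l _; apply: sqr_ge0.
Qed.

Lemma hyb_upd i (w w' : Om) t v : g t = i -> hyb g i (upd w t v) w' = upd (hyb g i w w') t v.
Proof.
move=> gt; apply/ffunP => s; rewrite !ffunE; case: eqP => [->|//].
by rewrite gt ltnn.
Qed.

Lemma av_upd t w v : av t (upd w t v) = wvec (lshift d v).
Proof. by rewrite /av /upd ffunE eqxx. Qed.
Lemma bv_upd t w v : bv t (upd w (nx t) v) = wvec (rshift d v).
Proof. by rewrite /bv /upd ffunE eqxx. Qed.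

(** The [i]-th hybrid keeps block [i] of the first copy, so a state of the block can be averaged
    with the matrix and the weight [Th] frozen. *)
Lemma Ex2_avbv T i t N (Th : Om -> Om -> R) (x : 'I_n -> Om -> 'cV[R]_(d + d)) :
  good T -> t \in Tb T i -> (forall w w', 0 <= Th w w') ->
  (forall w w' t' v, g t' = i -> Th (upd w t' v) w' = Th w w') ->
  x = av \/ x = bv ->
  Ex2 (fun w w' => Th w w' * nrm (pw (HP (T0 T i) (hyb g i w w')) N (x t (hyb g i w w'))) ^+ 2) <=
  Ex2 (fun w w' => Th w w' * (kap / d%:R * Wk (HP (T0 T i) (hyb g i w w')) N)).
Proof.
move=> gT; rewrite inE => /andP[tT /eqP ti] Th0 ThE [->|->].
  rewrite (Ex2_upd1 mu1 t); apply: Ex2_le => // w w'.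
  apply: (@le_trans _ _ (Th w w' * avg (Ab t) (fun l => nrm (pw (HP (T0 T i) (hyb g i w w')) N (wvec l)) ^+ 2))).
    rewrite le_eqVlt; apply/orP; left; apply/eqP.
    rewrite -(cond_law_avgl t (fun l => nrm (pw (HP (T0 T i) (hyb g i w w')) N (wvec l)) ^+ 2)).
    rewrite mulr_sumr; apply: eq_bigr => v _.
    rewrite (ThE _ _ _ _ ti) (hyb_upd _ _ _ ti) (HP_T0_upd _ _ gT ti) av_upd; exact: mulrCA.
  by apply: ler_wpM2l => //; apply: avg_Wk.
have [h _] := gT; have [_ gn] := h t tT; have gni : g (nx t) = i by rewrite gn.
rewrite (Ex2_upd1 mu1 (nx t)); apply: Ex2_le => // w w'.
apply: (@le_trans _ _ (Th w w' * avg (Bb t) (fun l => nrm (pw (HP (T0 T i) (hyb g i w w')) N (wvec l)) ^+ 2))).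
  rewrite le_eqVlt; apply/orP; left; apply/eqP.
  rewrite -(cond_law_avgr (nx t) (fun l => nrm (pw (HP (T0 T i) (hyb g i w w')) N (wvec l)) ^+ 2)).
  rewrite mulr_sumr; apply: eq_bigr => v _.
  rewrite (ThE _ _ _ _ gni) (hyb_upd _ _ _ gni) (HP_T0_upd _ _ gT gni) bv_upd; exact: mulrCA.
by apply: ler_wpM2l => //; apply: avg_Wk.
Qed.

(** According to whether [(th / g1) ^+ a] is below or above [s], the first or the second summand
    alone suffices. *)
Lemma young_gap (th s g1 : R) a b N : 0 < s -> 0 < g1 -> g1 <= th -> (a <= b)%N -> (a + b = N)%N ->
  th ^+ a * g1 ^+ b <= s * g1 ^+ N + s^-1 * th ^+ N.
Proof.
move=> s0 g10 h ab E.
have th0 : 0 < th by apply: lt_le_trans h.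
have x0 : 0 < (th / g1) ^+ a by rewrite exprn_gt0 // divr_gt0.
have [h1|h1] := lerP ((th / g1) ^+ a) s.
  have -> : th ^+ a * g1 ^+ b = (th / g1) ^+ a * g1 ^+ N.
    by rewrite -E exprD expr_div_n mulrA divfK // expf_neq0 // gt_eqF.
  rewrite -[leLHS]addr0; apply: lerD; first by apply: ler_wpM2r => //; rewrite exprn_ge0 // ltW.
  by rewrite mulr_ge0 ?invr_ge0 ?exprn_ge0 // ltW.
rewrite -[leLHS]add0r; apply: lerD; first by rewrite mulr_ge0 ?exprn_ge0 // ltW.
rewrite -E exprD mulrCA; apply: ler_wpM2l; first by rewrite exprn_ge0 // ltW.
rewrite mulrC ler_pdivlMr //; apply: (@le_trans _ _ (g1 ^+ b * (th / g1) ^+ a)).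
  by apply: ler_wpM2l; rewrite ?exprn_ge0 // ltW.
apply: (@le_trans _ _ (g1 ^+ b * (th / g1) ^+ b)).
  apply: ler_wpM2l; first by rewrite exprn_ge0 // ltW.
  apply: ler_weXn2l => //; by rewrite ler_pdivlMr // mul1r.
by rewrite -exprMn mulrC divfK // gt_eqF.
Qed.

Lemma sqrt_amgm (x s : R) : 0 <= x -> 0 < s -> Num.sqrt x <= 1 / 2 * (s + x / s).
Proof.
move=> x0 s0; have := sqr_ge0 (Num.sqrt x - s); rewrite sqrrB sqr_sqrtr // => h.
have -> : 1 / 2 * (s + x / s) = (s ^+ 2 + x) / (2 * s) by field; rewrite gt_eqF.
by rewrite ler_pdivlMr ?mulr_gt0 //; lra.
Qed.

Definition rootn (k : nat) (a : R) := a `^ (k%:R^-1).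
Lemma rootn_ge0 k a : 0 <= rootn k a.
Proof. exact: powR_ge0. Qed.
Lemma rootnK k a : 0 <= a -> rootn k.+1 a ^+ k.+1 = a.
Proof.
by move=> a0; rewrite -powR_mulrn ?powR_ge0 // -powRrM mulVf ?pnatr_eq0 // powRr1.
Qed.

Lemma Ex_Wk T B N : (\sum_I Ex (fun w => tau I (HP T w) (N + N)) <= B) ->
  Ex (fun w => Wk (HP T w) N) <= d%:R * B.
Proof.
move=> h; rewrite (eq_Ex mu (fun w => WkE T w N)) Ex_sum.
apply: (@le_trans _ _ (d%:R * \sum_I Ex (fun w => tau I (HP T w) (N + N)))).
  rewrite mulr_sumr; apply: ler_sum => I _; rewrite ExZ.
  apply: ler_wpM2r; last exact: bsz_le.
  by apply: Ex_ge0 => // w; apply: tau_ev_ge0.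
by apply: ler_wpM2l.
Qed.

Section CovU.
Variables (T : {set 'I_n}) (i p q : nat) (BN : R).
Hypothesis gT : good T.
Hypothesis pq : (p <= q)%N.
Let N := (p + q).+1.
Let N1 := (p + p).+1.
Let N2 := (q + q).+1.
Hypothesis small : (2 * ell)%:R * r / g0 * N2%:R <= 1 / 2.
Hypothesis hBN : \sum_I Ex (fun w => tau I (HP (T0 T i) w) (N + N)) <= BN.
Let H0 w := HP (T0 T i) w.
(** Its [2 N]-th root [th] bounds the norms of both matrices without block [i], and it ignores the
    states of that block. *)
Let Th w w' := g0 ^+ (N + N) + Wk (H0 w) N + Wk (H0 (hyb g i w w')) N.
Let th w w' := rootn (N + N) (Th w w').
Let sd : R := Num.sqrt d%:R.
(** The typical size of [sqrt Gam] at exponent [N2]: averaging the block turns [Gam] into a trace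
    over [d], at most [th ^ (2 N2) / d]. *)
Let sv w w' := g0 ^+ N2 + sd^-1 * th w w' ^+ N2.

Lemma cu_sd : 0 < sd. Proof. by rewrite sqrtr_gt0 dR_gt0. Qed.
Lemma cu_sd2 : sd ^+ 2 = d%:R. Proof. by rewrite sqr_sqrtr // ler0n. Qed.
Lemma cu_g0 m : 0 <= g0 ^+ m. Proof. by rewrite exprn_ge0 // ltW. Qed.

Lemma cu_Th0 w w' : 0 <= Th w w'.
Proof. by rewrite !addr_ge0 ?Wk_ge0 ?cu_g0. Qed.

Lemma cu_thE w w' : th w w' ^+ (N + N) = Th w w'.
Proof. by rewrite /th /N addnS rootnK ?cu_Th0. Qed.

Lemma cu_th0 w w' : 0 <= th w w'. Proof. exact: rootn_ge0. Qed.

Lemma cu_gth w w' : g0 <= th w w'.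
Proof.
rewrite -(@ler_pXn2r _ (N + N)) ?nnegrE ?(ltW g0_gt0) ?cu_th0 // cu_thE.
by rewrite /Th -addrA lerDl addr_ge0 ?Wk_ge0.
Qed.

Lemma cu_op1 w w' : opnorm (H0 w) <= th w w'.
Proof.
rewrite -(@ler_pXn2r _ (N + N)) ?nnegrE ?opnorm_ge0 ?cu_th0 // cu_thE.
apply: (le_trans (opn_W _ _ _)); rewrite /Th -addrA addrCA.
by rewrite lerDl addr_ge0 ?Wk_ge0 ?cu_g0.
Qed.

Lemma cu_op2 w w' : opnorm (H0 (hyb g i w w')) <= th w w'.
Proof.
rewrite -(@ler_pXn2r _ (N + N)) ?nnegrE ?opnorm_ge0 ?cu_th0 // cu_thE.
apply: (le_trans (opn_W _ _ _)); rewrite /Th.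
by rewrite lerDr addr_ge0 ?Wk_ge0 ?cu_g0.
Qed.

Lemma cu_s0 w w' : 0 < sv w w'.
Proof.
rewrite /sv; apply: ltr_wpDr; last by rewrite exprn_gt0.
by rewrite mulr_ge0 ?exprn_ge0 ?cu_th0 // invr_ge0 ltW // cu_sd.
Qed.

(** One of the two influences is bounded by operator norms. This is affordable for the shorter power
    only. *)
Lemma cu_A1 w w' : Num.sqrt (Gam T i N1 w) <= (1 + (2 * ell)%:R) * th w w' ^+ N1.
Proof.
have e0 : 0 <= (2 * ell)%:R :> R by [].
have t0 := cu_th0 w w'.
have B0 : 0 <= (1 + (2 * ell)%:R) * th w w' ^+ N1 by rewrite mulr_ge0 ?exprn_ge0 // addr_ge0.
rewrite -[leRHS](ger0_norm B0) -sqrtr_sqr; apply: ler_wsqrtr.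
have hx x : nrm x <= 1 -> nrm (pw (H0 w) N1 x) ^+ 2 <= th w w' ^+ (N1 + N1).
  move=> hx; rewrite exprD -expr2 ler_sqr ?nnegrE ?exprn_ge0 ?nrm_ge0 //.
  by apply: nrm_pw1 => //; apply: cu_op1.
apply: (@le_trans _ _ ((1 + (2 * ell)%:R) * th w w' ^+ (N1 + N1))).
  rewrite mulrDl mul1r /Gam; apply: lerD.
    apply: lerXn2r; rewrite ?nnegrE ?(ltW g0_gt0) //; exact: cu_gth.
  have -> : (2 * ell)%:R * th w w' ^+ (N1 + N1) = ell%:R * (2 * th w w' ^+ (N1 + N1)).
    by rewrite natrM; ring.
  apply: (@le_trans _ _ (\sum_(s in Tb T i) 2 * th w w' ^+ (N1 + N1))).
    apply: ler_sum => s _; rewrite mulr_natl mulr2n.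
    by apply: lerD; apply: hx; [exact: nrm_av | exact: nrm_bv].
  by apply: sum_cst_le; [rewrite mulr_ge0 // exprn_ge0|exact: card_Tb].
rewrite exprMn -exprM muln2 -addnn; apply: ler_wpM2r; first exact: exprn_ge0.
by rewrite expr2 ler_peMr ?addr_ge0 // lerDl.
Qed.

Lemma cu_upd w w' t v : g t = i -> Th (upd w t v) w' = Th w w'.
Proof. by move=> gt; rewrite /Th /H0 (HP_T0_upd _ _ gT gt) (hyb_upd _ _ _ gt) (HP_T0_upd _ _ gT gt). Qed.

(** The other influence is delocalised: by AM-GM with weight [sv] the square root becomes linear in
    [Gam], and the states of block [i] can be averaged. *)
Lemma cu_A3 : Ex2 (fun w w' => th w w' ^+ N1 * Num.sqrt (Gam T i N2 (hyb g i w w'))) <=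
  (1 + ell%:R * kap) * Ex2 (fun w w' => th w w' ^+ N1 * sv w w').
Proof.
pose X w w' := th w w' ^+ N1 / sv w w'.
have X0 w w' : 0 <= X w w' by rewrite divr_ge0 ?exprn_ge0 ?cu_th0 // ltW // cu_s0.
have XE w w' t v : g t = i -> X (upd w t v) w' = X w w'.
  by move=> gt; rewrite /X /sv /th cu_upd.
have main : Ex2 (fun w w' => X w w' * Gam T i N2 (hyb g i w w')) <=
    (1 + (2 * ell)%:R * kap) * Ex2 (fun w w' => th w w' ^+ N1 * sv w w').
  apply: (@le_trans _ _ (Ex2 (fun w w' => X w w' * (g0 ^+ (N2 + N2)) +
      (2 * ell)%:R * (X w w' * (kap / d%:R * Wk (H0 (hyb g i w w')) N2))))).
    rewrite (eq_Ex2 mu (G := fun w w' => X w w' * g0 ^+ (N2 + N2) +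
      \sum_(t in Tb T i) (X w w' * nrm (pw (HP (T0 T i) (hyb g i w w')) N2 (av t (hyb g i w w'))) ^+ 2 +
         X w w' * nrm (pw (HP (T0 T i) (hyb g i w w')) N2 (bv t (hyb g i w w'))) ^+ 2))); last first.
      move=> w w'; rewrite /Gam mulrDr mulr_sumr; congr (_ + _).
      by apply: eq_bigr => t _; rewrite mulrDr.
    rewrite !Ex2D lerD2l Ex2_sum Ex2Z.
    have -> : (2 * ell)%:R * Ex2 (fun w w' => X w w' * (kap / d%:R * Wk (H0 (hyb g i w w')) N2)) =
       ell%:R * (2 * Ex2 (fun w w' => X w w' * (kap / d%:R * Wk (H0 (hyb g i w w')) N2))).
      by rewrite natrM; ring.
    apply: (@le_trans _ _ (\sum_(t in Tb T i) 2 * Ex2 (fun w w' => X w w' * (kap / d%:R * Wk (H0 (hyb g i w w')) N2)))).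
      apply: ler_sum => t ht; rewrite Ex2D mulr_natl mulr2n.
      apply: lerD.
        exact: (@Ex2_avbv T i t N2 X av gT ht X0 XE (or_introl erefl)).
      exact: (@Ex2_avbv T i t N2 X bv gT ht X0 XE (or_intror erefl)).
    apply: sum_cst_le; last exact: card_Tb.
    rewrite mulr_ge0 //; apply: Ex_ge0 => // w; apply: Ex_ge0 => // w'.
    by apply: mulr_ge0 => //; apply: mulr_ge0; [rewrite divr_ge0 ?kap_ge0|exact: Wk_ge0].
  rewrite -Ex2Z; apply: Ex2_le => // w w'.
  have s0 := cu_s0 w w'; have t0 : 0 <= th w w' ^+ N1 by rewrite exprn_ge0 // cu_th0.
  have tN2 : 0 <= th w w' ^+ N2 by rewrite exprn_ge0 // cu_th0.
  have sdp := cu_sd; have gN2 := cu_g0 N2.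
  have s1 : g0 ^+ (N2 + N2) <= sv w w' ^+ 2.
    rewrite exprD -expr2 ler_sqr ?nnegrE ?(ltW s0) //.
    by rewrite lerDl mulr_ge0 // invr_ge0 ltW.
  have s2 : d%:R^-1 * Wk (H0 (hyb g i w w')) N2 <= sv w w' ^+ 2.
    apply: (@le_trans _ _ (d%:R^-1 * th w w' ^+ (N2 + N2))).
      apply: ler_wpM2l; first by rewrite invr_ge0.
      have {1}-> : N2 = ((q - p) + N)%N by rewrite /N2 /N; clear - pq; lia.
      apply: (le_trans (Wk_mono _ _ _ _)).
      have -> : (N2 + N2 = ((q - p) + (q - p)) + (N + N))%N by rewrite /N2 /N; clear - pq; lia.
      rewrite (exprD (th w w')); apply: ler_pM; rewrite ?exprn_ge0 ?opnorm_ge0 ?Wk_ge0 //.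
        by apply: lerXn2r; rewrite ?nnegrE ?opnorm_ge0 ?cu_th0 //; apply: cu_op2.
      by rewrite cu_thE /Th lerDr addr_ge0 ?Wk_ge0 ?cu_g0.
    have -> : d%:R^-1 * th w w' ^+ (N2 + N2) = (sd^-1 * th w w' ^+ N2) ^+ 2.
      by rewrite exprMn exprVn cu_sd2 -exprM muln2 -addnn.
    rewrite ler_sqr ?nnegrE ?(ltW s0) ?mulr_ge0 ?invr_ge0 ?(ltW sdp) //.
    by rewrite lerDr.
  have e0 : 0 <= (2 * ell)%:R * kap by rewrite mulr_ge0 // kap_ge0.
  have -> : X w w' * g0 ^+ (N2 + N2) + (2 * ell)%:R * (X w w' * (kap / d%:R * Wk (H0 (hyb g i w w')) N2)) =
    X w w' * (g0 ^+ (N2 + N2) + (2 * ell)%:R * kap * (d%:R^-1 * Wk (H0 (hyb g i w w')) N2)) by ring.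
  apply: (@le_trans _ _ (X w w' * ((1 + (2 * ell)%:R * kap) * sv w w' ^+ 2))).
    apply: ler_wpM2l => //; rewrite mulrDl mul1r; apply: lerD => //.
    exact: ler_wpM2l.
  rewrite /X le_eqVlt; apply/orP; left; apply/eqP; field.
  by rewrite gt_eqF.
have -> : (1 + ell%:R * kap) * Ex2 (fun w w' => th w w' ^+ N1 * sv w w') =
   1 / 2 * (Ex2 (fun w w' => th w w' ^+ N1 * sv w w') +
     (1 + (2 * ell)%:R * kap) * Ex2 (fun w w' => th w w' ^+ N1 * sv w w')).
  by rewrite natrM; field.
apply: (@le_trans _ _ (1 / 2 * (Ex2 (fun w w' => th w w' ^+ N1 * sv w w') + Ex2 (fun w w' => X w w' * Gam T i N2 (hyb g i w w'))))).
  rewrite -Ex2D -Ex2Z; apply: Ex2_le => // w w'.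
  have -> : 1 / 2 * (th w w' ^+ N1 * sv w w' + X w w' * Gam T i N2 (hyb g i w w')) =
     th w w' ^+ N1 * (1 / 2 * (sv w w' + Gam T i N2 (hyb g i w w') / sv w w')).
    by rewrite /X; field; rewrite gt_eqF // cu_s0.
  apply: ler_wpM2l; first by rewrite exprn_ge0 // cu_th0.
  by apply: sqrt_amgm; [exact: Gam_ge0|exact: cu_s0].
by apply: ler_wpM2l => //; rewrite lerD2l.
Qed.

(** A trace is at most [d] block averages, and [sv] contains [1 / sqrt d], so the loss is [sqrt d]
    and not [d]; [young_gap] gives the same loss for the part of [sv] coming from the floor. *)
Lemma cu_A4 : Ex2 (fun w w' => th w w' ^+ N1 * sv w w') <=
  4 * sd * (g0 ^+ (N + N) + BN).
Proof.
have sdp := cu_sd.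
have B0 : 0 <= BN.
  by apply: le_trans hBN; apply: sumr_ge0 => J _; apply: Ex_ge0 => // w; apply: tau_ev_ge0.
have sd1 : sd^-1 <= sd.
  have : 1 <= sd ^+ 2 by rewrite cu_sd2 ler1n.
  rewrite -[sd^-1]mul1r ler_pdivrMr // expr2 //.
apply: (@le_trans _ _ (sd * g0 ^+ (N + N) + 2 * sd^-1 * Ex2 Th)).
  have <- : Ex2 (fun w w' => sd * g0 ^+ (N + N) + 2 * sd^-1 * Th w w') = sd * g0 ^+ (N + N) + 2 * sd^-1 * Ex2 Th.
    by rewrite Ex2D (Ex2_cst mu1) Ex2Z.
  apply: Ex2_le => // w w'; rewrite /sv mulrDr -cu_thE.
  have N12 : (N1 + N2 = N + N)%N by rewrite /N1 /N2 /N; clear; lia.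
  have N12' : (N1 <= N2)%N by rewrite /N1 /N2; clear - pq; lia.
  have := @young_gap (th w w') sd g0 N1 N2 (N + N) sdp g0_gt0 (cu_gth w w') N12' N12.
  have -> : th w w' ^+ N1 * (sd^-1 * th w w' ^+ N2) = sd^-1 * th w w' ^+ (N + N).
    by rewrite mulrCA -exprD N12.
  move=> h; rewrite -mulrA mulr_natl mulr2n addrA; exact: lerD.
have hTh : Ex2 Th <= g0 ^+ (N + N) + 2 * (d%:R * BN).
  pose F w := Wk (H0 w) N; pose c0 := g0 ^+ (N + N).
  have E1 := Ex2D mu (fun _ _ => c0) (fun w _ => F w).
  have E2 := Ex2D mu (fun w w' => c0 + F w) (fun w w' => F (hyb g i w w')).
  have E : Ex2 Th = c0 + Ex F + Ex F.
    by rewrite -{1}(Ex2_cst mu1 c0) -{1}(Ex2_fst mu1 F) -(Ex2_hyb mu1 g i F) -E1 -E2.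
  have h : Ex F <= d%:R * BN by exact: Ex_Wk hBN.
  rewrite E -addrA lerD2l mulr_natl mulr2n; exact: lerD.
apply: (@le_trans _ _ (sd * g0 ^+ (N + N) + 2 * sd^-1 * (g0 ^+ (N + N) + 2 * (d%:R * BN)))).
  by rewrite lerD2l; apply: ler_wpM2l => //; rewrite mulr_ge0 // invr_ge0 ltW.
have -> : sd * g0 ^+ (N + N) + 2 * sd^-1 * (g0 ^+ (N + N) + 2 * (d%:R * BN)) =
  (sd + 2 * sd^-1) * g0 ^+ (N + N) + 4 * sd * BN.
  by rewrite -cu_sd2; field; rewrite gt_eqF.
rewrite mulrDr lerD2r; apply: ler_wpM2r; first exact: cu_g0.
lra.
Qed.

(** Swapping block [i] between the copies exchanges the two hybrids and leaves [Th] unchanged. *)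
Lemma cu_swap : Ex2 (fun w w' => th w w' ^+ N1 * Num.sqrt (Gam T i N2 (hyb g i.+1 w w'))) =
  Ex2 (fun w w' => th w w' ^+ N1 * Num.sqrt (Gam T i N2 (hyb g i w w'))).
Proof.
pose F w w' := th w w' ^+ N1 * Num.sqrt (Gam T i N2 (hyb g i.+1 w w')).
pose G w w' := th w w' ^+ N1 * Num.sqrt (Gam T i N2 (hyb g i w w')).
have ThE w w' : Th (mix (inblk g i) w w') (mix (inblk g i) w' w) = Th w w'.
  by rewrite /Th /H0 (HP_T0_mix _ _ _ gT) hyb_swap hybS (HP_T0_mix _ _ _ gT).
have h w w' : F (mix (inblk g i) w w') (mix (inblk g i) w' w) = G w w'.
  by rewrite /F /G hyb_swapS /th ThE.
have A := Ex2_swap mu (inblk g i) F.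
have B := @eq_Ex2 _ _ _ mu (fun w w' => F (mix (inblk g i) w w') (mix (inblk g i) w' w)) G.
have B' := B h.
exact (etrans A B').
Qed.

Variables (I J : 'I_(K + K)).
Let Kp := 4 * ((p + p).+2%:R * ell%:R * r * kap) / d%:R.
Let Kq := 4 * ((q + q).+2%:R * ell%:R * r * kap) / d%:R.
Let dJ w := `|tau J (HP T w) (p + p).+2 - tau J (HP (T0 T i) w) (p + p).+2|.
Let dI w := `|tau I (HP T w) (q + q).+2 - tau I (HP (T0 T i) w) (q + q).+2|.

Lemma le_eqr (x y z : R) : x <= y -> y = z -> x <= z.
Proof. by move=> h <-. Qed.

Lemma cu_arith (k1 k2 e x y z : R) : k1 * k2 * e * (x * y + x * z) = (k1 * (e * x)) * (k2 * y + k2 * z).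
Proof. ring. Qed.

Lemma cu_arith2 (k1 k2 e x b : R) : 0 <= k1 * k2 * e -> x <= b ->
  k1 * k2 * e * (x + x) <= k1 * k2 * (e * (2 * b)).
Proof. by move=> h hx; rewrite [leRHS]mulrA; apply: ler_wpM2l => //; lra. Qed.

Lemma cu_final : Ex2 (fun w w' => dJ w * (dI (hyb g i w w') + dI (hyb g i.+1 w w'))) <=
  Kp * Kq * ((1 + (2 * ell)%:R) * (2 * ((1 + ell%:R * kap) * (4 * sd * (g0 ^+ (N + N) + BN))))).
Proof.
have e0 : 0 <= (2 * ell)%:R * r / g0 by rewrite divr_ge0 ?mulr_ge0 // ltW.
have small1 : (2 * ell)%:R * r / g0 * N1%:R <= 1 / 2.
  apply: le_trans small; apply: ler_wpM2l => //; rewrite ler_nat /N1 /N2; clear - pq; lia.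
have kp := kap_ge0.
have k0 : 0 <= 1 + ell%:R * kap by rewrite addr_ge0 // mulr_ge0.
have Kp0 : 0 <= Kp by rewrite divr_ge0 // !mulr_ge0.
have Kq0 : 0 <= Kq by rewrite divr_ge0 // !mulr_ge0.
pose F w w' := th w w' ^+ N1 * Num.sqrt (Gam T i N2 (hyb g i w w')).
pose G w w' := th w w' ^+ N1 * Num.sqrt (Gam T i N2 (hyb g i.+1 w w')).
pose c1 := Kp * Kq * (1 + (2 * ell)%:R).
have c10 : 0 <= c1 by rewrite !mulr_ge0 // addr_ge0.
have step w w' : dJ w * (dI (hyb g i w w') + dI (hyb g i.+1 w w')) <= c1 * (F w w' + G w w').
  have b1 : dJ w <= Kp * Num.sqrt (Gam T i N1 w) by exact: tau_diff.
  have b2 : dI (hyb g i w w') <= Kq * Num.sqrt (Gam T i N2 (hyb g i w w')) by exact: tau_diff.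
  have b3 : dI (hyb g i.+1 w w') <= Kq * Num.sqrt (Gam T i N2 (hyb g i.+1 w w')) by exact: tau_diff.
  have b4 := cu_A1 w w'.
  have b5 : dJ w <= Kp * ((1 + (2 * ell)%:R) * th w w' ^+ N1).
    by apply: (le_trans b1); apply: ler_wpM2l.
  have -> : c1 * (F w w' + G w w') = (Kp * ((1 + (2 * ell)%:R) * th w w' ^+ N1)) *
     (Kq * Num.sqrt (Gam T i N2 (hyb g i w w')) + Kq * Num.sqrt (Gam T i N2 (hyb g i.+1 w w'))).
    exact (cu_arith _ _ _ _ _ _).
  apply: ler_pM => //; first by rewrite /dJ normr_ge0.
    by rewrite addr_ge0 // normr_ge0.
  exact (lerD b2 b3).
have A : Ex2 (fun w w' => c1 * (F w w' + G w w')) = c1 * (Ex2 F + Ex2 G).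
  exact (etrans (Ex2Z mu c1 (fun w w' => F w w' + G w w')) (congr1 (fun z => c1 * z) (Ex2D mu F G))).
have sw : Ex2 G = Ex2 F by exact cu_swap.
have h3 : Ex2 F <= (1 + ell%:R * kap) * (4 * sd * (g0 ^+ (N + N) + BN)).
  have a3 := cu_A3; have a4 := cu_A4; exact (le_trans a3 (ler_wpM2l k0 a4)).
have A2 := etrans A (congr1 (fun z => c1 * (Ex2 F + z)) sw).
have h4 := @Ex2_le R _ _ mu mu0 (fun w w' => dJ w * (dI (hyb g i w w') + dI (hyb g i.+1 w w')))
  (fun w w' => c1 * (F w w' + G w w')) step.
exact (le_trans (le_eqr h4 A2) (cu_arith2 c10 h3)).
Qed.
End CovU.

Definition Ccov : R := 128 * (ell%:R * kap) ^+ 2 * (1 + (2 * ell)%:R) * (1 + ell%:R * kap).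

Lemma Ccov_ge0 : 0 <= Ccov.
Proof.
have k := kap_ge0; have e : 0 <= 1 + ell%:R * kap by rewrite addr_ge0 // mulr_ge0.
by rewrite /Ccov mulr_ge0 // mulr_ge0 ?addr_ge0 // mulr_ge0 // exprn_ge0 // mulr_ge0.
Qed.

(** There are [n] blocks, each with two influences of order [r / d] and the loss [sqrt d] of
    [cu_A4]. Since [n * r ^ 2 <= d], the total is of order [1 / sqrt d]. *)
Lemma cov_U T J I p q BN : good T -> (p <= q)%N ->
  (2 * ell)%:R * r / g0 * (q + q).+1%:R <= 1 / 2 ->
  (forall i, \sum_I Ex (fun w => tau I (HP (T0 T i) w) ((p + q).+1 + (p + q).+1)) <= BN) ->
  `|Ex (fun w => tau J (HP T w) (p + p).+2 * tau I (HP T w) (q + q).+2) -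
    Ex (fun w => tau J (HP T w) (p + p).+2) * Ex (fun w => tau I (HP T w) (q + q).+2)| <=
  Ccov * ((p + p).+2%:R * (q + q).+2%:R) / Num.sqrt d%:R * (g0 ^+ ((p + q).+1 + (p + q).+1) + BN).
Proof.
move=> gT pq small hBN; set sd := Num.sqrt _.
have sdp : 0 < sd by rewrite sqrtr_gt0 dR_gt0.
have sd2 : sd ^+ 2 = d%:R by rewrite sqr_sqrtr // ler0n.
have B0 : 0 <= BN.
  by apply: le_trans (hBN 0%N); apply: sumr_ge0 => J' _; apply: Ex_ge0 => // w; apply: tau_ev_ge0.
have kp := kap_ge0.
pose Kp := 4 * ((p + p).+2%:R * ell%:R * r * kap) / d%:R.
pose Kq := 4 * ((q + q).+2%:R * ell%:R * r * kap) / d%:R.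
pose GB := g0 ^+ ((p + q).+1 + (p + q).+1) + BN.
have GB0 : 0 <= GB by rewrite addr_ge0 // exprn_ge0 // ltW.
have C := @cov_le _ _ _ mu mu0 mu1 g n g_lt (fun w => tau J (HP T w) (p + p).+2) (fun w => tau I (HP T w) (q + q).+2)
   (fun i w => tau J (HP (T0 T i) w) (p + p).+2) (fun i w => tau I (HP (T0 T i) w) (q + q).+2)
   (fun i w w' => congr1 (fun H => tau J H (p + p).+2) (HP_T0_mix i w w' gT))
   (fun i w w' => congr1 (fun H => tau I H (q + q).+2) (HP_T0_mix i w w' gT)).
refine (le_trans C _).
apply: (@le_trans _ _ (n%:R * (Kp * Kq * ((1 + (2 * ell)%:R) * (2 * ((1 + ell%:R * kap) * (4 * sd * GB))))))).
  rewrite -sum_ord_cst; apply: ler_sum => i _; exact: (cu_final gT pq small (hBN i)).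
have -> : n%:R * (Kp * Kq * ((1 + (2 * ell)%:R) * (2 * ((1 + ell%:R * kap) * (4 * sd * GB))))) =
  (n%:R * r ^+ 2) * (Ccov * ((p + p).+2%:R * (q + q).+2%:R) / d%:R ^+ 2 * sd * GB).
  by rewrite /Kp /Kq /Ccov; field; rewrite pnatr_eq0 -lt0n.
have -> : Ccov * ((p + p).+2%:R * (q + q).+2%:R) / sd * GB =
   d%:R * (Ccov * ((p + p).+2%:R * (q + q).+2%:R) / d%:R ^+ 2 * sd * GB).
  by rewrite -sd2; field; rewrite gt_eqF.
apply: ler_wpM2r => //.
have Cc := Ccov_ge0; have sd0 := ltW sdp.
apply: mulr_ge0 => //; apply: mulr_ge0 => //; apply: mulr_ge0; last by rewrite invr_ge0 exprn_ge0.
by apply: mulr_ge0 => //; rewrite mulr_ge0.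
Qed.
Lemma sum_even (F : nat -> R) m : (forall j, odd j -> F j = 0) ->
  \sum_(j < (m + m).+1) F j = \sum_(a < m.+1) F (a + a)%N.
Proof.
move=> h; elim: m => [|m IH]; first by rewrite !big_ord_recl !big_ord0.
rewrite addSn addnS big_ord_recr big_ord_recr /= IH [RHS]big_ord_recr /=.
rewrite (h (m + m).+1) ?addr0; last by rewrite /= addnn odd_double.
by congr (_ + F _); rewrite addSn addnS.
Qed.

Lemma tau0 I T w : tau I (HP T w) 0 = avg I (fun l => nrm (wvec l) ^+ 2).
Proof. by apply: eq_avg => l _; rewrite nrm_sqr. Qed.

Lemma tau0_le1 I T w : tau I (HP T w) 0 <= 1.
Proof.
rewrite tau0 -[leRHS](avg_cst bsz_gt0 I); apply: avg_le => l _.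
by rewrite expr_le1 ?nrm_ge0 ?nrm_w.
Qed.

(** The three summands come from the third-order terms, the crossed pairing and the covariance of
    two block averages. *)
Definition CE : R := 16 * (ell%:R ^+ 2 * (1 + (2 * ell)%:R)) / g0 + 2 * kap ^+ 2 + 4 * Ccov.

Lemma CE_ge0 : 0 <= CE.
Proof.
have := Ccov_ge0; have k := kap_ge0 => c.
rewrite /CE addr_ge0 ?mulr_ge0 // addr_ge0 ?mulr_ge0 ?exprn_ge0 // ?invr_ge0 ?(ltW g0_gt0) //.
Qed.

(** The relative error at power [m]: the first term is the third order in a block, the second
    collects crossed pairings and covariances. *)
Definition eps (m : nat) : R := r * m%:R ^+ 2 + m%:R ^+ 3 / Num.sqrt d%:R.

Lemma eps_ge0 m : 0 <= eps m.
Proof. by rewrite addr_ge0 // ?mulr_ge0 ?exprn_ge0 ?invr_ge0 ?sqrtr_ge0. Qed.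

Lemma tauB_ge0 T N BN : \sum_I Ex (fun w => tau I (HP T w) (N + N)) <= BN -> 0 <= BN.
Proof.
by apply: le_trans; apply: sumr_ge0 => I _; apply: Ex_ge0 => // w; apply: tau_ev_ge0.
Qed.

Lemma Ex_rem T I J j c N BN : (j + c = N + N)%N ->
  \sum_I Ex (fun w => tau I (HP T w) (N + N)) <= BN ->
  `|Ex (fun w => rem (HP T w) I J j c)| <= 2 * kap ^+ 2 / Num.sqrt d%:R * BN.
Proof.
move=> jc hB; apply: (le_trans (Ex_abs mu0 _)).
apply: (le_trans (Ex_le mu0 (fun w => rem_le T w I J jc))).
rewrite !ExZ; set s := Num.sqrt d%:R.
have s0 : 0 < s by rewrite sqrtr_gt0 dR_gt0.
have sd : s ^+ 2 = d%:R by rewrite sqr_sqrtr.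
have -> : 2 * kap ^+ 2 / s * BN = (kap / d%:R) ^+ 2 * (2 * s * (d%:R * BN)).
  by rewrite -sd; field; rewrite gt_eqF.
apply: ler_wpM2l; first by rewrite sqr_ge0.
apply: ler_pM; rewrite ?sqrtr_ge0 //; last exact: Ex_Wk.
  by apply: Ex_ge0 => // w; apply: Wk_ge0.
apply: le_sqr2; first by rewrite mulr_ge0 // ltW.
by rewrite sqr_sqrtr // exprMn sd natrD -natrX; have := dR_gt0; lra.
Qed.

Definition mainE T t n' := \sum_(a < n'.+1)
  Ex (fun w => tau (Bb t) (HP (T0 T (g t)) w) (a + a)) *
  Ex (fun w => tau (Ab t) (HP (T0 T (g t)) w) ((n' - a) + (n' - a))).

(** Only [s = t] survives the average, and only even exponents contribute by [tau_odd]. *)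
Lemma Ex_second_sum T t n' : good T -> t \in T ->
  \sum_(j < (n' + n').+1) Ex (fun w => \sum_(s in Tb T (g t)) second T (g t) w s t j ((n' + n') - j)) =
  \sum_(a < n'.+1) Ex (fun w => tau (Bb t) (HP (T0 T (g t)) w) (a + a) * tau (Ab t) (HP (T0 T (g t)) w) ((n' - a) + (n' - a)))
  + \sum_(j < (n' + n').+1) Ex (fun w => rem (HP (T0 T (g t)) w) (Ab t) (Bb t) j ((n' + n') - j)).
Proof.
move=> gT tT.
rewrite (eq_bigr (fun j : 'I_(n' + n').+1 =>
  Ex (fun w => tau (Bb t) (HP (T0 T (g t)) w) j * tau (Ab t) (HP (T0 T (g t)) w) ((n' + n') - j))
  + Ex (fun w => rem (HP (T0 T (g t)) w) (Ab t) (Bb t) j ((n' + n') - j)))); last first.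
  move=> j _; rewrite Ex_sum (bigD1 t) /=; last by rewrite inE tT /=.
  rewrite big1 ?addr0; first exact: Ex_second_eq.
  by move=> s; rewrite inE => /andP[/andP[sT /eqP gs] st]; apply: Ex_second_neq.
rewrite big_split /=; congr (_ + _).
rewrite (@sum_even (fun j => Ex (fun w => tau (Bb t) (HP (T0 T (g t)) w) j * tau (Ab t) (HP (T0 T (g t)) w) ((n' + n') - j)))).
  apply: eq_bigr => a _; apply: eq_Ex => w; congr (_ * tau _ _ _).
  by clear; lia.
move=> j oj; rewrite -[RHS](Ex_cst mu1 0); apply: eq_Ex => w; by rewrite tau_odd // mul0r.
Qed.

(** Removes the order of the exponents by symmetry and admits exponent 0, where the block average is
    deterministic. *)
Lemma cov_U' (T : {set 'I_n}) J I a b BN : good T -> (2 * ell)%:R * r / g0 * (a + a + (b + b)).+1%:R <= 1 / 2 ->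
  (forall T' : {set 'I_n}, T' \subset T -> \sum_I Ex (fun w => tau I (HP T' w) ((a + b).-1 + (a + b).-1)) <= BN) ->
  `|Ex (fun w => tau J (HP T w) (a + a) * tau I (HP T w) (b + b)) -
    Ex (fun w => tau J (HP T w) (a + a)) * Ex (fun w => tau I (HP T w) (b + b))| <=
  Ccov * ((a + a)%:R * (b + b)%:R) / Num.sqrt d%:R * (g0 ^+ ((a + b).-1 + (a + b).-1) + BN).
Proof.
move=> gT small hB.
have sq : 0 <= Num.sqrt d%:R :> R by apply: sqrtr_ge0.
have B0 : 0 <= BN by apply: tauB_ge0 (hB T _).
have e0 : 0 <= (2 * ell)%:R * r / g0 by rewrite divr_ge0 ?mulr_ge0 // ltW.
have rhs0 : 0 <= Ccov * ((a + a)%:R * (b + b)%:R) / Num.sqrt d%:R * (g0 ^+ ((a + b).-1 + (a + b).-1) + BN).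
  apply: mulr_ge0; last by rewrite addr_ge0 // exprn_ge0 // ltW.
  apply: mulr_ge0; last by rewrite invr_ge0.
  by apply: mulr_ge0; rewrite ?Ccov_ge0 // mulr_ge0.
have cst I' : exists c, forall w, tau I' (HP T w) (0 + 0) = c.
  by exists (avg I' (fun l => nrm (wvec l) ^+ 2)) => w; rewrite tau0.
case: a small hB rhs0 => [|p] small hB rhs0.
  have [c hc] := cst J.
  rewrite (eq_Ex mu (g := fun w => c * tau I (HP T w) (b + b))); last by move=> w; rewrite hc.
  by rewrite ExZ (@eq_Ex _ _ _ mu (fun w => tau J (HP T w) (0 + 0)) (fun=> c)) // Ex_cst // subrr normr0.
case: b small hB rhs0 => [|q] small hB rhs0.
  have [c hc] := cst I.
  rewrite (eq_Ex mu (g := fun w => tau J (HP T w) (p.+1 + p.+1) * c)); last by move=> w; rewrite hc.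
  by rewrite ExZr (@eq_Ex _ _ _ mu (fun w => tau I (HP T w) (0 + 0)) (fun=> c)) // Ex_cst // subrr normr0.
have E : (p.+1 + q.+1).-1 = (p + q).+1 by clear; lia.
rewrite E in hB rhs0 *; rewrite !(addSn, addnS) in rhs0 *.
have hB' i : \sum_I Ex (fun w => tau I (HP (T0 T i) w) ((p + q).+1 + (p + q).+1)) <= BN.
  exact: hB (T0_sub _ _).
have [pq|/ltnW pq] := leqP p q.
  rewrite -(addSn (p + q)) -(addnS (p + q).+1); apply: cov_U => //.
  apply: le_trans small; apply: ler_wpM2l => //; rewrite ler_nat; clear; lia.
have E2 : (p + q = q + p)%N by rewrite addnC.
have C := @cov_U T I J q p BN gT pq.
rewrite [X in X - _](eq_Ex mu (g := fun w => tau I (HP T w) (q + q).+2 * tau J (HP T w) (p + p).+2)); last by move=> w; rewrite mulrC.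
rewrite [X in _ - X]mulrC [(p + p).+2%:R * _]mulrC E2 -(addSn (q + p)) -(addnS (q + p).+1); apply: C.
  apply: le_trans small; apply: ler_wpM2l => //; rewrite ler_nat; clear; lia.
by rewrite -E2.
Qed.

(** Uniform over subfamilies, because the recursion for [T] refers to [T] without a block, and its
    error terms to [T] without two. *)
Definition EB (T : {set 'I_n}) m BN := forall T' : {set 'I_n}, T' \subset T ->
  \sum_I Ex (fun w => tau I (HP T' w) (m + m)) <= BN.

Lemma EB_sub (T U : {set 'I_n}) m BN : U \subset T -> EB T m BN -> EB U m BN.
Proof. by move=> h hB T' hT'; apply: hB; apply: fintype.subset_trans h. Qed.

Definition third (T : {set 'I_n}) t n' w : R :=
  dot (av t w) (pw (HP T w) (n' + n').+1 (bv t w)) - dot (av t w) (pw (HP (T0 T (g t)) w) (n' + n').+1 (bv t w))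
    - r * \sum_(j < (n' + n').+1) \sum_(s in Tb T (g t)) second T (g t) w s t j ((n' + n') - j).

Lemma Ex_third T t n' BN : good T -> t \in T -> (2 * ell)%:R * r / g0 * (n' + n').+1%:R <= 1 / 2 ->
  EB T n' BN ->
  `|Ex (third T t n')| <= 16 * (ell%:R ^+ 2 * (1 + (2 * ell)%:R)) / g0 * ((n' + n').+1%:R * r) ^+ 2 * (g0 ^+ (n' + n') + BN).
Proof.
move=> gT tT small hB.
have e0 : 0 <= (2 * ell)%:R * r / g0 by rewrite divr_ge0 ?mulr_ge0 // ltW.
have B0 : 0 <= BN by apply: tauB_ge0 (hB T _).
have gg m : 0 <= g0 ^+ m by rewrite exprn_ge0 // ltW.
(* At power 1 the expansion has one term and is exact, so [third] vanishes; [expand2] covers the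
   positive case. *)
case: n' small hB => [|N] small hB.
  have -> : third T t 0 = (fun _ => 0).
    apply/funext => w; rewrite /third big_ord1 /= -dotBr -mulmxBl.
    have := S_expand T (g t) w (av t w) (bv t w) 0; rewrite /= => ->.
    by rewrite subrr.
  rewrite Ex_cst // normr0; apply: mulr_ge0; last by rewrite addr_ge0.
  by rewrite !mulr_ge0 ?invr_ge0 ?(ltW g0_gt0) ?sqr_ge0 ?exprn_ge0 // addr_ge0.
have sm : (2 * ell)%:R * r / g0 * N.+1%:R <= 1 / 2.
  apply: le_trans small; apply: ler_wpM2l => //; rewrite ler_nat; clear; lia.
have sm0 w : `|third T t N.+1 w| <= 16 * ((N.+1 + N.+1).+1%:R * ell%:R * r) ^+ 2 * (Gam T (g t) N.+1 w / g0).
  have := expand2 w gT tT sm (erefl _) (erefl (N.+1 + N.+1).+1).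
  rewrite /third; under eq_bigr => j _ do rewrite subSS; exact.
apply: (le_trans (Ex_abs mu0 _)); apply: (le_trans (Ex_le mu0 sm0)).
rewrite ExZ ExZr.
have h1 : Ex (Gam T (g t) N.+1) <= (1 + (2 * ell)%:R) * (g0 ^+ (N.+1 + N.+1) + BN).
  apply: (le_trans (Ex_Gam gT (hB _ (T0_sub _ _)))).
  have := gg (N.+1 + N.+1)%N; have : 0 <= (2 * ell)%:R :> R by []. 
  move=> h2 h3; have := mulr_ge0 h2 h3; rewrite mulrDl mul1r mulrDr; lra.
have -> : 16 * (ell%:R ^+ 2 * (1 + (2 * ell)%:R)) / g0 * ((N.+1 + N.+1).+1%:R * r) ^+ 2 * (g0 ^+ (N.+1 + N.+1) + BN) =
  16 * ((N.+1 + N.+1).+1%:R * ell%:R * r) ^+ 2 * ((1 + (2 * ell)%:R) * (g0 ^+ (N.+1 + N.+1) + BN) / g0) by ring.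
apply: ler_wpM2l; first by rewrite mulr_ge0 ?sqr_ge0.
by apply: ler_wpM2r; rewrite ?invr_ge0 ?(ltW g0_gt0).
Qed.

Lemma dot_arith (A B C D E F G r1 x y z : R) : C = A - B - r1 * D -> B = 0 -> D = E + F ->
  `|C| <= x -> `|F| <= y -> `|E - G| <= z -> 0 <= r1 -> `|A - r1 * G| <= x + r1 * (y + z).
Proof.
move=> hC hB hD h1 h2 h3 r1p.
have -> : A - r1 * G = C + r1 * (F + (E - G)) by rewrite hC hB hD; ring.
apply: (le_trans (ler_normD _ _)); apply: lerD => //.
rewrite normrM ger0_norm //; apply: ler_wpM2l => //.
by apply: (le_trans (ler_normD _ _)); apply: lerD.
Qed.

Lemma dot_arith2 (c1 c2 c3 e1 e2 G0 G1 B r1 : R) : 0 <= c1 -> 0 <= c2 -> 0 <= c3 -> 0 <= e1 -> 0 <= e2 ->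
  0 <= G0 -> 0 <= G1 -> 0 <= B -> 0 <= r1 ->
  r1 * (c1 * e1 * (G0 + B)) + r1 * (c2 * e2 * B + c3 * e2 * (G1 + B)) <=
  r1 * ((c1 + c2 + 4 * c3) * (e1 + e2) * (G0 + G1 + B)).
Proof.
move=> c1p c2p c3p e1p e2p g0p g1p bp rp; rewrite -mulrDr; apply: ler_wpM2l => //.
have -> : (c1 + c2 + 4 * c3) * (e1 + e2) * (G0 + G1 + B) =
  c1 * e1 * (G0 + B) + (c2 * e2 * B + c3 * e2 * (G1 + B)) +
  (c1 * e1 * G1 + c1 * e2 * (G0 + G1 + B) + c2 * e1 * (G0 + G1 + B) + c2 * e2 * (G0 + G1) +
  4 * c3 * e1 * (G0 + G1 + B) + c3 * e2 * (G0 + 3 * (G0 + G1 + B))) by ring.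
by rewrite lerDl; repeat first [assumption | apply: addr_ge0 | apply: mulr_ge0 | by []].
Qed.

(** Collects the recursion for one transition: the first order vanishes, the second order factorises
    up to [rem] and covariances, the third order is small. The exponent [n'.-1] comes from the
    covariance bound. *)
Lemma Ex_dot T t n' BN : good T -> t \in T -> (2 * ell)%:R * r / g0 * (n' + n').+1%:R <= 1 / 2 ->
  EB T n' BN -> EB T n'.-1 BN ->
  `|Ex (fun w => dot (av t w) (pw (HP T w) (n' + n').+1 (bv t w))) - r * mainE T t n'| <=
  r * (CE * eps (n' + n').+1 * (g0 ^+ (n' + n') + g0 ^+ (n'.-1 + n'.-1) + BN)).
Proof.
move=> gT tT small hB hB1.
have B0 : 0 <= BN by apply: tauB_ge0 (hB T _).
have gg m : 0 <= g0 ^+ m by rewrite exprn_ge0 // ltW.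
have sq : 0 <= (Num.sqrt d%:R)^-1 :> R by rewrite invr_ge0 sqrtr_ge0.
pose m := (n' + n').+1; have mE : (n' + n').+1 = m by [].
have m1 : 1 <= m%:R :> R by rewrite ler1n.
have H3 := Ex_third gT tT small hB.
have HE : Ex (third T t n') = Ex (fun w => dot (av t w) (pw (HP T w) m (bv t w)))
  - Ex (fun w => dot (av t w) (pw (HP (T0 T (g t)) w) m (bv t w)))
  - r * (\sum_(j < m) Ex (fun w => \sum_(s in Tb T (g t)) second T (g t) w s t j ((n' + n') - j))).
  by rewrite -Ex_sum -ExZ -2!ExB; apply: eq_Ex => w; reflexivity.
have H0 := Ex_first m gT tT.
have HS := Ex_second_sum n' gT tT.
have HR : `|\sum_(j < m) Ex (fun w => rem (HP (T0 T (g t)) w) (Ab t) (Bb t) j ((n' + n') - j))| <=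
   2 * kap ^+ 2 * (m%:R ^+ 3 / Num.sqrt d%:R) * BN.
  apply: (le_trans (ler_norm_sum _ _ _)).
  apply: (@le_trans _ _ (\sum_(j < m) 2 * kap ^+ 2 / Num.sqrt d%:R * BN)).
    apply: ler_sum => j _; apply: (@Ex_rem _ _ _ _ _ n'); last exact: hB (T0_sub _ _).
    by have := ltn_ord j; rewrite /m; clear; lia.
  rewrite sum_ord_cst.
  have -> : 2 * kap ^+ 2 * (m%:R ^+ 3 / Num.sqrt d%:R) * BN = m%:R ^+ 3 * (2 * kap ^+ 2 / Num.sqrt d%:R * BN) by ring.
  apply: ler_wpM2r; last exact: ler_eXnr.
  by rewrite mulr_ge0 // mulr_ge0 // mulr_ge0 // sqr_ge0.
have HC : `|\sum_(a < n'.+1) Ex (fun w => tau (Bb t) (HP (T0 T (g t)) w) (a + a) * tau (Ab t) (HP (T0 T (g t)) w) ((n' - a) + (n' - a)))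
   - mainE T t n'| <= Ccov * (m%:R ^+ 3 / Num.sqrt d%:R) * (g0 ^+ (n'.-1 + n'.-1) + BN).
  rewrite /mainE -sumrB; apply: (le_trans (ler_norm_sum _ _ _)).
  apply: (@le_trans _ _ (\sum_(a < n'.+1) Ccov * (m%:R ^+ 2 / Num.sqrt d%:R) * (g0 ^+ (n'.-1 + n'.-1) + BN))).
    apply: ler_sum => a _; have ha := ltn_ord a.
    have E : (a + (n' - a) = n')%N by clear - ha; lia.
    have := @cov_U' (T0 T (g t)) (Bb t) (Ab t) a (n' - a) BN (good_T0 _ gT); rewrite E.
    have -> : (a + a + (n' - a + (n' - a)) = n' + n')%N by clear - ha; lia.
    move=> h; apply: (le_trans (h small _)).
      by move=> T' hT'; apply: hB1; apply: fintype.subset_trans hT' (T0_sub _ _).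
    apply: ler_wpM2r; first by rewrite addr_ge0.
    rewrite -[leLHS]mulrA; apply: ler_wpM2l; first exact: Ccov_ge0.
    apply: ler_wpM2r => //.
    rewrite expr2; apply: ler_pM => //; rewrite ler_nat /m; clear - ha; lia.
  rewrite sum_ord_cst.
  have -> : Ccov * (m%:R ^+ 3 / Num.sqrt d%:R) * (g0 ^+ (n'.-1 + n'.-1) + BN) =
    m%:R * (Ccov * (m%:R ^+ 2 / Num.sqrt d%:R) * (g0 ^+ (n'.-1 + n'.-1) + BN)) by ring.
  apply: ler_wpM2r; last by rewrite ler_nat /m; clear; lia.
  apply: mulr_ge0; last by rewrite addr_ge0.
  by apply: mulr_ge0; [exact: Ccov_ge0|rewrite mulr_ge0 // exprn_ge0].
have F := dot_arith HE H0 HS H3 HR HC r_ge0.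
refine (le_trans F _).
rewrite /CE /eps mE.
have -> : 16 * (ell%:R ^+ 2 * (1 + (2 * ell)%:R)) / g0 * (m%:R * r) ^+ 2 * (g0 ^+ (n' + n') + BN) =
  r * (16 * (ell%:R ^+ 2 * (1 + (2 * ell)%:R)) / g0 * (r * m%:R ^+ 2) * (g0 ^+ (n' + n') + BN)) by ring.
have k1 : 0 <= 16 * (ell%:R ^+ 2 * (1 + (2 * ell)%:R)) / g0.
  by rewrite !mulr_ge0 ?invr_ge0 ?(ltW g0_gt0) ?exprn_ge0 // addr_ge0.
have k2 : 0 <= 2 * kap ^+ 2 by rewrite mulr_ge0 // sqr_ge0.
have k3 : 0 <= r * m%:R ^+ 2 by rewrite mulr_ge0 // sqr_ge0.
have k4 : 0 <= m%:R ^+ 3 / Num.sqrt d%:R :> R by rewrite mulr_ge0 // exprn_ge0.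
exact: (dot_arith2 k1 k2 Ccov_ge0 k3 k4 (gg _) (gg _) B0 r_ge0).
Qed.

Lemma chat_ge0 T I J : 0 <= chat T I J.
Proof.
rewrite mulr_ge0 ?divr_ge0 ?sqr_ge0 ?bsz_ge0 //.
by apply: sumr_ge0 => s _; rewrite addr_ge0.
Qed.

Lemma chat_sum T I (F : 'I_(K + K) -> R) :
  \sum_J chat T I J * F J = r ^+ 2 / bsz I * \sum_(t in T) ((Ab t == I)%:R * F (Bb t) + (Bb t == I)%:R * F (Ab t)).
Proof.
rewrite /chat; under eq_bigr => J _ do rewrite -mulrA mulr_suml.
rewrite -mulr_sumr exchange_big /=; congr (_ * _); apply: eq_bigr => t _.
under eq_bigr => J _ do rewrite mulrDl.
rewrite big_split /= (bigD1 (Bb t)) //= [X in _ + X](bigD1 (Ab t)) //= !eqxx !andbT.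
rewrite !big1 ?addr0 // => J hJ.
  by rewrite [Ab t == J]eq_sym (negbTE hJ) andbF mul0r.
by rewrite [Bb t == J]eq_sym (negbTE hJ) andbF mul0r.
Qed.

Lemma r2n_le (T : {set 'I_n}) I : r ^+ 2 / bsz I * #|T|%:R <= kap.
Proof.
have [k0 b0] := (kap_ge0, bsz_gt0 I).
apply: (@le_trans _ _ (d%:R / bsz I)); last by rewrite ler_pdivrMr.
rewrite mulrAC; apply: ler_wpM2r; first by rewrite invr_ge0 ltW.
apply: le_trans nr2; rewrite mulrC; apply: ler_wpM2r; first exact: sqr_ge0.
by rewrite ler_nat; apply: (leq_trans (max_card _)); rewrite card_ord.
Qed.

Lemma tau_rec T I n' BN : good T -> (2 * ell)%:R * r / g0 * (n' + n').+1%:R <= 1 / 2 ->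
  EB T n' BN -> EB T n'.-1 BN ->
  `|Ex (fun w => tau I (HP T w) (n'.+1 + n'.+1)) -
    r ^+ 2 / bsz I * \sum_(t in T) ((Ab t == I)%:R + (Bb t == I)%:R) * mainE T t n'| <=
  2 * kap * (CE * eps (n' + n').+1 * (g0 ^+ (n' + n') + g0 ^+ (n'.-1 + n'.-1) + BN)).
Proof.
move=> gT small hB hB1; have b0 := bsz_gt0 I.
set X := CE * _ * _.
have B0 : 0 <= BN by apply: tauB_ge0 (hB T _).
have X0 : 0 <= X by rewrite mulr_ge0 ?mulr_ge0 ?CE_ge0 ?eps_ge0 // !addr_ge0 // exprn_ge0 // ltW.
have -> : Ex (fun w => tau I (HP T w) (n'.+1 + n'.+1)) =
  (bsz I)^-1 * (r * \sum_(s in T) ((Ab s == I)%:R + (Bb s == I)%:R) * Ex (fun w => dot (av s w) (pw (HP T w) (n' + n').+1 (bv s w)))).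
  by rewrite -Ex_tau_step mulrA mulVf ?gt_eqF // mul1r addSn addnS.
have -> : forall Y, r ^+ 2 / bsz I * Y = (bsz I)^-1 * (r * (r * Y)) by move=> Y; ring.
rewrite -mulrBr -mulrBr mulr_sumr -sumrB normrM (ger0_norm (x := _^-1)) ?invr_ge0 ?(ltW b0) //.
rewrite normrM (ger0_norm r_ge0).
have st (s : 'I_n) : s \in T -> `|((Ab s == I)%:R + (Bb s == I)%:R) * Ex (fun w => dot (av s w) (pw (HP T w) (n' + n').+1 (bv s w)))
   - r * (((Ab s == I)%:R + (Bb s == I)%:R) * mainE T s n')| <= 2 * (r * X).
  move=> sT; rewrite [r * (_ * _)]mulrCA -mulrBr normrM; apply: ler_pM => //; last exact: Ex_dot.
  rewrite ger0_norm ?addr_ge0 //; apply: (@le_trans _ _ (1 + 1)); last by lra.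
  by apply: lerD; rewrite lern1 leq_b1.
apply: (@le_trans _ _ ((bsz I)^-1 * (r * (#|T|%:R * (2 * (r * X)))))).
  apply: ler_wpM2l; first by rewrite invr_ge0 ltW.
  apply: ler_wpM2l => //; apply: (le_trans (ler_norm_sum _ _ _)).
  apply: (@le_trans _ _ (\sum_(s in T) 2 * (r * X))); first exact: ler_sum.
  have rX : 0 <= 2 * (r * X) by rewrite mulr_ge0 // mulr_ge0.
  exact: (sum_cst_le rX (leqnn _)).
have -> : (bsz I)^-1 * (r * (#|T|%:R * (2 * (r * X)))) = r ^+ 2 / bsz I * #|T|%:R * (2 * X) by ring.
have -> : 2 * kap * X = kap * (2 * X) by ring.
apply: ler_wpM2r; [by rewrite mulr_ge0|exact: r2n_le].
Qed.
(** A transition whose second block is [I] gives the same convolution after reversing the summation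
    index. *)
Lemma main_chat T I n' (F : nat -> 'I_(K + K) -> R) :
  \sum_J chat T I J * (\sum_(a < n'.+1) F a J * F (n' - a)%N I) =
  r ^+ 2 / bsz I * \sum_(t in T) ((Ab t == I)%:R + (Bb t == I)%:R) *
     \sum_(a < n'.+1) F a (Bb t) * F (n' - a)%N (Ab t).
Proof.
rewrite chat_sum; congr (_ * _); apply: eq_bigr => t _; rewrite mulrDl; congr (_ + _).
  by case: eqP => [->|_]; rewrite ?mul0r.
case: eqP => [->|_]; rewrite ?mul0r // !mul1r (reindex_inj rev_ord_inj) /=.
apply: eq_bigr => a _; rewrite subSS mulrC; congr (F _ _ * _).
by have := ltn_ord a; clear; lia.
Qed.

Definition Eerr n' BN := 2 * kap * (CE * eps (n' + n').+1 * (g0 ^+ (n' + n') + g0 ^+ (n'.-1 + n'.-1) + BN)).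

Lemma tau_up T I n' BN (be : nat -> 'I_(K + K) -> R) : good T ->
  (2 * ell)%:R * r / g0 * (n' + n').+1%:R <= 1 / 2 ->
  EB T n' BN -> EB T n'.-1 BN ->
  (forall (T' : {set 'I_n}) a J, T' \subset T -> (a <= n')%N -> Ex (fun w => tau J (HP T' w) (a + a)) <= be a J) ->
  Ex (fun w => tau I (HP T w) (n'.+1 + n'.+1)) <=
  \sum_J chat T I J * (\sum_(a < n'.+1) be a J * be (n' - a)%N I) + Eerr n' BN.
Proof.
move=> gT small hB hB1 hbe; have := tau_rec I gT small hB hB1.
rewrite -/(Eerr n' BN) => h; have := le_trans (ler_norm _) h.
rewrite lerBlDl => h1; apply: (le_trans h1); rewrite lerD2r main_chat.
apply: ler_wpM2l; first by rewrite divr_ge0 ?sqr_ge0 ?bsz_ge0.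
apply: ler_sum => t _; apply: ler_wpM2l; first by rewrite addr_ge0.
apply: ler_sum => a _; have ha := ltn_ord a.
have p0 J b T' : 0 <= Ex (fun w => tau J (HP T' w) (b + b)).
  by apply: Ex_ge0 => // w; apply: tau_ev_ge0.
by apply: ler_pM => //; apply: hbe; rewrite ?T0_sub //; clear - ha; lia.
Qed.

Lemma tau_lo T I n' BN (lo : nat -> 'I_(K + K) -> R) e : good T ->
  (2 * ell)%:R * r / g0 * (n' + n').+1%:R <= 1 / 2 ->
  EB T n' BN -> EB T n'.-1 BN -> 0 <= e -> (forall a J, 0 <= lo a J) ->
  (forall i a J, (a <= n')%N -> lo a J - e <= Ex (fun w => tau J (HP (T0 T i) w) (a + a))) ->
  \sum_J chat T I J * (\sum_(a < n'.+1) (lo a J * lo (n' - a)%N I - e * (lo a J + lo (n' - a)%N I))) - Eerr n' BN <=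
  Ex (fun w => tau I (HP T w) (n'.+1 + n'.+1)).
Proof.
move=> gT small hB hB1 e0 lo0 hlo; have := tau_rec I gT small hB hB1.
rewrite -/(Eerr n' BN) distrC => h; have := le_trans (ler_norm _) h.
rewrite lerBlDl => h1; rewrite lerBlDl addrC; apply: le_trans h1.
rewrite chat_sum; apply: ler_wpM2l; first by rewrite divr_ge0 ?sqr_ge0 ?bsz_ge0.
apply: ler_sum => t _; rewrite mulrDl.
have p0 J b T' : 0 <= Ex (fun w => tau J (HP T' w) (b + b)).
  by apply: Ex_ge0 => // w; apply: tau_ev_ge0.
(* If either target is below the error [e], the left side is nonpositive; otherwise both lower
   bounds can be multiplied. *)
have prod (m m' x y : R) : 0 <= m -> 0 <= m' -> 0 <= x -> 0 <= y -> m - e <= x -> m' - e <= y ->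
   m * m' - e * (m + m') <= x * y.
  move=> mp mp' xp yp hx hy; have [hm|hm] := lerP m e; first by have := mulr_ge0 xp yp; nra.
  have [hm'|hm'] := lerP m' e; first by have := mulr_ge0 xp yp; nra.
  apply: (@le_trans _ _ ((m - e) * (m' - e))); first by nra.
  by apply: ler_pM => //; rewrite subr_ge0 ltW.
have st : \sum_(a < n'.+1) (lo a (Bb t) * lo (n' - a)%N (Ab t) - e * (lo a (Bb t) + lo (n' - a)%N (Ab t))) <= mainE T t n'.
  apply: ler_sum => a _; have ha := ltn_ord a.
  by apply: prod => //; apply: hlo; clear - ha; lia.
apply: lerD.
  case: eqP => [<-|_]; rewrite ?mul0r // !mul1r; exact: st.
case: eqP => [<-|_]; rewrite ?mul0r // !mul1r.
apply: le_trans st; rewrite (reindex_inj rev_ord_inj) /= le_eqVlt; apply/orP; left; apply/eqP.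
apply: eq_bigr => a _; have ha := ltn_ord a; rewrite subSS.
have -> : (n' - (n' - a) = a)%N by clear - ha; lia.
by congr (_ - _ * _); [exact: mulrC|exact: addrC].
Qed.

Lemma g0_pow m : 0 <= g0 ^+ m. Proof. by rewrite exprn_ge0 // ltW. Qed.

Lemma geo_half m : \sum_(k < m) (1 / 2) ^+ k <= 2 :> R.
Proof.
have -> : \sum_(k < m) (1 / 2) ^+ k = 2 - 2 * (1 / 2) ^+ m :> R.
  elim: m => [|m IH]; first by rewrite big_ord0 expr0; ring.
  by rewrite big_ord_recr /= IH exprS; field.
by rewrite gerBl mulr_ge0 // exprn_ge0.
Qed.

Lemma half_mul (a b : R) : 2 * a <= b -> a <= 1 / 2 * b.
Proof. lra. Qed.

Lemma drop2_le (a b c l : R) : 0 <= b -> 0 <= c -> a + b + c <= l -> a <= l.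
Proof. lra. Qed.

(** Feasibility of [y = 1 / xi] multiplied by [y * L], which is the form in which an induction on
    partial sums consumes it. The slack [dl] pays for error terms. *)
Lemma feasible_step (lm L xi y S dl : R) : lm * L = 1 -> xi * y = 1 -> 0 <= y -> 0 <= L ->
  xi + S + dl <= lm -> L + (L * (S * y) + dl * y * L) <= y.
Proof.
move=> lL xy y0 L0 h; have := ler_wpM2r (mulr_ge0 y0 L0) h.
have -> : lm * (y * L) = y * (lm * L) by ring.
have -> : (xi + S + dl) * (y * L) = L * (xi * y) + (L * (S * y) + dl * y * L) by ring.
by rewrite lL xy !mulr1.
Qed.

Section Upper.
Variables (T : {set 'I_n}) (cb : 'I_(K + K) -> 'I_(K + K) -> R) (x : 'I_(K + K) -> R) (lam del : R) (q : nat).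
Hypothesis gT : good T.
Hypothesis hcb : forall I J, chat T I J <= cb I J.
Hypothesis x_gt0 : forall I, 0 < x I.
Hypothesis lam_gt0 : 0 < lam.
Hypothesis hx : forall I, (x I)^-1 + \sum_J cb I J * x J + del <= lam.
Hypothesis hg : 2 * g0 <= lam.
Hypothesis small : (2 * ell)%:R * r / g0 * (q + q).+1%:R <= 1 / 2.
Let Sx := \sum_I x I.
Let L := lam^-1.
Let e1 := 2 * kap * (CE * eps (q + q).+1).
Hypothesis del_ge0 : 0 <= del.
Hypothesis he : forall I, e1 * (6 * L ^+ 3 + 4 * L ^+ 5 + (3 * L ^+ 2 + 2 * L ^+ 4) * Sx) <= del * x I * L.

(** The maximum over all subfamilies turns the recursion into a closed inequality between
    numbers. *)
Let al k (I : 'I_(K + K)) : R := \big[Num.max/0]_(U in powerset T) Ex (fun w => tau I (HP U w) (k + k)).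
Let ap k I := al k I * L ^+ (k + k).+1.

Lemma L_gt0 : 0 < L. Proof. by rewrite invr_gt0. Qed.

Lemma al_ub k I (U : {set 'I_n}) : U \subset T -> Ex (fun w => tau I (HP U w) (k + k)) <= al k I.
Proof. by move=> h; apply: (le_bigmax_cond _ _ (j := U)); rewrite inE. Qed.

Lemma al_le k I c : 0 <= c -> (forall U : {set 'I_n}, U \subset T -> Ex (fun w => tau I (HP U w) (k + k)) <= c) -> al k I <= c.
Proof. by move=> c0 h; apply: bigmax_le => // U; rewrite inE; apply: h. Qed.

Lemma al_ge0 k I : 0 <= al k I.
Proof. exact: bigmax_ge_id. Qed.

Lemma ap_ge0 k I : 0 <= ap k I.
Proof. by rewrite mulr_ge0 ?al_ge0 // exprn_ge0 // ltW // L_gt0. Qed.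

Lemma al_EB m k BN : m = k \/ m = k.-1 -> BN = \sum_J (al k J + al k.-1 J) -> EB T m BN.
Proof.
move=> hm -> U hU; apply: ler_sum => J _; apply: (le_trans (al_ub m J hU)).
by case: hm => ->; rewrite ?lerDl ?lerDr al_ge0.
Qed.

Lemma chat_sub (U : {set 'I_n}) I J : U \subset T -> chat U I J <= chat T I J.
Proof.
move=> h; apply: ler_wpM2l; first by rewrite divr_ge0 ?sqr_ge0 ?bsz_ge0.
rewrite [leRHS](big_setID U) /= (finset.setIidPr h) lerDl; apply: sumr_ge0 => s _.
by rewrite addr_ge0.
Qed.

Lemma al_step k I : (k <= q)%N -> al k.+1 I <=
  \sum_J cb I J * (\sum_(a < k.+1) al a J * al (k - a)%N I) +
  e1 * (g0 ^+ (k + k) + g0 ^+ (k.-1 + k.-1) + \sum_J (al k J + al k.-1 J)).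
Proof.
move=> kq.
have E0 := CE_ge0; have k0 := kap_ge0; have ep0 := eps_ge0.
have G0 : 0 <= g0 ^+ (k + k) + g0 ^+ (k.-1 + k.-1) + \sum_J (al k J + al k.-1 J).
  by rewrite !addr_ge0 ?g0_pow //; apply: sumr_ge0 => J _; rewrite addr_ge0 ?al_ge0.
have S0 J : 0 <= \sum_(a < k.+1) al a J * al (k - a)%N I.
  by apply: sumr_ge0 => a _; rewrite mulr_ge0 ?al_ge0.
have cb0 J : 0 <= cb I J by apply: le_trans (hcb I J); apply: chat_ge0.
apply: al_le.
  rewrite addr_ge0 ?mulr_ge0 //; by apply: sumr_ge0 => J _; rewrite mulr_ge0.
move=> U hU; have gU := good_sub hU gT.
have e0 : 0 <= (2 * ell)%:R * r / g0 by rewrite divr_ge0 ?mulr_ge0 // ltW.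
have sm : (2 * ell)%:R * r / g0 * (k + k).+1%:R <= 1 / 2.
  apply: le_trans small; apply: ler_wpM2l => //; rewrite ler_nat; clear - kq; lia.
have := @tau_up U I k _ al gU sm (EB_sub hU (al_EB (or_introl erefl) erefl))
  (EB_sub hU (al_EB (or_intror erefl) erefl)) _.
move=> h; apply: (le_trans (h _)).
  by move=> T' a J hT' _; apply: al_ub; apply: fintype.subset_trans hU.
apply: lerD.
  by apply: ler_sum => J _; apply: ler_wpM2r => //; apply: le_trans (hcb I J); apply: chat_sub.
rewrite /Eerr /e1 -!mulrA; apply: ler_wpM2l => //; apply: ler_wpM2l => //; apply: ler_wpM2l => //.
apply: ler_wpM2r => //; rewrite /eps.
have hm : (k + k).+1%:R <= (q + q).+1%:R :> R by rewrite ler_nat; clear - kq; lia.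
apply: lerD.
  by apply: ler_wpM2l => //; apply: lerXn2r; rewrite ?nnegrE.
apply: ler_wpM2r; first by rewrite invr_ge0 sqrtr_ge0.
by apply: lerXn2r; rewrite ?nnegrE.
Qed.

Lemma L3 k : L ^+ 3 * (L ^+ k * L ^+ k) = L ^+ (k.+1 + k.+1).+1.
Proof. by rewrite -!exprD; congr (_ ^+ _); clear; lia. Qed.

Lemma apE k I : ap k I = al k I * (L * (L ^+ k * L ^+ k)).
Proof. by rewrite /ap exprS exprD. Qed.

(** As [g0] is at most half of [lam], the floor contributes a summable error. *)
Lemma gL m : g0 ^+ (m + m) * (L ^+ m * L ^+ m) <= (1 / 2) ^+ m.
Proof.
rewrite exprD mulrACA -!exprMn.
have h : g0 * L <= 1 / 2.
  rewrite /L ler_pdivrMr //. exact: half_mul.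
have h0 : 0 <= g0 * L by rewrite mulr_ge0 ?(ltW L_gt0) // ltW.
apply: lerXn2r; [exact: mulr_ge0|by rewrite nnegrE|].
apply: le_trans (ler_pM h0 h0 h h) _.
by rewrite ler_piMl // mul1r invf_le1 // ler1n.
Qed.

Lemma ap_step k I : (k <= q)%N -> ap k.+1 I <=
  L * (\sum_J cb I J * (\sum_(a < k.+1) ap a J * ap (k - a)%N I)) +
  e1 * (L ^+ 3 * (1 / 2) ^+ k + (L ^+ 3 + L ^+ 5) * (2 * (1 / 2) ^+ k) +
     \sum_J (L ^+ 2 * ap k J + (L ^+ 2 + L ^+ 4) * ap k.-1 J)).
Proof.
move=> kq; have l0 := ltW L_gt0; have Lk m : 0 <= L ^+ m by rewrite exprn_ge0.
have e10 : 0 <= e1 by rewrite /e1 !mulr_ge0 ?kap_ge0 ?CE_ge0 ?eps_ge0.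
rewrite {1}/ap -L3; have h := al_step I kq.
have := ler_wpM2r (mulr_ge0 (Lk 3) (mulr_ge0 (Lk k) (Lk k))) h.
move=> h1; apply: (le_trans h1); rewrite mulrDl; apply: lerD.
  rewrite le_eqVlt; apply/orP; left; apply/eqP.
  rewrite mulr_suml mulr_sumr; apply: eq_bigr => J _; rewrite -mulrA [RHS]mulrCA; congr (_ * _).
  rewrite mulr_suml mulr_sumr; apply: eq_bigr => a _; rewrite /ap.
  have E : L ^+ 3 * (L ^+ k * L ^+ k) = L * (L ^+ (a + a).+1 * L ^+ (k - a + (k - a)).+1).
    by rewrite -!exprD -exprS; congr (_ ^+ _); have := ltn_ord a; clear; lia.
  by rewrite E; ring.
rewrite -mulrA; apply: ler_wpM2l => //; rewrite !mulrDl; apply: lerD; first apply: lerD.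
- by rewrite mulrCA; apply: ler_wpM2l => //; apply: gL.
- case: k {kq h h1} => [|k] /=.
    rewrite !expr0 !mulr1 mul1r; have := Lk 3; have := Lk 5; lra.
  rewrite (_ : (1 / 2) ^+ k.+1 = 1 / 2 * (1 / 2) ^+ k); last by rewrite exprS.
  have := gL k; have p := exprn_ge0 k (_ : 0 <= 1 / 2 :> R).
  have -> : g0 ^+ (k + k) * (L ^+ 3 * (L ^+ k.+1 * L ^+ k.+1)) = L ^+ 5 * (g0 ^+ (k + k) * (L ^+ k * L ^+ k)).
    by rewrite !exprS; ring.
  move=> h2; have := ler_wpM2l (Lk 5) h2.
  have : 0 <= L ^+ 3 * (1 / 2) ^+ k by rewrite mulr_ge0 // exprn_ge0.
  have : 0 <= L ^+ 5 * (1 / 2) ^+ k by rewrite mulr_ge0 // exprn_ge0.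
  lra.
- rewrite mulr_suml; apply: ler_sum => J _; rewrite mulrDl; apply: lerD.
    by rewrite apE le_eqVlt; apply/orP; left; apply/eqP; ring.
  case: k {kq h h1} => [|k] /=.
    rewrite apE !expr0 !mulr1 mulrDl; have := mulr_ge0 (Lk 4) (mulr_ge0 (al_ge0 0 J) l0).
    have -> : L ^+ 2 * (al 0 J * L) = al 0 J * L ^+ 3 by ring.
    lra.
  rewrite mulrDl; have := mulr_ge0 (Lk 2) (ap_ge0 k J).
  have -> : L ^+ 4 * ap k J = al k J * (L ^+ 3 * (L ^+ k.+1 * L ^+ k.+1)).
    by rewrite apE [L ^+ k.+1]exprS; ring.
  lra.
Qed.

(** Induction on the length of the partial sum: the convolution is bounded by the product of two
    shorter partial sums, hence by [x I * x J], and feasibility of [x] with slack [del] absorbs the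
    accumulated errors. *)
Lemma sum_ap j : (j <= q)%N -> forall I, \sum_(k < j.+1) ap k I <= x I.
Proof.
have l0 := ltW L_gt0; have Lk m : 0 <= L ^+ m by rewrite exprn_ge0.
have ap0 I : ap 0 I <= L.
  rewrite /ap expr1 -[leRHS]mul1r; apply: ler_wpM2r => //; apply: al_le => // U _.
  rewrite -[leRHS](Ex_cst mu1 1); apply: Ex_le => // w; exact: tau0_le1.
have e10 : 0 <= e1 by rewrite /e1 !mulr_ge0 ?kap_ge0 ?CE_ge0 ?eps_ge0.
have cb0 I J : 0 <= cb I J by apply: le_trans (hcb I J); apply: chat_ge0.
have lamL : lam * L = 1 by rewrite mulfV ?gt_eqF.
have xL I : L <= x I.
  have := hx I; have : 0 <= \sum_J cb I J * x J by apply: sumr_ge0 => J _; rewrite mulr_ge0 // ltW.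
  move=> h1 h2; have : (x I)^-1 <= lam by exact: (drop2_le h1 del_ge0 h2).
  by rewrite -[x I in X in _ -> X]invrK /L lef_pV2 ?posrE ?invr_gt0.
elim: j => [|j IH] jq I; first by rewrite big_ord1; apply: le_trans (xL I); apply: ap0.
have {}IH := IH (ltnW jq).
rewrite big_ord_recl /=.
apply: (@le_trans _ _ (L + \sum_(k < j.+1) (L * (\sum_J cb I J * (\sum_(a < k.+1) ap a J * ap (k - a)%N I)) +
  e1 * (L ^+ 3 * (1 / 2) ^+ k + (L ^+ 3 + L ^+ 5) * (2 * (1 / 2) ^+ k) +
     \sum_J (L ^+ 2 * ap k J + (L ^+ 2 + L ^+ 4) * ap k.-1 J))))).
  apply: lerD; first exact: ap0.
  by apply: ler_sum => k _; apply: ap_step; have := ltn_ord k; clear - jq; lia.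
rewrite big_split /= -!mulr_sumr.
have M1 : \sum_(k < j.+1) \sum_J cb I J * (\sum_(a < k.+1) ap a J * ap (k - a)%N I) <= (\sum_J cb I J * x J) * x I.
  rewrite exchange_big /= mulr_suml; apply: ler_sum => J _; rewrite -mulr_sumr -mulrA; apply: ler_wpM2l => //.
  apply: (le_trans (cauchy_le _ (fun k => ap_ge0 k J) (fun k => ap_ge0 k I))).
  by apply: ler_pM => //; apply: sumr_ge0 => k _; apply: ap_ge0.
(* The truncated predecessor counts the term of index 0 twice, hence the 2. *)
have sP J : \sum_(k < j.+1) ap k.-1 J <= 2 * x J.
  rewrite big_ord_recl /=; have -> : 2 * x J = x J + x J by ring.
  apply: lerD; first by apply: le_trans (xL J); apply: ap0.
  apply: le_trans (IH J); rewrite [leRHS]big_ord_recr /= lerDl; exact: ap_ge0.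
(* The geometric sums are at most 2, giving [2 + 4] copies of [L ^+ 3] and 4 of [L ^+ 5]; [sP] gives
   the 3 and the 2 in front of [Sx]. *)
have M2 : \sum_(k < j.+1) (L ^+ 3 * (1 / 2) ^+ k + (L ^+ 3 + L ^+ 5) * (2 * (1 / 2) ^+ k) +
     \sum_J (L ^+ 2 * ap k J + (L ^+ 2 + L ^+ 4) * ap k.-1 J)) <=
    6 * L ^+ 3 + 4 * L ^+ 5 + (3 * L ^+ 2 + 2 * L ^+ 4) * Sx.
  rewrite !big_split /= -!mulr_sumr.
  have G := geo_half j.+1.
  have h : \sum_(k < j.+1) \sum_J (L ^+ 2 * ap k J + (L ^+ 2 + L ^+ 4) * ap k.-1 J) <= (3 * L ^+ 2 + 2 * L ^+ 4) * Sx.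
    rewrite exchange_big /= /Sx mulr_sumr; apply: ler_sum => J _; rewrite big_split /= -!mulr_sumr.
    have -> : (3 * L ^+ 2 + 2 * L ^+ 4) * x J = L ^+ 2 * x J + (L ^+ 2 + L ^+ 4) * (2 * x J) by ring.
    by apply: lerD; apply: ler_wpM2l => //; rewrite addr_ge0.
  have := ler_wpM2l (Lk 3) G; have := ler_wpM2l (addr_ge0 (Lk 3) (Lk 5)) G.
  move=> h2 h3; apply: le_trans (lerD (lerD h3 (_ : _ <= (L ^+ 3 + L ^+ 5) * (2 * 2))) h) _.
    by rewrite mulrCA [leRHS]mulrCA; apply: ler_wpM2l.
  by rewrite le_eqVlt; apply/orP; left; apply/eqP; ring.
have T1 := ler_wpM2l l0 M1; have T2 := ler_wpM2l e10 M2.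
apply: le_trans (lerD (lexx L) (lerD T1 T2)) _.
apply: le_trans (lerD (lexx L) (lerD (lexx _) (he I))) _.
have xi : (x I)^-1 * x I = 1 by rewrite mulVf ?gt_eqF.
exact: (feasible_step lamL xi (ltW (x_gt0 I)) l0 (hx I)).
Qed.

Lemma U_bound k I (U : {set 'I_n}) : (k <= q)%N -> U \subset T ->
  Ex (fun w => tau I (HP U w) (k + k)) <= x I * lam ^+ (k + k).+1.
Proof.
move=> kq hU; apply: (le_trans (al_ub k I hU)).
have -> : al k I = ap k I * lam ^+ (k + k).+1.
  by rewrite /ap -mulrA -exprMn mulVf ?gt_eqF // expr1n mulr1.
apply: ler_wpM2r; first by rewrite exprn_ge0 // ltW.
apply: le_trans (sum_ap kq I); rewrite big_ord_recr /= lerDr; apply: sumr_ge0 => a _; exact: ap_ge0.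
Qed.
Lemma sum_tau (U : {set 'I_n}) J m : U \subset T -> (m <= (q + q).+1)%N ->
  \sum_(a < m) Ex (fun w => tau J (HP U w) a) * L ^+ a.+1 <= x J.
Proof.
move=> hU hm; have Lk k : 0 <= L ^+ k by rewrite exprn_ge0 // ltW // L_gt0.
have od k : odd k -> Ex (fun w => tau J (HP U w) k) = 0.
  by move=> ok; rewrite -(Ex_cst mu1 0); apply: eq_Ex => w; rewrite tau_odd.
pose F k := Ex (fun w => tau J (HP U w) k) * L ^+ k.+1.
have F0 k : 0 <= F k.
  rewrite /F; apply: mulr_ge0; last exact: Lk.
  case: (boolP (odd k)) => [ho|he1]; first by rewrite od.
  rewrite -(odd_double_half k) (negbTE he1) add0n -addnn; apply: Ex_ge0 => // w; exact: tau_ev_ge0.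
apply: (le_trans (sum_ord_mono hm F0)).
rewrite (@sum_even F) => [|k /od h]; last by rewrite /F h mul0r.
apply: le_trans (sum_ap (leqnn q) J); apply: ler_sum => a _.
by apply: ler_wpM2r; [exact: Lk|exact: al_ub].
Qed.
End Upper.
Lemma nrm_wE l : nrm (wvec l) ^+ 2 = 1 - (bsz (blk l))^-1.
Proof.
rewrite nrm_sqr dot_w // [in X in _ - X]dotC dot_wu // subr0 wvecE !eqxx.
by rewrite mul1r.
Qed.

Lemma Ex_tau0_ge I T : 1 - kap / d%:R <= Ex (fun w => tau I (HP T w) (0 + 0)).
Proof.
rewrite -(Ex_cst mu1 (1 - kap / d%:R)); apply: Ex_le => // w; rewrite tau0.
rewrite -[leLHS](avg_cst bsz_gt0 I); apply: avg_le => l _; rewrite nrm_wE.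
by rewrite lerD2l lerN2 bszV_le.
Qed.

Lemma card_T0 (T T' : {set 'I_n}) i : good T' -> (#|T :\: T0 T' i| <= #|T :\: T'| + ell)%N.
Proof.
move=> gT'; apply: leq_trans (_ : #|(T :\: T') :|: Tb T' i| <= _)%N.
  apply: subset_leq_card; apply/fintype.subsetP => s; rewrite !inE.
  by case: (s \in T'); case: (s \in T); case: (g s == i).
rewrite cardsU; apply: (leq_trans (leq_subr _ _)); rewrite leq_add2l; exact: card_Tb.
Qed.

Lemma chat_sum1 T I : \sum_J chat T I J <= 2 * kap.
Proof.
have := chat_sum T I (fun _ => 1); under eq_bigr => J _ do rewrite mulr1.
move=> ->; have h0 : 0 <= r ^+ 2 / bsz I by rewrite divr_ge0 ?sqr_ge0 ?bsz_ge0.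
apply: (@le_trans _ _ (r ^+ 2 / bsz I * (#|T|%:R * 2))).
  apply: ler_wpM2l => //; apply: (@le_trans _ _ (\sum_(t in T) 2)).
    apply: ler_sum => t _; rewrite !mulr1; apply: (@le_trans _ _ (1 + 1)); last by lra.
    by apply: lerD; rewrite lern1 leq_b1.
  by rewrite sumr_const mulr_natl.
by rewrite mulrA mulrC; apply: ler_wpM2l => //; apply: r2n_le.
Qed.

Section Lower.
Variables (T : {set 'I_n}) (cl : 'I_(K + K) -> 'I_(K + K) -> R) (kmax : nat) (BN Mm del : R).
Hypothesis gT : good T.
Hypothesis cl_ge0 : forall I J, 0 <= cl I J.
Hypothesis hcl : forall (T' : {set 'I_n}) I J, T' \subset T -> (#|T :\: T'| <= ell * kmax)%N -> cl I J <= chat T' I J.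
Hypothesis hEB : forall k, (k <= kmax)%N -> EB T k BN.
Hypothesis small : (2 * ell)%:R * r / g0 * (kmax + kmax).+1%:R <= 1 / 2.
Hypothesis Mm_ge0 : 0 <= Mm.
Hypothesis hMm : forall k I, (k <= kmax)%N -> ms cl k I <= Mm.
Hypothesis hdel0 : kap / d%:R <= del.
Hypothesis hdel : forall k, (k < kmax)%N -> Eerr k BN <= del.
Let A := 1 + 4 * kap * kmax%:R * Mm.

Lemma lo_A_ge1 : 1 <= A.
Proof. by rewrite lerDl !mulr_ge0 ?kap_ge0. Qed.

Lemma lo_del0 : 0 <= del.
Proof. by apply: le_trans hdel0; rewrite divr_ge0 ?kap_ge0. Qed.

Lemma lo_arith (S chS kk e A1 dl : R) : 0 <= chS -> chS <= 2 * kap -> 0 <= kk -> kk <= kmax%:R ->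
  S <= chS * (kk * (e * (Mm + Mm))) -> 0 <= dl -> e = A1 * dl -> 1 <= A1 ->
  S + dl <= (A * A1) * dl.
Proof.
move=> c0 c1 k0 k1 hS d0 eE hA; rewrite {}eE in hS.
have d1 : dl <= A1 * dl by rewrite ler_peMl.
have h2 : chS * (kk * (A1 * dl * (Mm + Mm))) <= 2 * kap * (kmax%:R * (A1 * dl * (Mm + Mm))).
  have x0 : 0 <= A1 * dl * (Mm + Mm) by rewrite !mulr_ge0 ?addr_ge0 // (le_trans ler01).
  by apply: ler_pM => //; [rewrite mulr_ge0|apply: ler_wpM2r].
have -> : A * A1 * dl = 2 * kap * (kmax%:R * (A1 * dl * (Mm + Mm))) + A1 * dl by rewrite /A; ring.
by apply: lerD => //; apply: le_trans h2.
Qed.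

(** Each step of the recursion deletes one more block, at most [ell] transitions. So the statement
    for [k] allows for the [kmax - k] deletions that may already have been made, and [cl] must bound
    the coefficients after all of them. *)
Lemma lower_tau k : (k <= kmax)%N -> forall (T' : {set 'I_n}) I, T' \subset T ->
  (#|T :\: T'| <= ell * (kmax - k))%N ->
  ms cl k I - A ^+ k * del <= Ex (fun w => tau I (HP T' w) (k + k)).
Proof.
have A1 := lo_A_ge1; have d0 := lo_del0.
have Ak m : 1 <= A ^+ m by apply: exprn_ege1.
move: k; apply: (ms_ind cl) => [_ T' I hT' _|k IH hk T' I hT' hc].
  by rewrite ms0 expr0 mul1r; apply: le_trans (Ex_tau0_ge I T'); rewrite lerD2l lerN2.
have gT' := good_sub hT' gT.
have e0 : 0 <= (2 * ell)%:R * r / g0 by rewrite divr_ge0 ?mulr_ge0 // ltW.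
have sm : (2 * ell)%:R * r / g0 * (k + k).+1%:R <= 1 / 2.
  apply: le_trans small; apply: ler_wpM2l => //; rewrite ler_nat; clear - hk; lia.
have b1 : EB T' k BN by apply: (EB_sub hT'); apply: hEB; clear - hk; lia.
have b2 : EB T' k.-1 BN by apply: (EB_sub hT'); apply: hEB; clear - hk; lia.
have ek : 0 <= A ^+ k * del by rewrite mulr_ge0 // (le_trans ler01).
have m0 := ms_ge0 cl_ge0.
have hlo i a J : (a <= k)%N -> ms cl a J - A ^+ k * del <= Ex (fun w => tau J (HP (T0 T' i) w) (a + a)).
  move=> ak; apply: (@le_trans _ _ (ms cl a J - A ^+ a * del)).
    by rewrite lerD2l lerN2; apply: ler_wpM2r => //; apply: ler_weXn2l.
  apply: IH => //; first by clear - ak hk; lia.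
    exact: fintype.subset_trans (T0_sub _ _) hT'.
  apply: (leq_trans (card_T0 T i gT')); apply: (@leq_trans (ell * (kmax - k.+1) + ell)); first by rewrite leq_add2r.
  by rewrite -mulnSr leq_mul2l; apply/orP; right; clear - ak hk; lia.
have := tau_lo I gT' sm b1 b2 ek m0 hlo => h; apply: le_trans h.
rewrite msS.
pose P J := \sum_(a < k.+1) ms cl a J * ms cl (k - a) I.
pose Q J := \sum_(a < k.+1) A ^+ k * del * (ms cl a J + ms cl (k - a) I).
have -> : \sum_J chat T' I J * (\sum_(a < k.+1) (ms cl a J * ms cl (k - a) I - A ^+ k * del * (ms cl a J + ms cl (k - a) I)))
  = \sum_J chat T' I J * P J - \sum_J chat T' I J * Q J.
  by rewrite -sumrB; apply: eq_bigr => J _; rewrite -mulrBr /P /Q -sumrB.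
have h1 : \sum_J cl I J * P J <= \sum_J chat T' I J * P J.
  apply: ler_sum => J _; apply: ler_wpM2r; first by apply: sumr_ge0 => a _; rewrite mulr_ge0.
  apply: hcl => //; apply: (leq_trans hc); rewrite leq_mul2l; apply/orP; right; exact: leq_subr.
have h2 : \sum_J chat T' I J * Q J + del <= (A * A ^+ k) * del.
  apply: (@lo_arith _ (\sum_J chat T' I J) k.+1%:R (A ^+ k * del)) => //.
  - by apply: sumr_ge0 => J _; apply: chat_ge0.
  - exact: chat_sum1.
  - by rewrite ler_nat.
  - rewrite mulr_suml; apply: ler_sum => J _; apply: ler_wpM2l; first exact: chat_ge0.
    rewrite -sum_ord_cst; apply: ler_sum => a _; apply: ler_wpM2l => //.
    by have := ltn_ord a; rewrite ltnS => ak; apply: lerD; apply: hMm; clear - ak hk; lia.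
have h3 := hdel hk; rewrite exprS; rewrite -/(Eerr k BN) in h3 *.
have h4 : \sum_J cl I J * P J <= \sum_J chat T' I J * P J + (A * A ^+ k * del - (\sum_J chat T' I J * Q J + del)).
  by rewrite -[leLHS]addr0 lerD // subr_ge0.
rewrite lerBlDr; apply: (le_trans h4); rewrite -subr_ge0.
set a1 := \sum_J _; set a2 := \sum_J _; set a3 := A * _ * _.
have -> : a1 - a2 - Eerr k BN + a3 - (a1 + (a3 - (a2 + del))) = del - Eerr k BN by ring.
by rewrite subr_ge0.
Qed.
End Lower.

Lemma cheb_lo (f : Om -> R) (y eta V : R) : 0 < eta -> y <= Ex f -> 
  Ex (fun w => f w * f w) - Ex f * Ex f <= V -> 
  Pr (fun w => f w < y - eta) <= V / eta ^+ 2.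
Proof.
move=> e0 hy hV; have e2 : 0 < eta ^+ 2 by apply: exprn_gt0.
rewrite ler_pdivlMr //; apply: le_trans hV.
have -> : Ex (fun w => f w * f w) - Ex f * Ex f = Ex (fun w => (f w * f w + (- (2 * Ex f)) * f w) + Ex f * Ex f).
  have E m : Ex (fun w => f w * f w + (- (2 * m)) * f w + m * m) = Ex (fun w => f w * f w) + (- (2 * m)) * Ex f + m * m.
    by rewrite ExD ExD ExZ Ex_cst.
  by rewrite E; ring.
apply: (@le_trans _ _ (Ex (fun w => (f w < y - eta)%R%:R * eta ^+ 2))); first by rewrite ExZr.
apply: Ex_le => // w; set m := Ex f in hy *.
have -> : f w * f w + - (2 * m) * f w + m * m = (f w - m) ^+ 2 by ring.
case: ltP => h; last by rewrite mul0r sqr_ge0.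
have h2 : eta <= m - f w by lra.
by rewrite mul1r -[leRHS]sqrrN opprB ler_sqr ?nnegrE ?(ltW e0) // (le_trans (ltW e0)).
Qed.

Lemma tau_opn I T w k : tau I (HP T w) (k + k) <= opnorm (HP T w) ^+ (k + k).
Proof.
rewrite tau_ev -[leRHS](avg_cst bsz_gt0 I); apply: avg_le => l _.
rewrite exprD -expr2 ler_sqr ?nnegrE ?nrm_ge0 ?exprn_ge0 ?opnorm_ge0 //.
by apply: nrm_pw1; rewrite ?nrm_w.
Qed.

(** The block average is at most the power of the norm and concentrates, by the covariance bound
    with both functions equal and Chebyshev. *)
Lemma opn_lower T I k BN (y eta : R) : good T -> (2 * ell)%:R * r / g0 * (k + k + (k + k)).+1%:R <= 1 / 2 ->
  EB T (k + k).-1 BN -> 0 < eta -> y <= Ex (fun w => tau I (HP T w) (k + k)) ->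
  Pr (fun w => opnorm (HP T w) ^+ (k + k) < y - eta) <=
  Ccov * ((k + k)%:R * (k + k)%:R) / Num.sqrt d%:R * (g0 ^+ ((k + k).-1 + (k + k).-1) + BN) / eta ^+ 2.
Proof.
move=> gT sm hB e0 hy; have hV := cov_U' I I gT sm hB.
have := cheb_lo e0 hy (le_trans (ler_norm _) hV).
apply: le_trans; apply: Pr_sub => // w; apply: le_lt_trans; exact: tau_opn.
Qed.

(** * The conditionally centred matrix with the block-mean directions included *)

Definition Ym (s : 'I_n) (w : Om) : 'M[R]_(d + d) :=
  av s w *m (bv s w)^T + bv s w *m (av s w)^T +
  (av s w *m (uvec (Bb s))^T + uvec (Bb s) *m (av s w)^T) +
  (bv s w *m (uvec (Ab s))^T + uvec (Ab s) *m (bv s w)^T).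
(* When the states are compatible with the clusters, w_a + u_A = e_a, and this is r times
   the hermitization of the part of N - E(N | clusters) coming from T. *)
Definition HF (T : {set 'I_n}) (w : Om) : 'M[R]_(d + d) := r *: \sum_(s in T) Ym s w.
(** A transition splits by direction: [Wx] acts within the centred vectors, [Cx] sends block means
    to centred vectors, and [Ux] sends centred vectors back to block means. *)
Definition Wx (s : 'I_n) (w : Om) x := dot (bv s w) x *: av s w + dot (av s w) x *: bv s w.
Definition Cx (s : 'I_n) (w : Om) x := dot (uvec (Bb s)) x *: av s w + dot (uvec (Ab s)) x *: bv s w.
Definition Ux (s : 'I_n) (w : Om) x := dot (av s w) x *: uvec (Bb s) + dot (bv s w) x *: uvec (Ab s).

Lemma outer_mul (x y z : 'cV[R]_(d + d)) : x *m y^T *m z = dot y z *: x.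
Proof.
rewrite -mulmxA (_ : y^T *m z = (dot y z)%:M) ?mul_mx_scalar //.
rewrite [LHS]mx11_scalar; congr (_%:M); rewrite mxE; apply: eq_bigr => i _; by rewrite mxE.
Qed.

Lemma YmE s w x : Ym s w *m x = Wx s w x + Cx s w x + Ux s w x.
Proof.
have rearr (p1 p2 p3 p4 p5 p6 : 'cV[R]_(d + d)) : p1 + p2 + (p3 + p4) + (p5 + p6) = p1 + p2 + (p3 + p5) + (p4 + p6).
  by rewrite -addrA (addrACA p3) addrA.
by rewrite /Ym 5!mulmxDl 6!outer_mul rearr.
Qed.

Lemma HFx T w x : HF T w *m x = r *: \sum_(s in T) (Wx s w x + Cx s w x + Ux s w x).
Proof. by rewrite /HF -scalemxAl mulmx_suml; congr (_ *: _); apply: eq_bigr => s _; exact: YmE. Qed.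

Lemma HF_sym T w : (HF T w)^T = HF T w.
Proof.
rewrite /HF linearZ /= linear_sum /=; congr (_ *: _); apply: eq_bigr => s _.
have T1 (x y : 'cV[R]_(d + d)) : (x *m y^T + y *m x^T)^T = x *m y^T + y *m x^T.
  by rewrite linearD /= !trmx_mul !trmxK addrC.
have T2 (A B C : 'M[R]_(d + d)) : (A + B + C)^T = A^T + B^T + C^T by rewrite !linearD.
by rewrite /Ym T2 !T1.
Qed.

Lemma HF_agree (T : {set 'I_n}) (w w' : Om) : (forall s, s \in T -> w s = w' s /\ w (nx s) = w' (nx s)) -> HF T w = HF T w'.
Proof.
move=> h; congr (_ *: _); apply: eq_bigr => s /h[h1 h2].
by rewrite /Ym /av /bv h1 h2.
Qed.

Lemma HF_T0_mix T i w w' : good T -> HF (T0 T i) (mix (inblk g i) w w') = HF (T0 T i) w.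
Proof.
move=> [hT _]; apply: HF_agree => s; rewrite inE => /andP[sT gs].
have [_ gn] := hT s sT; rewrite !ffunE /inblk gn (negbTE gs); by split.
Qed.

Lemma HF_Tb_mix T i w w' : good T -> HF (Tb T i) (mix (inblk g i) w w') = HF (Tb T i) w'.
Proof.
move=> [hT _]; apply: HF_agree => s; rewrite inE => /andP[sT gs].
have [_ gn] := hT s sT; rewrite !ffunE /inblk gn gs; by split.
Qed.

Lemma HF_split T i w : HF T w - HF (T0 T i) w = HF (Tb T i) w.
Proof.
rewrite /HF -scalerBr; congr (_ *: _).
rewrite (bigID (fun s => g s == i)) /=.
rewrite (eq_bigl (fun s => s \in Tb T i)) => [|s]; last by rewrite inE.
rewrite [X in _ + X - _](eq_bigl (fun s => s \in T0 T i)) => [|s]; last by rewrite inE.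
by rewrite addrK.
Qed.

Lemma HF_sum T w : HF T w = \sum_(i < n) (HF T w - HF (T0 T i) w).
Proof.
under eq_bigr => i _ do rewrite HF_split.
rewrite /HF -scaler_sumr; congr (_ *: _).
rewrite (partition_big (fun s => Ordinal (g_lt s)) predT) //=; apply: eq_bigr => i _.
by apply: eq_bigl => s; rewrite inE -(inj_eq val_inj).
Qed.

Lemma Ex_zero (t : 'I_n) (f : 'I_d -> 'I_(d + d)) (F : Om -> 'cV[R]_(d + d)) : f = @lshift d d \/ f = @rshift d d ->
  (forall w v, F (upd w t v) = F w) -> Ex (fun w => dot (wvec (f (w t))) (F w)) = 0.
Proof.
move=> hf hF; rewrite (@Ex_G1 _ t (fun v y => dot (wvec (f v)) y) F) //.
rewrite -[RHS](Ex_cst mu1 0); apply: eq_Ex => w.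
case: hf => ->.
  by rewrite (cond_law_avgl t (fun l => dot (wvec l) _)) avg_w.
by rewrite (cond_law_avgr t (fun l => dot (wvec l) _)) avg_w.
Qed.

Lemma av_updN s t w v : s != t -> av s (upd w t v) = av s w.
Proof. by move=> h; rewrite /av /upd ffunE (negbTE h). Qed.
Lemma bv_updN s t w v : nx s != t -> bv s (upd w t v) = bv s w.
Proof. by move=> h; rewrite /bv /upd ffunE (negbTE h). Qed.

Lemma Ex_av0 s (F : Om -> 'cV[R]_(d + d)) : (forall w v, F (upd w s v) = F w) -> Ex (fun w => dot (av s w) (F w)) = 0.
Proof. by move=> h; apply: (Ex_zero (f := @lshift d d)) => //; left. Qed.
Lemma Ex_bv0 s (F : Om -> 'cV[R]_(d + d)) : (forall w v, F (upd w (nx s) v) = F w) -> Ex (fun w => dot (bv s w) (F w)) = 0.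
Proof. by move=> h; apply: (Ex_zero (f := @rshift d d)) => //; right. Qed.

Lemma HF_mean s x y : nx s != s -> Ex (fun w => dot x (Ym s w *m y)) = 0.
Proof.
move=> ns; have sn : s != nx s by rewrite eq_sym.
have E w : dot x (Ym s w *m y) = dot (av s w) ((dot (bv s w) y) *: x + (dot (bv s w) x) *: y)
  + (dot (av s w) (dot (uvec (Bb s)) y *: x + dot (uvec (Bb s)) x *: y)
  + dot (bv s w) (dot (uvec (Ab s)) y *: x + dot (uvec (Ab s)) x *: y)).
  rewrite YmE /Wx /Cx /Ux; move: (av s w) (bv s w) (uvec (Ab s)) (uvec (Bb s)) => a b ua ub.
  by rewrite !dotDr !dotZr !(dotC x); ring.
rewrite (eq_Ex mu E) ExD ExD Ex_av0 ?Ex_av0 ?Ex_bv0 ?addr0 // => w v.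
by rewrite bv_updN.
Qed.

(** The 40 is the 10 of [sq4] times its four squares, each with mean at most [kap / d] on unit
    vectors. *)
Definition vS : R := 40 * (ell%:R ^+ 2 * kap * r ^+ 2) / d%:R.

Lemma nrm_u_sq I : nrm (uvec I) ^+ 2 <= kap / d%:R.
Proof. by rewrite nrm_u // bszV_le. Qed.

Lemma bsz_ge1' I : 1 <= bsz I.
Proof.
have : 0 < bsz I by []. rewrite /bsz; case: fintype.split => k; rewrite ler1n ltr0n //.
Qed.

Lemma nrm_u_le1 I : nrm (uvec I) <= 1.
Proof.
by apply: le_sqr2 => //; rewrite nrm_u // expr1n invf_le1 // bsz_ge1'.
Qed.

Lemma avg_wsq I x : avg I (fun l => dot (wvec l) x ^+ 2) <= kap / d%:R * nrm x ^+ 2.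
Proof.
rewrite /avg mulrC; apply: ler_pM; rewrite ?invr_ge0 ?bsz_ge0 ?bszV_le //.
  by apply: sumr_ge0 => l _; apply: sqr_ge0.
apply: le_trans (sum_w_sqr bsz_gt0 x); rewrite [leRHS](bigID (fun l => blk l == I)) /= lerDl.
by apply: sumr_ge0 => l _; apply: sqr_ge0.
Qed.

Lemma Ex_avsq s x : Ex (fun w => dot (av s w) x ^+ 2) <= kap / d%:R * nrm x ^+ 2.
Proof.
rewrite (@Ex_G1 _ s (fun v y => dot (wvec (lshift d v)) y ^+ 2) (fun=> x)) //.
rewrite -[leRHS](Ex_cst mu1); apply: Ex_le => // w.
by rewrite (cond_law_avgl s (fun l => dot (wvec l) x ^+ 2)) avg_wsq.
Qed.
Lemma Ex_bvsq s x : Ex (fun w => dot (bv s w) x ^+ 2) <= kap / d%:R * nrm x ^+ 2.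
Proof.
rewrite (@Ex_G1 _ (nx s) (fun v y => dot (wvec (rshift d v)) y ^+ 2) (fun=> x)) //.
rewrite -[leRHS](Ex_cst mu1); apply: Ex_le => // w.
by rewrite (cond_law_avgr (nx s) (fun l => dot (wvec l) x ^+ 2)) avg_wsq.
Qed.

Lemma usq I x : dot (uvec I) x ^+ 2 <= kap / d%:R * nrm x ^+ 2.
Proof.
apply: (le_trans (dot_sqr_le _ _)); rewrite -!nrm_sqr; apply: ler_wpM2r; first exact: sqr_ge0.
exact: nrm_u_sq.
Qed.

Lemma nrm2Z (a b : R) (p q : 'cV[R]_(d + d)) c : nrm p <= c -> nrm q <= c -> nrm (a *: p + b *: q) <= c * (`|a| + `|b|).
Proof.
move=> hp hq; apply: (le_trans (nrmD _ _)); rewrite !nrmZ mulrDr !(mulrC c).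
by apply: lerD; apply: ler_wpM2l.
Qed.

Lemma nrm_Ym s w x : nrm (Ym s w *m x) <=
  2 * (`|dot (bv s w) x| + `|dot (av s w) x|) + (`|dot (uvec (Bb s)) x| + `|dot (uvec (Ab s)) x|).
Proof.
rewrite YmE; apply: (le_trans (nrmD _ _)).
have h1 := nrm2Z (dot (bv s w) x) (dot (av s w) x) (nrm_av s w) (nrm_bv s w).
have h2 := nrm2Z (dot (uvec (Bb s)) x) (dot (uvec (Ab s)) x) (nrm_av s w) (nrm_bv s w).
have h3 := nrm2Z (dot (av s w) x) (dot (bv s w) x) (nrm_u_le1 (Bb s)) (nrm_u_le1 (Ab s)).
have h4 := nrmD (Wx s w x) (Cx s w x); rewrite !mul1r in h1 h2 h3.
rewrite -/(Wx s w x) in h1; rewrite -/(Cx s w x) in h2; rewrite -/(Ux s w x) in h3.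
have := lerD (le_trans h4 (lerD h1 h2)) h3 => h; apply: (le_trans h).
set p := `|_|; set q := `|_|; set p' := `|_|; set q' := `|_|; lra.
Qed.

Lemma sq4 (a b c e : R) : (2 * (a + b) + (c + e)) ^+ 2 <= 10 * (a ^+ 2 + b ^+ 2 + c ^+ 2 + e ^+ 2).
Proof.
have := sqr_ge0 (a - b); have := sqr_ge0 (a - 2 * c); have := sqr_ge0 (a - 2 * e);
have := sqr_ge0 (b - 2 * c); have := sqr_ge0 (b - 2 * e); have := sqr_ge0 (c - e); rewrite !expr2; lra.
Qed.

Lemma Ex_Ym2 s x : Ex (fun w => nrm (Ym s w *m x) ^+ 2) <= 40 * (kap / d%:R) * nrm x ^+ 2.
Proof.
apply: (@le_trans _ _ (Ex (fun w => 10 * (dot (bv s w) x ^+ 2 + dot (av s w) x ^+ 2 + dot (uvec (Bb s)) x ^+ 2 + dot (uvec (Ab s)) x ^+ 2)))).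
  apply: Ex_le => // w.
  apply: (@le_trans _ _ ((2 * (`|dot (bv s w) x| + `|dot (av s w) x|) + (`|dot (uvec (Bb s)) x| + `|dot (uvec (Ab s)) x|)) ^+ 2)).
    apply: lerXn2r; rewrite ?nnegrE ?nrm_ge0 ?nrm_Ym //.
  apply: (le_trans (sq4 _ _ _ _)); by rewrite !real_normK // num_real.
rewrite ExZ !ExD !Ex_cst //.
have := Ex_bvsq s x; have := Ex_avsq s x; have := usq (Bb s) x; have := usq (Ab s) x.
set p := Ex _; set q := Ex _; set p' := _ ^+ 2; set q' := _ ^+ 2; set c := kap / _ * _ => h1 h2 h3 h4.
rewrite -mulrA -/c; lra.
Qed.

Lemma nrm_sumsq (A : {set 'I_n}) (F : 'I_n -> 'cV[R]_(d + d)) : (#|A| <= ell)%N ->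
  nrm (\sum_(s in A) F s) ^+ 2 <= ell%:R * \sum_(s in A) nrm (F s) ^+ 2.
Proof.
move=> hA; apply: (@le_trans _ _ ((\sum_(s in A) 1 * nrm (F s)) ^+ 2)).
  apply: lerXn2r; rewrite ?nnegrE ?nrm_ge0 //; first by apply: sumr_ge0 => s _; rewrite mul1r nrm_ge0.
  by apply: (le_trans (nrm_sum _ _ _)); apply: ler_sum => s _; rewrite mul1r.
apply: (le_trans (sum_CS _ _ _)); apply: ler_wpM2r; first by apply: sumr_ge0 => s _; apply: sqr_ge0.
rewrite expr1n sumr_const; by rewrite ler_nat.
Qed.

Lemma Ex_Sb2 (T : {set 'I_n}) i (F : 'I_n -> Om -> 'cV[R]_(d + d)) c : good T -> 0 <= c ->
  (forall s, s \in Tb T i -> Ex (fun w => nrm (F s w) ^+ 2) <= c) ->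
  Ex (fun w => nrm (r *: \sum_(s in Tb T i) F s w) ^+ 2) <= ell%:R ^+ 2 * r ^+ 2 * c.
Proof.
move=> gT c0 hF.
apply: (@le_trans _ _ (Ex (fun w => r ^+ 2 * (ell%:R * \sum_(s in Tb T i) nrm (F s w) ^+ 2)))).
  apply: Ex_le => // w; rewrite nrmZ ger0_norm // exprMn; apply: ler_wpM2l; first exact: sqr_ge0.
  exact: nrm_sumsq (card_Tb i gT).
rewrite ExZ ExZ Ex_sum.
have -> : ell%:R ^+ 2 * r ^+ 2 * c = r ^+ 2 * (ell%:R * (ell%:R * c)) by ring.
apply: ler_wpM2l; first exact: sqr_ge0.
apply: ler_wpM2l => //; apply: (@le_trans _ _ (\sum_(s in Tb T i) c)); first exact: ler_sum.
exact: (sum_cst_le c0 (card_Tb i gT)).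
Qed.

Lemma HFb_x T i w (x : 'cV[R]_(d + d)) : HF (Tb T i) w *m x = r *: \sum_(s in Tb T i) (Ym s w *m x).
Proof. by rewrite /HF -scalemxAl mulmx_suml. Qed.

Lemma HFb_var T i x : good T -> Ex (fun w => nrm (HF (Tb T i) w *m x) ^+ 2) <= vS * nrm x ^+ 2.
Proof.
move=> gT; have -> : (fun w => nrm (HF (Tb T i) w *m x) ^+ 2) = (fun w => nrm (r *: \sum_(s in Tb T i) (Ym s w *m x)) ^+ 2).
  by apply/funext => w; rewrite HFb_x.
have k0 := kap_ge0.
have c0 : 0 <= 40 * (kap / d%:R) * nrm x ^+ 2 by apply: mulr_ge0; [apply: mulr_ge0 => //; apply: divr_ge0|exact: sqr_ge0].
have := @Ex_Sb2 T i (fun s w => Ym s w *m x) _ gT c0 (fun s _ => Ex_Ym2 s x).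
by have -> : ell%:R ^+ 2 * r ^+ 2 * (40 * (kap / d%:R) * nrm x ^+ 2) = vS * nrm x ^+ 2 by rewrite /vS; ring.
Qed.

Lemma HFb_mean T i x y : good T -> Ex (fun w => dot x (HF (Tb T i) w *m y)) = 0.
Proof.
move=> gT; have E w : dot x (HF (Tb T i) w *m y) = r * \sum_(s in Tb T i) dot x (Ym s w *m y).
  by rewrite HFb_x dotZr dot_sumr.
rewrite (eq_Ex mu E) ExZ Ex_sum big1 ?mulr0 // => s; rewrite inE => /andP[sT _].
by apply: HF_mean; apply: nx_neq gT sT.
Qed.

Definition sS : R := 6 * ell%:R * r.

Lemma HFb_le T i w : good T -> opnorm (HF (Tb T i) w) <= sS.
Proof.
move=> gT; apply: opnorm_le => x hx; rewrite HFb_x nrmZ ger0_norm //.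
have -> : sS = r * (ell%:R * 6) by rewrite /sS; ring.
apply: ler_wpM2l => //; apply: (le_trans (nrm_sum _ _ _)).
apply: (@le_trans _ _ (\sum_(s in Tb T i) 6)); last first.
  have h6 : 0 <= 6 :> R by [].
  exact: (sum_cst_le h6 (card_Tb i gT)).
apply: ler_sum => s _; apply: (le_trans (nrm_Ym _ _ _)).
have h1 := dot_le1 (nrm_bv s w) hx; have h2 := dot_le1 (nrm_av s w) hx.
have h3 := dot_le1 (nrm_u_le1 (Bb s)) hx; have h4 := dot_le1 (nrm_u_le1 (Ab s)) hx.
rewrite !mul1r in h1 h2 h3 h4.
move: h1 h2 h3 h4; set p := `|_|; set q := `|_|; set p' := `|_|; set q' := `|_|; lra.
Qed.

Lemma vS_ge0 : 0 <= vS.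
Proof. by rewrite /vS !mulr_ge0 ?invr_ge0 ?sqr_ge0 ?kap_ge0. Qed.

Lemma nvS : n%:R * vS <= 40 * (ell%:R ^+ 2 * kap).
Proof.
have -> : n%:R * vS = 40 * (ell%:R ^+ 2 * kap) * (n%:R * r ^+ 2 / d%:R) by rewrite /vS; ring.
have c0 : 0 <= 40 * (ell%:R ^+ 2 * kap) by rewrite !mulr_ge0 ?sqr_ge0 ?kap_ge0.
rewrite -[leRHS]mulr1; apply: ler_wpM2l => //; rewrite ler_pdivrMr ?dR_gt0 //.
by rewrite mul1r.
Qed.

Lemma sS_ge0 : 0 <= sS. Proof. by rewrite /sS !mulr_ge0. Qed.
Definition kd : R := Num.sqrt (kap / d%:R).
Lemma kd_ge0 : 0 <= kd. Proof. exact: sqrtr_ge0. Qed.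
Lemma kd2 : kd ^+ 2 = kap / d%:R.
Proof. by rewrite sqr_sqrtr // divr_ge0 ?kap_ge0. Qed.
Lemma nr2kd : n%:R * r ^+ 2 * kd ^+ 2 <= kap.
Proof.
rewrite kd2 mulrA ler_pdivrMr ?dR_gt0 // mulrC; apply: ler_wpM2l; first exact: kap_ge0.
exact: nr2.
Qed.

Definition tauM I (A : 'M[R]_(d + d)) : R := avg I (fun l => dot (wvec l) (A *m wvec l)).
Definition sw (l : 'I_(d + d)) : 'I_(d + d) :=
  match fintype.split l with inl j => rshift d j | inr j => lshift d j end.
(* Consecutive transitions share a state, as the column index of one and the row index of
   the next; these averages carry the resulting correlation. *)
Definition rlM (k : 'I_K) (A : 'M[R]_(d + d)) : R := avg (lshift K k) (fun l => dot (wvec l) (A *m wvec (sw l))).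
Definition rho A := \sum_k `|rlM k A|.

Lemma swl j : sw (lshift d j) = rshift d j. Proof. by rewrite /sw splitl. Qed.
Lemma swr j : sw (rshift d j) = lshift d j. Proof. by rewrite /sw splitr. Qed.

Lemma rlM_le k A : `|rlM k A| <= rho A.
Proof. by rewrite /rho (bigD1 k) //= lerDl; apply: sumr_ge0. Qed.

Lemma rho_ge0 A : 0 <= rho A. Proof. by apply: sumr_ge0. Qed.

Lemma dot_tr (A : 'M[R]_(d + d)) x y : A^T = A -> dot x (A *m y) = dot y (A *m x).
Proof. by move=> h; rewrite -dot_sym // dotC. Qed.

Lemma Ex_aAa s A : Ex (fun w => dot (av s w) (A *m av s w)) = tauM (Ab s) A.
Proof.
rewrite (@Ex_G1 _ s (fun v B => dot (wvec (lshift d v)) (B *m wvec (lshift d v))) (fun=> A)) //.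
by rewrite Ex_cst // (cond_law_avgl s (fun l => dot (wvec l) (A *m wvec l))).
Qed.
Lemma Ex_bAb s A : Ex (fun w => dot (bv s w) (A *m bv s w)) = tauM (Bb s) A.
Proof.
rewrite (@Ex_G1 _ (nx s) (fun v B => dot (wvec (rshift d v)) (B *m wvec (rshift d v))) (fun=> A)) //.
by rewrite Ex_cst // (cond_law_avgr (nx s) (fun l => dot (wvec l) (A *m wvec l))).
Qed.
(** The two vectors depend on different states unless [s] starts where [t] ends; in that case the
    average is one of the [rlM]. *)
Lemma Ex_aAb s t (A : 'M[R]_(d + d)) : `|Ex (fun w => dot (av s w) (A *m bv t w))| <= (s == nx t)%:R * rho A.
Proof.
have [->|st] := eqVneq s (nx t).
  rewrite (@Ex_G1 _ (nx t) (fun v B => dot (wvec (lshift d v)) (B *m wvec (rshift d v))) (fun=> A)) //.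
  have E v : dot (wvec (lshift d v)) (A *m wvec (rshift d v)) = dot (wvec (lshift d v)) (A *m wvec (sw (lshift d v))) by rewrite swl.
  under eq_Ex => w do under eq_bigr => v _ do rewrite E.
  rewrite Ex_cst // (cond_law_avgl (nx t) (fun l => dot (wvec l) (A *m wvec (sw l)))) mul1r.
  exact: rlM_le.
rewrite (Ex_av0 (F := fun w => A *m bv t w)) ?normr0 ?mul0r // => w v.
by rewrite bv_updN // eq_sym.
Qed.
Lemma Ex_bAa s t (A : 'M[R]_(d + d)) : A^T = A -> `|Ex (fun w => dot (bv s w) (A *m av t w))| <= (t == nx s)%:R * rho A.
Proof.
move=> hA; have := Ex_aAb t s A.
by rewrite (eq_Ex mu (fun w => dot_tr (bv s w) (av t w) hA)).
Qed.

Lemma updN (w : Om) s v t : t != s -> upd w s v t = w t.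
Proof. by move=> h; rewrite /upd ffunE (negbTE h). Qed.

(** [Wx t] involves two states and the test vector only one, so at least one state of [t] occurs in
    a single centred vector. *)
Lemma Ex_cW0 (t tt : 'I_n) (f : 'I_d -> 'I_(d + d)) (A : 'M[R]_(d + d)) z : nx t != t -> A^T = A ->
  Ex (fun w => dot (wvec (f (w tt))) (A *m Wx t w z)) = 0.
Proof.
move=> nt hA.
have E (a b c : 'cV[R]_(d + d)) : dot c (A *m (dot b z *: a + dot a z *: b)) =
   dot b (dot c (A *m a) *: z + dot a z *: (A *m c)).
  rewrite mulmxDr -!scalemxAr !dotDr !dotZr (dot_tr c b) //; ring.
have [h|h] := eqVneq (nx t) tt; last first.
  have Q (w : Om) : dot (wvec (f (w tt))) (A *m Wx t w z) =
    dot (bv t w) (dot (wvec (f (w tt))) (A *m av t w) *: z + dot (av t w) z *: (A *m wvec (f (w tt)))).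
    exact: E.
  have tt' : t != nx t by rewrite eq_sym.
  have h' : tt != nx t by rewrite eq_sym.
  rewrite (eq_Ex mu Q); apply: Ex_bv0 => w v.
  rewrite (av_updN w v tt') (updN w v h'); reflexivity.
have Q (w : Om) : dot (wvec (f (w tt))) (A *m Wx t w z) =
    dot (av t w) (dot (wvec (f (w tt))) (A *m bv t w) *: z + dot (bv t w) z *: (A *m wvec (f (w tt)))).
  by rewrite /Wx addrC; exact: E.
have h' : tt != t by rewrite -h.
rewrite (eq_Ex mu Q); apply: Ex_av0 => w v.
rewrite (bv_updN w v nt) (updN w v h'); reflexivity.
Qed.

Lemma Ex_CW0 s t (A : 'M[R]_(d + d)) x z : nx t != t -> A^T = A -> Ex (fun w => dot (Cx s w x) (A *m Wx t w z)) = 0.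
Proof.
move=> nt hA.
have E (w : Om) : dot (Cx s w x) (A *m Wx t w z) = dot (uvec (Bb s)) x * dot (wvec (lshift d (w s))) (A *m Wx t w z)
  + dot (uvec (Ab s)) x * dot (wvec (rshift d (w (nx s)))) (A *m Wx t w z).
  by rewrite /Cx dotDl !dotZl.
by rewrite (eq_Ex mu E) ExD !ExZ !Ex_cW0 // !mulr0 addr0.
Qed.

Lemma Wx_updN s t w v x : s != t -> nx s != t -> Wx s (upd w t v) x = Wx s w x.
Proof. by move=> h1 h2; rewrite /Wx (av_updN w v h1) (bv_updN w v h2). Qed.

(** Two distinct transitions share at most one state, so some state of [s] is free: its endpoint, or
    its starting point if [t] follows [s]. *)
Lemma Ex_WW0 T s t (A : 'M[R]_(d + d)) x z : good T -> s \in T -> t \in T -> s != t -> A^T = A ->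
  Ex (fun w => dot (Wx s w x) (A *m Wx t w z)) = 0.
Proof.
move=> gT sT tT st hA; have ns := nx_neq gT sT; have nt := nx_neq gT tT.
have [h _] := gT; have [vs _] := h s sT; have [vt _] := h t tT.
have E1 (w : Om) : dot (Wx s w x) (A *m Wx t w z) = dot (bv s w) (dot (av s w) (A *m Wx t w z) *: x + dot (av s w) x *: (A *m Wx t w z)).
  by rewrite /Wx dotDl !dotDr !dotZl !dotZr -!/(Wx _ _ _); ring.
have E2 (w : Om) : dot (Wx s w x) (A *m Wx t w z) = dot (av s w) (dot (bv s w) (A *m Wx t w z) *: x + dot (bv s w) x *: (A *m Wx t w z)).
  by rewrite /Wx dotDl !dotDr !dotZl !dotZr -!/(Wx _ _ _); ring.
have nn : nx t != nx s.
  by apply/eqP => E; move: vs vt; rewrite -E => -> [] /val_inj E'; rewrite E' eqxx in st.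
have [tE|tE] := eqVneq t (nx s).
  have nts : nx t != s.
    apply/eqP => E; move: vt; rewrite E tE vs => /eqP; rewrite -[X in X == _]addn0 -(addn2 s) eqn_add2l; done.
  have ts : t != s by rewrite eq_sym.
  rewrite (eq_Ex mu E2); apply: Ex_av0 => w v.
  rewrite (bv_updN w v ns) (Wx_updN w v z ts nts); reflexivity.
have sn : s != nx s by rewrite eq_sym.
rewrite (eq_Ex mu E1); apply: Ex_bv0 => w v.
rewrite (av_updN w v sn) (Wx_updN w v z tE nn); reflexivity.
Qed.

Lemma absu I x : nrm x <= 1 -> `|dot (uvec I) x| <= kd.
Proof.
move=> hx; apply: le_sqr2; first exact: kd_ge0.
rewrite real_normK ?num_real // kd2; apply: (le_trans (usq I x)).
rewrite -[leRHS]mulr1; apply: ler_wpM2l; first by rewrite divr_ge0 ?kap_ge0.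
by rewrite expr_le1 ?nrm_ge0.
Qed.
Lemma nrm_u_kd I : nrm (uvec I) <= kd.
Proof. by apply: le_sqr2; [exact: kd_ge0|rewrite kd2 nrm_u_sq]. Qed.

Lemma nrm_Cx s w x : nrm x <= 1 -> nrm (Cx s w x) <= 2 * kd.
Proof.
move=> hx; apply: (le_trans (nrm2Z _ _ (nrm_av s w) (nrm_bv s w))); rewrite mul1r.
have := absu (Bb s) hx; have := absu (Ab s) hx; set p := `|_|; set q := `|_|; lra.
Qed.

Lemma Ex_Wx2 s x : nrm x <= 1 -> Ex (fun w => nrm (Wx s w x) ^+ 2) <= 4 * kd ^+ 2.
Proof.
move=> hx; apply: (@le_trans _ _ (Ex (fun w => 2 * (dot (bv s w) x ^+ 2 + dot (av s w) x ^+ 2)))).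
  apply: Ex_le => // w; have h := nrm2Z (dot (bv s w) x) (dot (av s w) x) (nrm_av s w) (nrm_bv s w).
  rewrite mul1r -/(Wx s w x) in h.
  rewrite -(real_normK (num_real (dot (bv s w) x))) -(real_normK (num_real (dot (av s w) x))).
  move: h (nrm_ge0 (Wx s w x)) (normr_ge0 (dot (bv s w) x)) (normr_ge0 (dot (av s w) x)).
  set p := `|_|; set q := `|_|; set y := nrm _ => h y0 p0 q0.
  have h1 : y ^+ 2 <= (p + q) ^+ 2 by apply: lerXn2r; rewrite ?nnegrE ?addr_ge0.
  apply: (le_trans h1); have := sqr_ge0 (p - q); rewrite !expr2; lra.
rewrite ExZ ExD; have := Ex_bvsq s x; have := Ex_avsq s x; rewrite -kd2.
have : kd ^+ 2 * nrm x ^+ 2 <= kd ^+ 2.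
  by rewrite -[leRHS]mulr1; apply: ler_wpM2l; [exact: sqr_ge0|rewrite expr_le1 ?nrm_ge0].
set p := Ex _; set q := Ex _; lra.
Qed.

Lemma Ex_Ux2 s x : nrm x <= 1 -> Ex (fun w => nrm (Ux s w x) ^+ 2) <= 4 * kd ^+ 4.
Proof.
move=> hx; apply: (@le_trans _ _ (Ex (fun w => 2 * kd ^+ 2 * (dot (av s w) x ^+ 2 + dot (bv s w) x ^+ 2)))).
  apply: Ex_le => // w; have h := nrm2Z (dot (av s w) x) (dot (bv s w) x) (nrm_u_kd (Bb s)) (nrm_u_kd (Ab s)).
  rewrite -/(Ux s w x) in h.
  rewrite -(real_normK (num_real (dot (bv s w) x))) -(real_normK (num_real (dot (av s w) x))).
  move: h (nrm_ge0 (Ux s w x)) (normr_ge0 (dot (av s w) x)) (normr_ge0 (dot (bv s w) x)) kd_ge0.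
  set p := `|_|; set q := `|_|; set y := nrm _ => h y0 p0 q0 k0.
  have h1 : y ^+ 2 <= (kd * (p + q)) ^+ 2 by apply: lerXn2r; rewrite ?nnegrE ?mulr_ge0 ?addr_ge0.
  apply: (le_trans h1); rewrite exprMn; have -> : 2 * kd ^+ 2 * (p ^+ 2 + q ^+ 2) = kd ^+ 2 * (2 * (p ^+ 2 + q ^+ 2)) by ring.
  apply: ler_wpM2l; first exact: sqr_ge0.
  have := sqr_ge0 (p - q); rewrite !expr2; lra.
rewrite ExZ ExD; have := Ex_bvsq s x; have := Ex_avsq s x; rewrite -kd2.
have : kd ^+ 2 * nrm x ^+ 2 <= kd ^+ 2.
  by rewrite -[leRHS]mulr1; apply: ler_wpM2l; [exact: sqr_ge0|rewrite expr_le1 ?nrm_ge0].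
set p := Ex _; set q := Ex _ => h1 h2 h3.
have -> : 4 * kd ^+ 4 = 2 * kd ^+ 2 * (2 * kd ^+ 2) by ring.
apply: ler_wpM2l; first by rewrite mulr_ge0 ?sqr_ge0.
lra.
Qed.

Definition SX (X : 'I_n -> Om -> 'cV[R]_(d + d) -> 'cV[R]_(d + d)) T i w z := r *: \sum_(s in Tb T i) X s w z.

Lemma HFb_SX T i w z : HF (Tb T i) w *m z = SX Wx T i w z + SX Cx T i w z + SX Ux T i w z.
Proof. by rewrite HFx /SX -!scalerDr -!big_split. Qed.

Lemma Ex_dot_CS (F G : Om -> 'cV[R]_(d + d)) A a b : 0 <= a -> 0 <= b ->
  Ex (fun w => nrm (F w) ^+ 2) <= a ^+ 2 -> Ex (fun w => nrm (G w) ^+ 2) <= b ^+ 2 ->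
  `|Ex (fun w => dot (F w) (A *m G w))| <= opnorm A * (a * b).
Proof.
move=> a0 b0 hF hG; apply: (le_trans (Ex_abs mu0 _)).
apply: (@le_trans _ _ (Ex (fun w => opnorm A * (nrm (F w) * nrm (G w))))).
  apply: Ex_le => // w; apply: (le_trans (dot_le _ _)); rewrite mulrCA.
  by apply: ler_wpM2l; [exact: nrm_ge0|exact: opnormP].
rewrite ExZ; apply: ler_wpM2l; first exact: opnorm_ge0.
apply: le_sqr2; first exact: mulr_ge0.
apply: (le_trans (Ex_CS mu0 _ _)); rewrite exprMn.
by apply: ler_pM => //; apply: Ex_ge0 => // w; apply: sqr_ge0.
Qed.

Lemma SX2 X T i z c : good T -> 0 <= c -> (forall s, s \in Tb T i -> Ex (fun w => nrm (X s w z) ^+ 2) <= c ^+ 2) ->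
  Ex (fun w => nrm (SX X T i w z) ^+ 2) <= (ell%:R * r * c) ^+ 2.
Proof.
move=> gT c0 h; have := @Ex_Sb2 T i (fun s w => X s w z) (c ^+ 2) gT (sqr_ge0 c) h.
by rewrite !exprMn.
Qed.

Lemma SW2 T i z : good T -> nrm z <= 1 -> Ex (fun w => nrm (SX Wx T i w z) ^+ 2) <= (ell%:R * r * (2 * kd)) ^+ 2.
Proof.
move=> gT hz; apply: SX2 => //; first by rewrite mulr_ge0 ?kd_ge0.
by move=> s _; have -> : (2 * kd) ^+ 2 = 4 * kd ^+ 2 by [ring|]; apply: Ex_Wx2.
Qed.
Lemma SC2 T i z : good T -> nrm z <= 1 -> Ex (fun w => nrm (SX Cx T i w z) ^+ 2) <= (ell%:R * r * (2 * kd)) ^+ 2.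
Proof.
move=> gT hz; have k0 : 0 <= 2 * kd by rewrite mulr_ge0 ?kd_ge0.
apply: SX2 => // s _; rewrite -(Ex_cst mu1 ((2 * kd) ^+ 2)); apply: Ex_le => // w.
by apply: lerXn2r; rewrite ?nnegrE ?nrm_ge0 ?nrm_Cx.
Qed.
Lemma SU2 T i z : good T -> nrm z <= 1 -> Ex (fun w => nrm (SX Ux T i w z) ^+ 2) <= (ell%:R * r * (2 * kd ^+ 2)) ^+ 2.
Proof.
move=> gT hz; apply: SX2 => //; first by rewrite mulr_ge0 ?sqr_ge0.
by move=> s _; have -> : (2 * kd ^+ 2) ^+ 2 = 4 * kd ^+ 4 by [ring|]; apply: Ex_Ux2.
Qed.

(** The sum over blocks of the second-order terms with [A] in the middle. It is shown to act almost
    as the scalar [DI T I A] on the directions attached to block [I]. *)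
Definition Phi (T : {set 'I_n}) (A : 'M[R]_(d + d)) x z :=
  \sum_(i < n) Ex (fun w => dot x (HF (Tb T i) w *m (A *m (HF (Tb T i) w *m z)))).

Lemma Ex_SXSX X X' T i (A : 'M[R]_(d + d)) x z : Ex (fun w => dot (SX X T i w x) (A *m SX X' T i w z)) =
  r ^+ 2 * \sum_(s in Tb T i) \sum_(t in Tb T i) Ex (fun w => dot (X s w x) (A *m X' t w z)).
Proof.
have E (w : Om) : dot (SX X T i w x) (A *m SX X' T i w z) =
   r ^+ 2 * \sum_(s in Tb T i) \sum_(t in Tb T i) dot (X s w x) (A *m X' t w z).
  rewrite /SX -scalemxAr dotZl dotZr mulrA -expr2 mulmx_sumr dot_suml; congr (_ * _).
  by apply: eq_bigr => s _; rewrite dot_sumr.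
rewrite (eq_Ex mu E) ExZ Ex_sum; congr (_ * _); apply: eq_bigr => s _; exact: Ex_sum.
Qed.

Lemma sum_Tb (T : {set 'I_n}) (F : 'I_n -> R) : \sum_(i < n) \sum_(s in Tb T i) F s = \sum_(s in T) F s.
Proof.
rewrite [RHS](partition_big (fun s => Ordinal (g_lt s)) predT) //=; apply: eq_bigr => i _.
by apply: eq_bigl => s; rewrite inE -(inj_eq val_inj).
Qed.
Lemma eq_le_idx (F : 'I_n -> 'I_n -> R) (T : {set 'I_n}) (e : 'I_n -> 'I_n -> bool) c : 0 <= c ->
  (forall s t, `|F s t| <= (e s t)%:R * c) -> (forall t, (#|[set s in T | e s t]| <= 1)%N) ->
  `|\sum_(s in T) \sum_(t in T) F s t| <= #|T|%:R * c.
Proof.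
move=> c0 hF he; apply: (le_trans (ler_norm_sum _ _ _)).
apply: (@le_trans _ _ (\sum_(s in T) \sum_(t in T) (e s t)%:R * c)).
  apply: ler_sum => s _; apply: (le_trans (ler_norm_sum _ _ _)); exact: ler_sum.
rewrite exchange_big /=; apply: (@le_trans _ _ (\sum_(t in T) c)).
  apply: ler_sum => t _; rewrite -mulr_suml -[leRHS]mul1r; apply: ler_wpM2r => //.
  have -> : \sum_(s in T) (e s t)%:R = #|[set s in T | e s t]|%:R :> R.
    rewrite -sum1_card natr_sum (eq_bigl (fun s => (s \in T) && e s t)); last by move=> s; rewrite inE.
    by rewrite big_mkcondr /=; apply: eq_bigr => s _; case: (e s t).
  by rewrite lern1 he.
by rewrite sumr_const mulr_natl.
Qed.

Lemma Ex_CC (T : {set 'I_n}) s t (A : 'M[R]_(d + d)) x z : good T -> s \in T -> t \in T -> A^T = A ->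
  nrm x <= 1 -> nrm z <= 1 ->
  `|Ex (fun w => dot (Cx s w x) (A *m Cx t w z)) - (s == t)%:R *
     (dot (uvec (Bb s)) x * dot (uvec (Bb s)) z * tauM (Ab s) A + dot (uvec (Ab s)) x * dot (uvec (Ab s)) z * tauM (Bb s) A)| <=
  (s == nx t)%:R * (kd ^+ 2 * rho A) + (t == nx s)%:R * (kd ^+ 2 * rho A).
Proof.
move=> gT sT tT hA hx hz.
have E (w : Om) : dot (Cx s w x) (A *m Cx t w z) =
   dot (uvec (Bb s)) x * dot (uvec (Bb t)) z * dot (av s w) (A *m av t w) +
   dot (uvec (Ab s)) x * dot (uvec (Ab t)) z * dot (bv s w) (A *m bv t w) +
   (dot (uvec (Bb s)) x * dot (uvec (Ab t)) z * dot (av s w) (A *m bv t w) +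
    dot (uvec (Ab s)) x * dot (uvec (Bb t)) z * dot (bv s w) (A *m av t w)).
  rewrite /Cx; move: (av s w) (bv s w) (av t w) (bv t w) => a b a' b'.
  rewrite mulmxDr -!scalemxAr dotDl !dotDr !dotZl !dotZr; ring.
rewrite (eq_Ex mu E) !ExD !ExZ.
have h1 : Ex (fun w => dot (av s w) (A *m av t w)) = (s == t)%:R * tauM (Ab s) A.
  have [<-|st] := eqVneq s t; first by rewrite mul1r Ex_aAa.
  rewrite mul0r; apply: Ex_av0 => w v; by rewrite av_updN // eq_sym.
have h2 : Ex (fun w => dot (bv s w) (A *m bv t w)) = (s == t)%:R * tauM (Bb s) A.
  have [<-|st] := eqVneq s t; first by rewrite mul1r Ex_bAb.
  have [h _] := gT; have [vs _] := h s sT; have [vt _] := h t tT.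
  have nn : nx t != nx s.
    by apply/eqP => E'; move: vs vt; rewrite -E' => -> [] /val_inj E2; rewrite E2 eqxx in st.
  rewrite mul0r; apply: Ex_bv0 => w v; by rewrite bv_updN.
have h3 := Ex_aAb s t A; have h4 := Ex_bAa s t hA.
rewrite h1 h2; set p3 := Ex _ in h3 *; set p4 := Ex _ in h4 *.
have -> : dot (uvec (Bb s)) x * dot (uvec (Bb t)) z * ((s == t)%:R * tauM (Ab s) A) +
  dot (uvec (Ab s)) x * dot (uvec (Ab t)) z * ((s == t)%:R * tauM (Bb s) A) =
  (s == t)%:R * (dot (uvec (Bb s)) x * dot (uvec (Bb s)) z * tauM (Ab s) A + dot (uvec (Ab s)) x * dot (uvec (Ab s)) z * tauM (Bb s) A).
  by have [->|_] := eqVneq s t; rewrite ?mul1r ?mul0r ?mulr0 ?addr0.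
rewrite addrAC subrr add0r; apply: (le_trans (ler_normD _ _)).
have kk I J : `|dot (uvec I) x * dot (uvec J) z| <= kd ^+ 2.
  by rewrite normrM expr2; apply: ler_pM => //; apply: absu.
apply: lerD; rewrite normrM mulrCA; apply: ler_pM => //.
Qed.

Definition mainU (T : {set 'I_n}) (A : 'M[R]_(d + d)) x z := r ^+ 2 * \sum_(s in T)
  (dot (uvec (Bb s)) x * dot (uvec (Bb s)) z * tauM (Ab s) A + dot (uvec (Ab s)) x * dot (uvec (Ab s)) z * tauM (Bb s) A).

Lemma inj_nx (T U : {set 'I_n}) (t : 'I_n) : good T -> U \subset T -> (#|[set s in U | t == nx s]| <= 1)%N.
Proof.
move=> gT hU; rewrite leqNgt; apply/negP => /card_gt1P[s [s' [hs hs' ss]]].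
move: hs hs'; rewrite !inE => /andP[sU /eqP e1] /andP[sU' /eqP e2].
have [h _] := gT; have [v1 _] := h s (fintype.subsetP hU _ sU); have [v2 _] := h s' (fintype.subsetP hU _ sU').
by move: v1 v2; rewrite -e1 -e2 => -> [] /val_inj E; rewrite E eqxx in ss.
Qed.

Lemma Tb_sub T i : Tb T i \subset T.
Proof. by apply/fintype.subsetP => s; rewrite inE => /andP[]. Qed.

Lemma CC_block (T : {set 'I_n}) i (A : 'M[R]_(d + d)) x z : good T -> A^T = A -> nrm x <= 1 -> nrm z <= 1 ->
  `|Ex (fun w => dot (SX Cx T i w x) (A *m SX Cx T i w z)) - mainU (Tb T i) A x z| <=
  r ^+ 2 * (#|Tb T i|%:R * (2 * (kd ^+ 2 * rho A))).
Proof.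
move=> gT hA hx hz; rewrite Ex_SXSX /mainU -mulrBr normrM (ger0_norm (sqr_ge0 r)).
apply: ler_wpM2l; first exact: sqr_ge0.
pose M s := dot (uvec (Bb s)) x * dot (uvec (Bb s)) z * tauM (Ab s) A + dot (uvec (Ab s)) x * dot (uvec (Ab s)) z * tauM (Bb s) A.
have -> : \sum_(s in Tb T i) (dot (uvec (Bb s)) x * dot (uvec (Bb s)) z * tauM (Ab s) A + dot (uvec (Ab s)) x * dot (uvec (Ab s)) z * tauM (Bb s) A)
   = \sum_(s in Tb T i) \sum_(t in Tb T i) (s == t)%:R * M s.
  apply: eq_bigr => s sT; rewrite (bigD1 s) //= eqxx mul1r big1 ?addr0 // => t /andP[_ st].
  by rewrite eq_sym (negbTE st) mul0r.
rewrite -sumrB; under eq_bigr => s _ do rewrite -sumrB.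
have sub s : s \in Tb T i -> s \in T by apply/fintype.subsetP/Tb_sub.
apply: (@le_trans _ _ (\sum_(s in Tb T i) \sum_(t in Tb T i) ((s == nx t)%:R * (kd ^+ 2 * rho A) + (t == nx s)%:R * (kd ^+ 2 * rho A)))).
  apply: (le_trans (ler_norm_sum _ _ _)); apply: ler_sum => s sT.
  apply: (le_trans (ler_norm_sum _ _ _)); apply: ler_sum => t tT.
  by apply: (@Ex_CC T) => //; apply: sub.
have c0 : 0 <= kd ^+ 2 * rho A by rewrite mulr_ge0 ?sqr_ge0 ?rho_ge0.
have S1 : `|\sum_(s in Tb T i) \sum_(t in Tb T i) (t == nx s)%:R * (kd ^+ 2 * rho A)| <= #|Tb T i|%:R * (kd ^+ 2 * rho A).
  apply: (@eq_le_idx _ _ (fun s t => t == nx s)) => // [s t|t]; first by rewrite ger0_norm // mulr_ge0.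
  exact: inj_nx gT (Tb_sub _ _).
have S2 : `|\sum_(s in Tb T i) \sum_(t in Tb T i) (s == nx t)%:R * (kd ^+ 2 * rho A)| <= #|Tb T i|%:R * (kd ^+ 2 * rho A).
  by rewrite exchange_big /=.
under eq_bigr => s _ do rewrite big_split /=.
rewrite big_split /=; have := le_trans (ler_norm _) S1; have := le_trans (ler_norm _) S2.
set p := \sum_(s in _) _; set q := \sum_(s in _) _; set y := _%:R * (kd ^+ 2 * rho A) => h1 h2.
have -> : #|Tb T i|%:R * (2 * (kd ^+ 2 * rho A)) = y + y by rewrite /y; ring.
exact: lerD.
Qed.

Lemma mainU_sum T A x z : \sum_(i < n) mainU (Tb T i) A x z = mainU T A x z.
Proof. by rewrite /mainU -mulr_sumr sum_Tb. Qed.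

Lemma card_Tb_sum (T : {set 'I_n}) c : 0 <= c -> \sum_(i < n) r ^+ 2 * (#|Tb T i|%:R * c) <= n%:R * r ^+ 2 * c.
Proof.
move=> c0; rewrite -mulr_sumr -mulr_suml [n%:R * _]mulrC -[leRHS]mulrA.
apply: ler_wpM2l; first exact: sqr_ge0.
apply: ler_wpM2r => //.
have := sum_Tb T (fun _ => 1); rewrite sumr_const; under eq_bigr => i _ do rewrite sumr_const.
by move=> ->; rewrite ler_nat; apply: (leq_trans (max_card _)); rewrite card_ord.
Qed.

Lemma SXW0 T i w x : (forall l, dot (wvec l) x = 0) -> SX Wx T i w x = 0.
Proof. by move=> xu; rewrite /SX big1 ?scaler0 // => s _; rewrite /Wx (xu (lshift d (w s))) (xu (rshift d (w (nx s)))) !scale0r addr0. Qed.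
Lemma SXU0 T i w x : (forall l, dot (wvec l) x = 0) -> SX Ux T i w x = 0.
Proof. by move=> xu; rewrite /SX big1 ?scaler0 // => s _; rewrite /Ux (xu (lshift d (w s))) (xu (rshift d (w (nx s)))) !scale0r addr0. Qed.
Lemma SXC0 T i w x : (forall I, dot (uvec I) x = 0) -> SX Cx T i w x = 0.
Proof. by move=> xu; rewrite /SX big1 ?scaler0 // => s _; rewrite /Cx !xu !scale0r addr0. Qed.

(** On a combination of block means only [Cx] acts. Its pairing with [Wx] averages to zero, with
    [Ux] it is small by Cauchy-Schwarz, and with itself it gives the main term plus the correlation
    of consecutive transitions, measured by [rho]. *)
Lemma PhiU T (A : 'M[R]_(d + d)) x z : good T -> A^T = A -> nrm x <= 1 -> nrm z <= 1 ->
  (forall l, dot (wvec l) x = 0) ->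
  `|Phi T A x z - mainU T A x z| <= 2 * kap * rho A + 4 * (ell%:R ^+ 2 * kap) * (kd * opnorm A).
Proof.
move=> gT hA hx hz xu; rewrite /Phi -mainU_sum -sumrB.
have o0 := opnorm_ge0 A; have k0 := kd_ge0; have kp := kap_ge0; have rh := rho_ge0 A.
apply: (le_trans (ler_norm_sum _ _ _)).
apply: (@le_trans _ _ (\sum_(i < n) (r ^+ 2 * (#|Tb T i|%:R * (2 * (kd ^+ 2 * rho A))) + opnorm A * (ell%:R * r * (2 * kd) * (ell%:R * r * (2 * kd ^+ 2)))))).
  apply: ler_sum => i _.
  have Sx w : HF (Tb T i) w *m x = SX Cx T i w x.
    by rewrite HFb_SX (SXW0 T i w xu) (SXU0 T i w xu) add0r addr0.
  have E (w : Om) : dot x (HF (Tb T i) w *m (A *m (HF (Tb T i) w *m z))) =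
     dot (SX Cx T i w x) (A *m SX Wx T i w z) + dot (SX Cx T i w x) (A *m SX Cx T i w z) + dot (SX Cx T i w x) (A *m SX Ux T i w z).
    by rewrite -dot_sym ?HF_sym // Sx HFb_SX !mulmxDr !dotDr.
  rewrite (eq_Ex mu E) !ExD.
  have Z : Ex (fun w => dot (SX Cx T i w x) (A *m SX Wx T i w z)) = 0.
    rewrite Ex_SXSX big1 ?mulr0 // => s _; rewrite big1 // => t.
    by rewrite inE => /andP[tT _]; apply: Ex_CW0 => //; apply: nx_neq gT tT.
  rewrite Z add0r addrAC; apply: (le_trans (ler_normD _ _)); apply: lerD; first exact: CC_block.
  apply: Ex_dot_CS; [by rewrite !mulr_ge0|by rewrite !mulr_ge0 ?sqr_ge0|exact: SC2|exact: SU2].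
rewrite big_split /=; apply: lerD.
  have c0 : 0 <= 2 * (kd ^+ 2 * rho A) by rewrite !mulr_ge0 ?sqr_ge0.
  apply: (le_trans (card_Tb_sum T c0)).
  have -> : n%:R * r ^+ 2 * (2 * (kd ^+ 2 * rho A)) = n%:R * r ^+ 2 * kd ^+ 2 * (2 * rho A) by ring.
  have -> : 2 * kap * rho A = kap * (2 * rho A) by ring.
  by apply: ler_wpM2r; [rewrite mulr_ge0|exact: nr2kd].
rewrite sum_ord_cst.
have -> : n%:R * (opnorm A * (ell%:R * r * (2 * kd) * (ell%:R * r * (2 * kd ^+ 2)))) =
  n%:R * r ^+ 2 * kd ^+ 2 * (4 * (ell%:R ^+ 2 * (kd * opnorm A))) by ring.
have -> : 4 * (ell%:R ^+ 2 * kap) * (kd * opnorm A) = kap * (4 * (ell%:R ^+ 2 * (kd * opnorm A))) by ring.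
by apply: ler_wpM2r; [rewrite !mulr_ge0 ?sqr_ge0|exact: nr2kd].
Qed.

Lemma avgPB I y y' : `|avg I (fun l => dot (wvec l) y * dot (wvec l) y')| <= kd ^+ 2 * (nrm y * nrm y').
Proof.
rewrite /avg -/(PB part I y y') mulrC normrM (ger0_norm (x := _^-1)) ?invr_ge0 ?bsz_ge0 //.
by apply: ler_pM; rewrite ?invr_ge0 ?bsz_ge0 ?kd2 ?bszV_le ?PB_le.
Qed.

Lemma Ex_absa s x : nrm x <= 1 -> Ex (fun w => `|dot (av s w) x|) <= kd.
Proof.
move=> hx; apply: le_sqr2; first exact: kd_ge0.
have := Ex_CS mu0 (fun w => 1) (fun w => `|dot (av s w) x|).
have -> : (fun w : Om => 1 * `|dot (av s w) x|) = (fun w => `|dot (av s w) x|) by apply/funext => w; rewrite mul1r.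
move=> h; apply: (le_trans h); rewrite expr1n Ex_cst // mul1r.
rewrite (eq_Ex mu (fun w => real_normK (num_real (dot (av s w) x)))).
apply: (le_trans (Ex_avsq s x)); rewrite kd2 -[leRHS]mulr1; apply: ler_wpM2l; first by rewrite divr_ge0 ?kap_ge0.
by rewrite expr_le1 ?nrm_ge0.
Qed.
Lemma Ex_absb s x : nrm x <= 1 -> Ex (fun w => `|dot (bv s w) x|) <= kd.
Proof.
move=> hx; apply: le_sqr2; first exact: kd_ge0.
have := Ex_CS mu0 (fun w => 1) (fun w => `|dot (bv s w) x|).
have -> : (fun w : Om => 1 * `|dot (bv s w) x|) = (fun w => `|dot (bv s w) x|) by apply/funext => w; rewrite mul1r.
move=> h; apply: (le_trans h); rewrite expr1n Ex_cst // mul1r.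
rewrite (eq_Ex mu (fun w => real_normK (num_real (dot (bv s w) x)))).
apply: (le_trans (Ex_bvsq s x)); rewrite kd2 -[leRHS]mulr1; apply: ler_wpM2l; first by rewrite divr_ge0 ?kap_ge0.
by rewrite expr_le1 ?nrm_ge0.
Qed.

(** Averaging the state at [s] first gives [kd ^+ 2] from the Bessel bound; the remaining linear
    factor contributes the third [kd]. *)
Lemma Ex_crossb s (A : 'M[R]_(d + d)) x z : nx s != s -> nrm x <= 1 -> nrm z <= 1 ->
  `|Ex (fun w => dot (bv s w) x * dot (av s w) z * dot (av s w) (A *m bv s w))| <= kd ^+ 3 * opnorm A.
Proof.
move=> ns hx hz.
rewrite (@Ex_G1 _ s (fun v b => dot b x * dot (wvec (lshift d v)) z * dot (wvec (lshift d v)) (A *m b)) (fun w => bv s w)); last first.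
  by move=> w v; rewrite bv_updN.
have E (w : Om) : \sum_v mu s v * (dot (bv s w) x * dot (wvec (lshift d v)) z * dot (wvec (lshift d v)) (A *m bv s w)) =
   dot (bv s w) x * avg (Ab s) (fun l => dot (wvec l) z * dot (wvec l) (A *m bv s w)).
  rewrite -(cond_law_avgl s (fun l => dot (wvec l) z * dot (wvec l) (A *m bv s w))) mulr_sumr.
  apply: eq_bigr => v _; ring.
rewrite (eq_Ex mu E); apply: (le_trans (Ex_abs mu0 _)).
have o0 := opnorm_ge0 A.
apply: (@le_trans _ _ (Ex (fun w => kd ^+ 2 * opnorm A * `|dot (bv s w) x|))).
  apply: Ex_le => // w; rewrite normrM mulrC; apply: ler_wpM2r => //.
  apply: (le_trans (avgPB _ _ _)); apply: ler_wpM2l; first exact: sqr_ge0.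
  rewrite -[leRHS]mul1r; apply: ler_pM; rewrite ?nrm_ge0 //.
  have := opnormP1 (lexx (opnorm A)) (nrm_bv s w); by rewrite mulr1.
rewrite ExZ; have -> : kd ^+ 3 * opnorm A = kd ^+ 2 * opnorm A * kd by ring.
by apply: ler_wpM2l; [rewrite mulr_ge0 ?sqr_ge0|exact: Ex_absb].
Qed.
Lemma Ex_crossa s (A : 'M[R]_(d + d)) x z : nx s != s -> nrm x <= 1 -> nrm z <= 1 ->
  `|Ex (fun w => dot (av s w) x * dot (bv s w) z * dot (bv s w) (A *m av s w))| <= kd ^+ 3 * opnorm A.
Proof.
move=> ns hx hz.
rewrite (@Ex_G1 _ (nx s) (fun v b => dot b x * dot (wvec (rshift d v)) z * dot (wvec (rshift d v)) (A *m b)) (fun w => av s w)); last first.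
  by move=> w v; rewrite av_updN // eq_sym.
have E (w : Om) : \sum_v mu (nx s) v * (dot (av s w) x * dot (wvec (rshift d v)) z * dot (wvec (rshift d v)) (A *m av s w)) =
   dot (av s w) x * avg (Bb s) (fun l => dot (wvec l) z * dot (wvec l) (A *m av s w)).
  rewrite -(cond_law_avgr (nx s) (fun l => dot (wvec l) z * dot (wvec l) (A *m av s w))) mulr_sumr.
  apply: eq_bigr => v _; ring.
rewrite (eq_Ex mu E); apply: (le_trans (Ex_abs mu0 _)).
have o0 := opnorm_ge0 A.
apply: (@le_trans _ _ (Ex (fun w => kd ^+ 2 * opnorm A * `|dot (av s w) x|))).
  apply: Ex_le => // w; rewrite normrM mulrC; apply: ler_wpM2r => //.
  apply: (le_trans (avgPB _ _ _)); apply: ler_wpM2l; first exact: sqr_ge0.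
  rewrite -[leRHS]mul1r; apply: ler_pM; rewrite ?nrm_ge0 //.
  have := opnormP1 (lexx (opnorm A)) (nrm_av s w); by rewrite mulr1.
rewrite ExZ; have -> : kd ^+ 3 * opnorm A = kd ^+ 2 * opnorm A * kd by ring.
by apply: ler_wpM2l; [rewrite mulr_ge0 ?sqr_ge0|exact: Ex_absa].
Qed.
Definition avgw I x z := avg I (fun l => dot (wvec l) x * dot (wvec l) z).

Lemma Ex_main1 s (A : 'M[R]_(d + d)) x z : nx s != s ->
  Ex (fun w => dot (bv s w) x * dot (bv s w) z * dot (av s w) (A *m av s w)) = tauM (Ab s) A * avgw (Bb s) x z.
Proof.
move=> ns.
rewrite (@Ex_G1 _ s (fun v b => dot b x * dot b z * dot (wvec (lshift d v)) (A *m wvec (lshift d v))) (fun w => bv s w)); last first.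
  by move=> w v; rewrite bv_updN.
have E (w : Om) : \sum_v mu s v * (dot (bv s w) x * dot (bv s w) z * dot (wvec (lshift d v)) (A *m wvec (lshift d v))) =
   tauM (Ab s) A * (dot (bv s w) x * dot (bv s w) z).
  rewrite /tauM -(cond_law_avgl s (fun l => dot (wvec l) (A *m wvec l))) mulr_suml.
  apply: eq_bigr => v _; ring.
rewrite (eq_Ex mu E) ExZ; congr (_ * _).
rewrite (@Ex_G1 _ (nx s) (fun v (_ : unit) => dot (wvec (rshift d v)) x * dot (wvec (rshift d v)) z) (fun=> tt)) //.
by rewrite Ex_cst // (cond_law_avgr (nx s) (fun l => dot (wvec l) x * dot (wvec l) z)).
Qed.
Lemma Ex_main2 s (A : 'M[R]_(d + d)) x z : nx s != s ->
  Ex (fun w => dot (av s w) x * dot (av s w) z * dot (bv s w) (A *m bv s w)) = tauM (Bb s) A * avgw (Ab s) x z.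
Proof.
move=> ns.
rewrite (@Ex_G1 _ (nx s) (fun v b => dot b x * dot b z * dot (wvec (rshift d v)) (A *m wvec (rshift d v))) (fun w => av s w)); last first.
  by move=> w v; rewrite av_updN // eq_sym.
have E (w : Om) : \sum_v mu (nx s) v * (dot (av s w) x * dot (av s w) z * dot (wvec (rshift d v)) (A *m wvec (rshift d v))) =
   tauM (Bb s) A * (dot (av s w) x * dot (av s w) z).
  rewrite /tauM -(cond_law_avgr (nx s) (fun l => dot (wvec l) (A *m wvec l))) mulr_suml.
  apply: eq_bigr => v _; ring.
rewrite (eq_Ex mu E) ExZ; congr (_ * _).
rewrite (@Ex_G1 _ s (fun v (_ : unit) => dot (wvec (lshift d v)) x * dot (wvec (lshift d v)) z) (fun=> tt)) //.
by rewrite Ex_cst // (cond_law_avgl s (fun l => dot (wvec l) x * dot (wvec l) z)).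
Qed.

Lemma Ex_WWs s (A : 'M[R]_(d + d)) x z : nx s != s -> nrm x <= 1 -> nrm z <= 1 ->
  `|Ex (fun w => dot (Wx s w x) (A *m Wx s w z)) - (tauM (Ab s) A * avgw (Bb s) x z + tauM (Bb s) A * avgw (Ab s) x z)|
  <= 2 * kd ^+ 3 * opnorm A.
Proof.
move=> ns hx hz.
have E (w : Om) : dot (Wx s w x) (A *m Wx s w z) =
   dot (bv s w) x * dot (bv s w) z * dot (av s w) (A *m av s w) +
   dot (av s w) x * dot (av s w) z * dot (bv s w) (A *m bv s w) +
   (dot (bv s w) x * dot (av s w) z * dot (av s w) (A *m bv s w) +
    dot (av s w) x * dot (bv s w) z * dot (bv s w) (A *m av s w)).
  rewrite /Wx; move: (av s w) (bv s w) => a b.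
  rewrite mulmxDr -!scalemxAr dotDl !dotDr !dotZl !dotZr; ring.
rewrite (eq_Ex mu E) !ExD Ex_main1 // Ex_main2 // addrAC subrr add0r.
have := Ex_crossb A ns hx hz; have := Ex_crossa A ns hx hz.
set p := Ex _; set q := Ex _ => h1 h2; apply: (le_trans (ler_normD _ _)).
have -> : 2 * kd ^+ 3 * opnorm A = kd ^+ 3 * opnorm A + kd ^+ 3 * opnorm A by ring.
exact: lerD.
Qed.

Definition mainW (T : {set 'I_n}) (A : 'M[R]_(d + d)) x z := r ^+ 2 * \sum_(s in T)
  (tauM (Ab s) A * avgw (Bb s) x z + tauM (Bb s) A * avgw (Ab s) x z).

Lemma WW_block (T : {set 'I_n}) i (A : 'M[R]_(d + d)) x z : good T -> A^T = A -> nrm x <= 1 -> nrm z <= 1 ->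
  `|Ex (fun w => dot (SX Wx T i w x) (A *m SX Wx T i w z)) - mainW (Tb T i) A x z| <=
  r ^+ 2 * (#|Tb T i|%:R * (2 * kd ^+ 3 * opnorm A)).
Proof.
move=> gT hA hx hz; rewrite Ex_SXSX /mainW -mulrBr normrM (ger0_norm (sqr_ge0 r)).
apply: ler_wpM2l; first exact: sqr_ge0.
have sub s : s \in Tb T i -> s \in T by apply/fintype.subsetP/Tb_sub.
rewrite (eq_bigr (fun s => Ex (fun w => dot (Wx s w x) (A *m Wx s w z)))); last first.
  move=> s sT; rewrite (bigD1 s) //= big1 ?addr0 // => t /andP[tT ts].
  by apply: (Ex_WW0 x z gT (sub _ sT) (sub _ tT)) => //; rewrite eq_sym.
rewrite -sumrB; apply: (le_trans (ler_norm_sum _ _ _)).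
apply: (@le_trans _ _ (\sum_(s in Tb T i) 2 * kd ^+ 3 * opnorm A)).
  by apply: ler_sum => s /sub sT; apply: Ex_WWs => //; apply: nx_neq gT sT.
have c0 : 0 <= 2 * kd ^+ 3 * opnorm A by rewrite !mulr_ge0 ?exprn_ge0 ?kd_ge0 ?opnorm_ge0.
exact: (sum_cst_le c0 (leqnn _)).
Qed.

Lemma mainW_sum T A x z : \sum_(i < n) mainW (Tb T i) A x z = mainW T A x z.
Proof. by rewrite /mainW -mulr_sumr sum_Tb. Qed.

Lemma vS_le : vS <= (7 * ell%:R * r * kd) ^+ 2.
Proof.
have -> : vS = 40 * (ell%:R * r * kd) ^+ 2 by rewrite /vS !exprMn kd2; ring.
have -> : (7 * ell%:R * r * kd) ^+ 2 = 49 * (ell%:R * r * kd) ^+ 2 by ring.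
by apply: ler_wpM2r; [exact: sqr_ge0|rewrite ler_nat].
Qed.

(** On a vector orthogonal to the block means the pairing of [Wx] with itself is diagonal in the
    transitions, so no correlation of neighbours enters; every term containing [Ux] is small by
    Cauchy-Schwarz. *)
Lemma PhiW T (A : 'M[R]_(d + d)) x z : good T -> A^T = A -> nrm x <= 1 -> nrm z <= 1 ->
  (forall I, dot (uvec I) x = 0) ->
  `|Phi T A x z - mainW T A x z| <= (2 * kap + 18 * (ell%:R ^+ 2 * kap)) * (kd * opnorm A).
Proof.
move=> gT hA hx hz xu; rewrite /Phi -mainW_sum -sumrB.
have o0 := opnorm_ge0 A; have k0 := kd_ge0; have kp := kap_ge0.
apply: (le_trans (ler_norm_sum _ _ _)).
apply: (@le_trans _ _ (\sum_(i < n) (r ^+ 2 * (#|Tb T i|%:R * (2 * kd ^+ 3 * opnorm A)) +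
  (opnorm A * (ell%:R * r * (2 * kd) * (ell%:R * r * (2 * kd ^+ 2))) + opnorm A * (ell%:R * r * (2 * kd ^+ 2) * (7 * ell%:R * r * kd)))))).
  apply: ler_sum => i _.
  have Sx w : HF (Tb T i) w *m x = SX Wx T i w x + SX Ux T i w x.
    by rewrite HFb_SX (SXC0 T i w xu) addr0.
  have E (w : Om) : dot x (HF (Tb T i) w *m (A *m (HF (Tb T i) w *m z))) =
     dot (SX Wx T i w x) (A *m SX Wx T i w z) + dot (SX Cx T i w z) (A *m SX Wx T i w x) + (dot (SX Wx T i w x) (A *m SX Ux T i w z)
      + dot (SX Ux T i w x) (A *m (HF (Tb T i) w *m z))).
    rewrite (dot_tr (SX Cx T i w z) _ hA) -dot_sym ?HF_sym // Sx dotDl {1}HFb_SX !mulmxDr !dotDr; ring.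
  rewrite (eq_Ex mu E) !ExD.
  have Z : Ex (fun w => dot (SX Cx T i w z) (A *m SX Wx T i w x)) = 0.
    rewrite Ex_SXSX big1 ?mulr0 // => s _; rewrite big1 // => t.
    by rewrite inE => /andP[tT _]; apply: Ex_CW0 => //; apply: nx_neq gT tT.
  rewrite Z addr0 addrAC; apply: (le_trans (ler_normD _ _)); apply: lerD; first exact: WW_block.
  apply: (le_trans (ler_normD _ _)); apply: lerD.
    apply: Ex_dot_CS; [by rewrite !mulr_ge0|by rewrite !mulr_ge0 ?sqr_ge0|exact: SW2|exact: SU2].
  apply: Ex_dot_CS; [by rewrite !mulr_ge0 ?sqr_ge0|by rewrite !mulr_ge0|exact: SU2|].
  apply: (le_trans (HFb_var i z gT)); apply: le_trans vS_le; rewrite -[leRHS]mulr1.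
  by apply: ler_wpM2l; [exact: vS_ge0|rewrite expr_le1 ?nrm_ge0].
rewrite big_split [leRHS]mulrDl; apply: lerD.
  have c0 : 0 <= 2 * kd ^+ 3 * opnorm A by rewrite !mulr_ge0 ?exprn_ge0.
  apply: (le_trans (card_Tb_sum T c0)).
  have -> : n%:R * r ^+ 2 * (2 * kd ^+ 3 * opnorm A) = n%:R * r ^+ 2 * kd ^+ 2 * (2 * (kd * opnorm A)) by ring.
  have -> : 2 * kap * (kd * opnorm A) = kap * (2 * (kd * opnorm A)) by ring.
  by apply: ler_wpM2r; [rewrite !mulr_ge0|exact: nr2kd].
rewrite sum_ord_cst.
have -> : n%:R * (opnorm A * (ell%:R * r * (2 * kd) * (ell%:R * r * (2 * kd ^+ 2))) + opnorm A * (ell%:R * r * (2 * kd ^+ 2) * (7 * ell%:R * r * kd))) =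
  n%:R * r ^+ 2 * kd ^+ 2 * (18 * (ell%:R ^+ 2 * (kd * opnorm A))) by ring.
have -> : 18 * (ell%:R ^+ 2 * kap) * (kd * opnorm A) = kap * (18 * (ell%:R ^+ 2 * (kd * opnorm A))) by ring.
by apply: ler_wpM2r; [rewrite !mulr_ge0 ?sqr_ge0|exact: nr2kd].
Qed.

Definition DI T I A := \sum_J chat T I J * tauM J A.
Definition uhat I := Num.sqrt (bsz I) *: uvec I.

Lemma nrm_uhat I : nrm (uhat I) = 1.
Proof.
rewrite nrmZ ger0_norm ?sqrtr_ge0 //.
apply/eqP; rewrite -sqrp_eq1 ?mulr_ge0 ?sqrtr_ge0 ?nrm_ge0 // exprMn nrm_u // sqr_sqrtr ?bsz_ge0 //.
by rewrite mulfV // gt_eqF.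
Qed.

Lemma hat_arith (r2 b q S u : R) : 0 < q -> q ^+ 2 = b -> r2 / b * S * (q * u) = r2 * (S * (u / q)).
Proof. by move=> q0 <-; field; rewrite gt_eqF. Qed.

Lemma mainU_hat T A I z : mainU T A (uhat I) z = DI T I A * dot (uhat I) z.
Proof.
have E s : dot (uvec s) (uhat I) = (s == I)%:R / Num.sqrt (bsz I).
  rewrite /uhat dotZr dot_uu //; have := bsz_gt0 I; have [->|_] := eqVneq s I; last by rewrite !mul0r mulr0.
  move=> b0; have : Num.sqrt (bsz I) ^+ 2 = bsz I by rewrite sqr_sqrtr ?ltW.
  have : 0 < Num.sqrt (bsz I) by rewrite sqrtr_gt0.
  set q := Num.sqrt _ => q0 <-; by field; rewrite gt_eqF.
have b0 := bsz_gt0 I; have q0 : 0 < Num.sqrt (bsz I) by rewrite sqrtr_gt0.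
have qq : Num.sqrt (bsz I) ^+ 2 = bsz I by rewrite sqr_sqrtr ?ltW.
rewrite /mainU /DI chat_sum {2}/uhat dotZl (hat_arith _ _ _ q0 qq); congr (_ * _).
rewrite mulr_suml; apply: eq_bigr => s _; rewrite !E.
have h J : (J == I)%:R / Num.sqrt (bsz I) * dot (uvec J) z = (J == I)%:R * (dot (uvec I) z / Num.sqrt (bsz I)).
  by have [->|_] := eqVneq J I; rewrite ?mul1r ?mul0r // mulrC.
rewrite !h [in RHS]addrC; ring.
Qed.

(** An exact identity, because [PB] reproduces the centred vectors of its block. *)
Lemma mainW_w T A l z : mainW T A (wvec l) z = DI T (blk l) A * dot (wvec l) z.
Proof.
have E I : avgw I (wvec l) z = (I == blk l)%:R / bsz (blk l) * dot (wvec l) z.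
  rewrite /avgw /avg -/(PB part I (wvec l) z) PBw // eq_sym.
  by have [->|_] := eqVneq I (blk l); rewrite ?mul0r // mul1r mulrC.
have ar (r2 b S X : R) : r2 / b * S * X = r2 * (S * (X / b)) by ring.
rewrite /mainW /DI chat_sum ar mulr_suml; congr (_ * _).
apply: eq_bigr => s _; rewrite !E; ring.
Qed.

Lemma PhiZ T A x a z : Phi T A x (a *: z) = a * Phi T A x z.
Proof.
rewrite /Phi mulr_sumr; apply: eq_bigr => i _; rewrite -ExZ; apply: eq_Ex => w.
by rewrite -!scalemxAr dotZr.
Qed.

Lemma scale_z (F : 'cV[R]_(d + d) -> R) c : (forall a z, F (a *: z) = a * F z) -> 
  (forall z, nrm z <= 1 -> `|F z| <= c) -> forall z, `|F z| <= c * nrm z.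
Proof.
move=> hF hc z; have [/eqP h|h] := boolP (nrm z == 0).
  by rewrite h mulr0 (nrm_eq0 h) -(scale0r 0) hF mul0r normr0.
have z0 : 0 < nrm z by rewrite lt_neqAle eq_sym h nrm_ge0.
have : `|F ((nrm z)^-1 *: z)| <= c.
  by apply: hc; rewrite nrmZ ger0_norm ?invr_ge0 ?nrm_ge0 // mulVf.
by rewrite hF normrM ger0_norm ?invr_ge0 ?nrm_ge0 // mulrC ler_pdivrMr.
Qed.

Lemma PhiU_hat T A I z : good T -> A^T = A ->
  `|Phi T A (uhat I) z - DI T I A * dot (uhat I) z| <=
  (2 * kap * rho A + 4 * (ell%:R ^+ 2 * kap) * (kd * opnorm A)) * nrm z.
Proof.
move=> gT hA; apply: (@scale_z (fun z => Phi T A (uhat I) z - DI T I A * dot (uhat I) z)) => [a z'|z' hz].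
  by rewrite PhiZ dotZr; ring.
rewrite -mainU_hat; apply: PhiU => //; first by rewrite nrm_uhat.
by move=> l; rewrite /uhat dotZr dot_wu // mulr0.
Qed.

Lemma PhiW_w T A l z : good T -> A^T = A ->
  `|Phi T A (wvec l) z - DI T (blk l) A * dot (wvec l) z| <=
  (2 * kap + 18 * (ell%:R ^+ 2 * kap)) * (kd * opnorm A) * nrm z.
Proof.
move=> gT hA; apply: (@scale_z (fun z => Phi T A (wvec l) z - DI T (blk l) A * dot (wvec l) z)) => [a z'|z' hz].
  by rewrite PhiZ dotZr; ring.
rewrite -mainW_w; apply: PhiW => //; first exact: nrm_w.
by move=> I; rewrite dotC dot_wu.
Qed.
Definition mpow (G : 'M[R]_(d + d)) k : 'M[R]_(d + d) := iter k (mulmx G) 1%:M.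

Lemma mpowE G k x : pw G k x = mpow G k *m x.
Proof. by elim: k => [|k IH]; [rewrite /= mul1mx|rewrite pwS IH mulmxA]. Qed.

Lemma mpow_sym G k : G^T = G -> (mpow G k)^T = mpow G k.
Proof.
move=> h; apply/matrixP => i j; rewrite mxE.
have E i' j' : mpow G k i' j' = dot (bvec R i') (mpow G k *m bvec R j').
  rewrite dot_bvecl mxE (bigD1 j') //= mxE !eqxx mulr1 big1 ?addr0 // => l hl.
  by rewrite mxE (negbTE hl) mulr0.
by rewrite !E -!mpowE -dot_pw // dotC.
Qed.

Lemma mpow_le G k : opnorm (mpow G k) <= opnorm G ^+ k.
Proof. by apply: opnorm_le => x hx; rewrite -mpowE; apply: nrm_pw1. Qed.

Definition Px (x : 'cV[R]_(d + d)) := x - \sum_I dot (uhat I) x *: uhat I.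

Lemma dot_uhat I J : dot (uhat I) (uhat J) = (I == J)%:R.
Proof.
rewrite /uhat dotZl dotZr dot_uu //; have [<-|_] := eqVneq I J; last by rewrite mul0r !mulr0.
have b0 := bsz_gt0 I; rewrite mulrA -expr2 sqr_sqrtr ?ltW //.
by rewrite mul1r mulfV ?gt_eqF.
Qed.

Lemma uhat_Px I x : dot (uhat I) (Px x) = 0.
Proof.
rewrite /Px dotBr dot_sumr (bigD1 I) //= dotZr dot_uhat eqxx mulr1 big1 ?addr0 ?subrr // => J hJ.
by rewrite dotZr dot_uhat eq_sym (negbTE hJ) mulr0.
Qed.

Lemma u_uhat I x : dot (uvec I) x = dot (uhat I) x / Num.sqrt (bsz I).
Proof.
have q0 : 0 < Num.sqrt (bsz I) by rewrite sqrtr_gt0.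
rewrite /uhat (dotZl (Num.sqrt (bsz I)) (uvec I) x) mulrAC mulfV ?mul1r // gt_eqF //.
Qed.

Lemma u_Px I x : dot (uvec I) (Px x) = 0.
Proof. by rewrite u_uhat uhat_Px mul0r. Qed.

Lemma nrm_Px_sqr x : nrm x ^+ 2 = nrm (Px x) ^+ 2 + \sum_I dot (uhat I) x ^+ 2.
Proof.
have -> : nrm (Px x) ^+ 2 = dot (Px x) x.
  rewrite nrm_sqr {2}/Px dotBr dot_sumr big1 ?subr0 // => I _.
  by rewrite dotZr (dotC (Px x)) uhat_Px mulr0.
rewrite /Px dotBl dot_suml nrm_sqr.
rewrite [X in _ - X](eq_bigr (fun I => dot (uhat I) x ^+ 2)) ?subrK // => I _.
by rewrite dotZl expr2.
Qed.

Lemma nrm_Px x : nrm (Px x) <= nrm x.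
Proof.
apply: le_sqr2; rewrite ?nrm_ge0 // (nrm_Px_sqr x) lerDl; apply: sumr_ge0 => I _; exact: sqr_ge0.
Qed.

Lemma HP_Px T w x : HP T w *m Px x = HP T w *m x.
Proof.
rewrite /Px mulmxBr mulmx_sumr big1 ?subr0 // => I _.
by rewrite -scalemxAr /uhat -scalemxAr HP_u !scaler0.
Qed.

(** The image of the block mean under [HF], multiplied by the block size; see [HF_u]. *)
Definition qv (T : {set 'I_n}) (w : Om) (I : 'I_(K + K)) : 'cV[R]_(d + d) := r *: \sum_(s in T) ((Bb s == I)%:R *: av s w + (Ab s == I)%:R *: bv s w).

Lemma HF_HP T w x : HF T w *m x = HP T w *m x + \sum_I (dot (uvec I) x *: qv T w I + dot (qv T w I) x *: uvec I).
Proof.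
rewrite HFx HPx.
have -> : \sum_(s in T) (Wx s w x + Cx s w x + Ux s w x) = \sum_(s in T) Wx s w x + \sum_(s in T) (Cx s w x + Ux s w x).
  by rewrite -big_split; apply: eq_bigr => s _; exact (esym (addrA _ _ _)).
rewrite scalerDr; congr (_ + _).
rewrite (eq_bigr (fun I => r *: \sum_(s in T) (dot (uvec I) x *: ((Bb s == I)%:R *: av s w + (Ab s == I)%:R *: bv s w) +
   ((Bb s == I)%:R * dot (av s w) x + (Ab s == I)%:R * dot (bv s w) x) *: uvec I))); last first.
  move=> I _; rewrite big_split scalerDr /= -scaler_sumr /qv; congr (_ + _).
    by rewrite !scalerA mulrC.
  rewrite dotZl dot_suml -scalerA scaler_suml; congr (_ *: _); apply: eq_bigr => s _.
  by congr (_ *: _); rewrite dotDl !dotZl.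
rewrite -scaler_sumr exchange_big /=; congr (_ *: _); apply: eq_bigr => s _.
have pick J (F : 'I_(K + K) -> 'cV[R]_(d + d)) : \sum_I (J == I)%:R *: F I = F J.
  rewrite (bigD1 J) //= eqxx scale1r big1 ?addr0 // => I hI.
  by rewrite eq_sym (negbTE hI) scale0r.
rewrite (eq_bigr (fun I => ((Bb s == I)%:R *: (dot (uvec I) x *: av s w) + (Ab s == I)%:R *: (dot (uvec I) x *: bv s w)) +
   ((Bb s == I)%:R *: (dot (av s w) x *: uvec I) + (Ab s == I)%:R *: (dot (bv s w) x *: uvec I)))); last first.
  move=> I _; move: (av s w) (bv s w) (uvec I) => a b u.
  by rewrite scalerDr scalerDl !scalerA !(mulrC (dot u x)).
by rewrite !big_split /= !pick.
Qed.

Lemma wperp_HP T w x I : dot (uvec I) (HP T w *m x) = 0.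
Proof. by rewrite -dot_sym ?HP_sym // HP_u dot0l. Qed.

Lemma wperp_q T w I J : dot (uvec J) (qv T w I) = 0.
Proof.
rewrite /qv dotZr dot_sumr big1 ?mulr0 // => s _.
by rewrite dotDr !dotZr /av /bv ![dot (uvec J) _]dotC !dot_wu // !mulr0 addr0.
Qed.

(** On a vector without block means, [HF] differs from [HP] only by a component along the block
    means, orthogonal to the image of [HP]. *)
Lemma opn_HP_HF T w : opnorm (HP T w) <= opnorm (HF T w).
Proof.
apply: opnorm_le => x hx; rewrite -HP_Px.
have h : nrm (HP T w *m Px x) <= nrm (HF T w *m Px x).
  rewrite HF_HP (eq_bigr (fun I => dot (qv T w I) (Px x) *: uvec I)); last first.
    by move=> I _; rewrite u_Px scale0r add0r.
  apply: le_sqr2; rewrite ?nrm_ge0 // !nrm_sqr dotDl !dotDr.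
  have Z : dot (HP T w *m Px x) (\sum_I dot (qv T w I) (Px x) *: uvec I) = 0.
    by rewrite dot_sumr big1 // => I _; rewrite dotZr (dotC (HP T w *m Px x)) wperp_HP mulr0.
  by rewrite (dotC (\sum_I _)) Z addr0 add0r lerDl dot_ge0.
apply: (le_trans h); apply: opnorm_ub; exact: le_trans (nrm_Px x) hx.
Qed.

Lemma HF_u T w I : HF T w *m uvec I = (bsz I)^-1 *: qv T w I.
Proof.
rewrite HF_HP HP_u add0r (bigD1 I) //= big1 ?addr0 => [|J hJ].
  by rewrite dot_uu // eqxx mul1r (dotC (qv T w I)) wperp_q scale0r addr0.
by rewrite dot_uu // (negbTE hJ) mul0r scale0r add0r (dotC (qv T w J)) wperp_q scale0r.
Qed.

Lemma qv_le T w I : nrm (qv T w I) * nrm (uvec I) <= opnorm (HF T w).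
Proof.
have b0 := bsz_gt0 I.
have -> : qv T w I = bsz I *: (HF T w *m uvec I) by rewrite HF_u scalerA mulfV ?gt_eqF // scale1r.
rewrite nrmZ gtr0_norm //; have h := opnormP (HF T w) (uvec I).
have u0 := nrm_ge0 (uvec I); have o0 := opnorm_ge0 (HF T w).
apply: (@le_trans _ _ (bsz I * (opnorm (HF T w) * nrm (uvec I)) * nrm (uvec I))).
  by apply: ler_wpM2r => //; apply: ler_wpM2l => //; apply: ltW.
have -> : bsz I * (opnorm (HF T w) * nrm (uvec I)) * nrm (uvec I) = opnorm (HF T w) * (bsz I * nrm (uvec I) ^+ 2) by ring.
by rewrite nrm_u // mulfV ?gt_eqF // mulr1.
Qed.

(** The Bessel bound needed to average a rank-one term. It holds for the identity, giving the
    [tauM], and for the exchange of rows and columns, giving the [rlM]. *)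
Definition admis I (f : 'I_(d + d) -> 'I_(d + d)) := forall y y',
  `|avg I (fun l => dot (wvec l) y * dot (wvec (f l)) y')| <= kd ^+ 2 * (nrm y * nrm y').

Lemma swK : involutive sw.
Proof. by move=> l; rewrite -(splitK l); case: (fintype.split l) => j /=; rewrite ?swl ?swr ?swl. Qed.

Lemma admis_id I : admis I id.
Proof. exact: avgPB. Qed.

Lemma admis_sw I : admis I sw.
Proof.
move=> y y'; rewrite /avg normrM mulrC (ger0_norm (x := _^-1)) ?invr_ge0 ?bsz_ge0 //.
apply: ler_pM; rewrite ?invr_ge0 ?bsz_ge0 ?kd2 ?bszV_le //.
apply: le_sqr2; first by rewrite mulr_ge0 ?nrm_ge0.
rewrite real_normK ?num_real //; apply: (le_trans (sum_CS _ _ _)); rewrite exprMn.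
have h z : \sum_(l | blk l == I) dot (wvec l) z ^+ 2 <= nrm z ^+ 2.
  apply: le_trans (sum_w_sqr bsz_gt0 z); rewrite [leRHS](bigID (fun l => blk l == I)) /= lerDl.
  by apply: sumr_ge0 => l _; apply: sqr_ge0.
apply: ler_pM; rewrite ?h //; try by apply: sumr_ge0 => l _; apply: sqr_ge0.
apply: le_trans (sum_w_sqr bsz_gt0 y'); rewrite [leRHS](reindex_inj (inv_inj swK)) /=.
rewrite [leRHS](bigID (fun l => blk l == I)) /= lerDl.
by apply: sumr_ge0 => l _; apply: sqr_ge0.
Qed.

(** A rank-one insertion splits the diagonal entry into two linear forms, so averaging over the
    block gains [kd ^+ 2], of order [1 / d]. *)
Lemma rank1_avg I f (G G' : 'M[R]_(d + d)) a j al be x1 x2 : admis I f -> G'^T = G' ->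
  nrm (pw G a al) <= x1 -> nrm (pw G' j be) <= x2 ->
  `|avg I (fun l => dot (wvec l) (pw G a (dot be (pw G' j (wvec (f l))) *: al)))| <= kd ^+ 2 * (x1 * x2).
Proof.
move=> hf hG h1 h2.
have E l : dot (wvec l) (pw G a (dot be (pw G' j (wvec (f l))) *: al)) = dot (wvec l) (pw G a al) * dot (wvec (f l)) (pw G' j be).
  by rewrite pwZ dotZr mulrC; congr (_ * _); rewrite -dot_pw // dotC.
rewrite (@eq_avg _ _ _ _ _ _ (fun l => dot (wvec l) (pw G a al) * dot (wvec (f l)) (pw G' j be))); last by move=> l _; exact: E.
apply: (le_trans (hf _ _)); apply: ler_wpM2l; first exact: sqr_ge0.
by apply: ler_pM; rewrite ?nrm_ge0.
Qed.

Lemma avgD_le I p q (x y : R) : `|avg I p| <= x -> `|avg I q| <= y -> `|avg I (fun l => p l + q l)| <= x + y.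
Proof. by move=> h1 h2; rewrite avgD; apply: (le_trans (ler_normD _ _)); apply: lerD. Qed.

Lemma Ym_avg I f (G G' : 'M[R]_(d + d)) a j s w x1 x2 : admis I f -> G'^T = G' ->
  (forall al, nrm al <= 1 -> nrm (pw G a al) <= x1) -> (forall al, nrm al <= 1 -> nrm (pw G' j al) <= x2) ->
  `|avg I (fun l => dot (wvec l) (pw G a (Ym s w *m pw G' j (wvec (f l)))))| <= 6 * (kd ^+ 2 * (x1 * x2)).
Proof.
move=> hf hG h1 h2.
have ha := nrm_av s w; have hb := nrm_bv s w; have hA := nrm_u_le1 (Ab s); have hB := nrm_u_le1 (Bb s).
have E l : dot (wvec l) (pw G a (Ym s w *m pw G' j (wvec (f l)))) =
   (dot (wvec l) (pw G a (dot (bv s w) (pw G' j (wvec (f l))) *: av s w)) +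
    dot (wvec l) (pw G a (dot (av s w) (pw G' j (wvec (f l))) *: bv s w))) +
  ((dot (wvec l) (pw G a (dot (uvec (Bb s)) (pw G' j (wvec (f l))) *: av s w)) +
    dot (wvec l) (pw G a (dot (uvec (Ab s)) (pw G' j (wvec (f l))) *: bv s w))) +
   (dot (wvec l) (pw G a (dot (av s w) (pw G' j (wvec (f l))) *: uvec (Bb s))) +
    dot (wvec l) (pw G a (dot (bv s w) (pw G' j (wvec (f l))) *: uvec (Ab s))))).
  rewrite YmE -addrA /Wx /Cx /Ux; move: (av s w) (bv s w) (uvec (Ab s)) (uvec (Bb s)) => p q u u'.
  by rewrite !pw_add !dotDr.
rewrite (@eq_avg _ _ _ _ _ _ _ (fun l _ => E l)).
set c := kd ^+ 2 * (x1 * x2); have -> : 6 * c = (c + c) + ((c + c) + (c + c)) by ring.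
by do !apply: avgD_le; (apply: rank1_avg => //; [exact: h1|exact: h2]).
Qed.

(** * The recursion for powers of the full matrix along the block means *)

Section Full.
Variables (T : {set 'I_n}) (P : nat) (Mo : R).
Hypothesis gT : good T.
Hypothesis s1 : sS <= 1.
Hypothesis hMo : forall i, Ex (fun w => (opnorm (HF (T0 T i) w) + 1) ^+ P) <= Mo.
Let thi i w := opnorm (HF (T0 T i) w) + 1.
Let th w := thi 0 w.

Lemma thi_ge1 i w : 1 <= thi i w. Proof. by rewrite lerDr opnorm_ge0. Qed.
Lemma thi_ge0 i w : 0 <= thi i w. Proof. exact: le_trans (thi_ge1 i w). Qed.
Lemma thi_pow0 i w p : 0 <= thi i w ^+ p. Proof. by rewrite exprn_ge0 ?thi_ge0. Qed.
Lemma HF_thi i w : opnorm (HF T w) <= thi i w.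
Proof.
have -> : HF T w = HF (T0 T i) w + HF (Tb T i) w by rewrite -HF_split addrC subrK.
by apply: (le_trans (opnormD _ _)); rewrite lerD2l (le_trans (HFb_le _ _ gT)).
Qed.
Lemma thi_Mo i p : (p <= P)%N -> Ex (fun w => thi i w ^+ p) <= Mo.
Proof.
move=> h; apply: le_trans (hMo i); apply: Ex_le => // w.
by apply: ler_weXn2l => //; apply: thi_ge1.
Qed.
Lemma Mo_ge1 : 1 <= Mo.
Proof. by have := thi_Mo 0 (leq0n P); rewrite (eq_Ex mu (g := fun=> 1)) ?Ex_cst // => w; rewrite expr0. Qed.
Lemma Mo_ge0' : 0 <= Mo. Proof. exact: le_trans Mo_ge1. Qed.

Lemma pwF_th i w k x : nrm (pw (HF T w) k x) <= thi i w ^+ k * nrm x.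
Proof.
apply: (le_trans (nrm_pw _ _ _)); apply: ler_wpM2r; first exact: nrm_ge0.
by apply: lerXn2r; rewrite ?nnegrE ?opnorm_ge0 ?thi_ge0 ?HF_thi.
Qed.
Lemma pwF0_th i w k x : nrm (pw (HF (T0 T i) w) k x) <= thi i w ^+ k * nrm x.
Proof.
apply: (le_trans (nrm_pw _ _ _)); apply: ler_wpM2r; first exact: nrm_ge0.
by apply: lerXn2r; rewrite ?nnegrE ?opnorm_ge0 ?thi_ge0 // lerDl.
Qed.
Lemma mpow_th w k : opnorm (mpow (HF T w) k) <= th w ^+ k.
Proof.
apply: (le_trans (mpow_le _ _)).
by apply: lerXn2r; rewrite ?nnegrE ?opnorm_ge0 ?thi_ge0 ?HF_thi.
Qed.

Definition d1 : R := 2 * P%:R ^+ 2 * (40 * (ell%:R ^+ 2 * kap)) * (sS * Mo).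

Lemma d1_ge0 : 0 <= d1.
Proof. by rewrite /d1 !mulr_ge0 ?sqr_ge0 ?kap_ge0 ?sS_ge0 ?Mo_ge0'. Qed.

Lemma fu_second k x y : (k <= P)%N -> nrm x <= 1 -> nrm y <= 1 ->
  `|Ex (fun w => dot x (pw (HF T w) k.+1 y)) -
    \sum_(j < k) Ex (fun w => Phi T (mpow (HF T w) (k - j.+1)) x (pw (HF T w) j y))| <= d1.
Proof.
move=> kP hx hy.
have S0 := @second_order R _ _ mu mu0 mu1 g n (d + d) (HF T) (fun i w => HF (T0 T i) w) sS vS
  (fun w => HF_sum T w) (fun w => HF_sym T w) (fun i w w' => HF_T0_mix i w w' gT).
have h1 i w w' : HF T (mix (inblk g i) w w') - HF (T0 T i) (mix (inblk g i) w w') = HF T w' - HF (T0 T i) w'.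
  by rewrite !HF_split HF_Tb_mix.
have h2 i x' y' : Ex (fun w => dot x' ((HF T w - HF (T0 T i) w) *m y')) = 0.
  rewrite (eq_Ex mu (g := fun w => dot x' (HF (Tb T i) w *m y'))) ?HFb_mean // => w; by rewrite HF_split.
have h3 i x' : Ex (fun w => nrm ((HF T w - HF (T0 T i) w) *m x') ^+ 2) <= vS * nrm x' ^+ 2.
  rewrite (eq_Ex mu (g := fun w => nrm (HF (Tb T i) w *m x') ^+ 2)) ?HFb_var // => w; by rewrite HF_split.
have h4 i w : opnorm (HF T w - HF (T0 T i) w) <= sS by rewrite HF_split HFb_le.
have {}S0 := S0 h1 h2 h3 h4 (fun i w => HF_sym _ w) s1 sS_ge0 vS_ge0 P Mo hMo k x y kP hx hy.
have E j w : \sum_(i < n) phi mu (HF T) (fun i w => HF (T0 T i) w) i (HF T w) (k - j.+1) x (pw (HF T w) j y) =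
  Phi T (mpow (HF T w) (k - j.+1)) x (pw (HF T w) j y).
  apply: eq_bigr => i _; apply: eq_Ex => w'; by rewrite mpowE HF_split.
move: S0; under eq_bigr => j _ do rewrite (eq_Ex mu (E j)).
move=> S0; apply: (le_trans S0).
have -> : n%:R * (k%:R * (k%:R * (2 * (vS * sS * Mo)))) = k%:R ^+ 2 * (2 * ((n%:R * vS) * (sS * Mo))) by ring.
have -> : d1 = P%:R ^+ 2 * (2 * ((40 * (ell%:R ^+ 2 * kap)) * (sS * Mo))) by rewrite /d1; ring.
have sM : 0 <= sS * Mo by rewrite mulr_ge0 ?sS_ge0 ?Mo_ge0'.
apply: ler_pM; rewrite ?sqr_ge0 //.
- by rewrite mulr_ge0 // mulr_ge0 // mulr_ge0 ?vS_ge0.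
- by apply: lerXn2r; rewrite ?nnegrE // ler_nat.
- by apply: ler_wpM2l => //; apply: ler_wpM2r => //; apply: nvS.
Qed.

(** Treats diagonal averages and neighbour correlations together; [f] is the identity or [sw]. *)
Definition gpM I f (G : 'M[R]_(d + d)) p := avg I (fun l => dot (wvec l) (pw G p (wvec (f l)))).

Lemma tauM_gp J G p : tauM J (mpow G p) = gpM J id G p.
Proof. by apply: eq_avg => l _; rewrite mpowE. Qed.
Lemma rlM_gp k G p : rlM k (mpow G p) = gpM (lshift K k) sw G p.
Proof. by apply: eq_avg => l _; rewrite mpowE. Qed.

Lemma avgB I (p q : 'I_(d + d) -> R) : avg I (fun l => p l - q l) = avg I p - avg I q.
Proof. by rewrite /avg sumrB mulrBl. Qed.

Lemma gp_tele I f (G G' : 'M[R]_(d + d)) p :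
  gpM I f G p - gpM I f G' p = \sum_(j < p) avg I (fun l => dot (wvec l) (pw G (p - j.+1) ((G - G') *m pw G' j (wvec (f l))))).
Proof.
rewrite /gpM -avgB -avg_sum; apply: eq_avg => l _.
by rewrite -dotBr (pw_tele G G') [X in dot _ (X - _)]addrC addrK dot_sumr.
Qed.

Lemma gp_diff I f i w p : admis I f ->
  `|gpM I f (HF T w) p - gpM I f (HF (T0 T i) w) p| <= 6 * ell%:R * r * kd ^+ 2 * (p%:R * thi i w ^+ p).
Proof.
move=> hf; rewrite gp_tele; apply: (le_trans (ler_norm_sum _ _ _)).
have k2 : 0 <= kd ^+ 2 by apply: sqr_ge0.
apply: (@le_trans _ _ (\sum_(j < p) r * (ell%:R * (6 * (kd ^+ 2 * thi i w ^+ p))))); last first.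
  by rewrite sum_ord_cst le_eqVlt; apply/orP; left; apply/eqP; ring.
apply: ler_sum => j _; have hj := ltn_ord j.
have E l : dot (wvec l) (pw (HF T w) (p - j.+1) ((HF T w - HF (T0 T i) w) *m pw (HF (T0 T i) w) j (wvec (f l)))) =
  r * \sum_(s in Tb T i) dot (wvec l) (pw (HF T w) (p - j.+1) (Ym s w *m pw (HF (T0 T i) w) j (wvec (f l)))).
  by rewrite HF_split HFb_x pwZ dotZr pw_sum dot_sumr.
rewrite (@eq_avg _ _ _ _ _ _ _ (fun l _ => E l)) avgZ avg_sum normrM ger0_norm //.
apply: ler_wpM2l => //; apply: (le_trans (ler_norm_sum _ _ _)).
have c0 : 0 <= 6 * (kd ^+ 2 * thi i w ^+ p) by apply: mulr_ge0 => //; apply: mulr_ge0 => //; exact: thi_pow0.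
apply: le_trans (sum_cst_le c0 (card_Tb i gT)); apply: ler_sum => s _.
apply: (@le_trans _ _ (6 * (kd ^+ 2 * (thi i w ^+ (p - j.+1) * thi i w ^+ j)))).
  apply: Ym_avg => //; first exact: HF_sym.
    move=> al ha; apply: (le_trans (pwF_th i _ _ _)); rewrite -[leRHS]mulr1; apply: ler_wpM2l => //; exact: thi_pow0.
  move=> al ha; apply: (le_trans (pwF0_th i _ _ _)); rewrite -[leRHS]mulr1; apply: ler_wpM2l => //; exact: thi_pow0.
apply: ler_wpM2l => //; apply: ler_wpM2l => //; rewrite -exprD; apply: ler_weXn2l; first exact: thi_ge1.
by clear - hj; lia.
Qed.

Definition Vb : R := 72 * (ell%:R ^+ 2 * kap) * P%:R ^+ 2 * (kd ^+ 2 * Mo).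

(** Efron-Stein: a block has influence of order [r * kd ^+ 2], and [n * r ^+ 2 * kd ^+ 2] is
    bounded, so the variance is of order [kd ^+ 2]. Here the powers are fixed and moments of norms
    are affordable. *)
Lemma gp_var I f p : admis I f -> (p + p <= P)%N ->
  Ex (fun w => (gpM I f (HF T w) p - Ex (fun w => gpM I f (HF T w) p)) ^+ 2) <= Vb.
Proof.
move=> hf pP; pose c : R := 6 * ell%:R * r * kd ^+ 2 * p%:R.
have c0 : 0 <= c by rewrite /c !mulr_ge0 ?sqr_ge0 ?kd_ge0.
have := @variance_le R _ _ mu mu0 mu1 g n g_lt (fun w => gpM I f (HF T w) p) (fun i w => gpM I f (HF (T0 T i) w) p) (c ^+ 2 * Mo).
move=> h; apply: (le_trans (h _ _)).
- move=> i w w'; by rewrite HF_T0_mix.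
- move=> i; apply: (@le_trans _ _ (Ex (fun w => c ^+ 2 * thi i w ^+ (p + p)))); last first.
    by rewrite ExZ; apply: ler_wpM2l; [exact: sqr_ge0|exact: thi_Mo].
  apply: Ex_le => // w; rewrite exprD -expr2 -exprMn -(real_normK (num_real (_ - _))).
  apply: lerXn2r; [by rewrite nnegrE|by rewrite nnegrE; apply: mulr_ge0 => //; exact: thi_pow0|].
  by apply: (le_trans (gp_diff _ _ _ hf)); rewrite /c -!mulrA.
have -> : n%:R * (2 * (c ^+ 2 * Mo)) = n%:R * r ^+ 2 * kd ^+ 2 * (72 * (ell%:R ^+ 2) * (p%:R ^+ 2 * (kd ^+ 2 * Mo))) by rewrite /c; ring.
have -> : Vb = kap * (72 * (ell%:R ^+ 2) * (P%:R ^+ 2 * (kd ^+ 2 * Mo))) by rewrite /Vb; ring.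
have kM : 0 <= kd ^+ 2 * Mo by rewrite mulr_ge0 ?sqr_ge0 ?Mo_ge0'.
have pp : 0 <= 72 * ell%:R ^+ 2 * (p%:R ^+ 2 * (kd ^+ 2 * Mo)) by apply: mulr_ge0; apply: mulr_ge0 => //; apply: sqr_ge0.
apply: ler_pM; rewrite ?nr2kd //; first by rewrite !mulr_ge0 ?sqr_ge0 ?kd_ge0.
apply: ler_wpM2l; first by rewrite mulr_ge0 ?sqr_ge0.
apply: ler_wpM2r => //; apply: lerXn2r; rewrite ?nnegrE // ler_nat; clear - pP; lia.
Qed.

Lemma Ex_abs_CS (F G : Om -> R) a b : 0 <= a -> 0 <= b -> Ex (fun w => F w ^+ 2) <= a ^+ 2 -> Ex (fun w => G w ^+ 2) <= b ^+ 2 ->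
  Ex (fun w => `|F w| * `|G w|) <= a * b.
Proof.
move=> a0 b0 hF hG; apply: le_sqr2; first exact: mulr_ge0.
apply: (le_trans (Ex_CS mu0 _ _)); rewrite exprMn.
have E (X : Om -> R) : Ex (fun w => `|X w| ^+ 2) = Ex (fun w => X w ^+ 2).
  by apply: eq_Ex => w; rewrite real_normK // num_real.
by rewrite !E; apply: ler_pM => //; apply: Ex_ge0 => // w; apply: sqr_ge0.
Qed.

Lemma th2_Mo p : (p + p <= P)%N -> Ex (fun w => (th w ^+ p) ^+ 2) <= Mo ^+ 2.
Proof.
move=> h; rewrite (eq_Ex mu (g := fun w => th w ^+ (p + p))); last by move=> w; rewrite expr2 -exprD.
apply: (le_trans (thi_Mo 0 h)); rewrite expr2 ler_peMr ?Mo_ge0' ?Mo_ge1 //.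
Qed.
Definition CW : R := 2 * kap + 18 * (ell%:R ^+ 2 * kap).
Definition dl : R := P%:R * (CW * (kd * Mo)) + d1 + Num.sqrt Vb.
Definition AA : R := 2 * kap * Mo * P%:R + 1.

Lemma CW_ge0 : 0 <= CW.
Proof. by rewrite /CW addr_ge0 // mulr_ge0 ?kap_ge0 // mulr_ge0 ?kap_ge0 ?sqr_ge0. Qed.
Lemma Vb_ge0 : 0 <= Vb.
Proof.
rewrite /Vb; apply: mulr_ge0; last by rewrite mulr_ge0 ?sqr_ge0 ?Mo_ge0'.
by apply: mulr_ge0; last exact: sqr_ge0; rewrite mulr_ge0 // mulr_ge0 ?sqr_ge0 ?kap_ge0.
Qed.
Lemma dl_ge0 : 0 <= dl.
Proof.
rewrite /dl addr_ge0 ?sqrtr_ge0 // addr_ge0 ?d1_ge0 // mulr_ge0 // mulr_ge0 ?CW_ge0 //.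
by rewrite mulr_ge0 ?kd_ge0 ?Mo_ge0'.
Qed.
Lemma AA_ge1 : 1 <= AA.
Proof. by rewrite /AA lerDr mulr_ge0 // mulr_ge0 ?Mo_ge0' // mulr_ge0 ?kap_ge0. Qed.
Lemma AAp_ge1 p : 1 <= AA ^+ p. Proof. exact/exprn_ege1/AA_ge1. Qed.

Lemma tauM_le J A : `|tauM J A| <= opnorm A.
Proof.
apply: (le_trans (avg_abs _ _ _)); rewrite -[leRHS](avg_cst bsz_gt0 J); apply: avg_le => l _.
apply: (le_trans (dot_le _ _)); rewrite -[leRHS]mul1r.
apply: ler_pM; rewrite ?nrm_ge0 ?nrm_w //; apply: opnorm_ub; exact: nrm_w.
Qed.

Lemma DI_le I A : `|DI T I A| <= 2 * kap * opnorm A.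
Proof.
apply: (le_trans (ler_norm_sum _ _ _)).
apply: (@le_trans _ _ (\sum_J chat T I J * opnorm A)).
  apply: ler_sum => J _; rewrite normrM ger0_norm ?chat_ge0 //.
  by apply: ler_wpM2l; [exact: chat_ge0|exact: tauM_le].
by rewrite -mulr_suml; apply: ler_wpM2r; [exact: opnorm_ge0|exact: chat_sum1].
Qed.

Lemma Ex_avg I (F : 'I_(d + d) -> Om -> R) : Ex (fun w => avg I (fun l => F l w)) = avg I (fun l => Ex (F l)).
Proof. by rewrite /avg ExZr Ex_sum. Qed.

Lemma rlM0 k w : rlM k (mpow (HF T w) 0) = 0.
Proof.
rewrite rlM_gp /gpM -[RHS](avg_cst bsz_gt0 (lshift K k)); apply: eq_avg => l _ /=.
rewrite -(splitK l); case: (fintype.split l) => j /=; rewrite ?swl ?swr.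
  by apply: dot_LR; [exact: w_isL|exact: w_isR].
by rewrite dotC; apply: dot_LR; [exact: w_isL|exact: w_isR].
Qed.

Lemma Ex_sqr_var (X : Om -> R) : Ex (fun w => X w ^+ 2) = Ex (fun w => (X w - Ex X) ^+ 2) + Ex X ^+ 2.
Proof.
have E c w : (X w - c) ^+ 2 = X w ^+ 2 + (- (2 * c)) * X w + c ^+ 2 by ring.
rewrite (eq_Ex mu (E (Ex X))).
have E2 c : Ex (fun w => X w ^+ 2 + (- (2 * c)) * X w + c ^+ 2) = Ex (fun w => X w ^+ 2) + (- (2 * c)) * Ex X + c ^+ 2.
  by rewrite ExD ExD ExZ Ex_cst.
by rewrite E2; ring.
Qed.

Lemma Ex_avgPhi k a j : (a + j <= P)%N ->
  (forall w, `|avg (lshift K k) (fun l => Phi T (mpow (HF T w) a) (wvec l) (pw (HF T w) j (wvec (sw l)))) -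
    DI T (lshift K k) (mpow (HF T w) a) * rlM k (mpow (HF T w) j)| <= CW * (kd * th w ^+ (a + j))).
Proof.
move=> aj w; set A := mpow (HF T w) a.
have hA : A^T = A by apply: mpow_sym; apply: HF_sym.
have cw := CW_ge0; have k0 := kd_ge0.
have -> : DI T (lshift K k) A * rlM k (mpow (HF T w) j) =
   avg (lshift K k) (fun l => DI T (blk l) A * dot (wvec l) (pw (HF T w) j (wvec (sw l)))).
  rewrite rlM_gp /gpM -avgZ; by apply: eq_avg => l ->.
rewrite -avgB; apply: (le_trans (avg_abs _ _ _)); rewrite -[leRHS](avg_cst bsz_gt0 (lshift K k)).
apply: avg_le => l _; apply: (le_trans (PhiW_w l _ gT hA)).
rewrite -/CW -!mulrA; apply: ler_wpM2l => //; apply: ler_wpM2l => //; rewrite exprD.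
apply: ler_pM; rewrite ?opnorm_ge0 ?nrm_ge0 ?mpow_th //.
apply: (le_trans (pwF_th 0 _ _ _)); rewrite -[leRHS]mulr1; apply: ler_wpM2l; [exact: thi_pow0|exact: nrm_w].
Qed.

(** The neighbour correlations satisfy a linear recursion in the power, with bounded coefficients
    and small source. They start from zero, since at power 0 they pair the two sides of the
    bipartite structure. *)
Lemma RL_small p : (p + p <= P)%N -> forall k, Ex (fun w => rlM k (mpow (HF T w) p) ^+ 2) <= (AA ^+ p * dl) ^+ 2.
Proof.
have d0 := dl_ge0; have M0 := Mo_ge0'; have kp := kap_ge0; have k0 := kd_ge0; have cw := CW_ge0.
have A0 q : 0 <= AA ^+ q * dl by rewrite mulr_ge0 // (le_trans ler01) // AAp_ge1.
(* [ms_ind] serves as strong induction; the coefficient argument is a dummy. *)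
move: p; apply: (ms_ind (fun (_ _ : 'I_K) => 0 : R)) => [_ k|p IH pP k].
  rewrite (eq_Ex mu (g := fun=> 0)) ?Ex_cst ?sqr_ge0 // => w; by rewrite rlM0 expr0n.
have pP' : (p <= P)%N by clear - pP; lia.
pose X w := rlM k (mpow (HF T w) p.+1).
have EXb : `|Ex X| <= P%:R * (2 * kap * Mo * (AA ^+ p * dl)) + (P%:R * (CW * (kd * Mo)) + d1).
  have -> : Ex X = avg (lshift K k) (fun l => Ex (fun w => dot (wvec l) (pw (HF T w) p.+1 (wvec (sw l))))).
    by rewrite -Ex_avg; apply: eq_Ex => w; rewrite /X rlM_gp.
  pose S l := \sum_(j < p) Ex (fun w => Phi T (mpow (HF T w) (p - j.+1)) (wvec l) (pw (HF T w) j (wvec (sw l)))).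
  have h1 : `|avg (lshift K k) (fun l => Ex (fun w => dot (wvec l) (pw (HF T w) p.+1 (wvec (sw l))))) - avg (lshift K k) S| <= d1.
    rewrite -avgB; apply: (le_trans (avg_abs _ _ _)); rewrite -[leRHS](avg_cst bsz_gt0 (lshift K k)).
    by apply: avg_le => l _; apply: fu_second; rewrite ?nrm_w.
  have h2 : `|avg (lshift K k) S| <= P%:R * (2 * kap * Mo * (AA ^+ p * dl)) + P%:R * (CW * (kd * Mo)).
    rewrite /S avg_sum; apply: (le_trans (ler_norm_sum _ _ _)).
    have c0 : 0 <= 2 * kap * Mo * (AA ^+ p * dl) + CW * (kd * Mo).
      by apply: addr_ge0; [apply: mulr_ge0 => //; apply: mulr_ge0 => //; rewrite mulr_ge0|apply: mulr_ge0 => //; rewrite mulr_ge0].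
    apply: (@le_trans _ _ (p%:R * (2 * kap * Mo * (AA ^+ p * dl) + CW * (kd * Mo)))); last first.
      by rewrite -mulrDr; apply: ler_wpM2r => //; rewrite ler_nat.
    rewrite -sum_ord_cst; apply: ler_sum => j _; have hj := ltn_ord j.
    rewrite -Ex_avg.
    have aj : (p - j.+1 + j <= P)%N by clear - hj pP'; lia.
    apply: (@le_trans _ _ (Ex (fun w => (2 * kap) * (`|th w ^+ (p - j.+1)| * `|rlM k (mpow (HF T w) j)|) + CW * (kd * th w ^+ (p - j.+1 + j))))).
      apply: (le_trans (Ex_abs mu0 _)); apply: Ex_le => // w.
      have q1 := Ex_avgPhi k aj w.
      have q2 : `|DI T (lshift K k) (mpow (HF T w) (p - j.+1)) * rlM k (mpow (HF T w) j)| <= 2 * kap * (`|th w ^+ (p - j.+1)| * `|rlM k (mpow (HF T w) j)|).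
        rewrite normrM mulrA; apply: ler_wpM2r => //; apply: (le_trans (DI_le _ _)).
        apply: ler_wpM2l; first by rewrite mulr_ge0.
        by apply: (le_trans (mpow_th _ _)); exact: ler_norm.
      have := ler_normD (DI T (lshift K k) (mpow (HF T w) (p - j.+1)) * rlM k (mpow (HF T w) j))
         (avg (lshift K k) (fun l => Phi T (mpow (HF T w) (p - j.+1)) (wvec l) (pw (HF T w) j (wvec (sw l)))) -
    DI T (lshift K k) (mpow (HF T w) (p - j.+1)) * rlM k (mpow (HF T w) j)).
      rewrite addrC subrK => q3; apply: (le_trans q3); exact: lerD.
    rewrite ExD !ExZ; apply: lerD; last first.
      by apply: ler_wpM2l => //; apply: ler_wpM2l => //; apply: thi_Mo.
    rewrite -[leRHS]mulrA; apply: ler_wpM2l; first by rewrite mulr_ge0.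
    apply: Ex_abs_CS => //.
      by apply: th2_Mo; clear - hj pP; lia.
    apply: le_trans (IH j _ _ k) _; [by clear - hj; lia|by clear - hj pP; lia|].
    apply: lerXn2r; rewrite ?nnegrE //; apply: ler_wpM2r => //; apply: ler_weXn2l; [exact: AA_ge1|by clear - hj; lia].
  have := ler_normD (avg (lshift K k) (fun l => Ex (fun w => dot (wvec l) (pw (HF T w) p.+1 (wvec (sw l))))) - avg (lshift K k) S) (avg (lshift K k) S).
  rewrite subrK => h3; apply: (le_trans h3); rewrite addrC addrA; exact: lerD.
rewrite (Ex_sqr_var X).
have V : Ex (fun w => (X w - Ex X) ^+ 2) <= Vb.
  have E : X = (fun w => gpM (lshift K k) sw (HF T w) p.+1) by apply/funext => w; rewrite /X rlM_gp.
  by rewrite E; apply: gp_var => //; exact: admis_sw.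
have s0 := sqrtr_ge0 Vb; have sV : Num.sqrt Vb ^+ 2 = Vb by rewrite sqr_sqrtr ?Vb_ge0.
rewrite -sV in V; rewrite -(real_normK (num_real (Ex X))).
set y := `|Ex X| in EXb *; have y0 : 0 <= y by exact: normr_ge0.
apply: (@le_trans _ _ ((Num.sqrt Vb + y) ^+ 2)).
  apply: (le_trans (lerD V (lexx _))); rewrite sqrrD; have := mulr_ge0 s0 y0; lra.
apply: lerXn2r; rewrite ?nnegrE ?addr_ge0 //.
apply: (le_trans (lerD (lexx _) EXb)).
have dA : dl <= AA ^+ p * dl by rewrite ler_peMl // AAp_ge1.
have -> : AA ^+ p.+1 * dl = P%:R * (2 * kap * Mo * (AA ^+ p * dl)) + AA ^+ p * dl by rewrite exprS /AA; ring.
rewrite addrCA lerD2l; apply: le_trans dA; rewrite /dl addrC; exact: lexx.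
Qed.

Definition uhat_mean I p := Ex (fun w => dot (uhat I) (pw (HF T w) p (uhat I))).
Definition tau_mean J a := Ex (fun w => tau J (HP T w) a).

(** The two matrices differ by two rank-one terms per block, and a rank-one term changes a block
    average only by order [1 / d]. So the block averages found for [HP] also serve for [HF]. *)
Lemma tau_cmp J w p : `|gpM J id (HF T w) p - gpM J id (HP T w) p| <= (K + K)%:R * (2 * kd ^+ 2) * (p%:R * th w ^+ p).
Proof.
rewrite gp_tele; apply: (le_trans (ler_norm_sum _ _ _)).
have k2 : 0 <= kd ^+ 2 by apply: sqr_ge0.
have -> : (K + K)%:R * (2 * kd ^+ 2) * (p%:R * th w ^+ p) = p%:R * ((K + K)%:R * (kd ^+ 2 * th w ^+ p + kd ^+ 2 * th w ^+ p)) by ring.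
rewrite -sum_ord_cst; apply: ler_sum => j _; have hj := ltn_ord j.
have E l : dot (wvec l) (pw (HF T w) (p - j.+1) ((HF T w - HP T w) *m pw (HP T w) j (wvec (id l)))) =
  \sum_I (dot (wvec l) (pw (HF T w) (p - j.+1) (dot (uvec I) (pw (HP T w) j (wvec (id l))) *: qv T w I)) +
          dot (wvec l) (pw (HF T w) (p - j.+1) (dot (qv T w I) (pw (HP T w) j (wvec (id l))) *: uvec I))).
  rewrite mulmxBl HF_HP [X in X - _]addrC addrK pw_sum dot_sumr; apply: eq_bigr => I _.
  by rewrite pw_add dotDr.
rewrite (@eq_avg _ _ _ _ _ _ _ (fun l _ => E l)) avg_sum; apply: (le_trans (ler_norm_sum _ _ _)).
rewrite -sum_ord_cst; apply: ler_sum => I _.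
have t0 q : 0 <= th w ^+ q by apply: thi_pow0.
have hH : opnorm (HP T w) <= th w by apply: le_trans (opn_HP_HF _ _) (HF_thi _ _).
have pP k x : nrm (pw (HP T w) k x) <= th w ^+ k * nrm x.
  apply: (le_trans (nrm_pw _ _ _)); apply: ler_wpM2r; first exact: nrm_ge0.
  by apply: lerXn2r; rewrite ?nnegrE ?opnorm_ge0 ?thi_ge0.
have qu : nrm (qv T w I) * nrm (uvec I) <= th w by apply: le_trans (qv_le _ _ _) (HF_thi _ _).
have ex : th w ^+ p = th w ^+ (p - j.+1) * th w ^+ j * th w.
  by rewrite -exprD -exprSr; congr (_ ^+ _); clear - hj; lia.
apply: avgD_le.
  apply: (le_trans (rank1_avg (admis_id J) (HP_sym _ _) (pwF_th 0 _ _ _) (pP _ _))).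
  apply: ler_wpM2l => //; rewrite ex -/(th w).
  have -> : th w ^+ (p - j.+1) * nrm (qv T w I) * (th w ^+ j * nrm (uvec I)) = th w ^+ (p - j.+1) * th w ^+ j * (nrm (qv T w I) * nrm (uvec I)) by ring.
  by apply: ler_wpM2l => //; rewrite mulr_ge0.
apply: (le_trans (rank1_avg (admis_id J) (HP_sym _ _) (pwF_th 0 _ _ _) (pP _ _))).
apply: ler_wpM2l => //; rewrite ex -/(th w).
have -> : th w ^+ (p - j.+1) * nrm (uvec I) * (th w ^+ j * nrm (qv T w I)) = th w ^+ (p - j.+1) * th w ^+ j * (nrm (qv T w I) * nrm (uvec I)) by ring.
by apply: ler_wpM2l => //; rewrite mulr_ge0.
Qed.
Definition ePhi : R := 2 * kap * (K%:R * (AA ^+ P * dl * Mo)) + 4 * (ell%:R ^+ 2 * kap) * (kd * Mo)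
  + 2 * kap * (Num.sqrt Vb * Mo + (K + K)%:R * (2 * kd ^+ 2) * (P%:R * Mo) * Mo).
Definition Err : R := d1 + P%:R * ePhi.

Lemma ePhi_ge0 : 0 <= ePhi.
Proof.
have M0 := Mo_ge0'; have kp := kap_ge0; have k0 := kd_ge0; have d0 := dl_ge0.
have A0 : 0 <= AA ^+ P by rewrite (le_trans ler01) // AAp_ge1.
have s0 := sqrtr_ge0 Vb; have k2 : 0 <= kd ^+ 2 by apply: sqr_ge0.
have e2 : 0 <= ell%:R ^+ 2 :> R by apply: sqr_ge0.
rewrite /ePhi; repeat first [assumption | apply: addr_ge0 | apply: mulr_ge0 | by []].
Qed.
Lemma Err_ge0 : 0 <= Err.
Proof. by rewrite /Err addr_ge0 ?d1_ge0 // mulr_ge0 // ePhi_ge0. Qed.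

Lemma uX_le I j w : `|dot (uhat I) (pw (HF T w) j (uhat I))| <= th w ^+ j.
Proof.
apply: (le_trans (dot_le _ _)); rewrite nrm_uhat mul1r; apply: (le_trans (pwF_th 0 _ _ _)).
by rewrite nrm_uhat mulr1.
Qed.

Lemma ph_le I j : (j <= P)%N -> `|uhat_mean I j| <= Mo.
Proof.
move=> jP; apply: (le_trans (Ex_abs mu0 _)); apply: le_trans (thi_Mo 0 jP).
by apply: Ex_le => // w; apply: uX_le.
Qed.

(** The block average concentrates by [gp_var], so it can be pulled out of the expectation even
    though the other factor is not known to concentrate. *)
Lemma tauX_le J I a j : (a + a <= P)%N -> (j + j <= P)%N ->
  `|Ex (fun w => tauM J (mpow (HF T w) a) * dot (uhat I) (pw (HF T w) j (uhat I))) - tau_mean J a * uhat_mean I j| <=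
  Num.sqrt Vb * Mo + (K + K)%:R * (2 * kd ^+ 2) * (P%:R * Mo) * Mo.
Proof.
move=> aP jP; have M0 := Mo_ge0'; have k2 : 0 <= kd ^+ 2 by apply: sqr_ge0.
pose X (w : Om) := dot (uhat I) (pw (HF T w) j (uhat I)).
pose Y (w : Om) := gpM J id (HF T w) a.
have -> : Ex (fun w => tauM J (mpow (HF T w) a) * dot (uhat I) (pw (HF T w) j (uhat I))) - tau_mean J a * uhat_mean I j =
   Ex (fun w => (Y w - Ex Y) * X w) + (Ex Y - tau_mean J a) * uhat_mean I j.
  have E c : Ex (fun w => (Y w - c) * X w) = Ex (fun w => Y w * X w) - c * Ex X.
    by rewrite -ExZ -ExB; apply: eq_Ex => w; ring.
  rewrite E -/X (eq_Ex mu (g := fun w => Y w * X w)); last by move=> w; rewrite tauM_gp.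
  rewrite /uhat_mean -/X; ring.
apply: (le_trans (ler_normD _ _)); apply: lerD.
  apply: (le_trans (Ex_abs mu0 _)).
  apply: (@le_trans _ _ (Ex (fun w => `|Y w - Ex Y| * `|th w ^+ j|))).
    apply: Ex_le => // w; rewrite normrM; apply: ler_wpM2l => //.
    by apply: (le_trans (uX_le I j w)); apply: ler_norm.
  apply: Ex_abs_CS; rewrite ?sqrtr_ge0 // ?th2_Mo // sqr_sqrtr ?Vb_ge0 //.
  by apply: gp_var => //; apply: admis_id.
rewrite normrM; apply: ler_pM => //; last by apply: ph_le; clear - jP; lia.
rewrite /Y /tau_mean -ExB; apply: (le_trans (Ex_abs mu0 _)).
apply: (@le_trans _ _ (Ex (fun w => (K + K)%:R * (2 * kd ^+ 2) * (a%:R * th w ^+ a)))).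
  by apply: Ex_le => // w; apply: tau_cmp.
rewrite !ExZ; apply: ler_wpM2l; first by rewrite mulr_ge0 // mulr_ge0.
apply: ler_pM => //; first by apply: Ex_ge0 => // w; apply: thi_pow0.
  by rewrite ler_nat; clear - aP; lia.
by apply: thi_Mo; clear - aP; lia.
Qed.

(** A linear recursion for the block-mean direction, driven by the block averages already
    controlled. *)
Lemma phi_rec I p : (p.+1 + p.+1 <= P)%N ->
  `|uhat_mean I p.+1 - \sum_(j < p) (\sum_J chat T I J * tau_mean J (p - j.+1)) * uhat_mean I j| <= Err.
Proof.
move=> pP; have M0 := Mo_ge0'; have kp := kap_ge0; have k0 := kd_ge0.
have pP' : (p <= P)%N by clear - pP; lia.
have h1 := fu_second pP' (eq_ind_r (fun z => z <= 1) (lexx 1) (nrm_uhat I)) (eq_ind_r (fun z => z <= 1) (lexx 1) (nrm_uhat I)).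
pose S := \sum_(j < p) Ex (fun w => Phi T (mpow (HF T w) (p - j.+1)) (uhat I) (pw (HF T w) j (uhat I))).
have -> : uhat_mean I p.+1 - \sum_(j < p) (\sum_J chat T I J * tau_mean J (p - j.+1)) * uhat_mean I j =
  (uhat_mean I p.+1 - S) + (S - \sum_(j < p) (\sum_J chat T I J * tau_mean J (p - j.+1)) * uhat_mean I j) by rewrite addrA subrK.
apply: (le_trans (ler_normD _ _)); apply: lerD; first exact: h1.
rewrite /S -sumrB; apply: (le_trans (ler_norm_sum _ _ _)).
have e0 := ePhi_ge0.
apply: (@le_trans _ _ (p%:R * ePhi)); last by apply: ler_wpM2r => //; rewrite ler_nat.
rewrite -sum_ord_cst; apply: ler_sum => j _; have hj := ltn_ord j.
set a := (p - j.+1)%N.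
have aP : (a + a <= P)%N by rewrite /a; clear - hj pP; lia.
have jP : (j + j <= P)%N by clear - hj pP; lia.
have ajP : (a + j <= P)%N by rewrite /a; clear - hj pP; lia.
pose X (w : Om) := dot (uhat I) (pw (HF T w) j (uhat I)).
pose Q := Ex (fun w => DI T I (mpow (HF T w) a) * X w).
have -> : Ex (fun w => Phi T (mpow (HF T w) a) (uhat I) (pw (HF T w) j (uhat I))) - (\sum_J chat T I J * tau_mean J a) * uhat_mean I j =
  (Ex (fun w => Phi T (mpow (HF T w) a) (uhat I) (pw (HF T w) j (uhat I))) - Q) + (Q - (\sum_J chat T I J * tau_mean J a) * uhat_mean I j).
  by rewrite addrA subrK.
apply: (le_trans (ler_normD _ _)); rewrite /ePhi; apply: lerD.
  rewrite /Q -ExB; apply: (le_trans (Ex_abs mu0 _)).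
  apply: (@le_trans _ _ (Ex (fun w => 2 * kap * (\sum_k `|rlM k (mpow (HF T w) a)| * `|th w ^+ j|) + 4 * (ell%:R ^+ 2 * kap) * (kd * th w ^+ (a + j))))).
    apply: Ex_le => // w; apply: (le_trans (PhiU_hat I _ gT (mpow_sym _ (HF_sym _ _)))).
    have t0 := thi_pow0 0 w j.
    have hz : nrm (pw (HF T w) j (uhat I)) <= th w ^+ j by apply: (le_trans (pwF_th 0 _ _ _)); rewrite nrm_uhat mulr1.
    rewrite mulrDl; apply: lerD.
      rewrite -mulrA; apply: ler_wpM2l; first by rewrite mulr_ge0.
      rewrite -mulr_suml; apply: ler_wpM2l; first exact: rho_ge0.
      by apply: (le_trans hz); apply: ler_norm.
    rewrite -!mulrA; do 5![apply: ler_wpM2l; first by rewrite ?sqr_ge0 ?exprn_ge0].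
    rewrite exprD; apply: ler_pM; rewrite ?opnorm_ge0 ?nrm_ge0 //; exact: mpow_th.
  rewrite ExD !ExZ; apply: lerD; last first.
    apply: ler_wpM2l; first by rewrite mulr_ge0 // mulr_ge0 ?sqr_ge0.
    by apply: ler_wpM2l => //; apply: thi_Mo.
  apply: ler_wpM2l; first by rewrite mulr_ge0.
  rewrite Ex_sum -[K%:R]/(K%:R) -sum_ord_cst; apply: ler_sum => k _.
  have Ad : 0 <= AA ^+ P * dl by rewrite mulr_ge0 ?dl_ge0 // (le_trans ler01) // AAp_ge1.
  apply: Ex_abs_CS => //; last exact: th2_Mo.
  apply: (le_trans (RL_small aP k)).
  have Aa : 0 <= AA ^+ a * dl by rewrite mulr_ge0 ?dl_ge0 // (le_trans ler01) // AAp_ge1.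
  apply: lerXn2r; rewrite ?nnegrE //; apply: ler_wpM2r; first exact: dl_ge0.
  by apply: ler_weXn2l; [exact: AA_ge1|clear - ajP; lia].
have -> : Q - (\sum_J chat T I J * tau_mean J a) * uhat_mean I j = \sum_J chat T I J *
   (Ex (fun w => tauM J (mpow (HF T w) a) * X w) - tau_mean J a * uhat_mean I j).
  have -> : Q = \sum_J chat T I J * Ex (fun w => tauM J (mpow (HF T w) a) * X w).
    rewrite /Q /DI; under [RHS]eq_bigr => J _ do rewrite -ExZ.
    rewrite -Ex_sum; apply: eq_Ex => w; rewrite mulr_suml; apply: eq_bigr => J _; by rewrite mulrA.
  by rewrite mulr_suml -sumrB; apply: eq_bigr => J _; ring.
apply: (le_trans (ler_norm_sum _ _ _)).
set e := Num.sqrt Vb * Mo + _.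
apply: (@le_trans _ _ (\sum_J chat T I J * e)).
  apply: ler_sum => J _; rewrite normrM ger0_norm ?chat_ge0 //; apply: ler_wpM2l; first exact: chat_ge0.
  exact: tauX_le.
have e00 : 0 <= e.
  by rewrite /e addr_ge0 // ?mulr_ge0 ?sqrtr_ge0 ?sqr_ge0 ?kd_ge0.
by rewrite -mulr_suml; apply: ler_wpM2r => //; exact: chat_sum1.
Qed.

(** The same feasibility argument as for the block averages, applied to the linear recursion
    [phi_rec]; total errors of at most 1 cost the factor 2. *)
Lemma F_bound (x : 'I_(K + K) -> R) lam N : 0 < lam -> (forall I, 0 < x I) ->
  (forall I, (x I)^-1 + \sum_J chat T I J * x J <= lam) -> (N + N <= P)%N ->
  (forall m J, (m <= N)%N -> \sum_(a < m) tau_mean J a * lam^-1 ^+ a.+1 <= x J) ->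
  (forall J a, 0 <= tau_mean J a) ->
  Err * (\sum_(p < N) lam^-1 ^+ p.+1) <= 1 ->
  forall I p, (p <= N)%N -> `|uhat_mean I p| <= 2 * x I * lam ^+ p.+1.
Proof.
move=> lam0 x0 hx NP ht t0 hE I.
pose L := lam^-1; have L0 : 0 < L by rewrite invr_gt0.
have Lk k : 0 <= L ^+ k by rewrite exprn_ge0 // ltW.
have lL : lam * L = 1 by rewrite mulfV // gt_eqF.
have xx : (x I)^-1 * x I = 1 by rewrite mulVf // gt_eqF.
pose f j := `|uhat_mean I j| * L ^+ j.+1; have f0 j : 0 <= f j by rewrite mulr_ge0.
pose h a := (\sum_J chat T I J * tau_mean J a) * L ^+ a.+1.
have c0 J := chat_ge0 T I J.
have h0 a : 0 <= h a by rewrite mulr_ge0 //; apply: sumr_ge0 => J _; rewrite mulr_ge0.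
pose S := \sum_J chat T I J * x J.
have S0 : 0 <= S by apply: sumr_ge0 => J _; rewrite mulr_ge0 // ltW.
have hS m : (m <= N)%N -> \sum_(a < m) h a <= S.
  move=> mN; rewrite /h; under eq_bigr => a _ do rewrite mulr_suml.
  rewrite exchange_big /=; apply: ler_sum => J _; under eq_bigr => a _ do rewrite -mulrA.
  by rewrite -mulr_sumr; apply: ler_wpM2l => //; apply: ht.
pose E := Err * (\sum_(p < N) L ^+ p.+1).
have E0 : 0 <= E by rewrite mulr_ge0 ?Err_ge0 //; apply: sumr_ge0.
have f0E : f 0 = L.
  rewrite /f /uhat_mean (eq_Ex mu (g := fun=> 1)) ?Ex_cst ?normr1 ?mul1r // => w /=.
  by rewrite -nrm_sqr nrm_uhat expr1n.
have step m : (m <= N)%N -> \sum_(p < m.+1) f p <= x I * (1 + E).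
  elim: m => [_|m IH mN].
    rewrite big_ord1 f0E -[leLHS]mulr1; apply: ler_pM; rewrite ?(ltW L0) ?lerDl //.
    have := hx I => hxI; have : (x I)^-1 <= lam by apply: le_trans hxI; rewrite lerDl.
    by rewrite /L -{2}[x I]invrK lef_pV2 // posrE // invr_gt0.
  rewrite big_ord_recl f0E.
  have st (p : 'I_m.+1) : f (lift ord0 p) <= L * (\sum_(j < p) f j * h (p - j.+1)%N) + L * (Err * L ^+ p.+1).
    have hp := ltn_ord p; rewrite /f lift0.
    have pP : (p.+1 + p.+1 <= P)%N by clear - hp mN NP; lia.
    have q := phi_rec I pP.
    have q2 : `|uhat_mean I p.+1| <= \sum_(j < p) (\sum_J chat T I J * tau_mean J (p - j.+1)) * `|uhat_mean I j| + Err.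
      have := ler_normD (uhat_mean I p.+1 - \sum_(j < p) (\sum_J chat T I J * tau_mean J (p - j.+1)) * uhat_mean I j) (\sum_(j < p) (\sum_J chat T I J * tau_mean J (p - j.+1)) * uhat_mean I j).
      rewrite subrK => q3; apply: (le_trans q3); rewrite addrC; apply: lerD => //.
      apply: (le_trans (ler_norm_sum _ _ _)); apply: ler_sum => j _; rewrite normrM ger0_norm //.
      by apply: sumr_ge0 => J _; rewrite mulr_ge0.
    apply: (le_trans (ler_wpM2r (Lk p.+2) q2)); rewrite mulrDl exprS; apply: lerD; last first.
      by rewrite le_eqVlt; apply/orP; left; apply/eqP; ring.
    rewrite mulr_suml mulr_sumr; apply: ler_sum => j _; have hj := ltn_ord j.
    rewrite /h /f le_eqVlt; apply/orP; left; apply/eqP.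
    have -> : L * L ^+ p.+1 = L * (L ^+ j.+1 * L ^+ (p - j.+1).+1).
      by rewrite -exprD; congr (_ * _ ^+ _); clear - hj; lia.
    ring.
  apply: (le_trans (lerD (lexx L) (ler_sum _ (fun p _ => st p)))).
  rewrite big_split /= -!mulr_sumr.
  have M1 : \sum_(p < m.+1) \sum_(j < p) f j * h (p - j.+1)%N <= (x I * (1 + E)) * S.
    rewrite big_ord_recl big_ord0 add0r.
    have -> : \sum_(i < m) \sum_(j < lift ord0 i) f j * h (lift ord0 i - j.+1)%N = \sum_(i < m) \sum_(j < i.+1) f j * h (i - j)%N by [].
    apply: (le_trans (cauchy_le _ f0 h0)); apply: ler_pM; rewrite ?sumr_ge0 //.
      apply: le_trans (IH _); last by apply: ltnW.
      by rewrite big_ord_recr /= lerDl.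
    by apply: hS; apply: ltnW.
  have M2 : Err * (\sum_(p < m.+1) L ^+ p.+1) <= E.
    apply: ler_wpM2l; first exact: Err_ge0.
    by apply: (@sum_ord_mono R (fun p => L ^+ p.+1)).
  have T1 := ler_wpM2l (ltW L0) M1; have T2 := ler_wpM2l (ltW L0) M2.
  apply: (le_trans (lerD (lexx L) (lerD T1 T2))).
  (* The errors rescale the whole inequality by [1 + E], after which [feasible_step] applies with
     slack 0. *)
  have -> : L + (L * (x I * (1 + E) * S) + L * E) = (1 + E) * (L + (L * (S * x I) + 0 * x I * L)) by ring.
  rewrite [leRHS]mulrC; apply: ler_wpM2l; first by rewrite addr_ge0.
  apply: (feasible_step lL xx (ltW (x0 I)) (ltW L0)); rewrite addr0; exact: hx.
move=> p pN; have := step p pN; rewrite big_ord_recr /= => h1.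
have h2 : f p <= 2 * x I.
  apply: (@le_trans _ _ (x I * (1 + E))).
    by apply: le_trans h1; rewrite lerDr; apply: sumr_ge0.
  by rewrite mulrC; apply: ler_wpM2r; [exact: ltW|have -> : 2 = 1 + 1 :> R by []; rewrite lerD2l].
have -> : `|uhat_mean I p| = f p * lam ^+ p.+1.
  by rewrite /f -mulrA -exprMn mulVf ?gt_eqF // expr1n mulr1.
by apply: ler_wpM2r => //; rewrite exprn_ge0 // ltW.
Qed.
End Full.

(** * Moments and norm of the full matrix *)

Lemma qv_part T w I : qv T w I = \sum_(i < n) qv (Tb T i) w I.
Proof.
rewrite /qv -scaler_sumr; congr (_ *: _).
rewrite (partition_big (fun s => Ordinal (g_lt s)) predT) //=; apply: eq_bigr => i _.
by apply: eq_bigl => s; rewrite inE -(inj_eq val_inj).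
Qed.

Lemma qv_split T i w I : qv T w I - qv (T0 T i) w I = qv (Tb T i) w I.
Proof.
rewrite /qv -scalerBr; congr (_ *: _).
rewrite (bigID (fun s => g s == i)) /=.
rewrite (eq_bigl (fun s => s \in Tb T i)) => [|s]; last by rewrite inE.
rewrite [X in _ + X - _](eq_bigl (fun s => s \in T0 T i)) => [|s]; last by rewrite inE.
by rewrite addrK.
Qed.

Lemma qv_agree (T : {set 'I_n}) (w w' : Om) I : (forall s, s \in T -> w s = w' s /\ w (nx s) = w' (nx s)) -> qv T w I = qv T w' I.
Proof.
move=> h; congr (_ *: _); apply: eq_bigr => s /h[h1 h2].
by rewrite /av /bv h1 h2.
Qed.

Definition Cq : R := 4 * (ell%:R ^+ 2 * kap).

Lemma Cq_ge0 : 0 <= Cq.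
Proof. by rewrite /Cq mulr_ge0 // mulr_ge0 ?sqr_ge0 ?kap_ge0. Qed.

(** [qv] is a sum of independent centred vectors, one per block. Scaled by the length of [uvec] it
    has moments bounded independently of [d], but it does not become small. *)
Lemma qv_moment T I p : good T -> sS <= 1 -> kd <= 1 ->
  Ex (fun w => (nrm (uvec I) * nrm (qv T w I)) ^+ (p + p)) <= qmom Cq p.
Proof.
move=> gT s1 k1; set nu := nrm (uvec I).
have nu0 : 0 <= nu by apply: nrm_ge0.
have nuk : nu <= kd by apply: nrm_u_kd.
have k0 := kd_ge0.
pose q (w : Om) := nu *: qv T w I; pose q0 i (w : Om) := nu *: qv (T0 T i) w I.
have dqE i w : q w - q0 i w = nu *: qv (Tb T i) w I by rewrite /q /q0 -scalerBr qv_split.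
have e2 : 0 <= 2 * ell%:R * r :> R by rewrite !mulr_ge0.
have V := @vec_moment R _ _ mu mu0 mu1 g n (d + d) q q0 (2 * ell%:R * r * kd).
have E : (fun w => (nu * nrm (qv T w I)) ^+ (p + p)) = (fun w => nrm (q w) ^+ (p + p)).
  by apply/funext => w; rewrite /q nrmZ ger0_norm.
rewrite E; apply: V.
- move=> w; rewrite (eq_bigr (fun i : 'I_n => nu *: qv (Tb T i) w I)); last by move=> i _; exact: dqE.
  by rewrite -scaler_sumr -qv_part.
- move=> i w w'; congr (_ *: _); apply: qv_agree => s; rewrite inE => /andP[sT gs].
  have [h _] := gT; have [_ gn] := h s sT; by rewrite !ffunE /inblk gn (negbTE gs).
- move=> i w w'; rewrite !dqE; congr (_ *: _); apply: qv_agree => s; rewrite inE => /andP[sT gs].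
  have [h _] := gT; have [_ gn] := h s sT; by rewrite !ffunE /inblk gn gs.
- move=> i x.
  have E1 w : dot x (q w - q0 i w) = nu * (r * \sum_(s in Tb T i) ((Bb s == I)%:R * dot (av s w) x + (Ab s == I)%:R * dot (bv s w) x)).
    rewrite dqE dotZr /qv dotZr dot_sumr; congr (_ * (_ * _)); apply: eq_bigr => s _.
    by rewrite dotDr !dotZr !(dotC x).
  rewrite (eq_Ex mu E1) !ExZ Ex_sum big1 ?mulr0 // => s _.
  by rewrite ExD !ExZ Ex_av0 // Ex_bv0 // !mulr0 addr0.
- move=> i w; rewrite dqE nrmZ ger0_norm // mulrC; apply: ler_pM; rewrite ?nrm_ge0 //.
  rewrite /qv nrmZ ger0_norm //.
  have -> : 2 * ell%:R * r = r * (ell%:R * 2) by ring.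
  apply: ler_wpM2l => //; apply: (le_trans (nrm_sum _ _ _)).
  have h2 : 0 <= 2 :> R by [].
  apply: le_trans (sum_cst_le h2 (card_Tb i gT)); apply: ler_sum => s _.
  apply: (le_trans (nrm2Z _ _ (nrm_av s w) (nrm_bv s w))); rewrite mul1r.
  have h3 : `|(Bb s == I)%:R : R| <= 1 by rewrite ger0_norm // lern1 leq_b1.
  have h4 : `|(Ab s == I)%:R : R| <= 1 by rewrite ger0_norm // lern1 leq_b1.
  have -> : 2 = 1 + 1 :> R by []. 
  exact: lerD.
- by rewrite mulr_ge0.
- rewrite -[leRHS]mulr1; apply: ler_pM => //; apply: le_trans s1; rewrite /sS; apply: ler_wpM2r => //.
  by apply: ler_wpM2r => //; rewrite ler_nat.
- have -> : n%:R * (2 * ell%:R * r * kd) ^+ 2 = n%:R * r ^+ 2 * kd ^+ 2 * (4 * ell%:R ^+ 2) by ring.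
  have -> : Cq = kap * (4 * ell%:R ^+ 2) by rewrite /Cq; ring.
  by apply: ler_wpM2r; [rewrite mulr_ge0 // sqr_ge0|exact: nr2kd].
Qed.

Definition Bq T w := \sum_I nrm (uvec I) * nrm (qv T w I).

Lemma HF_HP_opn T w : opnorm (HF T w) <= opnorm (HP T w) + 2 * Bq T w.
Proof.
apply: opnorm_le => x hx; rewrite HF_HP; apply: (le_trans (nrmD _ _)); apply: lerD; first exact: opnorm_ub.
apply: (le_trans (nrm_sum _ _ _)); rewrite /Bq mulr_sumr; apply: ler_sum => I _.
move: (uvec I) (qv T w I) => u v.
apply: (le_trans (nrmD _ _)); rewrite !nrmZ.
have h1 := dot_le1 (lexx (nrm u)) hx; have h2 := dot_le1 (lexx (nrm v)) hx; rewrite !mulr1 in h1 h2.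
have := ler_wpM2r (nrm_ge0 v) h1; have := ler_wpM2r (nrm_ge0 u) h2; rewrite (mulrC (nrm v)); lra.
Qed.

Lemma sum_pow_le (F : 'I_(K + K) -> R) p : (forall I, 0 <= F I) -> (\sum_I F I) ^+ p <= (K + K)%:R ^+ p * \sum_I F I ^+ p + 1.
Proof.
move=> F0; case: p => [|p]; first by rewrite expr0 lerDr mulr_ge0 ?exprn_ge0 //; apply: sumr_ge0 => I _; rewrite exprn_ge0.
have S0 : 0 <= \sum_I F I ^+ p.+1 by apply: sumr_ge0 => I _; rewrite exprn_ge0.
have [y y0 yE] := root_ex p S0.
have Fy I : F I <= y.
  rewrite -(@ler_pXn2r _ p.+1) ?nnegrE // yE (bigD1 I) //= lerDl; apply: sumr_ge0 => J _; by rewrite exprn_ge0.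
apply: (@le_trans _ _ (((K + K)%:R * y) ^+ p.+1)).
  apply: lerXn2r; rewrite ?nnegrE ?mulr_ge0 ?sumr_ge0 //.
  by rewrite -sum_ord_cst; apply: ler_sum.
by rewrite exprMn yE lerDl.
Qed.

Definition Mom (p : nat) (c : R) : R :=
  4 ^+ (p + p) * (c + 1 + ((K + K)%:R ^+ (p + p) * ((K + K)%:R * qmom Cq p) + 1)) * 2 ^+ (p + p).

Lemma HF_moment T p c : good T -> sS <= 1 -> kd <= 1 ->
  Ex (fun w => opnorm (HP T w) ^+ (p + p)) <= c ->
  Ex (fun w => (opnorm (HF T w) + 1) ^+ (p + p)) <= Mom p c.
Proof.
move=> gT s1 k1 hc; set P := (p + p)%N.
have B0 w : 0 <= Bq T w by apply: sumr_ge0 => I _; rewrite mulr_ge0 ?nrm_ge0.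
pose F w := 4 ^+ P * (opnorm (HP T w) ^+ P + 1 + ((K + K)%:R ^+ P * \sum_I (nrm (uvec I) * nrm (qv T w I)) ^+ P + 1)) * 2 ^+ P.
have h w : (opnorm (HF T w) + 1) ^+ P <= F w.
  have o0 := opnorm_ge0 (HP T w); have o1 := opnorm_ge0 (HF T w).
  apply: (@le_trans _ _ ((opnorm (HP T w) + 1 + 2 * Bq T w) ^+ P)).
    apply: lerXn2r; rewrite ?nnegrE ?addr_ge0 ?mulr_ge0 //.
    by have := HF_HP_opn T w; lra.
  apply: (le_trans (pow_add_le P (addr_ge0 o0 ler01) (mulr_ge0 (ler0n R 2) (B0 w)))).
  have -> : F w = 2 ^+ P * (2 ^+ P * (opnorm (HP T w) ^+ P + 1) * 2 ^+ P + 2 ^+ P * ((K + K)%:R ^+ P * \sum_I (nrm (uvec I) * nrm (qv T w I)) ^+ P + 1) * 2 ^+ P).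
    rewrite /F; have -> : 4 ^+ P = 2 ^+ P * 2 ^+ P :> R by rewrite -exprMn; congr (_ ^+ _); ring.
    ring.
  have p1 : 1 <= 2 ^+ P :> R by apply: exprn_ege1; rewrite ler1n.
  have p0 : 0 <= 2 ^+ P :> R by apply: le_trans p1.
  apply: ler_wpM2l => //; apply: lerD.
    have x0 : 0 <= 2 ^+ P * (opnorm (HP T w) ^+ P + 1) by rewrite mulr_ge0 ?addr_ge0 ?exprn_ge0.
    apply: (@le_trans _ _ (2 ^+ P * (opnorm (HP T w) ^+ P + 1))); last by rewrite ler_peMr.
    by have := pow_add_le P o0 ler01; rewrite expr1n.
  rewrite exprMn; have G0 I : 0 <= nrm (uvec I) * nrm (qv T w I) by rewrite mulr_ge0 ?nrm_ge0.
  have q := sum_pow_le P G0.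
  have x0 : 0 <= 2 ^+ P * ((K + K)%:R ^+ P * (\sum_I (nrm (uvec I) * nrm (qv T w I)) ^+ P) + 1).
    by apply: le_trans (ler_wpM2l p0 q); rewrite mulr_ge0 // exprn_ge0 //; exact: (B0 w).
  apply: (@le_trans _ _ (2 ^+ P * ((K + K)%:R ^+ P * (\sum_I (nrm (uvec I) * nrm (qv T w I)) ^+ P) + 1))); last by rewrite ler_peMr.
  exact: ler_wpM2l.
apply: (le_trans (Ex_le mu0 h)); rewrite /F ExZr; apply: ler_wpM2r; first by rewrite exprn_ge0.
rewrite ExZ; apply: ler_wpM2l; first by rewrite exprn_ge0.
rewrite !ExD !Ex_cst // ExZ Ex_sum; apply: lerD; first by rewrite lerD2r.
rewrite lerD2r; apply: ler_wpM2l; first by rewrite exprn_ge0.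
by rewrite -sum_ord_cst; apply: ler_sum => I _; apply: qv_moment.
Qed.

(** Above the level [2 * lam] the norm is raised to the high power [2 (q + 1)]; the resulting
    [2 ^ (2 (q + 1)) = 4 ^+ q.+1] beats the dimension in the trace bound. *)
Lemma HP_moment T p q (lam S : R) : 0 < lam -> (p <= q.+1)%N -> 0 <= S ->
  Ex (fun w => Wk (HP T w) q.+1) <= d%:R * (S * lam ^+ (q.+1 + q.+1).+1) -> (d%:R <= 4 ^+ q.+1 :> R) ->
  Ex (fun w => opnorm (HP T w) ^+ (p + p)) <= (2 * lam) ^+ (p + p) * (1 + S * lam).
Proof.
move=> l0 pq S0 hW hd; have l2 : 0 < 2 * lam by rewrite mulr_gt0.
set Q := (q.+1 + q.+1)%N.
have lQ : 0 < lam ^+ Q by rewrite exprn_gt0.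
apply: (@le_trans _ _ (Ex (fun w => (2 * lam) ^+ (p + p) * (1 + (2 * lam) ^- Q * Wk (HP T w) q.+1)))).
  apply: Ex_le => // w; set h := opnorm _; have h0 : 0 <= h by apply: opnorm_ge0.
  have hw : h ^+ Q <= Wk (HP T w) q.+1 by apply: opn_W.
  have [h1|h1] := lerP h (2 * lam).
    apply: (@le_trans _ _ ((2 * lam) ^+ (p + p) * 1)).
      by rewrite mulr1; apply: lerXn2r; rewrite ?nnegrE // ltW.
    apply: ler_wpM2l; first by rewrite exprn_ge0 // ltW.
    by rewrite lerDl mulr_ge0 ?Wk_ge0 // invr_ge0 exprn_ge0 // ltW.
  have -> : h ^+ (p + p) = (2 * lam) ^+ (p + p) * (h / (2 * lam)) ^+ (p + p).
    by rewrite -exprMn mulrC divfK // gt_eqF.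
  apply: ler_wpM2l; first by rewrite exprn_ge0 // ltW.
  apply: (@le_trans _ _ ((h / (2 * lam)) ^+ Q)).
    apply: ler_weXn2l; first by rewrite ler_pdivlMr // mul1r ltW.
    by rewrite /Q; clear - pq; lia.
  rewrite expr_div_n mulrC -[leLHS]add0r; apply: lerD => //.
  by apply: ler_wpM2l => //; rewrite invr_ge0 exprn_ge0 // ltW.
rewrite ExZ; apply: ler_wpM2l; first by rewrite exprn_ge0 // ltW.
rewrite ExD ExZ Ex_cst // lerD2l.
apply: (@le_trans _ _ ((2 * lam) ^- Q * (d%:R * (S * lam ^+ Q.+1)))).
  by apply: ler_wpM2l => //; rewrite invr_ge0 exprn_ge0 // ltW.
have e4 : 4 ^+ q.+1 = 2 ^+ Q :> R by rewrite /Q exprD -exprMn; congr (_ ^+ _); ring.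
have p2 : 0 < 2 ^+ Q :> R by rewrite exprn_gt0.
have -> : (2 * lam) ^- Q * (d%:R * (S * lam ^+ Q.+1)) = d%:R / 2 ^+ Q * (S * lam).
  by rewrite exprMn exprS; field; rewrite !gt_eqF.
rewrite -[leRHS]mul1r; apply: ler_wpM2r; first by rewrite mulr_ge0 // ltW.
by rewrite ler_pdivrMr // mul1r -e4.
Qed.
Definition Qn (y : 'cV[R]_(d + d)) := Num.sqrt (\sum_I dot (uhat I) y ^+ 2).

Lemma Qn_sqr y : Qn y ^+ 2 = \sum_I dot (uhat I) y ^+ 2.
Proof. by rewrite sqr_sqrtr //; apply: sumr_ge0 => I _; apply: sqr_ge0. Qed.
Lemma Qn_ge0 y : 0 <= Qn y. Proof. exact: sqrtr_ge0. Qed.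

Lemma uhat_Qn I y : `|dot (uhat I) y| <= Qn y.
Proof.
apply: le_sqr2; first exact: Qn_ge0.
rewrite real_normK ?num_real // Qn_sqr (bigD1 I) //= lerDl; apply: sumr_ge0 => J _; exact: sqr_ge0.
Qed.

Lemma nrm_PQ y : nrm y <= nrm (Px y) + Qn y.
Proof.
apply: le_sqr2; first by rewrite addr_ge0 ?nrm_ge0 ?Qn_ge0.
rewrite (nrm_Px_sqr y) -Qn_sqr sqrrD; have := mulr_ge0 (nrm_ge0 (Px y)) (Qn_ge0 y); lra.
Qed.

Lemma nrm_uE I : nrm (uvec I) = (Num.sqrt (bsz I))^-1.
Proof.
have q0 : 0 < Num.sqrt (bsz I) by rewrite sqrtr_gt0.
have := nrm_uhat I; rewrite /uhat (nrmZ (Num.sqrt (bsz I)) (uvec I)) gtr0_norm // => h.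
by apply: (mulfI (lt0r_neq0 q0)); rewrite h mulfV // gt_eqF.
Qed.

Lemma u_Qn I y : `|dot (uvec I) y| <= nrm (uvec I) * Qn y.
Proof.
rewrite u_uhat normrM mulrC nrm_uE (ger0_norm (x := _^-1)) ?invr_ge0 ?sqrtr_ge0 //.
by apply: ler_wpM2l; [rewrite invr_ge0 sqrtr_ge0|exact: uhat_Qn].
Qed.

Lemma Px_HF T w y : Px (HF T w *m y) = HP T w *m Px y + \sum_I dot (uvec I) y *: qv T w I.
Proof.
rewrite {1}/Px.
have -> : \sum_I dot (uhat I) (HF T w *m y) *: uhat I = \sum_I dot (qv T w I) y *: uvec I.
  apply: eq_bigr => I _; rewrite -dot_sym ?HF_sym //.
  have q0 : 0 < Num.sqrt (bsz I) by rewrite sqrtr_gt0.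
  have qq : Num.sqrt (bsz I) ^+ 2 = bsz I by rewrite sqr_sqrtr ?bsz_ge0.
  rewrite {1}/uhat -scalemxAr HF_u; move: (qv T w I) => v.
  rewrite /uhat; move: (uvec I) v => u v; rewrite (dotZl (Num.sqrt (bsz I))) (dotZl (bsz I)^-1) scalerA; congr (_ *: _).
  have -> : Num.sqrt (bsz I) * ((bsz I)^-1 * dot v y) * Num.sqrt (bsz I) = Num.sqrt (bsz I) ^+ 2 * (bsz I)^-1 * dot v y by move: (Num.sqrt _) (_^-1) (dot v y) => e1 e2 e3; ring.
  by rewrite qq mulfV ?mul1r // gt_eqF.
rewrite HF_HP HP_Px big_split /= addrA addrK //.
Qed.

(** The centred part grows by the norm of [HP] and is fed by the block-mean part through the bounded
    vectors [qv]. *)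
Lemma Px_step T w y m b : opnorm (HP T w) <= m -> Bq T w <= b ->
  nrm (Px (HF T w *m y)) <= m * nrm (Px y) + b * Qn y.
Proof.
move=> hm hb; rewrite Px_HF; apply: (le_trans (nrmD _ _)); apply: lerD.
  by apply: (le_trans (opnormP _ _)); apply: ler_wpM2r; rewrite ?nrm_ge0.
apply: (@le_trans _ _ (Bq T w * Qn y)); last by apply: ler_wpM2r; rewrite ?Qn_ge0.
apply: (le_trans (nrm_sum _ _ _)); rewrite /Bq mulr_suml; apply: ler_sum => I _.
have h := u_Qn I y; move: h; move: (qv T w I) (uvec I) => v u h.
rewrite nrmZ mulrAC; apply: ler_wpM2r => //; exact: nrm_ge0.
Qed.

(** Bounds the block-mean part of the [j]-th iterate for all unit starting vectors at once, by
    symmetry of [HF]. *)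
Definition G2 T w j := \sum_I dot (uhat I) (pw (HF T w) (j + j) (uhat I)).

Lemma Qn_pw T w j x : nrm x <= 1 -> Qn (pw (HF T w) j x) ^+ 2 <= G2 T w j.
Proof.
move=> hx; rewrite Qn_sqr; apply: ler_sum => I _.
rewrite -dot_pw ?HF_sym // dot_pwD ?HF_sym // -nrm_sqr -[leRHS]mulr1.
apply: (le_trans (dot_sqr_le _ _)); rewrite -!nrm_sqr; apply: ler_wpM2l; first exact: sqr_ge0.
by rewrite expr_le1 ?nrm_ge0.
Qed.

Lemma G2_ge0 T w j : 0 <= G2 T w j.
Proof. by apply: le_trans (Qn_pw T w j (x := 0) _); rewrite ?sqr_ge0 // nrm0. Qed.

(** With the block-mean part at most [Y * lam ^+ j], each of the [N.+1] steps adds a bounded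
    multiple of [m ^+ j] to the centred part. The loss is linear in [N], and a high root removes
    it. *)
Lemma opn_upper T w N (lam m Y b : R) : 0 < lam -> lam <= m -> 0 <= Y -> opnorm (HP T w) <= m -> Bq T w <= b ->
  (forall j, (j <= N.+1)%N -> G2 T w j <= (Y * lam ^+ j) ^+ 2) ->
  opnorm (HF T w) ^+ N.+1 <= m ^+ N.+1 * (1 + N.+1%:R * (b * Y / m) + Y).
Proof.
move=> l0 lm Y0 hm hb hG; have m0 : 0 < m by apply: lt_le_trans lm.
have b0 : 0 <= b by apply: le_trans hb; apply: sumr_ge0 => I _; rewrite mulr_ge0 ?nrm_ge0.
have lp j : lam ^+ j <= m ^+ j by apply: lerXn2r; rewrite ?nnegrE // ltW.
have l0p j : 0 <= lam ^+ j by rewrite exprn_ge0 // ltW.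
have c0 : 0 <= b * Y / m by rewrite divr_ge0 ?mulr_ge0 // ltW.
have Qb x j : nrm x <= 1 -> (j <= N.+1)%N -> Qn (pw (HF T w) j x) <= Y * m ^+ j.
  move=> hx hj; apply: (@le_trans _ _ (Y * lam ^+ j)); last exact: ler_wpM2l.
  apply: le_sqr2; first by rewrite mulr_ge0.
  by apply: (le_trans (Qn_pw _ _ _ hx)); apply: hG.
have Pb x j : nrm x <= 1 -> (j <= N.+1)%N -> nrm (Px (pw (HF T w) j x)) <= m ^+ j * (1 + j%:R * (b * Y / m)).
  move=> hx; elim: j => [_|j IH hj].
    by rewrite mul0r addr0 mulr1; apply: le_trans (nrm_Px x) _.
  apply: (le_trans (Px_step _ hm hb)).
  apply: (le_trans (lerD (ler_wpM2l (ltW m0) (IH (ltnW hj))) (ler_wpM2l b0 (Qb x j hx (ltnW hj))))).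
  by rewrite le_eqVlt; apply/orP; left; apply/eqP; rewrite exprS -natr1; field; rewrite gt_eqF.
apply: opnorm_pow; first exact: HF_sym.
  by rewrite mulr_ge0 ?exprn_ge0 ?(ltW m0) // addr_ge0 // addr_ge0 // mulr_ge0.
move=> x hx; apply: (le_trans (nrm_PQ _)); rewrite mulrDr; apply: lerD; first exact: Pb.
by rewrite mulrC; apply: Qb.
Qed.

(** Three Markov bounds, one for each summand on the right: the high trace for the norm of [HP],
    [G2] at each exponent up to [N.+1], and the lengths of the [qv]. *)
Lemma HF_upper_prob T N q (lam m Y b S : R) (x : 'I_(K + K) -> R) : good T -> sS <= 1 -> kd <= 1 ->
  0 < lam -> lam <= m -> 0 < Y -> 0 < b -> \sum_I x I <= S ->
  Ex (fun w => Wk (HP T w) q.+1) <= d%:R * (S * lam ^+ (q.+1 + q.+1).+1) ->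
  (forall I j, (j <= N.+1)%N -> `|uhat_mean T I (j + j)| <= 2 * x I * lam ^+ (j + j).+1) ->
  Pr (fun w => m ^+ N.+1 * (1 + N.+1%:R * ((K + K)%:R * b * Y / m) + Y) < opnorm (HF T w) ^+ N.+1) <=
  d%:R * (S * lam) * (lam / m) ^+ (q.+1 + q.+1) + N.+2%:R * (2 * S * lam / Y ^+ 2) + (K + K)%:R * (qmom Cq 1 / b ^+ 2).
Proof.
move=> gT s1 k1 l0 lm Y0 b0 hS hW hph.
have m0 : 0 < m by apply: lt_le_trans lm.
have YL j : 0 < (Y * lam ^+ j) ^+ 2 by rewrite exprn_gt0 // mulr_gt0 // exprn_gt0.
have b2 : 0 < b ^+ 2 by rewrite exprn_gt0.
have mQ : 0 < m ^+ (q.+1 + q.+1) by rewrite exprn_gt0.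
pose F w := (Wk (HP T w) q.+1 / m ^+ (q.+1 + q.+1) + \sum_(j < N.+2) G2 T w j / (Y * lam ^+ j) ^+ 2) +
  \sum_I (nrm (uvec I) * nrm (qv T w I)) ^+ 2 / b ^+ 2.
have F1 w : 0 <= Wk (HP T w) q.+1 / m ^+ (q.+1 + q.+1) by rewrite divr_ge0 ?Wk_ge0 // ltW.
have F2 w j : 0 <= G2 T w j / (Y * lam ^+ j) ^+ 2 by rewrite divr_ge0 ?G2_ge0 // ltW.
have F3 w I : 0 <= (nrm (uvec I) * nrm (qv T w I)) ^+ 2 / b ^+ 2 by rewrite divr_ge0 ?sqr_ge0 // ltW.
have F20 w : 0 <= \sum_(j < N.+2) G2 T w j / (Y * lam ^+ j) ^+ 2 by apply: sumr_ge0.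
have F30 w : 0 <= \sum_I (nrm (uvec I) * nrm (qv T w I)) ^+ 2 / b ^+ 2 by apply: sumr_ge0.
have pt w : (m ^+ N.+1 * (1 + N.+1%:R * ((K + K)%:R * b * Y / m) + Y) < opnorm (HF T w) ^+ N.+1)%R%:R <= F w.
  have [hF|hF] := lerP 1 (F w).
    by apply: le_trans hF; rewrite lern1 leq_b1.
  have a1 : Wk (HP T w) q.+1 <= m ^+ (q.+1 + q.+1).
    rewrite -[leRHS]mul1r -ler_pdivrMr //; apply: le_trans (ltW hF); rewrite /F -addrA lerDl addr_ge0 //.
  have a2 j : (j <= N.+1)%N -> G2 T w j <= (Y * lam ^+ j) ^+ 2.
    move=> hj; rewrite -[leRHS]mul1r -ler_pdivrMr //; apply: le_trans (ltW hF).
    rewrite /F -ltnS in hj *; rewrite (bigD1 (Ordinal hj)) //=.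
    rewrite addrAC addrCA -[leLHS]addr0; apply: lerD => //.
    by rewrite addr_ge0 ?addr_ge0 // sumr_ge0.
  have a3 I : nrm (uvec I) * nrm (qv T w I) <= b.
    apply: le_sqr2; first exact: ltW.
    rewrite -[leRHS]mul1r -ler_pdivrMr //; apply: le_trans (ltW hF).
    rewrite /F (bigD1 I) //= addrCA -[leLHS]addr0; apply: lerD => //.
    by rewrite addr_ge0 ?addr_ge0 // sumr_ge0.
  have a4 : opnorm (HP T w) <= m.
    rewrite -(@ler_pXn2r _ (q.+1 + q.+1)) ?nnegrE ?opnorm_ge0 ?(ltW m0) //.
    exact: le_trans (opn_W _ _ _) a1.
  have a5 : Bq T w <= (K + K)%:R * b by rewrite /Bq -sum_ord_cst; apply: ler_sum.
  have := @opn_upper T w N lam m Y ((K + K)%:R * b) l0 lm (ltW Y0) a4 a5 a2.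
  rewrite leNgt => /negbTE ->; by rewrite /F addr_ge0 ?addr_ge0.
apply: (le_trans (Ex_le mu0 pt)); rewrite /F !ExD !Ex_sum; apply: lerD; first apply: lerD.
- rewrite ExZr ler_pdivrMr //; apply: (le_trans hW).
  by rewrite expr_div_n exprS le_eqVlt; apply/orP; left; apply/eqP; field; rewrite gt_eqF.
- rewrite -sum_ord_cst; apply: ler_sum => j _; have hj : (j <= N.+1)%N by rewrite -ltnS.
  rewrite ExZr ler_pdivrMr // /G2 Ex_sum.
  apply: (@le_trans _ _ (\sum_I 2 * x I * lam ^+ (j + j).+1)).
    by apply: ler_sum => I _; apply: (le_trans (ler_norm _)); apply: hph.
  rewrite -mulr_suml -mulr_sumr.
  have -> : 2 * S * lam / Y ^+ 2 * (Y * lam ^+ j) ^+ 2 = 2 * S * lam ^+ (j + j).+1.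
    rewrite exprMn -[(lam ^+ j) ^+ 2]exprM muln2 -addnn [lam ^+ (j + j).+1]exprS; move: (lam ^+ (j + j)) => L2.
    by field; rewrite gt_eqF.
  by apply: ler_wpM2r; [rewrite exprn_ge0 // ltW|apply: ler_wpM2l].
- rewrite -sum_ord_cst; apply: ler_sum => I _; rewrite ExZr; apply: ler_wpM2r; first by rewrite invr_ge0 ltW.
  exact: (qv_moment I 1 gT s1 k1).
Qed.
Lemma HF_upper T cb (x : 'I_(K + K) -> R) lam del q N (m Y b : R) :
  let P := (N.+1 + N.+1)%N in let Mo := Mom P ((2 * lam) ^+ (P + P) * (1 + (\sum_I x I) * lam)) in
  let e1 := 2 * kap * (CE * eps (q.+1 + q.+1).+1) in
  good T -> (forall I J, chat T I J <= cb I J) -> (forall I, 0 < x I) -> 0 < lam ->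
  (forall I, (x I)^-1 + \sum_J cb I J * x J + del <= lam) -> 2 * g0 <= lam ->
  (2 * ell)%:R * r / g0 * (q.+1 + q.+1).+1%:R <= 1 / 2 -> 0 <= del ->
  (forall I, e1 * (6 * lam^-1 ^+ 3 + 4 * lam^-1 ^+ 5 + (3 * lam^-1 ^+ 2 + 2 * lam^-1 ^+ 4) * (\sum_I x I)) <= del * x I * lam^-1) ->
  (d%:R <= 4 ^+ q.+1 :> R) -> sS <= 1 -> kd <= 1 -> lam <= m -> 0 < Y -> 0 < b -> (P <= q.+1)%N ->
  Err (P + P) Mo * (\sum_(k < P) lam^-1 ^+ k.+1) <= 1 ->
  Pr (fun w => m ^+ N.+1 * (1 + N.+1%:R * ((K + K)%:R * b * Y / m) + Y) < opnorm (HF T w) ^+ N.+1) <=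
  d%:R * ((\sum_I x I) * lam) * (lam / m) ^+ (q.+1 + q.+1) + N.+2%:R * (2 * (\sum_I x I) * lam / Y ^+ 2) + (K + K)%:R * (qmom Cq 1 / b ^+ 2).
Proof.
move=> P Mo e1 gT hcb x0 l0 hx hg sm del0 he hd s1 k1 lm Y0 b0 Pq hErr.
set S := \sum_I x I.
have S0 : 0 <= S by apply: sumr_ge0 => I _; apply: ltW.
have UB (U : {set 'I_n}) : U \subset T -> Ex (fun w => Wk (HP U w) q.+1) <= d%:R * (S * lam ^+ (q.+1 + q.+1).+1).
  move=> hU; apply: Ex_Wk; rewrite /S mulr_suml; apply: ler_sum => I _.
  exact: (@U_bound T cb x lam del q.+1 gT hcb x0 l0 hx hg sm del0 he q.+1 I U (leqnn _) hU).
have hMo i : Ex (fun w => (opnorm (HF (T0 T i) w) + 1) ^+ (P + P)) <= Mo.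
  have hU := T0_sub T i; apply: HF_moment => //; first exact: good_sub gT.
  exact: HP_moment l0 Pq S0 (UB _ hU) hd.
have hx' I : (x I)^-1 + \sum_J chat T I J * x J <= lam.
  apply: le_trans (hx I); rewrite -addrA lerD2l -[leLHS]addr0; apply: lerD => //.
  by apply: ler_sum => J _; apply: ler_wpM2r; [exact/ltW/x0|exact: hcb].
have htt J a : 0 <= tau_mean T J a.
  rewrite /tau_mean; case: (boolP (odd a)) => [ho|he1].
    by rewrite -[leLHS](Ex_cst mu1 0); apply: Ex_le => // w; rewrite tau_odd.
  rewrite -(odd_double_half a) (negbTE he1) add0n -addnn; apply: Ex_ge0 => // w; exact: tau_ev_ge0.
have hsum k J : (k <= P)%N -> \sum_(a < k) tau_mean T J a * lam^-1 ^+ a.+1 <= x J.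
  move=> kP; apply: (@sum_tau T cb x lam del q.+1 gT hcb x0 l0 hx hg sm del0 he T J k) => //.
  by clear - kP Pq; lia.
have FB := @F_bound T (P + P)%N Mo gT s1 hMo x lam P l0 x0 hx' (leqnn _) hsum htt hErr.
apply: (@HF_upper_prob T N q lam m Y b S x) => //; first exact: UB.
by move=> I j hj; apply: FB; rewrite /P; clear - hj; lia.
Qed.
(** These four constants are the error terms with their small factor removed, so that [Err_le]
    exhibits [Err] as linear in one small parameter. *)
Definition sVb P (Mo : R) : R := Num.sqrt (72 * (ell%:R ^+ 2 * kap) * P%:R ^+ 2 * Mo).
Definition cd1 P (Mo : R) : R := 2 * P%:R ^+ 2 * (40 * (ell%:R ^+ 2 * kap)) * Mo.
Definition cdl P (Mo : R) : R := P%:R * (CW * Mo) + cd1 P Mo + sVb P Mo.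
Definition cErr P (Mo : R) : R := cd1 P Mo + P%:R *
  (2 * kap * (K%:R * (AA P Mo ^+ P * cdl P Mo * Mo)) + 4 * (ell%:R ^+ 2 * kap) * Mo
    + 2 * kap * (sVb P Mo * Mo + (K + K)%:R * 2 * (P%:R * Mo) * Mo)).

Lemma mono_mid (a b k e : R) : 0 <= a -> 0 <= b -> k <= e -> a * (k * b) <= a * b * e.
Proof. by move=> a0 b0 h; rewrite [k * b]mulrC mulrA; apply: ler_wpM2l => //; apply: mulr_ge0. Qed.

Lemma lin2 (a b A B e : R) : a <= A * e -> b <= B * e -> a + b <= (A + B) * e.
Proof. by move=> h1 h2; rewrite mulrDl lerD. Qed.
Lemma lin3 (a b c A B C e : R) : a <= A * e -> b <= B * e -> c <= C * e -> a + b + c <= (A + B + C) * e.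
Proof. by move=> h1 h2 h3; rewrite !mulrDl !lerD. Qed.

Lemma Err_le P Mo e : 0 <= Mo -> sS <= e -> kd <= e -> e <= 1 -> Err P Mo <= cErr P Mo * e.
Proof.
move=> M0 hs hk e1; have k0 := kap_ge0; have kd0 := kd_ge0; have e0 := le_trans kd0 hk.
have C0 : 0 <= CW := CW_ge0.
have P0 : 0 <= P%:R :> R by [].
have l2 : 0 <= ell%:R ^+ 2 * kap by rewrite mulr_ge0 ?sqr_ge0.
have A0 : 0 <= AA P Mo ^+ P by rewrite exprn_ge0 // /AA addr_ge0 // !mulr_ge0.
have kd2e : kd ^+ 2 <= e by apply: le_trans (_ : kd <= e) => //; rewrite expr2; apply: ler_piMl => //; apply: le_trans e1.
have hV : Num.sqrt (Vb P Mo) <= sVb P Mo * e.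
  have -> : Vb P Mo = 72 * (ell%:R ^+ 2 * kap) * P%:R ^+ 2 * Mo * kd ^+ 2.
    by rewrite /Vb; move: (kd ^+ 2) (72 * _ * _) => u v; ring.
  rewrite sqrtrM; last by rewrite !mulr_ge0 ?sqr_ge0.
  by rewrite sqrtr_sqr ger0_norm //; apply: ler_wpM2l; rewrite ?sqrtr_ge0.
have h1 : d1 P Mo <= cd1 P Mo * e.
  by apply: mono_mid => //; rewrite mulr_ge0 ?mulr_ge0 ?sqr_ge0.
have h2 : dl P Mo <= cdl P Mo * e.
  apply: lin3 => //; rewrite -[_ * _ * e]mulrA; apply: ler_wpM2l => //; exact: mono_mid.
have c2 : 0 <= 2 * kap by rewrite mulr_ge0.
have S0 : 0 <= sVb P Mo by apply: sqrtr_ge0.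
apply: lin2 => //; rewrite -[_ * _ * e]mulrA; apply: ler_wpM2l => //.
apply: lin3.
- rewrite -!mulrA; apply: ler_wpM2l => //; apply: ler_wpM2l => //; apply: ler_wpM2l => //; apply: ler_wpM2l => //.
  by rewrite [Mo * e]mulrC mulrA; apply: ler_wpM2r.
- by apply: mono_mid; rewrite ?mulr_ge0 ?sqr_ge0.
- rewrite -[_ * _ * e]mulrA; apply: ler_wpM2l => //; apply: lin2.
    by rewrite mulrAC; apply: ler_wpM2r.
  have -> : (K + K)%:R * 2 * (P%:R * Mo) * Mo * e = (K + K)%:R * (2 * e) * (P%:R * Mo) * Mo by move: (P%:R) => p; ring.
  apply: ler_wpM2r => //; apply: ler_wpM2r; first by rewrite mulr_ge0.
  by apply: ler_wpM2l => //; apply: ler_wpM2l.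
Qed.

Lemma eps_mono (a b : nat) : (a <= b)%N -> eps a <= eps b.
Proof.
move=> ab; have h : a%:R <= b%:R :> R by rewrite ler_nat.
apply: lerD; first by apply: ler_wpM2l => //; apply: lerXn2r; rewrite ?nnegrE.
by apply: ler_wpM2r; rewrite ?invr_ge0 ?sqrtr_ge0 //; apply: lerXn2r; rewrite ?nnegrE.
Qed.

(** The lower bound also uses the upper bounds [cb]: they supply the a priori moment bound [BN] in
    the error of the recursion. The passage from [HP] to [HF] is free by compression. *)
Lemma HF_lower T cb (x : 'I_(K + K) -> R) lam del q cl k I Mm del2 y eta :
  let e1 := 2 * kap * (CE * eps (q.+1 + q.+1).+1) in
  let S := \sum_I x I in let BN := S * (1 + lam) ^+ (4 * k).+1 in
  good T -> (forall I J, chat T I J <= cb I J) -> (forall I, 0 < x I) -> 0 < lam ->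
  (forall I, (x I)^-1 + \sum_J cb I J * x J + del <= lam) -> 2 * g0 <= lam ->
  (2 * ell)%:R * r / g0 * (q.+1 + q.+1).+1%:R <= 1 / 2 -> 0 <= del ->
  (forall I, e1 * (6 * lam^-1 ^+ 3 + 4 * lam^-1 ^+ 5 + (3 * lam^-1 ^+ 2 + 2 * lam^-1 ^+ 4) * S) <= del * x I * lam^-1) ->
  (forall I J, 0 <= cl I J) -> (k + k <= q)%N ->
  (forall (T' : {set 'I_n}) I J, T' \subset T -> (#|T :\: T'| <= ell * k)%N -> cl I J <= chat T' I J) ->
  0 <= Mm -> (forall j I, (j <= k)%N -> ms cl j I <= Mm) -> kap / d%:R <= del2 ->
  2 * kap * (CE * eps (q.+1 + q.+1).+1 * (2 * (1 + g0) ^+ (k + k) + BN)) <= del2 -> 0 < eta ->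
  y <= ms cl k I - (1 + 4 * kap * k%:R * Mm) ^+ k * del2 ->
  Pr (fun w => opnorm (HF T w) ^+ (k + k) < y - eta) <=
  Ccov * ((k + k)%:R * (k + k)%:R) / Num.sqrt d%:R * ((1 + g0) ^+ (4 * k) + BN) / eta ^+ 2.
Proof.
move=> e1 S BN gT hcb x0 l0 hx hg sm del0 he cl0 kq hcl M0 hM hd2 hE eta0 hy.
have S0 : 0 <= S by apply: sumr_ge0 => J _; apply: ltW.
have l1 : 1 <= 1 + lam by rewrite lerDl ltW.
have G1 : 1 <= 1 + g0 by rewrite lerDl ltW.
have gp a b : (a <= b)%N -> g0 ^+ a <= (1 + g0) ^+ b.
  move=> ab; apply: (@le_trans _ _ ((1 + g0) ^+ a)).
    by apply: lerXn2r; rewrite ?nnegrE ?lerDr ?(ltW g0_gt0) // addr_ge0 // ltW.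
  by apply: ler_weXn2l.
have B0 : 0 <= BN by rewrite mulr_ge0 // exprn_ge0 // (le_trans ler01).
have hEB j : (j <= k + k)%N -> EB T j BN.
  move=> jk U hU; rewrite /BN mulr_suml; apply: ler_sum => J _.
  have jq : (j <= q.+1)%N by clear - jk kq; lia.
  apply: (le_trans (@U_bound T cb x lam del q.+1 gT hcb x0 l0 hx hg sm del0 he j J U jq hU)).
  apply: ler_wpM2l; first exact: ltW.
  apply: (@le_trans _ _ ((1 + lam) ^+ (j + j).+1)).
    by apply: lerXn2r; rewrite ?nnegrE ?lerDr ?(ltW l0) // addr_ge0 // ltW.
  by apply: ler_weXn2l => //; clear - jk; lia.
have c0 : 0 <= (2 * ell)%:R * r / g0 by rewrite divr_ge0 ?mulr_ge0 // ltW.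
have smm a : (a <= (q.+1 + q.+1).+1)%N -> (2 * ell)%:R * r / g0 * a%:R <= 1 / 2.
  move=> ha; apply: le_trans sm; apply: ler_wpM2l => //; by rewrite ler_nat.
have hEe j : (j < k)%N -> Eerr j BN <= del2.
  move=> jk; apply: le_trans hE; apply: ler_wpM2l; first by rewrite mulr_ge0 ?kap_ge0.
  apply: ler_pM; rewrite ?mulr_ge0 ?CE_ge0 ?eps_ge0 ?addr_ge0 ?exprn_ge0 ?(ltW g0_gt0) //.
    by apply: ler_wpM2l; [exact: CE_ge0|apply: eps_mono; clear - jk kq; lia].
  rewrite lerD2r [2 * _]mulr_natl mulr2n; apply: lerD; apply: gp; clear - jk; lia.
have h1 := @lower_tau T cl k BN Mm del2 gT cl0 hcl.
have h2 : ms cl k I - (1 + 4 * kap * k%:R * Mm) ^+ k * del2 <= Ex (fun w => tau I (HP T w) (k + k)).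
  apply: h1 => //.
  - by move=> j jk; apply: hEB; clear - jk; lia.
  - by apply: smm; clear - kq; lia.
  - by rewrite finset.setDv cards0.
have sm2 : (2 * ell)%:R * r / g0 * (k + k + (k + k)).+1%:R <= 1 / 2 by apply: smm; clear - kq; lia.
have hB2 : EB T (k + k).-1 BN by apply: hEB; clear; lia.
have h3 := opn_lower gT sm2 hB2 eta0 (le_trans hy h2).
apply: le_trans (_ : Pr (fun w => opnorm (HP T w) ^+ (k + k) < y - eta) <= _).
  apply: (Pr_sub mu0) => w; apply: le_lt_trans.
  by apply: lerXn2r; rewrite ?nnegrE ?opnorm_ge0 ?opn_HP_HF.
apply: (le_trans h3); apply: ler_wpM2r; first by rewrite invr_ge0 sqr_ge0.
apply: ler_wpM2l; first by rewrite divr_ge0 ?sqrtr_ge0 // mulr_ge0 ?Ccov_ge0 ?mulr_ge0.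
by rewrite lerD2r; apply: gp; clear; lia.
Qed.
End Model.

(** * Norm bounds uniform over all models with small parameters *)

Section Uniform.
Variable (R : realType).

Lemma near_lin (A B : R) : 0 < B -> \forall e \near 0^'+, A * e <= B.
Proof.
move=> B0; have c0 : 0 < B / (`|A| + 1) by rewrite divr_gt0 // ltr_wpDl.
near=> e; have e0 : 0 < e by near: e; exact: nbhs_right_gt.
have h : e <= B / (`|A| + 1) by near: e; exact: nbhs_right_le.
apply: (@le_trans _ _ ((`|A| + 1) * e)).
  by apply: ler_wpM2r; [exact: ltW|apply: (le_trans (ler_norm _)); rewrite lerDl].
by move: h; rewrite ler_pdivlMr ?ltr_wpDl // mulrC.
Unshelve. all: by end_near. Qed.

Lemma near_ex (P : R -> Prop) : (\forall e \near 0^'+, P e) -> exists2 e, 0 < e & P e.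
Proof.
move=> h; near (0 : R)^'+ => e; exists e; last by near: e.
by near: e; exact: nbhs_right_gt.
Unshelve. all: by end_near. Qed.

(** Provides the fixed power whose root hides the quadratic loss of the bound on [HF]. *)
Lemma poly_exp (h C : R) : 0 < h -> exists N, C * N.+2%:R ^+ 2 <= (1 + h) ^+ N.+1.
Proof.
(* With [N + 1 = 3 k], Bernoulli gives [(1 + h) ^ (3 k) >= (k h) ^ 3], and the 16 covers
   [3 k + 1 <= 4 k]. *)
move=> h0; pose k := (Num.bound (16 * `|C| / h ^+ 3)).+1.
have hk : 16 * `|C| <= k%:R * h ^+ 3.
  rewrite -ler_pdivrMr ?exprn_gt0 //; apply: ltW; apply: lt_le_trans (archi_boundP _) _.
    by apply: divr_ge0; [apply: mulr_ge0|apply: exprn_ge0; exact: ltW].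
  by rewrite ler_nat.
exists (3 * k).-1; rewrite prednK ?muln_gt0 // .
have k1 : 1 <= k%:R :> R by rewrite ler1n.
have b1 j : 1 + j%:R * h <= (1 + h) ^+ j.
  elim: j => [|j IH]; first by rewrite mul0r addr0.
  rewrite exprS; apply: le_trans (ler_wpM2l _ IH); last by rewrite addr_ge0 // ltW.
  rewrite -natr1; have : 0 <= j%:R :> R by []. nra.
have hh : (k%:R * h) ^+ 3 <= (1 + h) ^+ (3 * k).
  rewrite mulnC exprM; apply: lerXn2r; rewrite ?nnegrE ?exprn_ge0 ?addr_ge0 ?mulr_ge0 ?(ltW h0) //.
  by apply: le_trans (b1 k); rewrite lerDr.
apply: le_trans hh; rewrite exprMn.
have -> : ((3 * k).-1.+2)%:R = 3 * k%:R + 1 :> R by rewrite prednK ?muln_gt0 // -natr1 natrM.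
apply: (@le_trans _ _ (`|C| * (3 * k%:R + 1) ^+ 2)).
  by apply: ler_wpM2r; rewrite ?sqr_ge0 ?ler_norm.
apply: (@le_trans _ _ (`|C| * (16 * k%:R ^+ 2))); first by apply: ler_wpM2l => //; nra.
have -> : `|C| * (16 * k%:R ^+ 2) = 16 * `|C| * k%:R ^+ 2 by ring.
have -> : k%:R ^+ 3 * h ^+ 3 = k%:R * h ^+ 3 * k%:R ^+ 2 by ring.
by apply: ler_wpM2r => //; exact: sqr_ge0.
Qed.

Lemma thirds (a : R) : a / 3 + a / 3 + a / 3 = a.
Proof. by field. Qed.

Lemma le_third (a eta : R) : 0 <= a -> 0 < eta -> a <= eta / 3 * (1 + a * (3 / eta)) ^+ 2.
Proof.
move=> a0 e0; have t0 : 0 <= a * (3 / eta) by rewrite mulr_ge0 // divr_ge0 // ltW.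
have h : a * (3 / eta) <= (1 + a * (3 / eta)) ^+ 2 by nra.
have -> : a = eta / 3 * (a * (3 / eta)) by field; rewrite gt_eqF.
have -> : eta / 3 * (a * (3 / eta)) * (3 / eta) = a * (3 / eta) by field; rewrite gt_eqF.
by apply: ler_wpM2l => //; rewrite divr_ge0 // ltW.
Qed.

Lemma small_rearr (a r g m e : R) : 0 <= a / g -> r * m <= e -> a * r / g * m <= a / g * e.
Proof.
move=> h1 h2; have -> : a * r / g * m = a / g * (r * m) by move: (g^-1) => u; ring.
exact: ler_wpM2l.
Qed.

Lemma he_rearr (k ce Z ep e : R) : 0 <= k -> 0 <= ce -> 0 <= Z -> ep <= 2 * e -> k * (ce * ep) * Z <= k * (ce * 2) * Z * e.
Proof.
move=> k0 c0 Z0 h; have -> : k * (ce * 2) * Z * e = k * (ce * (2 * e)) * Z by ring.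
by apply: ler_wpM2r => //; apply: ler_wpM2l => //; apply: ler_wpM2l.
Qed.

Lemma bulk_le (u v c Y : R) : 1 <= v -> 0 <= u -> u <= v -> 0 <= c -> 0 <= Y ->
  1 + u * v * c + v * Y <= (1 + c + Y) * v ^+ 2.
Proof.
move=> v1 u0 uv c0 Y0; have v0 : 0 <= v by apply: le_trans v1.
have h1 : 1 <= v ^+ 2 by apply: exprn_ege1.
have h2 : u * v * c <= v ^+ 2 * c by apply: ler_wpM2r => //; rewrite expr2; apply: ler_wpM2r.
have h3 : v * Y <= v ^+ 2 * Y by apply: ler_wpM2r => //; rewrite expr2; apply: ler_peMr.
lra.
Qed.

Definition model (K d n ell : nat) (part : 'I_d -> 'I_K) (g : 'I_n -> nat) (r kap : R) :=
  [/\ (0 < d)%N, forall I, d%:R <= kap * bsz R part I, 0 <= r, n%:R * r ^+ 2 <= d%:R & forall s, (g s < n)%N].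
(** The two error rates at the top power [2 (q + 1) + 1], and a power large enough for [4 ^+ q.+1]
    to exceed the dimension. *)
Definition tiny d r q (e : R) :=
  [/\ r * (q.+1 + q.+1).+1%:R ^+ 2 <= e, (q.+1 + q.+1).+1%:R ^+ 3 / Num.sqrt d%:R <= e & d%:R <= 4 ^+ q.+1 :> R].

Lemma tiny_facts d r q (e kap : R) ell : (0 < d)%N -> 0 <= r -> 0 <= kap -> tiny d r q e ->
  [/\ 0 <= e, r * (q.+1 + q.+1).+1%:R <= e, eps d r (q.+1 + q.+1).+1 <= 2 * e, sS r ell <= 6 * ell%:R * e &
    [/\ (Num.sqrt d%:R)^-1 <= e, d%:R^-1 <= e & kd d kap <= Num.sqrt kap * e]].
Proof.
move=> d0 r0 k0 [h1 h2 _]; set m : R := ((q.+1 + q.+1).+1)%:R in h1 h2 *.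
have m1 : 1 <= m by rewrite ler1n.
have dR : 1 <= d%:R :> R by rewrite ler1n.
have sd : 1 <= Num.sqrt d%:R :> R by rewrite -[leLHS]sqrtr1; apply: ler_wsqrtr.
have rm : r * m <= e by apply: le_trans h1; apply: ler_wpM2l => //; rewrite expr2; apply: ler_peMl => //; apply: le_trans m1.
have re : r <= e by apply: le_trans rm; apply: ler_peMr.
have se : (Num.sqrt d%:R)^-1 <= e.
  apply: le_trans h2; rewrite -[leLHS]mul1r; apply: ler_wpM2r; first by rewrite invr_ge0 (le_trans ler01).
  exact: exprn_ege1.
split => //.
- exact: le_trans re.
- by rewrite /eps mulr_natl mulr2n; apply: lerD.
- by apply: ler_wpM2l => //; rewrite mulr_ge0.
split => //.
  apply: le_trans se; rewrite lef_pV2 ?posrE ?(lt_le_trans ltr01) //.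
  rewrite -[leRHS]sqr_sqrtr ?ler0n // expr2; apply: ler_peMl => //; exact: le_trans ler01 sd.
by rewrite /kd sqrtrM // sqrtrV ?ler0n //; apply: ler_wpM2l => //; exact: sqrtr_ge0.
Qed.

(** The thresholds [e0] and [q0] precede the dimension, the cluster sequence and the matrix, so that
    one choice serves almost all clusterings as [d] grows. *)
Lemma upper_unif (K ell : nat) (kap lam m m2 eta del : R) (cb : 'I_(K + K) -> 'I_(K + K) -> R) x :
  0 <= kap -> (forall I, 0 < x I) -> 0 < lam -> 0 < del ->
  (forall I, (x I)^-1 + \sum_J cb I J * x J + del <= lam) -> lam < m -> m < m2 -> 0 < eta ->
  exists2 e0, 0 < e0 & exists q0, forall d n part sig nx g r (T : {set 'I_n}) q,
    @model K d n ell part g r kap -> good nx g ell T -> (forall I J, chat part sig nx r T I J <= cb I J) ->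
    tiny d r q e0 -> d%:R * (lam / m) ^+ (q.+1 + q.+1) <= e0 -> (q0 <= q)%N ->
    Pr (cond_law R part sig) (fun w => m2 < opnorm (HF part sig nx r T w)) <= eta.
Proof.
move=> k0 x0 l0 del0 hx lm mm2 eta0.
have m0 : 0 < m by apply: lt_trans lm.
pose S := \sum_I x I; have S0 : 0 <= S by apply: sumr_ge0 => I _; apply: ltW.
pose qm := qmom (Cq kap ell) 1.
have t0 : 0 <= 3 / eta by rewrite divr_ge0 // ltW.
have a10 : 0 <= (K + K)%:R * `|qm| by rewrite mulr_ge0.
have q0' := mulr_ge0 a10 t0.
(* [b] and [Y1] make two of the three Markov bounds at most [eta / 3]. The level for the block-mean
   part is [N.+2 * Y1], growing with [N], because a union over [N.+2] exponents is taken. *)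
pose b := 1 + (K + K)%:R * `|qm| * (3 / eta).
have b0 : 0 < b by rewrite ltr_wpDr.
have a20 : 0 <= 2 * S * lam by rewrite mulr_ge0 ?mulr_ge0 // ltW.
have y0 := mulr_ge0 a20 t0.
pose Y1 := 1 + 2 * S * lam * (3 / eta).
have Y10 : 0 < Y1 by rewrite ltr_wpDr.
have hh : 0 < m2 / m - 1 by rewrite subr_gt0 ltr_pdivlMr // mul1r.
pose C := 1 + (K + K)%:R * b * Y1 / m + Y1.
have [N hN] := poly_exp C hh.
have hN' : m ^+ N.+1 * (1 + N.+1%:R * ((K + K)%:R * b * (N.+2%:R * Y1) / m) + N.+2%:R * Y1) <= m2 ^+ N.+1.
  have E : m2 ^+ N.+1 = m ^+ N.+1 * (1 + (m2 / m - 1)) ^+ N.+1.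
    by rewrite addrC subrK -exprMn mulrCA divff ?mulr1 // gt_eqF.
  rewrite E; apply: ler_wpM2l; first by rewrite exprn_ge0 // ltW.
  apply: le_trans hN; rewrite /C.
  have -> : N.+1%:R * ((K + K)%:R * b * (N.+2%:R * Y1) / m) = (N.+1%:R * N.+2%:R) * ((K + K)%:R * b * Y1 / m).
    by field; rewrite gt_eqF.
  have c0 : 0 <= (K + K)%:R * b * Y1 / m by rewrite divr_ge0 ?mulr_ge0 // ltW.
  have n1 : 1 <= N.+2%:R :> R by rewrite ler1n.
  have n2 : N.+1%:R <= N.+2%:R :> R by rewrite ler_nat.
  have n3 : 0 <= N.+1%:R :> R by [].
  exact: bulk_le n1 n3 n2 c0 (ltW Y10).
pose P := (N.+1 + N.+1)%N.
pose Mo := Mom K kap ell P ((2 * lam) ^+ (P + P) * (1 + S * lam)).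
pose Z := 6 * lam^-1 ^+ 3 + 4 * lam^-1 ^+ 5 + (3 * lam^-1 ^+ 2 + 2 * lam^-1 ^+ 4) * S.
pose Sg := \sum_(k < P) lam^-1 ^+ k.+1.
pose c := 6 * ell%:R + Num.sqrt kap.
have c0 : 0 <= c by rewrite addr_ge0 ?mulr_ge0 ?sqrtr_ge0.
have Sg0 : 0 <= Sg by apply: sumr_ge0 => k _; rewrite exprn_ge0 // invr_ge0 ltW.
have [|e0 e00 [[E1 E2] [E3 E4] E5]] := @near_ex (fun e => [/\
   (2 * ell)%:R / (lam / 2) * e <= 1 / 2 /\ (forall I, 2 * kap * (CE kap ell (lam / 2) * 2) * Z * e <= del * x I * lam^-1),
   c * e <= 1 /\ cErr K kap ell (P + P) Mo * c * Sg * e <= 1 & S * lam * e <= eta / 3]).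
  near=> e; split; first split.
  - by near: e; apply: near_lin; rewrite divr_gt0.
  - near: e; apply: filter_forall => I; apply: near_lin; by rewrite mulr_gt0 ?invr_gt0 // mulr_gt0.
  - by split; near: e; apply: near_lin.
  - by near: e; apply: near_lin; rewrite divr_gt0.
exists e0 => //; exists P => d n part sig nx g r T q [d0 hk r0 nr gl] gT hcb hT hd Pq.
have [e0' F1 F2 F3 [F4 F5 F6]] := tiny_facts ell d0 r0 k0 hT; have [_ _ hd4] := hT.
have g0 : 0 < lam / 2 by rewrite divr_gt0.
have ce0 := CE_ge0 ell d0 hk g0.
have Z0 : 0 <= Z.
  have il : 0 <= lam^-1 by rewrite invr_ge0 ltW.
  by rewrite /Z !addr_ge0 ?mulr_ge0 ?addr_ge0 ?mulr_ge0 ?exprn_ge0.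
have Mo0 : 0 <= Mo.
  have qq := qmom_ge0 P (Cq_ge0 ell d0 hk).
  rewrite /Mo /Mom; apply: mulr_ge0; last exact: exprn_ge0.
  apply: mulr_ge0; first exact: exprn_ge0.
  apply: addr_ge0; last by rewrite addr_ge0 // mulr_ge0 ?exprn_ge0 // mulr_ge0.
  apply: addr_ge0 => //; apply: mulr_ge0; first by rewrite exprn_ge0 // mulr_ge0 // ltW.
  by rewrite addr_ge0 // mulr_ge0 // ltW.
have A1 : sS r ell <= c * e0 by apply: (le_trans F3); apply: ler_wpM2r => //; rewrite lerDl sqrtr_ge0.
have A2 : kd d kap <= c * e0 by apply: (le_trans F6); apply: ler_wpM2r => //; rewrite lerDr mulr_ge0.
have Y0 : 0 < N.+2%:R * Y1 by rewrite mulr_gt0.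
have U := @HF_upper R K d n part sig nx g r kap ell d0 hk r0 nr gl (lam / 2) g0 T cb x lam del q N m (N.+2%:R * Y1) b
  gT hcb x0 l0 hx.
have U2 : Pr (cond_law R part sig) (fun w => m ^+ N.+1 * (1 + N.+1%:R * ((K + K)%:R * b * (N.+2%:R * Y1) / m) + N.+2%:R * Y1) < opnorm (HF part sig nx r T w) ^+ N.+1) <=
  d%:R * (S * lam) * (lam / m) ^+ (q.+1 + q.+1) + N.+2%:R * (2 * S * lam / (N.+2%:R * Y1) ^+ 2) + (K + K)%:R * (qm / b ^+ 2).
  apply: U => //.
  - by rewrite mulrCA divff ?mulr1 // pnatr_eq0.
  - by apply: le_trans E1; apply: small_rearr => //; rewrite divr_ge0 // ltW.
  - exact: ltW.
  - by move=> I; apply: le_trans (E2 I); apply: he_rearr => //; rewrite mulr_ge0.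
  - exact: le_trans E3.
  - exact: le_trans E3.
  - exact: ltW.
  - exact: leq_trans Pq _.
  - apply: le_trans E4; rewrite -[leRHS]mulrA [Sg * _]mulrC mulrA; apply: ler_wpM2r => //.
    rewrite -[leRHS]mulrA; have hE := @Err_le R K d part r kap ell d0 hk (P + P)%N Mo (c * e0) Mo0 A1 A2 E3; exact: hE.
rewrite -(thirds eta); apply: le_trans (le_trans _ U2) _.
  apply: Pr_sub => [s v|w hw]; [exact: cond_law_ge0|apply: (le_lt_trans hN')].
  by rewrite ltr_pXn2r ?nnegrE ?opnorm_ge0 // ltW // (lt_trans m0).
apply: lerD; first apply: lerD.
- by apply: le_trans E5; rewrite mulrAC mulrC; apply: ler_wpM2l => //; rewrite mulr_ge0 // ltW.
- have -> : N.+2%:R * (2 * S * lam / (N.+2%:R * Y1) ^+ 2) = 2 * S * lam / (N.+2%:R * Y1 ^+ 2).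
    by field; rewrite gt_eqF //= pnatr_eq0.
  have v1 : 1 <= N.+2%:R :> R by rewrite ler1n.
  rewrite ler_pdivrMr ?mulr_gt0 ?exprn_gt0 //; apply: (le_trans (le_third a20 eta0)).
  apply: ler_wpM2l; first by rewrite divr_ge0 // ltW.
  by apply: ler_peMl => //; exact: sqr_ge0.
- rewrite mulrA ler_pdivrMr ?exprn_gt0 //; apply: le_trans (le_third a10 eta0).
  by apply: ler_wpM2l => //; exact: ler_norm.
Unshelve. all: by end_near.
Qed.
(** Half of the gap between [ms cl k I] and [low ^+ (k + k)] pays for the bias of the moment, the
    other half for its fluctuation. *)
Lemma lower_unif (K ell k : nat) (kap lam eta del low : R) (cb cl : 'I_(K + K) -> 'I_(K + K) -> R) x I :
  0 <= kap -> (forall I, 0 < x I) -> 0 < lam -> 0 < del ->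
  (forall I, (x I)^-1 + \sum_J cb I J * x J + del <= lam) -> 0 < eta ->
  (forall I J, 0 <= cl I J) -> (0 < k)%N -> 0 <= low -> low ^+ (k + k) < ms cl k I ->
  exists2 e0, 0 < e0 & exists q0, forall d n part sig nx g r (T : {set 'I_n}) q,
    @model K d n ell part g r kap -> good nx g ell T -> (forall I J, chat part sig nx r T I J <= cb I J) ->
    tiny d r q e0 -> (q0 <= q)%N ->
    (forall (T' : {set 'I_n}) I J, T' \subset T -> (#|T :\: T'| <= ell * k)%N -> cl I J <= chat part sig nx r T' I J) ->
    Pr (cond_law R part sig) (fun w => opnorm (HF part sig nx r T w) < low) <= eta.
Proof.
move=> k0 x0 l0 del0 hx eta0 cl0 kp low0 hlow.
pose S := \sum_I x I; have S0 : 0 <= S by apply: sumr_ge0 => J _; apply: ltW.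
pose Mm := \sum_(j < k.+1) \sum_J ms cl j J.
have ms0' j J : 0 <= ms cl j J by apply: ms_ge0.
have hM j J : (j <= k)%N -> ms cl j J <= Mm.
  move=> jk; rewrite -ltnS in jk; rewrite /Mm (bigD1 (Ordinal jk)) //= (bigD1 J) //= -addrA lerDl.
  by rewrite addr_ge0 // sumr_ge0 // => ? _; rewrite sumr_ge0.
have Mm0 : 0 <= Mm by apply: le_trans (hM 0%N I _).
pose A := (1 + 4 * kap * k%:R * Mm) ^+ k.
have A0 : 0 < A by rewrite exprn_gt0 // ltr_wpDr // !mulr_ge0.
pose G := (ms cl k I - low ^+ (k + k)) / 2.
have G0 : 0 < G by rewrite divr_gt0 // subr_gt0.
have GE : ms cl k I - G - G = low ^+ (k + k) by rewrite /G; move: (ms cl k I) (low ^+ _) => u v; field.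
pose Z := 6 * lam^-1 ^+ 3 + 4 * lam^-1 ^+ 5 + (3 * lam^-1 ^+ 2 + 2 * lam^-1 ^+ 4) * S.
pose BN := S * (1 + lam) ^+ (4 * k).+1.
pose W := 2 * (1 + lam / 2) ^+ (k + k) + BN.
pose V := Ccov kap ell * ((k + k)%:R * (k + k)%:R) * ((1 + lam / 2) ^+ (4 * k) + BN) / G ^+ 2.
have [|e0 e00 [[E1 E2] [E3 E4] E5]] := @near_ex (fun e => [/\
   (2 * ell)%:R / (lam / 2) * e <= 1 / 2 /\ (forall I, 2 * kap * (CE kap ell (lam / 2) * 2) * Z * e <= del * x I * lam^-1),
   kap * e <= G / A /\ 2 * kap * (CE kap ell (lam / 2) * 2) * W * e <= G / A & V * e <= eta]).
  near=> e; split; first split.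
  - by near: e; apply: near_lin; rewrite divr_gt0.
  - near: e; apply: filter_forall => J; apply: near_lin; by rewrite mulr_gt0 ?invr_gt0 // mulr_gt0.
  - by split; near: e; apply: near_lin; rewrite divr_gt0.
  - by near: e; apply: near_lin.
exists e0 => //; exists (k + k)%N => d n part sig nx g r T q [d0 hk r0 nr gl] gT hcb hT kq hcl.
have [e0' F1 F2 F3 [F4 F5 F6]] := tiny_facts ell d0 r0 k0 hT.
have g0 : 0 < lam / 2 by rewrite divr_gt0.
have ce0 := CE_ge0 ell d0 hk g0.
have cc0 := Ccov_ge0 ell d0 hk.
have il : 0 <= lam^-1 by rewrite invr_ge0 ltW.
have Z0 : 0 <= Z by rewrite /Z !addr_ge0 ?mulr_ge0 ?addr_ge0 ?mulr_ge0 ?exprn_ge0.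
have B0 : 0 <= BN by rewrite mulr_ge0 // exprn_ge0 // addr_ge0 // ltW.
have h1 m' : 0 <= (1 + lam / 2) ^+ m' by rewrite exprn_ge0 // addr_ge0 // ltW.
have W0 : 0 <= W by rewrite addr_ge0 // mulr_ge0.
have U := @HF_lower R K d n part sig nx g r kap ell d0 hk r0 nr gl (lam / 2) g0 T cb x lam del q cl k I Mm (G / A) (ms cl k I - G) G
  gT hcb x0 l0 hx.
have U2 : Pr (cond_law R part sig) (fun w => opnorm (HF part sig nx r T w) ^+ (k + k) < ms cl k I - G - G) <=
  Ccov kap ell * ((k + k)%:R * (k + k)%:R) / Num.sqrt d%:R * ((1 + lam / 2) ^+ (4 * k) + BN) / G ^+ 2.
  apply: U => //.
  - by rewrite mulrCA divff ?mulr1 // pnatr_eq0.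
  - by apply: le_trans E1; apply: small_rearr => //; rewrite divr_ge0 // ltW.
  - exact: ltW.
  - by move=> J; apply: le_trans (E2 J); apply: he_rearr => //; rewrite mulr_ge0.
  - by apply: le_trans E3; apply: ler_wpM2l.
  - by apply: le_trans E4; rewrite mulrA; apply: he_rearr => //; rewrite mulr_ge0.
  - by rewrite -/A mulrC mulfVK // gt_eqF.
rewrite GE in U2; apply: le_trans (le_trans _ (le_trans U2 _)) E5.
  apply: Pr_sub => [s v|w hw]; first exact: cond_law_ge0.
  by rewrite ltr_pXn2r ?nnegrE ?opnorm_ge0 // addn_gt0 kp.
rewrite /V; have -> : Ccov kap ell * ((k + k)%:R * (k + k)%:R) / Num.sqrt d%:R * ((1 + lam / 2) ^+ (4 * k) + BN) / G ^+ 2 =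
  Ccov kap ell * ((k + k)%:R * (k + k)%:R) * ((1 + lam / 2) ^+ (4 * k) + BN) / G ^+ 2 * (Num.sqrt d%:R)^-1.
  by move: (Ccov _ _) (_ + BN) (G ^+ 2)^-1 (Num.sqrt _)^-1 => a1 a2 a3 a4; ring.
apply: ler_wpM2l => //; apply: divr_ge0; last exact: sqr_ge0.
by rewrite mulr_ge0 ?addr_ge0 // mulr_ge0 // mulr_ge0.
Unshelve. all: by end_near.
Qed.
End Uniform.
(** * The cluster chain *)

Section Chain.
Variables (R : realType) (K : nat) (p : 'M[R]_K) (pi : 'I_K -> R).
Hypothesis hp : stochastic p.
Hypothesis hpi : equilibrium p pi.

Definition pt n (s : {ffun 'I_n.+1 -> 'I_K}) (i : nat) : 'I_K := s (inord i).
Definition Qw n (s : {ffun 'I_n.+1 -> 'I_K}) : R := pi (pt s 0) * \prod_(i < n) p (pt s i) (pt s i.+1).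
Definition cluster_Ex n (F : {ffun 'I_n.+1 -> 'I_K} -> R) : R := \sum_s Qw s * F s.
Definition ext n (s : {ffun 'I_n.+1 -> 'I_K}) b : {ffun 'I_n.+2 -> 'I_K} :=
  [ffun i : 'I_n.+2 => if (i < n.+1)%N then s (inord i) else b].

Lemma pt_ext n (s : {ffun 'I_n.+1 -> 'I_K}) b i : (i <= n)%N -> pt (ext s b) i = pt s i.
Proof. by move=> h; rewrite /pt ffunE inordK ?ltnS ?h // leqW. Qed.
Lemma pt_ext_last n (s : {ffun 'I_n.+1 -> 'I_K}) b : pt (ext s b) n.+1 = b.
Proof. by rewrite /pt ffunE inordK // ltnn. Qed.

Lemma Qw_ge0 n (s : {ffun 'I_n.+1 -> 'I_K}) : 0 <= Qw s.
Proof.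
have [h1 [h2 h3]] := hpi; have [h4 h5] := hp; rewrite mulr_ge0 //; apply: prodr_ge0 => i _.
by have /andP[] := h4 (pt s i) (pt s i.+1).
Qed.

Lemma Qw_ext n (s : {ffun 'I_n.+1 -> 'I_K}) b : Qw (ext s b) = Qw s * p (pt s n) b.
Proof.
rewrite /Qw big_ord_recr /= pt_ext // pt_ext // pt_ext_last mulrA; congr (_ * _ * _).
by apply: eq_bigr => i _; have hi := ltn_ord i; rewrite !pt_ext // ltnW.
Qed.

Lemma EQ_ext n (F : {ffun 'I_n.+2 -> 'I_K} -> R) :
  cluster_Ex F = cluster_Ex (fun s => \sum_b p (pt s n) b * F (ext s b)).
Proof.
rewrite /cluster_Ex (reindex (fun x : {ffun 'I_n.+1 -> 'I_K} * 'I_K => ext x.1 x.2)) /=; last first.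
  exists (fun s => ([ffun j : 'I_n.+1 => s (inord j)], s ord_max)) => [[s b] _|s _] /=.
    congr (_, _).
      by apply/ffunP => j; rewrite !ffunE inordK ?ltn_ord ?inord_val // ltnW // ltnS.
    by rewrite ffunE /= ltnn.
  apply/ffunP => i; rewrite !ffunE; case: ifP => hi.
    by congr (s _); apply: val_inj; rewrite /= inordK // inordK // ltnW.
  congr (s _); apply: val_inj => /=; have := ltn_ord i; move/negbT: hi; rewrite -leqNgt; lia.
rewrite -(pair_big xpredT xpredT (fun s b => Qw (ext s b) * F (ext s b))) /=.
by apply: eq_bigr => s _; rewrite mulr_sumr; apply: eq_bigr => b _; rewrite Qw_ext mulrA.
Qed.

Lemma eq_EQ n (F G : {ffun 'I_n.+1 -> 'I_K} -> R) : F =1 G -> cluster_Ex F = cluster_Ex G.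
Proof. by move=> h; apply: eq_bigr => s _; rewrite h. Qed.
Lemma EQ_le n (F G : {ffun 'I_n.+1 -> 'I_K} -> R) : (forall s, F s <= G s) -> cluster_Ex F <= cluster_Ex G.
Proof. by move=> h; apply: ler_sum => s _; apply: ler_wpM2l; rewrite ?Qw_ge0. Qed.
Lemma EQD n (F G : {ffun 'I_n.+1 -> 'I_K} -> R) : cluster_Ex (fun s => F s + G s) = cluster_Ex F + cluster_Ex G.
Proof. by rewrite -big_split; apply: eq_bigr => s _; rewrite mulrDr. Qed.
Lemma EQZ n c (F : {ffun 'I_n.+1 -> 'I_K} -> R) : cluster_Ex (fun s => c * F s) = c * cluster_Ex F.
Proof. by rewrite /cluster_Ex mulr_sumr; apply: eq_bigr => s _; rewrite mulrCA. Qed.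

Lemma EQ_last n (f : 'I_K -> R) : cluster_Ex (fun s : {ffun 'I_n.+1 -> 'I_K} => f (pt s n)) = \sum_k pi k * f k.
Proof.
have [h1 [h2 h3]] := hpi; elim: n f => [|n IH] f.
  rewrite /cluster_Ex (reindex (fun k : 'I_K => [ffun _ : 'I_1 => k])) /=; last first.
    exists (fun s => s ord0) => [k _|s _]; first by rewrite ffunE.
    by apply/ffunP => i; rewrite ffunE (ord1 i).
  by apply: eq_bigr => k _; rewrite /Qw big_ord0 mulr1 /pt ffunE.
rewrite EQ_ext (eq_EQ (G := fun s => (fun k => \sum_b p k b * f b) (pt s n))); last first.
  by move=> s; apply: eq_bigr => b _; rewrite pt_ext_last.
rewrite (IH (fun k => \sum_b p k b * f b)); under eq_bigr => k _ do rewrite mulr_sumr.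
rewrite exchange_big /=; apply: eq_bigr => b _; rewrite -h3 mulr_suml.
by apply: eq_bigr => k _; rewrite mulrA.
Qed.

Lemma EQ1 n c : cluster_Ex (fun _ : {ffun 'I_n.+1 -> 'I_K} => c) = c.
Proof. by have [_ [h2 _]] := hpi; rewrite (EQ_last n (fun=> c)) -mulr_suml h2 mul1r. Qed.

Definition Sf (f : 'I_K -> 'I_K -> R) n (s : {ffun 'I_n.+1 -> 'I_K}) := \sum_(i < n) f (pt s i) (pt s i.+1).

Lemma Sf_ext f n (s : {ffun 'I_n.+1 -> 'I_K}) b : Sf f (ext s b) = Sf f s + f (pt s n) b.
Proof.
rewrite /Sf big_ord_recr /= pt_ext // pt_ext_last; congr (_ + _).
by apply: eq_bigr => i _; have hi := ltn_ord i; rewrite !pt_ext // ltnW.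
Qed.

Lemma EQ_Sf f n : cluster_Ex (@Sf f n) = n%:R * \sum_k pi k * \sum_m p k m * f k m.
Proof.
have [_ h5] := hp; elim: n => [|n IH].
  by rewrite mul0r -[RHS](EQ1 0 0); apply: eq_EQ => s; rewrite /Sf big_ord0.
rewrite EQ_ext (eq_EQ (G := fun s => Sf f s + (fun k => \sum_m p k m * f k m) (pt s n))); last first.
  move=> s; under eq_bigr => b _ do rewrite Sf_ext mulrDr.
  by rewrite big_split /= -mulr_suml h5 mul1r.
by rewrite EQD IH (EQ_last n (fun k => \sum_m p k m * f k m)) -natr1 mulrDl mul1r.
Qed.

(** Martingale increments are orthogonal: the cross term vanishes when the last state is
    averaged. *)
Lemma mart_var D C n : (forall k, \sum_m p k m * D k m = 0) -> (forall k m, D k m ^+ 2 <= C) ->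
  cluster_Ex (fun s : {ffun 'I_n.+1 -> 'I_K} => Sf D s ^+ 2) <= n%:R * C.
Proof.
have [h4 h5] := hp; move=> hD hC; elim: n => [|n IH].
  by rewrite mul0r -[leRHS](EQ1 0 0); apply: EQ_le => s; rewrite /Sf big_ord0 expr0n.
rewrite EQ_ext -natr1 mulrDl mul1r -[X in _ + X](EQ1 n C).
apply: le_trans (lerD IH (lexx _)); rewrite -EQD; apply: EQ_le => s.
under eq_bigr => b _ do rewrite Sf_ext sqrrD !mulrDr.
rewrite !big_split /= -mulr_suml h5 mul1r.
have -> : \sum_b p (pt s n) b * (Sf D s * D (pt s n) b) = Sf D s * \sum_b p (pt s n) b * D (pt s n) b.
  by rewrite mulr_sumr; apply: eq_bigr => b _; rewrite mulrCA.
rewrite hD mulr0 !addr0 lerD2l -[leRHS]mul1r -(h5 (pt s n)) mulr_suml; apply: ler_sum => b _.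
by apply: ler_wpM2l => //; have /andP[] := h4 (pt s n) b.
Qed.

(** Subtracting the solution [h] of Poisson's equation leaves a martingale and a boundary term. *)
Lemma poisson_var f h (C : R) n : (forall k, \sum_m p k m * f k m = h k - \sum_m p k m * h m) ->
  (forall k, `|h k| <= C) -> (forall k m, `|f k m| <= C) ->
  cluster_Ex (fun s : {ffun 'I_n.+1 -> 'I_K} => Sf f s ^+ 2) <= n.+1%:R * (18 * C ^+ 2).
Proof.
move=> hh hC fC; have [h4 h5] := hp.
(* Increments of size at most [3 C] give [9 C ^ 2], doubled by the inequality for the square of a
   sum; the boundary adds [2 (2 C) ^ 2], which fits into the extra [18 C ^ 2] of the index
   [n.+1]. *)
pose D k m := f k m - h k + h m.
have DE (s : {ffun 'I_n.+1 -> 'I_K}) : Sf f s = Sf D s + (h (pt s 0) - h (pt s n)).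
  have -> : h (pt s 0) - h (pt s n) = \sum_(i < n) (h (pt s i) - h (pt s i.+1)).
    rewrite -(big_mkord xpredT (fun i => h (pt s i) - h (pt s i.+1))).
    by rewrite -[LHS]opprB -(telescope_sumr (fun i => h (pt s i))) // -sumrN; apply: eq_bigr => i _; rewrite opprB.
  by rewrite /Sf -big_split; apply: eq_bigr => i _ /=; rewrite /D; ring.
have Dm k : \sum_m p k m * D k m = 0.
  rewrite /D; under eq_bigr => m _ do rewrite !mulrDr mulrN.
  by rewrite !big_split /= sumrN -mulr_suml h5 mul1r hh; ring.
have D2 k m : D k m ^+ 2 <= 9 * C ^+ 2.
  have h1 := fC k m; have h2 := hC k; have h3 := hC m; rewrite !ler_norml in h1 h2 h3; rewrite /D.
  move/andP: h1 h2 h3 => [a1 a2] /andP[b1 b2] /andP[c1 c2].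
  have x1 : - (3 * C) <= f k m - h k + h m by lra.
  have x2 : f k m - h k + h m <= 3 * C by lra.
  nra.
have V := mart_var n Dm D2.
apply: (@le_trans _ _ (cluster_Ex (fun s : {ffun 'I_n.+1 -> 'I_K} => 2 * Sf D s ^+ 2 + 8 * C ^+ 2))).
  apply: EQ_le => s; rewrite DE; have h2 := hC (pt s 0); have h3 := hC (pt s n); rewrite !ler_norml in h2 h3.
  move/andP: h2 h3 => [b1 b2] /andP[c1 c2]; move: (Sf D s) (h (pt s 0)) (h (pt s n)) b1 b2 c1 c2 => u v w b1 b2 c1 c2.
  have x1 : - (2 * C) <= v - w by lra.
  have x2 : v - w <= 2 * C by lra.
  move: (v - w) x1 x2 => t x1 x2; have t2 : t ^+ 2 <= 4 * C ^+ 2 by nra.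
  have := sqr_ge0 (u - t); nra.
rewrite EQD EQZ EQ1; have -> : n.+1%:R = n%:R + 1 :> R by rewrite natr1.
move: V (sqr_ge0 C).
by move: (cluster_Ex _) (n%:R) (C ^+ 2) => E N c V c0; lra.
Qed.

Hypothesis irr : irreducible_chain p.

Lemma mxpow_ge0 t k m : 0 <= mxpow p t k m.
Proof.
elim: t m => [|t IH] m; first by rewrite mxE.
rewrite mxE; apply: sumr_ge0 => j _; apply: mulr_ge0 => //; by have /andP[] := proj1 hp j m.
Qed.

Lemma mxpow_fix (h : 'I_K -> R) : (forall k, h k = \sum_m p k m * h m) -> forall t k, \sum_m mxpow p t k m * h m = h k.
Proof.
move=> hh; elim=> [|t IH] k.
  rewrite (bigD1 k) //= mxE eqxx mul1r big1 ?addr0 // => m mk; by rewrite mxE eq_sym (negbTE mk) mul0r.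
rewrite -[RHS]IH; under eq_bigr => m _ do rewrite mxE mulr_suml.
rewrite exchange_big /=; apply: eq_bigr => j _; rewrite hh mulr_sumr; apply: eq_bigr => m _; by rewrite mulrA.
Qed.

(** The maximum principle: at a maximiser the nonnegative gaps have zero weighted sum, and some
    power of [p] gives every state positive weight. *)
Lemma harmonic_cst (h : 'I_K -> R) : (forall k, h k = \sum_m p k m * h m) -> forall k m, h k = h m.
Proof.
move=> hh k1 m1; have [k0 _ hk0] := @arg_maxP _ _ 'I_K k1 xpredT h isT.
suff E m : h m = h k0 by rewrite !E.
have [t ht] := irr k0 m.
have s1 : \sum_j mxpow p t k0 j = 1.
  have := @mxpow_fix (fun=> 1) _ t k0; rewrite (eq_bigr (fun j => mxpow p t k0 j)) => [->//|j _]; last by rewrite mulr1.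
  move=> k; rewrite -[LHS](proj2 hp k); apply: eq_bigr => j _; by rewrite mulr1.
have s0 : \sum_j mxpow p t k0 j * (h k0 - h j) = 0.
  under eq_bigr => j _ do rewrite mulrBr.
  by rewrite sumrB -mulr_suml s1 mul1r mxpow_fix // subrr.
have := psumr_eq0P (fun j _ => mulr_ge0 (mxpow_ge0 t k0 j) (_ : 0 <= h k0 - h j)) s0.
move=> /(_ (fun j => _)) hz.
have hz' : forall j, mxpow p t k0 j * (h k0 - h j) = 0.
  by move=> j; apply: hz => // i; rewrite subr_ge0; exact: hk0.
have /eqP := hz' m; rewrite mulf_eq0 (gt_eqF ht) /= subr_eq0 => /eqP ->; by [].
Qed.

(** Fredholm alternative by rank: the kernel of [1 - p] is spanned by the constants, so its image
    has codimension at most one; it lies in the hyperplane annihilated by [pi], hence equals it. *)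
Lemma poisson_ex (f : 'I_K -> R) : \sum_k pi k * f k = 0 -> exists h, forall k, f k = h k - \sum_m p k m * h m.
Proof.
have [h1 [h2 h3]] := hpi.
move=> hf; pose A : 'M[R]_K := (1%:M - p)^T; pose pc : 'cV[R]_K := \col_k pi k.
have AE (v : 'rV[R]_K) k : (v *m A) 0 k = v 0 k - \sum_m p k m * v 0 m.
  rewrite mxE; under eq_bigr => m _ do rewrite !mxE mulrBr.
  rewrite sumrB (bigD1 k) //= eqxx mulr1 big1 => [|m mk]; last by rewrite eq_sym (negbTE mk) mulr0.
  by rewrite addr0; congr (_ - _); apply: eq_bigr => m _; rewrite mulrC.
have [k0 _] : exists k : 'I_K, true.
  case: (pickP 'I_K) => [k _|no]; first by exists k.
  by move/eqP: h2; rewrite big_pred0 // eq_sym oner_eq0.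
have kA : (\rank (kermx A) <= 1)%N.
  apply: leq_trans (rank_leq_row (const_mx 1 : 'rV[R]_K)); apply: mxrankS; apply/rV_subP => v /sub_kermxP hv.
  have hc : forall k m, v 0 k = v 0 m.
    apply: harmonic_cst => k; apply/eqP; rewrite -subr_eq0 -AE hv mxE //.
  have -> : v = v 0 k0 *: const_mx 1 by apply/rowP => j; rewrite !mxE mulr1.
  by rewrite scalemx_sub.
have rA : (K <= (\rank A).+1)%N by move: kA; rewrite mxrank_ker; have := rank_leq_row A; lia.
have pc0 : pc != 0.
  apply/eqP => E; have : \sum_k pi k = 0 by rewrite big1 // => k _; have := congr1 (fun M : 'cV[R]_K => M k 0) E; rewrite !mxE.
  by move/eqP; rewrite h2 oner_eq0.
have AB : (A <= kermx pc)%MS.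
  apply/sub_kermxP/matrixP => i j; rewrite !mxE; under eq_bigr => k _ do rewrite !mxE mulrBl.
  rewrite sumrB (bigD1 i) //= eqxx mul1r big1 => [|k ki]; last by rewrite (negbTE ki) mul0r.
  rewrite addr0 -(h3 i) -[X in X - _]addr0 addr0; apply/eqP; rewrite subr_eq0; apply/eqP.
  by apply: eq_bigr => k _; rewrite mulrC.
have rB : (\rank (kermx pc) < K)%N.
  rewrite mxrank_ker; have : (0 < \rank pc)%N by rewrite lt0n mxrank_eq0.
  by have := rank_leq_row pc; lia.
have BA : (kermx pc <= A)%MS.
  by rewrite -(geq_leqif (mxrank_leqif_sup AB)); lia.
have fB : (\row_k f k <= kermx pc)%MS.
  by apply/sub_kermxP/matrixP => i j; rewrite !mxE -[RHS]hf; apply: eq_bigr => k _; rewrite !mxE mulrC.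
have /submxP[h hE] := submx_trans fB BA.
by exists (fun k => h 0 k) => k; rewrite -AE -hE mxE.
Qed.

Definition trans_count k m n (s : {ffun 'I_n.+1 -> 'I_K}) : R := Sf (fun a b => ((a == k) && (b == m))%:R) s.

Lemma Nc_dev k m n (s : {ffun 'I_n.+1 -> 'I_K}) :
  trans_count k m s - n%:R * (pi k * p k m) = Sf (fun a b => ((a == k) && (b == m))%:R - pi k * p k m) s.
Proof. by rewrite /trans_count /Sf sumrB sumr_const card_ord mulr_natl. Qed.

Lemma sum_pkm k m : \sum_a pi a * \sum_b p a b * ((a == k) && (b == m))%:R = pi k * p k m.
Proof.
rewrite (bigD1 k) //= [X in _ + X]big1 ?addr0 => [|a /negbTE ak]; last by rewrite big1 ?mulr0 // => b _; rewrite ak mulr0.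
rewrite (bigD1 m) //= [X in _ + X]big1 ?addr0 => [|b /negbTE bm]; last by rewrite bm andbF mulr0.
by rewrite !eqxx mulr1.
Qed.

Lemma Nc_mean k m n : cluster_Ex (@trans_count k m n) = n%:R * (pi k * p k m).
Proof. by rewrite EQ_Sf sum_pkm. Qed.

(** Poisson's equation is solved for the mean of the indicator given the current cluster; the
    constants of the finitely many pairs are added to make one. *)
Lemma Nc_var : exists2 C, 0 <= C & forall k m n, cluster_Ex (fun s : {ffun 'I_n.+1 -> 'I_K} => (trans_count k m s - n%:R * (pi k * p k m)) ^+ 2) <= n.+1%:R * C.
Proof.
have [h1 [h2 h3]] := hpi.
have H (km : 'I_K * 'I_K) : exists C, 0 <= C /\ forall n, cluster_Ex (fun s : {ffun 'I_n.+1 -> 'I_K} => (trans_count km.1 km.2 s - n%:R * (pi km.1 * p km.1 km.2)) ^+ 2) <= n.+1%:R * C.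
  case: km => k m /=; set f : 'I_K -> 'I_K -> R := fun a b => ((a == k) && (b == m))%:R - pi k * p k m.
  have [h hh] : exists h, forall a, \sum_b p a b * f a b = h a - \sum_b p a b * h b.
    apply: poisson_ex; rewrite /f; under eq_bigr => a _ do under eq_bigr => b _ do rewrite mulrBr.
    under eq_bigr => a _ do rewrite sumrB -mulr_suml (proj2 hp) mul1r mulrBr.
    by rewrite sumrB sum_pkm -mulr_suml h2 mul1r subrr.
  pose C := 1 + `|pi k * p k m| + \sum_a `|h a|.
  have hC a : `|h a| <= C.
    by rewrite /C (bigD1 a) //= addrCA lerDl addr_ge0 ?addr_ge0 // sumr_ge0.
  have fC a b : `|f a b| <= C.
    apply: (le_trans (ler_normB _ _)); rewrite /C -[leLHS]addr0; apply: lerD; last by rewrite sumr_ge0.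
    by apply: lerD => //; rewrite ger0_norm // lern1 leq_b1.
  exists (18 * C ^+ 2); split; first by rewrite mulr_ge0 ?sqr_ge0.
  move=> n; apply: le_trans (poisson_var n hh hC fC).
  by rewrite le_eqVlt; apply/orP; left; apply/eqP; apply: eq_EQ => s; rewrite Nc_dev.
have [C hC] := boolp.choice H.
exists (\sum_x C x) => [|k m n]; first by apply: sumr_ge0 => x _; have [] := hC x.
have [_ hV] := hC (k, m); apply: (le_trans (hV n)); apply: ler_wpM2l => //.
rewrite (bigD1 (k, m)) //= lerDl; apply: sumr_ge0 => x _; by have [] := hC x.
Qed.

End Chain.

(** * Transitions of a path, and the norm of a hermitization *)

Section Paths.
Variables (R : realType) (n : nat).

(** At the last time [inord] returns a default value; [tms] excludes that time. *)
Definition nxt (s : 'I_n.+1) : 'I_n.+1 := inord s.+1.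
Definition tms : {set 'I_n.+1} := [set s : 'I_n.+1 | (s.+1 < n.+1)%N].

Lemma nxt_val s : s \in tms -> val (nxt s) = s.+1.
Proof. by rewrite inE => h; rewrite /nxt /= inordK. Qed.

Lemma widen_inord (i : 'I_n) : widen_ord (leqnSn n) i = inord i.
Proof. by apply: val_inj; rewrite /= inordK // ltnW // ltnS. Qed.

Lemma big_succ (T : Type) (x0 : T) (op : Monoid.com_law x0) (G : 'I_n.+1 -> 'I_n.+1 -> T) :
  \big[op/x0]_s \big[op/x0]_(t : 'I_n.+1 | val t == (val s).+1) G s t = \big[op/x0]_(i < n) G (inord i) (inord i.+1).
Proof.
rewrite big_ord_recr /= [X in op _ X]big1 ?Monoid.mulm1 => [|t /eqP ht]; last first.
  by exfalso; have := ltn_ord t; rewrite ht ltnn.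
apply: eq_bigr => i _; rewrite widen_inord (big_pred1 (inord i.+1)) // => t.
by rewrite /=; apply/eqP/eqP => [h|->]; [apply: val_inj; rewrite /= inordK ?ltnS|rewrite inordK ?ltnS].
Qed.

Lemma big_tms (T : Type) (x0 : T) (op : Monoid.com_law x0) (G : 'I_n.+1 -> 'I_n.+1 -> T) :
  \big[op/x0]_(s in tms) G s (nxt s) = \big[op/x0]_(i < n) G (inord i) (inord i.+1).
Proof.
rewrite big_mkcond big_ord_recr /= inE ltnn Monoid.mulm1; apply: eq_bigr => i _.
by rewrite inE /= ltnS ltn_ord widen_inord /nxt inordK // ltnW // ltnS.
Qed.
End Paths.

Section Herm.
Variables (R : realType).
Local Notation nrm := eucl_norm.

Lemma nrm_col_mx d (a b : 'cV[R]_d) : nrm (col_mx a b) ^+ 2 = nrm a ^+ 2 + nrm b ^+ 2.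
Proof.
rewrite !nrm_sqr /dot big_split_ord /=; congr (_ + _); apply: eq_bigr => i _; by rewrite ?col_mxEu ?col_mxEd.
Qed.

Lemma opnorm_tr_le d (X : 'M[R]_d) : opnorm X^T <= opnorm X.
Proof.
apply: opnorm_le => a ha; have o0 := opnorm_ge0 X.
have h : nrm (X^T *m a) ^+ 2 <= opnorm X * nrm (X^T *m a).
  rewrite nrm_sqr dot_mulmx trmxK; apply: (le_trans (ler_norm _)); apply: (le_trans (dot_le _ _)).
  rewrite -[leRHS]mul1r; apply: ler_pM; rewrite ?nrm_ge0 //; exact: opnormP.
have [->//|hz] := eqVneq (nrm (X^T *m a)) 0.
by rewrite expr2 ler_pM2r // in h; rewrite lt_neqAle eq_sym hz nrm_ge0.
Qed.

Lemma opnorm_herm d (X : 'M[R]_d) : opnorm (block_mx 0 X X^T 0) = opnorm X.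
Proof.
have o0 := opnorm_ge0 X.
apply/eqP; rewrite eq_le; apply/andP; split.
  apply: opnorm_le => x hx; rewrite -(vsubmxK x) mul_block_col !mul0mx add0r addr0.
  apply: le_sqr2 => //; rewrite nrm_col_mx.
  have h1 := opnormP X (dsubmx x).
  have h2 : nrm (X^T *m usubmx x) <= opnorm X * nrm (usubmx x).
    by apply: (le_trans (opnormP _ _)); apply: ler_wpM2r; rewrite ?nrm_ge0 ?opnorm_tr_le.
  have h3 : nrm (usubmx x) ^+ 2 + nrm (dsubmx x) ^+ 2 <= 1 by rewrite -nrm_col_mx vsubmxK expr_le1 ?nrm_ge0.
  have e1 : nrm (X *m dsubmx x) ^+ 2 <= opnorm X ^+ 2 * nrm (dsubmx x) ^+ 2.
    by rewrite -exprMn; apply: lerXn2r; rewrite ?nnegrE ?mulr_ge0 ?nrm_ge0.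
  have e2 : nrm (X^T *m usubmx x) ^+ 2 <= opnorm X ^+ 2 * nrm (usubmx x) ^+ 2.
    by rewrite -exprMn; apply: lerXn2r; rewrite ?nnegrE ?mulr_ge0 ?nrm_ge0.
  apply: (le_trans (lerD e1 e2)); rewrite -mulrDr addrC -[leRHS]mulr1; apply: ler_wpM2l => //; exact: sqr_ge0.
apply: opnorm_le => b hb; apply: le_trans (opnorm_ub _ (x := col_mx 0 b) _).
  rewrite mul_block_col !mul0mx mulmx0 add0r addr0.
  apply: le_sqr2; rewrite ?nrm_ge0 // nrm_col_mx lerDl; exact: sqr_ge0.
by apply: le_sqr2 => //; rewrite nrm_col_mx nrm0 expr0n add0r expr1n expr_le1 ?nrm_ge0.
Qed.

(** Crude, yet of the right order for the difference of the two centrings, which is constant on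
    blocks. *)
Lemma opnorm_entries d (A : 'M[R]_d) e : 0 <= e -> (forall i j, `|A i j| <= e) -> opnorm A <= d%:R * e.
Proof.
move=> e0 h; apply: opnorm_le => x hx; apply: le_sqr2; first by rewrite mulr_ge0.
apply: (le_trans (nrm_frob _ _)).
apply: (@le_trans _ _ (\sum_l nrm (A *m bvec R l) ^+ 2)).
  rewrite -[leRHS]mulr1; apply: ler_wpM2l; first by apply: sumr_ge0 => l _; apply: sqr_ge0.
  by rewrite expr_le1 ?nrm_ge0.
rewrite exprMn [d%:R ^+ 2]expr2 -mulrA -sum_ord_cst; apply: ler_sum => l _.
rewrite nrm_sqr /dot -sum_ord_cst; apply: ler_sum => i _.
have -> : (A *m bvec R l) i 0 = A i l.
  by rewrite mxE (bigD1 l) //= mxE !eqxx mulr1 big1 ?addr0 // => j jl; rewrite mxE (negbTE jl) mulr0.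
by rewrite -expr2 -real_normK ?num_real //; apply: lerXn2r; rewrite ?nnegrE.
Qed.

Lemma opnorm_dist d (A B : 'M[R]_d) : `|opnorm A - opnorm B| <= opnorm (A - B).
Proof.
have D (X Y : 'M[R]_d) : opnorm X <= opnorm (X - Y) + opnorm Y by rewrite -{1}(subrK Y X); apply: opnormD.
have N (X : 'M[R]_d) : opnorm (- X) <= opnorm X.
  by apply: opnorm_le => x hx; rewrite mulNmx nrmN; apply: opnorm_ub.
have := D A B; have := D B A; have := N (A - B); rewrite opprB ler_norml; lra.
Qed.
End Herm.

(** * The path measure as a mixture over cluster sequences *)

Section Mix.
Variables (R : realType) (K d n : nat) (part : 'I_d -> 'I_K) (p : 'M[R]_K) (pi : 'I_K -> R).
Hypothesis hp : stochastic p.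
Hypothesis hpi : equilibrium p pi.
Local Notation bs k := ((block_size part k)%:R : R).
Implicit Types (w : {ffun 'I_n.+1 -> 'I_d}) (s : {ffun 'I_n.+1 -> 'I_K}).

Definition clus w : {ffun 'I_n.+1 -> 'I_K} := [ffun i => part (w i)].

Lemma path_probE w : path_prob n.+1 part p pi w = Qw p pi (clus w) * \prod_i (bs (part (w i)))^-1.
Proof.
have pt_cl i : pt (clus w) i = part (w (inord i)) by rewrite /pt ffunE.
rewrite /path_prob (@big_succ n R 1 (@GRing.mul R)) (big_pred1 ord0) //= /block_init /block_trans big_split /=.
rewrite /Qw [in RHS]big_ord_recl /= pt_cl.
have -> : inord 0 = ord0 :> 'I_n.+1 by apply: val_inj; rewrite /= inordK.
have -> : \prod_(i < n) (bs (part (w (lift ord0 i))))^-1 = \prod_(i < n) (bs (part (w (inord i.+1))))^-1.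
  by apply: eq_bigr => i _; congr ((bs (part (w _)))^-1); apply: val_inj; rewrite /= inordK // ltnS.
rewrite mulrACA; congr (_ * _); congr (_ * _); apply: eq_bigr => i _; by rewrite !pt_cl.
Qed.

Lemma wt_cond s w : wt (cond_law R part s) w = if s == clus w then \prod_i (bs (part (w i)))^-1 else 0.
Proof.
case: eqP => [->|ne].
  by apply: eq_bigr => i _; rewrite /cond_law ffunE eqxx mul1r.
have [i /eqP hi] : exists i, s i != part (w i).
  by apply/existsP; apply: contra_notT ne => /existsPn h; apply/ffunP => i; rewrite ffunE; apply/eqP; rewrite -[_ == _]negbK h.
by rewrite /wt (bigD1 i) //= /cond_law eq_sym; move/eqP/negbTE: hi => ->; rewrite !mul0r.
Qed.

(** The transition probability depends on the new state only through its cluster, so given the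
    clusters the states are independent and uniform on their blocks. *)
Lemma EQ_Ex (F : {ffun 'I_n.+1 -> 'I_d} -> R) :
  \sum_w path_prob n.+1 part p pi w * F w = cluster_Ex p pi (fun s => Ex (cond_law R part s) F).
Proof.
rewrite /cluster_Ex /Ex; under [RHS]eq_bigr => s _ do rewrite mulr_sumr.
rewrite exchange_big /=; apply: eq_bigr => w _.
rewrite (bigD1 (clus w)) //= [X in _ + X]big1 ?addr0 => [|s hs]; last by rewrite wt_cond (negbTE hs) mul0r mulr0.
by rewrite wt_cond eqxx path_probE mulrA.
Qed.

Lemma prob_event_mix E : prob_event n.+1 part p pi E = cluster_Ex p pi (fun s => Pr (cond_law R part s) E).
Proof.
rewrite /Pr -EQ_Ex /prob_event big_mkcond; apply: eq_bigr => w _.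
by case: (E w); rewrite ?mulr1 ?mulr0.
Qed.

Lemma NhatE w i j : Nhat w i j = \sum_(t in tms n) ((w t == i) && (w (nxt t) == j))%:R :> R.
Proof.
by rewrite mxE (@big_succ n R 0 +%R) (@big_tms n R 0 +%R (fun u t => ((w u == i) && (w t == j))%:R)).
Qed.

Lemma NcE s k m : trans_count R k m s = \sum_(t in tms n) ((s t == k) && (s (nxt t) == m))%:R.
Proof.
by rewrite (@big_tms n R 0 +%R (fun t u => ((s t == k) && (s u == m))%:R)).
Qed.

(** Both means of the count matrix have this form: the conditional one with the actual transition
    counts, the unconditional one with their expectations. *)
Definition Bm (c : 'I_K -> 'I_K -> R) : 'M[R]_d :=
  \matrix_(i, j) (c (part i) (part j) / (bs (part i) * bs (part j))).

Lemma HF_herm r s w : clus w = s ->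
  HF part s (@nxt n) r (tms n) w = block_mx 0 (r *: (Nhat w - Bm (fun k m => trans_count R k m s))) (r *: (Nhat w - Bm (fun k m => trans_count R k m s)))^T 0.
Proof.
move=> hs; have hw t : part (w t) = s t by rewrite -hs ffunE.
have bl (i : 'I_d) k : (blk part (lshift d i) == lshift K k) = (part i == k).
  by rewrite /blk splitl (inj_eq (@lshift_inj _ _)).
have br (i : 'I_d) k : (blk part (rshift d i) == rshift K k) = (part i == k).
  by rewrite /blk splitr (inj_eq (@rshift_inj _ _)).
have blr (i : 'I_d) k : (blk part (lshift d i) == rshift K k) = false.
  by rewrite /blk splitl eq_lrshift.
have brl (i : 'I_d) k : (blk part (rshift d i) == lshift K k) = false.
  by rewrite /blk splitr eq_rlshift.
pose G t i j : R := ((w t == i) && (w (nxt t) == j))%:R - ((s t == part i) && (s (nxt t) == part j))%:R / (bs (part i) * bs (part j)).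
have XE i j : (r *: (Nhat w - Bm (fun k m => trans_count R k m s))) i j = r * \sum_(t in tms n) G t i j.
  have BE : Bm (fun k m => trans_count R k m s) i j = trans_count R (part i) (part j) s / (bs (part i) * bs (part j)) by rewrite mxE.
  have NE : (Nhat w - Bm (fun k m => trans_count R k m s)) i j = Nhat w i j - Bm (fun k m => trans_count R k m s) i j by rewrite !mxE.
  rewrite mxE NE BE NhatE NcE mulr_suml -sumrB //.
have oE (x y : 'cV[R]_(d + d)) l l' : (x *m y^T) l l' = x l 0 * y l' 0 by rewrite mxE big_ord1 mxE.
pose ea t l : R := (l == lshift d (w t))%:R; pose eb t l : R := (l == rshift d (w (nxt t)))%:R.
pose ua t l : R := (blk part l == lshift K (s t))%:R / bs (s t).
pose ub t l : R := (blk part l == rshift K (s (nxt t)))%:R / bs (s (nxt t)).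
have YE t l l' : Ym R part s (@nxt n) t w l l' = (ea t l * eb t l' - ua t l * ub t l') + (eb t l * ea t l' - ub t l * ua t l').
  have AE (A B C : 'M[R]_(d + d)) : (A + B + C) l l' = A l l' + B l l' + C l l' by rewrite !mxE.
  have AE2 (A B : 'M[R]_(d + d)) : (A + B) l l' = A l l' + B l l' by rewrite !mxE.
  rewrite /Ym AE !AE2 !oE /av /bv /Ab /Bb !wvecE !uvecE !blkl !blkr !hw !bszl !bszr -/(ea t l) -/(ea t l') -/(eb t l) -/(eb t l') -/(ua t l) -/(ua t l') -/(ub t l) -/(ub t l').
  by move: (ea t l) (ea t l') (eb t l) (eb t l') (ua t l) (ua t l') (ub t l) (ub t l') => *; ring.
have GE t i j : ea t (lshift d i) * eb t (rshift d j) - ua t (lshift d i) * ub t (rshift d j) = G t i j.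
  rewrite /ea /eb /ua /ub /G bl br (inj_eq (@lshift_inj _ _)) (inj_eq (@rshift_inj _ _)).
  rewrite [i == _]eq_sym [j == _]eq_sym -natrM mulnb; congr (_ - _).
  rewrite [part i == _]eq_sym [part j == _]eq_sym; case: eqP => [->|_] /=; last by rewrite !mul0r.
  case: eqP => [->|_] /=; last by rewrite !mul0r mulr0.
  by rewrite !mul1r invfM.
have HE l l' : HF part s (@nxt n) r (tms n) w l l' = r * \sum_(t in tms n) ((ea t l * eb t l' - ua t l * ub t l') + (eb t l * ea t l' - ub t l * ua t l')).
  by rewrite /HF mxE summxE; congr (_ * _); apply: eq_bigr => t _; exact: YE.
apply/matrixP => l l'; rewrite HE -(splitK l) -(splitK l').
case: (fintype.split l) => i; case: (fintype.split l') => j /=.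
- by rewrite block_mxEul mxE big1 ?mulr0 // => t _; rewrite /ea /eb /ua /ub !lr_neq !blr /= ?mulr0n !mul0r !mulr0 !subr0 ?addr0.
- rewrite block_mxEur XE; congr (_ * _); apply: eq_bigr => t _; rewrite GE.
  by rewrite /ea /eb /ua /ub !lr_neq !blr /= ?mulr0n !mul0r ?mulr0 ?subr0 ?addr0.
- rewrite block_mxEdl mxE XE; congr (_ * _); apply: eq_bigr => t _.
  rewrite [eb t _ * _]mulrC [ub t _ * _]mulrC GE.
  by rewrite /ea /eb /ua /ub !brl !(eq_sym (rshift _ _) (lshift _ _)) !lr_neq /= ?mulr0n ?mul0r ?mulr0 ?subr0 ?add0r.
- by rewrite block_mxEdr mxE big1 ?mulr0 // => t _; rewrite /ea /eb /ua /ub !brl !(eq_sym (rshift _ _) (lshift _ _)) !lr_neq /= ?mulr0n !mul0r !mulr0 !subr0 ?addr0.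
Qed.
End Mix.
Section Mix2.
Variables (R : realType) (K d n : nat) (part : 'I_d -> 'I_K) (p : 'M[R]_K) (pi : 'I_K -> R) (kap : R).
Hypothesis hp : stochastic p.
Hypothesis hpi : equilibrium p pi.
Hypothesis d_gt0 : (0 < d)%N.
Hypothesis hkap : forall I, d%:R <= kap * bsz R part I.
Local Notation bs k := ((block_size part k)%:R : R).
Local Notation trans_count := (trans_count R).
Implicit Types (w : {ffun 'I_n.+1 -> 'I_d}) (s : {ffun 'I_n.+1 -> 'I_K}).

Lemma Ex_pair s (t u : 'I_n.+1) (i j : 'I_d) : t != u ->
  Ex (cond_law R part s) (fun w => ((w t == i) && (w u == j))%:R) = cond_law R part s t i * cond_law R part s u j.
Proof.
move=> tu; have := @Ex_G2 R K d n.+1 part s kap d_gt0 hkap unit t u (fun v v' _ => ((v == i) && (v' == j))%:R) (fun _ => Datatypes.tt) tu.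
move=> -> //; rewrite Ex_cst; last exact: (cond_law_sum s d_gt0 hkap).
rewrite (bigD1 i) //= [X in _ + X]big1 ?addr0 => [|v /negbTE vi]; last by rewrite big1 ?mulr0 // => v' _; rewrite vi mulr0.
congr (_ * _); rewrite (bigD1 j) //= [X in _ + X]big1 ?addr0 => [|v /negbTE vj]; last by rewrite vj andbF mulr0.
by rewrite !eqxx mulr1.
Qed.

Lemma ENhatE : ENhat n.+1 part p pi = Bm part (fun k m => n%:R * (pi k * p k m)).
Proof.
apply/matrixP => i j; rewrite summxE (eq_bigr (fun w => path_prob n.+1 part p pi w * Nhat w i j)); last by move=> w _; rewrite mxE.
rewrite (EQ_Ex part p pi (fun w => Nhat w i j)) mxE -(Nc_mean hp hpi) mulrC -EQZ; apply: eq_EQ => s.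
rewrite (eq_Ex _ (fun w => @NhatE R d n w i j)) Ex_sum NcE mulr_sumr; apply: eq_bigr => t ht.
have tn : t != nxt t by apply/eqP => E; move: (nxt_val ht); rewrite -E => /esym/eqP; rewrite eqn_leq ltnn.
rewrite Ex_pair // /cond_law [s t == _]eq_sym [s (nxt t) == _]eq_sym.
case: eqP => [->|_]; last by rewrite !mul0r mulr0.
by case: eqP => [->|_]; rewrite /= ?mul0r ?mulr0 // !mul1r mulr1 invfM.
Qed.

(** The two centrings differ by a matrix with entries of size [r * (kap / d) ^ 2] times a count
    deviation, and the crude norm bound multiplies by [d]. *)
Lemma M_HF s w : clus part w = s ->
  `|opnorm (Mmat n.+1 part p pi w) - opnorm (HF part s (@nxt n) (Num.sqrt (d%:R / n.+1%:R)) (tms n) w)| <=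
  Num.sqrt (d%:R / n.+1%:R) * kap ^+ 2 / d%:R * \sum_k \sum_m `|trans_count k m s - n%:R * (pi k * p k m)|.
Proof.
move=> hs; rewrite (HF_herm _ hs) opnorm_herm /Mmat ENhatE.
set r := Num.sqrt _; have r0 : 0 <= r by apply: sqrtr_ge0.
have d0 : 0 < d%:R :> R by rewrite ltr0n.
have k0 := kap_ge0 d_gt0 hkap.
apply: (le_trans (opnorm_dist _ _)); set S := \sum_k _.
have S0 : 0 <= S by apply: sumr_ge0 => k _; apply: sumr_ge0.
have -> : r * kap ^+ 2 / d%:R * S = d%:R * (r * S * (kap / d%:R) ^+ 2) by field; rewrite gt_eqF.
apply: opnorm_entries; first by rewrite mulr_ge0 ?sqr_ge0 // mulr_ge0.
move=> i j; rewrite -scalerBr opprB addrC addrA subrK mxE normrM ger0_norm // -mulrA; apply: ler_wpM2l => //.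
rewrite !mxE -mulrBl normrM; apply: ler_pM => //.
  rewrite /S (bigD1 (part i)) //= (bigD1 (part j)) //= -addrA lerDl addr_ge0 ?sumr_ge0 // => k _; exact: sumr_ge0.
rewrite ger0_norm ?invr_ge0 ?mulr_ge0 // invfM expr2.
have h k : (bs k)^-1 <= kap / d%:R by rewrite -(bszl R part); apply: bszV_le.
by apply: ler_pM; rewrite ?invr_ge0.
Qed.

Definition un (I : 'I_(K + K)) : 'I_K := match fintype.split I with inl a => a | inr a => a end.
Definition cc (F : 'I_K -> 'I_K -> R) (I J : 'I_(K + K)) : R :=
  match fintype.split I, fintype.split J with inl a, inr b => F a b | inr a, inl b => F b a | _, _ => 0 end.

Lemma bsz_un I : bsz R part I = bs (un I).
Proof. by rewrite /bsz /un; case: fintype.split. Qed.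

Lemma ccoefE (alpha : 'I_K -> R) I J : ccoef alpha p pi I J = (alpha (un I))^-1 * cc (fun a b => pi a * p a b) I J.
Proof. by rewrite /ccoef /un /cc; case: (fintype.split I) => a; case: (fintype.split J) => b; rewrite ?mulr0 ?mulrA. Qed.

Lemma chat_tms s r I J : chat part s (@nxt n) r (tms n) I J = r ^+ 2 / bsz R part I * cc (fun a b => trans_count a b s) I J.
Proof.
have rl (a b : 'I_K) : (rshift K a == lshift K b) = false by rewrite eq_sym lr_neq.
rewrite /chat; congr (_ * _); rewrite /cc -{1}(splitK I) -{1}(splitK J) -{2}(splitK I) -{2}(splitK J).
case: (fintype.split I) => a; case: (fintype.split J) => b /=; rewrite ?NcE.
- by apply: big1 => t _; rewrite /Ab /Bb !rl andbF /= addr0.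
- by apply: eq_bigr => t _; rewrite /Ab /Bb !rl /= addr0 (inj_eq (@lshift_inj _ _)) (inj_eq (@rshift_inj _ _)).
- by apply: eq_bigr => t _; rewrite /Ab /Bb !lr_neq /= add0r (inj_eq (@lshift_inj _ _)) (inj_eq (@rshift_inj _ _)) andbC.
- by apply: big1 => t _; rewrite /Ab /Bb !lr_neq andbF /= addr0.
Qed.

Lemma chat_close s (alpha : 'I_K -> R) (del e : R) I J :
  (forall k m, `|trans_count k m s - n%:R * (pi k * p k m)| <= del * n.+1%:R) ->
  (forall k, `|d%:R / bs k - (alpha k)^-1| <= e) ->
  `|chat part s (@nxt n) (Num.sqrt (d%:R / n.+1%:R)) (tms n) I J - ccoef alpha p pi I J| <= kap * (del + n.+1%:R^-1) + e.
Proof.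
move=> hN he; have n0 : 0 < n.+1%:R :> R by [].
have [p1 p2] := hp; have [q1 [q2 q3]] := hpi.
have k0 := kap_ge0 d_gt0 hkap.
have pk k : pi k <= 1 by rewrite -q2 (bigD1 k) //= lerDl sumr_ge0.
have pp k m : 0 <= pi k * p k m <= 1.
  have /andP[a b] := p1 k m; by rewrite mulr_ge0 //= -[leRHS]mulr1 ler_pM.
have del0 : 0 <= del by have := le_trans (normr_ge0 _) (hN (un I) (un I)); rewrite pmulr_lge0.
have hc : 0 <= cc (fun a b => pi a * p a b) I J <= 1.
  by rewrite /cc; case: (fintype.split I) => a; case: (fintype.split J) => b; rewrite ?pp ?lexx ?ler01.
have hd : `|cc (fun a b => trans_count a b s) I J / n.+1%:R - cc (fun a b => pi a * p a b) I J| <= del + n.+1%:R^-1.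
  have H k m : `|trans_count k m s / n.+1%:R - pi k * p k m| <= del + n.+1%:R^-1.
    (* A path of [n.+1] states has [n] transitions while [r] is normalised by [n.+1]; this is the
       source of the term [n.+1^-1]. *)
    have -> : trans_count k m s / n.+1%:R - pi k * p k m = (trans_count k m s - n%:R * (pi k * p k m)) / n.+1%:R - (pi k * p k m) / n.+1%:R.
      have -> : n.+1%:R = n%:R + 1 :> R by rewrite natr1.
      by field; rewrite natr1 pnatr_eq0.
    have /andP[a b] := pp k m.
    apply: (le_trans (ler_normB _ _)); rewrite !normrM (ger0_norm (x := _^-1)) ?invr_ge0 ?(ger0_norm a) //.
    apply: lerD; first by rewrite ler_pdivrMr.
    by rewrite -normrM ger0_norm // -[leRHS]mul1r; apply: ler_wpM2r; rewrite ?invr_ge0.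
  have z : 0 <= del + n.+1%:R^-1 by rewrite addr_ge0 ?invr_ge0.
  by rewrite /cc; case: (fintype.split I) => a; case: (fintype.split J) => b; rewrite ?H // mul0r subrr normr0.
rewrite chat_tms ccoefE bsz_un sqr_sqrtr ?divr_ge0 //.
move: (un I) (cc _ _ _) (cc _ _ _) hc hd => u N c /andP[c0 c1] hd.
have -> : d%:R / n.+1%:R / bs u * N - (alpha u)^-1 * c = d%:R / bs u * (N / n.+1%:R - c) + (d%:R / bs u - (alpha u)^-1) * c.
  by move: (bs u)^-1 (n.+1%:R^-1) (alpha u)^-1 => x1 x2 x3; ring.
apply: (le_trans (ler_normD _ _)); rewrite !normrM; apply: lerD.
  apply: ler_pM => //; have hk := hkap (lshift K u); rewrite bszl in hk.
  have b0 : 0 < bs u by rewrite -(bszl R part); apply: (bsz_gt0 d_gt0 hkap).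
  by rewrite !ger0_norm ?invr_ge0 // ler_pdivrMr.
by rewrite (ger0_norm c0) -[leRHS]mulr1; apply: ler_pM.
Qed.

Lemma chat_diff s r (T : {set 'I_n.+1}) I J : T \subset tms n ->
  0 <= chat part s (@nxt n) r (tms n) I J - chat part s (@nxt n) r T I J <= r ^+ 2 / bsz R part I * (2 * #|tms n :\: T|%:R).
Proof.
move=> hT; have b0 : 0 <= r ^+ 2 / bsz R part I by rewrite divr_ge0 ?sqr_ge0 ?bsz_ge0.
rewrite /chat -mulrBr (big_setID T) /= (finset.setIidPr hT) addrAC subrr add0r.
apply/andP; split; first by apply: mulr_ge0 => //; apply: sumr_ge0 => t _; rewrite addr_ge0.
apply: ler_wpM2l => //; rewrite mulrC; apply: le_trans (sum_cst_le _ (leqnn _)) => //.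
apply: ler_sum => t _; rewrite -natrD ler_nat; by case: (_ && _); case: (_ && _).
Qed.
End Mix2.

(** * Separation of the transitions into two families with independent blocks *)

Section Split.
Variables (n L : nat).
Hypothesis L2 : (1 < L)%N.
(* Dropping the transitions T2 makes the blocks of L consecutive times independent. *)
Definition T1 : {set 'I_n.+1} := [set s in tms n | ~~ (L %| s.+1)%N].
Definition T2 : {set 'I_n.+1} := [set s in tms n | (L %| s.+1)%N].
Definition g1 (s : 'I_n.+1) := (s %/ L)%N.
(** Shifted by one so that both ends of a transition crossing a boundary of [g1] fall into the same
    block. As [L > 1], each such block contains a single transition of [T2]. *)
Definition g2 (s : 'I_n.+1) := (s.+1 %/ L)%N.

Lemma g1_lt s : (g1 s < n.+1)%N.
Proof. by apply: leq_ltn_trans (ltn_ord s); apply: leq_div. Qed.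

Lemma g2_lt s : (g2 s < n.+1)%N.
Proof.
rewrite /g2 ltn_divLR ?(ltnW L2) //; have := ltn_ord s; have : (n.+1 * 2 <= n.+1 * L)%N by rewrite leq_mul2l L2 orbT.
lia.
Qed.

Lemma sub_T1 : T1 \subset tms n. Proof. by apply/fintype.subsetP => s; rewrite inE => /andP[]. Qed.
Lemma setD_T1 : tms n :\: T1 = T2.
Proof. by apply/setP => s; rewrite !inE; case: (s.+1 < _)%N; case: (_ %| _)%N. Qed.

Lemma card_le_nat (A : {set 'I_n.+1}) (f : 'I_n.+1 -> nat) m : {in A &, injective f} -> (forall s, s \in A -> (f s < m)%N) -> (#|A| <= m)%N.
Proof.
move=> fi fm; rewrite -(size_iota 0 m) cardE -(size_map f); apply: uniq_leq_size.
  by rewrite map_inj_in_uniq ?enum_uniq // => x y; rewrite !mem_enum; apply: fi.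
by move=> k /mapP[s]; rewrite mem_enum => hs ->; rewrite mem_iota; apply: fm.
Qed.

Lemma good_T1 : good (@nxt n) g1 L T1.
Proof.
split=> [s|i].
  rewrite inE => /andP[st hL]; have v := nxt_val st; split => //.
  rewrite /g1 v; have hd := divn_eq s L; have hm := ltn_pmod s (ltnW L2).
  have ne : (s %% L).+1 != L.
    by apply: contraNneq hL => E; rewrite {1}hd -addnS E dvdn_addr ?dvdn_mull.
  have lt : ((s %% L).+1 < L)%N by rewrite ltn_neqAle ne.
  by rewrite {1}hd -addnS divnMDl ?(ltnW L2) // [((s %% L).+1 %/ L)%N]divn_small // addn0.
apply: (@card_le_nat _ (fun s => (s %% L)%N)) => [s t|s _]; last exact: ltn_pmod (ltnW L2).
rewrite !inE => /andP[_ /eqP hs] /andP[_ /eqP ht] h; apply: val_inj => /=.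
by rewrite (divn_eq s L) (divn_eq t L) h -/(g1 s) -/(g1 t) hs ht.
Qed.

Lemma good_T2 : good (@nxt n) g2 1 T2.
Proof.
split=> [s|i].
  rewrite inE => /andP[st hL]; have v := nxt_val st; split => //.
  rewrite /g2 v; have /dvdnP[j ->] := hL.
  by rewrite -addn1 divnMDl ?(ltnW L2) // mulnK ?(ltnW L2) // divn_small // addn0.
apply: (@card_le_nat _ (fun s => 0%N)) => // s t.
rewrite !inE => /andP[/andP[_ /dvdnP[j hj]] /eqP hs] /andP[/andP[_ /dvdnP[k hk]] /eqP ht] _; apply: val_inj => /=.
move: hs ht; rewrite /g2 hj hk !mulnK ?(ltnW L2) // => <- ejk; move: hj hk; rewrite ejk => <- [] //.
Qed.

Lemma card_T2 : (#|T2| * L <= n.+1)%N.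
Proof.
apply: leq_trans (leq_trunc_div n.+1 L); rewrite leq_mul2r; apply/orP; right.
apply: (@card_le_nat _ (fun s => (s.+1 %/ L).-1)) => [s t|s].
  rewrite !inE => /andP[_ /dvdnP[j hj]] /andP[_ /dvdnP[k hk]]; rewrite hj hk !mulnK ?(ltnW L2) // => E.
  apply: val_inj; apply: succn_inj; rewrite hj hk; congr (_ * _)%N.
  by case: j k hj hk E => [|j] [|k] //= _ _ ->.
rewrite !inE => /andP[st /dvdnP[j hj]]; have j0 : (0 < j)%N by case: j hj.
rewrite hj mulnK ?(ltnW L2) // prednK //; rewrite leq_divRL ?(ltnW L2) // -hj; exact: ltn_ord.
Qed.

Lemma HF_T12 (R : realType) (K d : nat) (part : 'I_d -> 'I_K) sig r w :
  HF part sig (@nxt n) r (tms n) w = HF part sig (@nxt n) r T1 w + HF (R := R) part sig (@nxt n) r T2 w.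
Proof.
rewrite /HF -scalerDr; congr (_ *: _); rewrite (big_setID T1) /= (finset.setIidPr sub_T1) setD_T1 //.
Qed.
End Split.

(** * Asymptotics of the error rates under the growth assumption *)

Section Asym.
Variables (R : realType) (n : nat -> nat).
Hypothesis n_gt0 : forall d, (0 < n d)%N.
Hypothesis hn : (fun d : nat => d%:R * ln (d%:R : R) ^+ 4 / (n d)%:R) @ \oo --> (0 : R).
Let r d : R := Num.sqrt (d%:R / (n d)%:R).

Lemma near_nat (a : R) : \forall d \near \oo, a <= d%:R.
Proof.
exists (Num.bound `|a|) => // d /= hd; apply: (le_trans (ler_norm a)); apply: ltW.
by apply: lt_le_trans (archi_boundP (normr_ge0 a)) _; rewrite ler_nat.
Qed.

(** With [g] the twelfth root of [d], [ln d = 12 ln g <= 12 g] and [sqrt d = g ^ 6], which leaves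
    three powers of [g] to spare. *)
Lemma ln_pow_bound d (G : R) : (0 < d)%N -> 0 < G -> G ^+ 12 <= d%:R -> ln (d%:R : R) ^+ 3 / Num.sqrt d%:R <= 12 ^+ 3 / G ^+ 3.
Proof.
move=> d0 G0 hG; have dR : 0 < d%:R :> R by rewrite ltr0n.
have [g g0 E] := root_ex 11 (ltW dR).
have gp : 0 < g by rewrite lt_neqAle g0 andbT; apply/eqP => z; move: dR; rewrite -E -z expr0n ltxx.
have gG : G <= g by rewrite -(@ler_pXn2r _ 12) ?nnegrE ?(ltW G0) // E.
have l1 : ln (d%:R : R) = 12 * ln g by rewrite -E lnXn // mulr_natl.
have l2 : ln g <= g by apply: ltW; apply: ln_sublinear.
have s : Num.sqrt d%:R = g ^+ 6 :> R by rewrite -E (exprM g 6 2) sqrtr_sqr ger0_norm // exprn_ge0.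
have l0 : 0 <= ln (d%:R : R) by rewrite ln_ge0 // ler1n.
have l3 : ln (d%:R : R) ^+ 3 <= (12 * g) ^+ 3.
  by apply: lerXn2r; rewrite ?nnegrE ?mulr_ge0 // l1; apply: ler_wpM2l.
rewrite s; apply: (@le_trans _ _ ((12 * g) ^+ 3 / g ^+ 6)).
  by apply: ler_wpM2r => //; rewrite invr_ge0 exprn_ge0.
have -> : (12 * g) ^+ 3 / g ^+ 6 = 12 ^+ 3 / g ^+ 3 by field; rewrite gt_eqF.
apply: ler_wpM2l; first exact: exprn_ge0.
by rewrite lef_pV2 ?posrE ?exprn_gt0 //; apply: lerXn2r; rewrite ?nnegrE ?(ltW G0).
Qed.

(** The factor 2 comes from [ln 2 >= 1 / 2]. *)
Lemma up_log_ln d : (1 < d)%N -> (up_log 2 d)%:R <= 1 + 2 * ln (d%:R : R).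
Proof.
move=> d1; have [h1 h2] : (2 ^ (up_log 2 d).-1 < d)%N /\ (0 < up_log 2 d)%N.
  by have /andP[] := up_log_bounds (ltnSn 1) d1; rewrite up_log_gt0.
have l2 : 1 / 2 <= ln (2 : R).
  have h : ln (2^-1 : R) <= - (1 / 2).
    have -> : ln (2^-1 : R) = ln (1 + - (1 / 2)) by congr ln; field.
    by apply: le_ln1Dx; lra.
  by rewrite lnV ?posrE // in h; lra.
have l3 : (up_log 2 d).-1%:R * ln (2 : R) <= ln (d%:R : R).
  rewrite mulr_natl -lnXn // ler_ln ?posrE ?exprn_gt0 ?ltr0n ?(ltnW d1) //.
  by rewrite -natrX ler_nat ltnW.
have -> : (up_log 2 d)%:R = (up_log 2 d).-1%:R + 1 :> R by rewrite natr1 prednK.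
have n0 : 0 <= (up_log 2 d).-1%:R :> R by [].
by move: (ln (d%:R : R)) (ln (2 : R)) (_.-1%:R : R) l2 l3 n0 => a b c l2 l3 n0; nra.
Qed.

Lemma ln_ge1_near : \forall d \near \oo, 1 <= ln (d%:R : R).
Proof.
near=> d; have h : expR 1 <= d%:R :> R by near: d; exact: near_nat.
by rewrite -[leLHS](@expRK R) ler_ln ?posrE ?expR_gt0 // (lt_le_trans (expR_gt0 _) h).
Unshelve. all: by end_near. Qed.

Lemma d_le_n_near : \forall d \near \oo, d%:R <= (n d)%:R :> R.
Proof.
near=> d; have l1 : 1 <= ln (d%:R : R) by near: d; exact: ln_ge1_near.
have h : `|0 - d%:R * ln (d%:R : R) ^+ 4 / (n d)%:R| < 1.
  by near: d; move/cvgrPdist_lt: hn; apply.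
have n0 : 0 < (n d)%:R :> R by rewrite ltr0n.
have l4 : 1 <= ln (d%:R : R) ^+ 4 by apply: exprn_ege1.
rewrite sub0r normrN in h; have {}h := le_lt_trans (ler_norm _) h; rewrite ltr_pdivrMr // mul1r in h.
by apply: le_trans (ltW h); apply: ler_peMr.
Unshelve. all: by end_near. Qed.

Lemma r_ln_near e : 0 < e -> \forall d \near \oo, r d * ln (d%:R : R) ^+ 2 <= e.
Proof.
move=> e0; have e2 : 0 < e ^+ 2 by rewrite exprn_gt0.
near=> d.
have h : `|0 - d%:R * ln (d%:R : R) ^+ 4 / (n d)%:R| < e ^+ 2.
  by near: d; move/cvgrPdist_lt: hn; apply.
rewrite sub0r normrN in h.
apply: le_sqr2; first exact: ltW.
have -> : (r d * ln (d%:R : R) ^+ 2) ^+ 2 = d%:R * ln (d%:R : R) ^+ 4 / (n d)%:R.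
  by rewrite exprMn /r sqr_sqrtr ?divr_ge0 // -exprM; move: (n d)%:R^-1 (ln _ ^+ _) => a b; ring.
exact/ltW/(le_lt_trans (ler_norm _) h).
Unshelve. all: by end_near. Qed.

(** With power [2 B log2 d] the geometric factor is at most [d ^ (- 2)], enough to beat the
    dimension in the trace bound. *)
Lemma rho_near B (rho e : R) : 0 <= rho -> rho ^+ B <= 1 / 2 -> (0 < B)%N -> 0 < e ->
  \forall d \near \oo, d%:R * rho ^+ ((B * up_log 2 d).-1.+1 + (B * up_log 2 d).-1.+1) <= e.
Proof.
move=> r0 hr B0 e0; near=> d; have d1 : (1 < d)%N.
  by rewrite -(ltr_nat R); apply: (@lt_le_trans _ _ 2); [rewrite ltr1n|near: d; exact: near_nat].
have de : e^-1 <= d%:R by near: d; exact: near_nat.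
have L0 : (0 < up_log 2 d)%N by rewrite up_log_gt0.
rewrite prednK ?muln_gt0 ?B0 //; set L := up_log 2 d in L0 *.
have dR : 0 < d%:R :> R by rewrite ltr0n (ltnW d1).
have hd : d%:R <= 2 ^+ L :> R by rewrite -natrX ler_nat; apply: up_logP.
have p0 : 0 < 2 ^+ L :> R by apply: lt_le_trans hd.
apply: (@le_trans _ _ (d%:R * ((1 / 2) ^+ L * (1 / 2) ^+ L))).
  apply: ler_wpM2l; first exact: ltW.
  rewrite exprD exprM; have hh : (rho ^+ B) ^+ L <= (1 / 2) ^+ L by apply: lerXn2r; rewrite ?nnegrE ?exprn_ge0 ?divr_ge0.
  by apply: ler_pM; rewrite ?exprn_ge0.
rewrite expr_div_n expr1n mul1r.
apply: (@le_trans _ _ (d%:R * (d%:R^-1 * d%:R^-1))).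
  apply: ler_wpM2l; first exact: ltW.
  by apply: ler_pM; rewrite ?invr_ge0 ?(ltW p0) // lef_pV2 ?posrE.
by rewrite mulVKf ?gt_eqF // -[leRHS]invrK lef_pV2 ?posrE ?invr_gt0.
Unshelve. all: by end_near. Qed.

Lemma q_near B q0 : (0 < B)%N -> \forall d \near \oo, (q0 <= (B * up_log 2 d).-1)%N.
Proof.
move=> B0; near=> d; have h : (2 ^ q0.+1)%:R <= d%:R :> R by near: d; exact: near_nat.
have : (q0.+1 <= up_log 2 d)%N by rewrite -(up_expnK q0.+1 (ltnSn 1)); apply: leq_up_log; rewrite -(ler_nat R).
by move: B0; clear; case: B => // B _ h; rewrite mulSn; lia.
Unshelve. all: by end_near. Qed.

Lemma tiny_near B e : (0 < B)%N -> 0 < e -> \forall d \near \oo, tiny d (r d) (B * up_log 2 d).-1 e.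
Proof.
(* The 9 suffices for [2 B (1 + 2 l) + 1 <= b l] whenever [l = ln d >= 1] and [B >= 1]. *)
move=> B0 e0; pose b : R := 9 * B%:R.
have b0 : 0 < b by rewrite mulr_gt0 // ltr0n.
pose G := 1 + b ^+ 3 * 12 ^+ 3 / e.
have G1 : 1 <= G by rewrite lerDl divr_ge0 ?mulr_ge0 ?exprn_ge0 // ltW.
have G0 : 0 < G by apply: lt_le_trans G1.
near=> d; have d1 : (1 < d)%N.
  by rewrite -(ltr_nat R); apply: (@lt_le_trans _ _ 2); [rewrite ltr1n|near: d; exact: near_nat].
have l1 : 1 <= ln (d%:R : R) by near: d; exact: ln_ge1_near.
have hr : r d * ln (d%:R : R) ^+ 2 <= e / b ^+ 2 by near: d; apply: r_ln_near; rewrite divr_gt0 ?exprn_gt0.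
have hG : G ^+ 12 <= d%:R by near: d; exact: near_nat.
have L0 : (0 < up_log 2 d)%N by rewrite up_log_gt0.
have hL := up_log_ln d1; have hP := up_logP d (ltnSn 1); rewrite /tiny prednK ?muln_gt0 ?B0 //.
move: (up_log 2 d) L0 hL hP => L L0 hL hP.
have hm : (B * L + B * L).+1%:R <= b * ln (d%:R : R).
  have B1 : 1 <= B%:R :> R by rewrite ler1n.
  have L1 : 1 <= L%:R :> R by rewrite ler1n.
  rewrite -natr1 natrD natrM /b; move: (ln _) (B%:R : R) (L%:R : R) l1 hL B1 L1; clear => l B L l1 hL B1 L1; nra.
have m0 : 0 <= (B * L + B * L).+1%:R :> R by [].
have r0 : 0 <= r d by apply: sqrtr_ge0.
have sd : 0 < Num.sqrt d%:R :> R by rewrite sqrtr_gt0 ltr0n (ltnW d1).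
have mp k : (B * L + B * L).+1%:R ^+ k <= (b * ln (d%:R : R)) ^+ k by apply: lerXn2r; rewrite ?nnegrE // (le_trans m0).
split.
- apply: (le_trans (ler_wpM2l r0 (mp 2%N))); rewrite exprMn mulrCA mulrC -ler_pdivlMr ?exprn_gt0 //.
- apply: (@le_trans _ _ ((b * ln (d%:R : R)) ^+ 3 / Num.sqrt d%:R)).
    by apply: ler_wpM2r => //; rewrite invr_ge0 ltW.
  rewrite exprMn -mulrA; apply: (@le_trans _ _ (b ^+ 3 * (12 ^+ 3 / G ^+ 3))).
    by apply: ler_wpM2l; [rewrite exprn_ge0 // ltW|apply: ln_pow_bound => //; exact: ltnW].
  have G3 : 0 < G ^+ 3 by apply: exprn_gt0.
  rewrite mulrA ler_pdivrMr // [e * _]mulrC -ler_pdivrMr //.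
  apply: (@le_trans _ _ G); first by rewrite /G lerDr.
  by rewrite -{1}(expr1 G); apply: ler_weXn2l.
- rewrite -natrX ler_nat; apply: (leq_trans hP); apply: (@leq_trans (2 ^ (B * L))).
    by rewrite leq_exp2l // leq_pmull.
  by rewrite leq_exp2r // muln_gt0 B0.
Unshelve. all: by end_near. Qed.
End Asym.
(** * The limit and the conclusion *)

Section FrakM.
Variables (R : realType) (K : nat) (alpha : 'I_K -> R) (p : 'M[R]_K) (pi : 'I_K -> R).
Hypothesis K_gt0 : (0 < K)%N.
Hypothesis a_gt0 : forall k, 0 < alpha k.
Hypothesis hp : stochastic p.
Hypothesis hpi : equilibrium p pi.
Let c := ccoef alpha p pi.

Lemma ccoef_ge0 I J : 0 <= c I J.
Proof.
have [p1 _] := hp; have [q1 _] := hpi.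
have H k m : 0 <= pi k * p k m by rewrite mulr_ge0 //; have /andP[] := p1 k m.
rewrite /c /ccoef; case: (fintype.split I) => a; case: (fintype.split J) => b //.
  by rewrite -mulrA mulr_ge0 // invr_ge0 ltW.
by rewrite -mulrA mulr_ge0 // invr_ge0 ltW.
Qed.

Let val x : R := \big[Num.max/0]_(i < K + K) ((x i)^-1 + \sum_(j < K + K) c i j * x j).

Lemma val_le x l : 0 <= l -> (forall I, (x I)^-1 + \sum_J c I J * x J <= l) -> val x <= l.
Proof. by move=> l0 h; apply: bigmax_le => // i _; apply: h. Qed.

Lemma val_ge x I : (x I)^-1 + \sum_J c I J * x J <= val x.
Proof. exact: (le_bigmax_cond 0 (fun i => (x i)^-1 + \sum_J c i J * x J) (erefl true)). Qed.

Lemma val_ge0 x : 0 <= val x.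
Proof. by apply: bigmax_ge_id. Qed.

Lemma frak_inf : has_inf [set r : R | exists x : 'I_(K + K) -> R, (forall i, 0 < x i) /\ r = val x].
Proof.
split; first by exists (val (fun=> 1)), (fun=> 1).
by exists 0 => _ [x [_ ->]]; apply: val_ge0.
Qed.

Lemma frak_m_ge0 : 0 <= frak_m alpha p pi.
Proof. by apply: lb_le_inf; [exact: (proj1 frak_inf)|move=> _ [x [_ ->]]; apply: val_ge0]. Qed.

Lemma frak_up e : 0 < e -> exists x, (forall I, 0 < x I) /\ forall I, (x I)^-1 + \sum_J c I J * x J <= frak_m alpha p pi + e.
Proof.
move=> e0; have [_ [x [x0 ->]] hx] := inf_adherent e0 frak_inf.
by exists x; split => // I; apply: le_trans (val_ge x I) (ltW hx).
Qed.

(** If no moment exceeded [low ^+ (k + k)], [frak_feasible] would give a point of value below the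
    infimum. *)
Lemma frak_lo low : 0 < low -> low < frak_m alpha p pi -> exists k I, (0 < k)%N /\ low ^+ (k + k) < ms c k I.
Proof.
move=> l0 lM; have [//|no] := pselect (exists k I, (0 < k)%N /\ low ^+ (k + k) < ms c k I).
set M := frak_m alpha p pi in lM; exfalso.
have h k I : ms c k I <= low ^+ (k + k).
  case: (posnP k) => [->|k0]; first by rewrite ms0 expr0.
  by rewrite leNgt; apply/negP => hk; apply: no; exists k, I.
(* Two intermediate levels strictly between [low] and [M], as [frak_feasible] requires. *)
have p1 : low < (2 * low + M) / 3 by lra.
have p2 : (2 * low + M) / 3 < (low + 2 * M) / 3 by lra.
have [x [x0 hx]] := frak_feasible ccoef_ge0 l0 p1 h p2.
have : M <= (low + 2 * M) / 3.
  apply: (@le_trans _ _ (val x)); last by apply: val_le => //; lra.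
  by apply: (ge_inf (proj2 frak_inf)); exists x.
lra.
Qed.
End FrakM.

Lemma sum2_cst (R : realType) K (c : R) : \sum_(k < K) \sum_(m < K) c = K%:R * K%:R * c.
Proof. by rewrite sum_ord_cst sum_ord_cst mulrA. Qed.

Lemma absB_le (R : realType) (u s v : R) : `|s - u| <= v -> u <= s + v.
Proof. by rewrite ler_norml => /andP[]; lra. Qed.

(** The budget of 8: 4 for the kept transitions, 3 for the dropped ones and 1 for the change of
    centring. *)
Lemma opnorm_sandwich (R : realType) (M0 e1 a b u v : R) : `|a - b| <= e1 -> b <= u + v -> u <= b + v ->
  u <= M0 + 4 * e1 -> v <= 3 * e1 -> M0 - 4 * e1 <= u -> `|a - M0| <= 8 * e1.
Proof. by rewrite !ler_norml => /andP[x1 x2] *; apply/andP; split; lra. Qed.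

(** * From conditional bounds to the unconditional probability *)

Section Final.
Variables (R : realType) (K d n L : nat) (part : 'I_d -> 'I_K) (p : 'M[R]_K) (pi : 'I_K -> R) (kap : R).
Hypothesis hp : stochastic p.
Hypothesis hpi : equilibrium p pi.
Hypothesis d_gt0 : (0 < d)%N.
Hypothesis hkap : forall I, d%:R <= kap * bsz R part I.
Variables (M0 e1 eta C del t2 : R).
Local Notation dev s k m := (trans_count R k m s - n%:R * (pi k * p k m)).
Local Notation r := (Num.sqrt (d%:R / n.+1%:R) : R).
Let gd (s : {ffun 'I_n.+1 -> 'I_K}) := forall k m, `|dev s k m| <= del * n.+1%:R.
Hypothesis hC : forall k m, cluster_Ex p pi (fun s : {ffun 'I_n.+1 -> 'I_K} => dev s k m ^+ 2) <= n.+1%:R * C.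
Hypothesis U1 : forall s, gd s -> Pr (cond_law R part s) (fun w => M0 + 4 * e1 < opnorm (HF part s (@nxt n) r (T1 n L) w)) <= eta.
Hypothesis U2 : forall s, gd s -> Pr (cond_law R part s) (fun w => 3 * e1 < opnorm (HF part s (@nxt n) r (T2 n L) w)) <= eta.
Hypothesis LO : forall s, gd s -> Pr (cond_law R part s) (fun w => opnorm (HF part s (@nxt n) r (T1 n L) w) < M0 - 4 * e1) <= eta.
Hypothesis ht2 : r * kap ^+ 2 / d%:R * (K%:R * K%:R * t2) <= e1.
Hypothesis t2_gt0 : 0 < t2.
Hypothesis del_gt0 : 0 < del.
Hypothesis eta_ge0 : 0 <= eta.

(** Two thresholds for the same deviations: [del * n.+1] keeps the coefficients close to their
    limits, [t2] makes the change of centring small. Otherwise a quadratic functional with small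
    mean is at least 1, as Markov's inequality needs. *)
Lemma dev_split (s : {ffun 'I_n.+1 -> 'I_K}) :
  (forall k m, `|dev s k m| <= del * n.+1%:R /\ `|dev s k m| <= t2) \/
  1 <= \sum_k \sum_m (dev s k m ^+ 2 / (del * n.+1%:R) ^+ 2 + dev s k m ^+ 2 / t2 ^+ 2).
Proof.
have [h|h] := pselect (forall k m, `|dev s k m| <= del * n.+1%:R /\ `|dev s k m| <= t2); [by left|right].
have t10 : 0 < del * n.+1%:R by rewrite mulr_gt0.
have term k m : 0 <= dev s k m ^+ 2 / (del * n.+1%:R) ^+ 2 + dev s k m ^+ 2 / t2 ^+ 2.
  by rewrite addr_ge0 // divr_ge0 ?sqr_ge0.
have big a t : 0 < t -> t < `|a| -> 1 <= a ^+ 2 / t ^+ 2 :> R.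
  move=> t0 ta; rewrite ler_pdivlMr ?exprn_gt0 // mul1r -[a ^+ 2]real_normK ?num_real //.
  by apply: lerXn2r; rewrite ?nnegrE ?(ltW t0) // ltW.
have [k /existsNP[m hm]] : exists k, ~ forall m, `|dev s k m| <= del * n.+1%:R /\ `|dev s k m| <= t2.
  by apply/existsNP.
apply: (@le_trans _ _ (dev s k m ^+ 2 / (del * n.+1%:R) ^+ 2 + dev s k m ^+ 2 / t2 ^+ 2)); last first.
  rewrite [leRHS](bigD1 k) //= [X in _ <= X + _](bigD1 m) //= -[leRHS]addrA lerDl.
  by rewrite addr_ge0 // sumr_ge0 // => i _; rewrite sumr_ge0.
case: (lerP `|dev s k m| (del * n.+1%:R)) => [h1|/(big _ _ t10) h1].
  case: (lerP `|dev s k m| t2) => [h2|/(big _ _ t2_gt0) h2]; first by exfalso; apply: hm.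
  by apply: (le_trans h2); rewrite lerDr divr_ge0 ?sqr_ge0.
by apply: (le_trans h1); rewrite lerDl divr_ge0 ?sqr_ge0.
Qed.

Lemma final_bound :
  prob_event n.+1 part p pi (fun z => 8 * e1 < `| opnorm (Mmat n.+1 part p pi z) - M0 |) <=
  3 * eta + K%:R * K%:R * (n.+1%:R * C / (del * n.+1%:R) ^+ 2 + n.+1%:R * C / t2 ^+ 2).
Proof.
rewrite prob_event_mix.
pose B (s : {ffun 'I_n.+1 -> 'I_K}) := \sum_k \sum_m (dev s k m ^+ 2 / (del * n.+1%:R) ^+ 2 + dev s k m ^+ 2 / t2 ^+ 2).
have B0 s : 0 <= B s.
  by apply: sumr_ge0 => k _; apply: sumr_ge0 => m _; rewrite addr_ge0 // divr_ge0 ?sqr_ge0.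
apply: (@le_trans _ _ (cluster_Ex p pi (fun s => 3 * eta + B s))); last first.
  rewrite EQD (EQ1 hpi) lerD2l /B /cluster_Ex.
  under eq_bigr => s _ do rewrite mulr_sumr.
  rewrite exchange_big /= -sum2_cst; apply: ler_sum => k _.
  under eq_bigr => s _ do rewrite mulr_sumr.
  rewrite exchange_big /=; apply: ler_sum => m _.
  have E (q x a b : R) : q * (x / a + x / b) = q * x / a + q * x / b by rewrite mulrDr !mulrA.
  under eq_bigr => s _ do rewrite E.
  by rewrite big_split /= -!mulr_suml; apply: lerD; apply: ler_wpM2r; rewrite ?invr_ge0 ?sqr_ge0 //; exact: hC.
apply: EQ_le => // s; have mu0 := cond_law_ge0 R part s; have mu1 := cond_law_sum s d_gt0 hkap.
have [hg|hb] := dev_split s; last first.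
  by apply: (le_trans (Pr_le1 mu0 mu1 _)); apply: (le_trans hb); rewrite lerDr mulr_ge0.
have g1 : gd s by move=> k m; have [] := hg k m.
have hd : r * kap ^+ 2 / d%:R * \sum_k \sum_m `|dev s k m| <= e1.
  apply: le_trans ht2; apply: ler_wpM2l.
    by apply: divr_ge0 => //; apply: mulr_ge0; [exact: sqrtr_ge0|exact: sqr_ge0].
  by rewrite -sum2_cst; apply: ler_sum => k _; apply: ler_sum => m _; have [] := hg k m.
apply: (@le_trans _ _ (Pr (cond_law R part s) (fun w => (M0 + 4 * e1 < opnorm (HF part s (@nxt n) r (T1 n L) w)) ||
   (3 * e1 < opnorm (HF part s (@nxt n) r (T2 n L) w)) || (opnorm (HF part s (@nxt n) r (T1 n L) w) < M0 - 4 * e1)))); last first.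
  apply: (le_trans (Pr_U mu0 _ _)); rewrite -[leLHS]addr0.
  have h1 := U1 g1; have h2 := U2 g1; have h3 := LO g1.
  have h4 := Pr_U mu0 (fun w => M0 + 4 * e1 < opnorm (HF part s (@nxt n) r (T1 n L) w)) (fun w => 3 * e1 < opnorm (HF part s (@nxt n) r (T2 n L) w)).
  apply: lerD => //; apply: (le_trans (lerD (le_trans h4 (lerD h1 h2)) h3)).
  by rewrite le_eqVlt; apply/orP; left; apply/eqP; move: eta; clear => e; ring.
apply: (Ex_le_supp (sig := s)) => w hw.
have hs : clus part w = s by apply/ffunP => t; rewrite ffunE hw.
have := le_trans (M_HF hp hpi d_gt0 hkap hs) hd; rewrite (@HF_T12 n L R K d part s).
move: (HF part s _ r (T1 n L) w) (HF part s _ r (T2 n L) w) => H1 H2 hM.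
have D1 := opnormD H1 H2; have D2 : opnorm H1 <= opnorm (H1 + H2) + opnorm H2.
  by have := opnorm_dist (H1 + H2) H1; rewrite addrAC subrr add0r => /absB_le.
case: (ltP (M0 + 4 * e1) (opnorm H1)) => [_|b1]; first by rewrite ler_nat leq_b1.
case: (ltP (3 * e1) (opnorm H2)) => [_|b2]; first by rewrite ler_nat leq_b1.
case: (ltP (opnorm H1) (M0 - 4 * e1)) => [_|b3]; first by rewrite ler_nat leq_b1.
rewrite ler_nat leqn0 eqb0 -leNgt.
exact: opnorm_sandwich hM D1 D2 b1 b2 b3.
Qed.
End Final.
Lemma tiny_le (R : realType) d (r : R) q e e' : e <= e' -> tiny d r q e -> tiny d r q e'.
Proof. by move=> h [h1 h2 h3]; split => //; apply: le_trans h. Qed.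

(** The moment index [k] and the tolerance [dl] are fixed before the block length [ell], which is
    later chosen in terms of [dl]. *)
Lemma lower_unif_low (R : realType) K (alpha : 'I_K -> R) (p : 'M[R]_K) (pi : 'I_K -> R) (low : R) :
  (forall k, 0 < alpha k) -> stochastic p -> equilibrium p pi -> low < frak_m alpha p pi ->
  exists k dl, 0 < dl /\ forall ell (kap lam eta del : R) (cb : 'I_(K + K) -> 'I_(K + K) -> R) x,
  0 <= kap -> (forall I, 0 < x I) -> 0 < lam -> 0 < del ->
  (forall I, (x I)^-1 + \sum_J cb I J * x J + del <= lam) -> 0 < eta ->
  exists2 e0, 0 < e0 & exists q0, forall d n part sig nx g r (T : {set 'I_n}) q,
    @model R K d n ell part g r kap -> good nx g ell T -> (forall I J, chat part sig nx r T I J <= cb I J) ->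
    tiny d r q e0 -> (q0 <= q)%N ->
    (forall (T' : {set 'I_n}) I J, T' \subset T -> (#|T :\: T'| <= ell * k)%N -> ccoef alpha p pi I J - dl <= chat part sig nx r T' I J) ->
    Pr (cond_law R part sig) (fun w => opnorm (HF part sig nx r T w) < low) <= eta.
Proof.
move=> a0 hp hpi hlow; have [low0|low0] := lerP low 0.
  exists 0%N, 1; split => // ell kap lam eta del cb x _ _ _ _ _ eta0; exists 1 => //; exists 0%N => *.
  rewrite /Pr /Ex big1 ?(ltW eta0) // => w _; rewrite ltNge (le_trans low0) ?opnorm_ge0 //= mulr0 //.
set M := frak_m alpha p pi in hlow; pose l' := (low + M) / 2.
have l1 : low < l' by rewrite /l'; lra.
have l2 : l' < M by rewrite /l'; lra.
have l0 : 0 < l' by apply: lt_trans l1.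
have [k [I [k0 hk]]] := frak_lo a0 hp hpi l0 l2.
pose th := (low / l') ^+ 2.
have y1 : low / l' < 1 by rewrite ltr_pdivrMr // mul1r.
have y0 : 0 <= low / l' by rewrite divr_ge0 // ltW.
have th1 : th < 1 by rewrite /th expr2; exact: (le_lt_trans (ler_piMr y0 (ltW y1)) y1).
have th0 : 0 <= th by apply: sqr_ge0.
have c0 := ccoef_ge0 a0 hp hpi.
(* Turns an additive loss in the coefficients into the multiplicative factor [th]. Zero coefficients
   then stay zero, and by [ms_scale] the moment scales by [th ^+ k], which is exactly the room
   between [low] and [l']. *)
have [dl dl0 hdl] : exists2 dl, 0 < dl & forall I J, 0 < ccoef alpha p pi I J -> 1 * dl <= (1 - th) * ccoef alpha p pi I J.
  apply: near_ex; apply: filter_forall => I1; apply: filter_forall => J1.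
  have [h|h] := lerP (ccoef alpha p pi I1 J1) 0.
    by apply: nearW.
  have hh : 0 < (1 - th) * ccoef alpha p pi I1 J1 by rewrite mulr_gt0 // subr_gt0.
  by have := near_lin 1 hh; apply: filterS.
exists k, dl; split => // ell kap lam eta del cb x kap0 x0 lam0 del0 hx eta0.
pose cl I J := th * ccoef alpha p pi I J.
have cl0 I1 J1 : 0 <= cl I1 J1 by rewrite mulr_ge0.
have hms : low ^+ (k + k) < ms cl k I.
  rewrite /cl ms_scale; have -> : low ^+ (k + k) = th ^+ k * l' ^+ (k + k).
    by rewrite /th -exprM mul2n -addnn -exprMn divfK // gt_eqF.
  by rewrite ltr_pM2l // exprn_gt0 // exprn_gt0 // divr_gt0.
have [e0 e00 [q0 H]] := lower_unif ell kap0 x0 lam0 del0 hx eta0 cl0 k0 (ltW low0) hms.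
exists e0 => //; exists q0 => d n part sig nx g r T q hm gT hcb ht hq hT.
apply: (H d n part sig nx g r T q) => // T' I1 J1 sT cT; rewrite /cl.
have [h|h] := lerP (ccoef alpha p pi I1 J1) 0.
  have -> : ccoef alpha p pi I1 J1 = 0 by apply: le_anti; rewrite h c0.
  by rewrite mulr0 chat_ge0.
apply: le_trans (hT T' I1 J1 sT cT); have := hdl I1 J1 h; rewrite mul1r mulrBl mul1r.
by rewrite !lerBrDr addrC.
Unshelve. all: by end_near.
Qed.

Lemma sum_cst_I (R : realType) K (c : R) : \sum_(J < K + K) c = (K + K)%:R * c.
Proof. exact: sum_ord_cst. Qed.

Lemma chat_aux1 (R : realType) (a b c kd kn dm : R) : 0 <= b - a -> b - c <= kd + kn + dm / 8 ->
  kd <= dm / 8 -> kn <= dm / 8 -> 0 <= dm -> a <= c + dm.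
Proof. lra. Qed.
Lemma chat_aux2 (R : realType) (a b c kd kn dm : R) : b - a <= dm / 8 + dm / 8 -> - (kd + kn + dm / 8) <= b - c ->
  kd <= dm / 8 -> kn <= dm / 8 -> 0 <= dm -> c - dm <= a.
Proof. lra. Qed.

Section Chats.
Variables (R : realType) (K d n L : nat) (part : 'I_d -> 'I_K) (p : 'M[R]_K) (pi alpha : 'I_K -> R) (kap : R).
Hypothesis hp : stochastic p.
Hypothesis hpi : equilibrium p pi.
Hypothesis d_gt0 : (0 < d)%N.
Hypothesis hkap : forall I, d%:R <= kap * bsz R part I.
Hypothesis L2 : (1 < L)%N.
Local Notation r := (Num.sqrt (d%:R / n.+1%:R) : R).
Variables (del dm : R) (k : nat) (s : {ffun 'I_n.+1 -> 'I_K}).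
Hypothesis hN : forall k m, `|trans_count R k m s - n%:R * (pi k * p k m)| <= del * n.+1%:R.
Hypothesis he : forall k, `|d%:R / (block_size part k)%:R - (alpha k)^-1| <= dm / 8.
Hypothesis hdel : kap * del <= dm / 8.
Hypothesis hn1 : kap * n.+1%:R^-1 <= dm / 8.
Hypothesis hL : 2 * kap / L%:R <= dm / 8.
Hypothesis hLk : 2 * kap * (L * k)%:R * n.+1%:R^-1 <= dm / 8.
Hypothesis dm_ge0 : 0 <= dm.
Let ch T := chat part s (@nxt n) r T.

Lemma r2b_le I : r ^+ 2 / bsz R part I <= kap * n.+1%:R^-1.
Proof.
rewrite sqr_sqrtr ?divr_ge0 // mulrAC; apply: ler_wpM2r; first by rewrite invr_ge0.
by rewrite ler_pdivrMr // (bsz_gt0 d_gt0 hkap).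
Qed.

Lemma card_T2_le : kap * n.+1%:R^-1 * (2 * #|T2 n L|%:R) <= 2 * kap / L%:R.
Proof.
have k0 := kap_ge0 d_gt0 hkap; have L0 : 0 < L%:R :> R by rewrite ltr0n ltnW.
have -> : kap * n.+1%:R^-1 * (2 * #|T2 n L|%:R) = 2 * kap * (#|T2 n L|%:R / n.+1%:R).
  by move: (n.+1%:R^-1) => u; ring.
apply: ler_wpM2l; first by rewrite mulr_ge0.
by rewrite ler_pdivrMr // mulrC ler_pdivlMr // -natrM ler_nat; apply: card_T2.
Qed.

(** At most a fraction [1 / L] of the transitions is dropped, so their matrix has small coefficients
    and hence small norm. *)
Lemma chat_T2 I J : ch (T2 n L) I J <= 2 * kap / L%:R.
Proof.
apply: le_trans card_T2_le; apply: (@le_trans _ _ (r ^+ 2 / bsz R part I * (2 * #|T2 n L|%:R))).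
  apply: ler_wpM2l; first by rewrite divr_ge0 ?sqr_ge0 ?bsz_ge0.
  rewrite mulrC; apply: le_trans (sum_cst_le _ (leqnn _)) => //.
  apply: ler_sum => t _; rewrite -natrD ler_nat; by case: (_ && _); case: (_ && _).
by apply: ler_wpM2r; [rewrite mulr_ge0|exact: r2b_le].
Qed.

Lemma chat_T1 I J : ch (T1 n L) I J <= ccoef alpha p pi I J + dm.
Proof.
have /andP[h _] := @chat_diff R K d n part s r (T1 n L) I J (sub_T1 n L).
have /ler_normlW h2 := chat_close hp hpi d_gt0 hkap I J hN he.
rewrite mulrDr in h2; exact: chat_aux1 h h2 hdel hn1 dm_ge0.
Qed.

(** What is missing is the family [T2], a fraction [1 / L], and at most [L * k] further transitions,
    negligible against [n]. *)
Lemma chat_T1_low (T' : {set 'I_n.+1}) I J : T' \subset T1 n L -> (#|T1 n L :\: T'| <= L * k)%N ->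
  ccoef alpha p pi I J - dm <= ch T' I J.
Proof.
move=> sT cT; have sT2 := fintype.subset_trans sT (sub_T1 n L).
have /andP[_ h] := @chat_diff R K d n part s r T' I J sT2.
have := chat_close hp hpi d_gt0 hkap I J hN he; rewrite ler_norml => /andP[h2 _].
have k0 := kap_ge0 d_gt0 hkap.
have cc : (#|tms n :\: T'| <= #|T2 n L| + L * k)%N.
  apply: (@leq_trans #|T2 n L :|: (T1 n L :\: T')|).
    apply: subset_leq_card; apply/fintype.subsetP => t; rewrite !inE.
    by case: (t \in T'); case: (t.+1 < _)%N; case: (_ %| _)%N.
  rewrite cardsU; apply: (leq_trans (leq_subr _ _)); by rewrite leq_add2l.
have h3 : r ^+ 2 / bsz R part I * (2 * #|tms n :\: T'|%:R) <= dm / 8 + dm / 8.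
  apply: (@le_trans _ _ (kap * n.+1%:R^-1 * (2 * (#|T2 n L|%:R + (L * k)%:R)))).
    apply: ler_pM; rewrite ?r2b_le ?divr_ge0 ?sqr_ge0 ?bsz_ge0 ?mulr_ge0 //.
    by apply: ler_wpM2l => //; rewrite -natrD ler_nat.
  rewrite mulrDr mulrDr; apply: lerD; first exact: le_trans card_T2_le hL.
  by apply: le_trans hLk; rewrite le_eqVlt; apply/orP; left; apply/eqP; move: (n.+1%:R^-1) => u; ring.
have {h3}h := le_trans h h3.
rewrite mulrDr in h2; exact: chat_aux2 h h2 hdel hn1 dm_ge0.
Qed.
End Chats.
Lemma ms_rem (R : realType) (n C e1 r d Z : R) : n * r ^+ 2 = d -> n != 0 -> r != 0 -> Z != 0 -> e1 != 0 ->
  n * C / (e1 * d / (r * Z)) ^+ 2 = C * Z ^+ 2 / e1 ^+ 2 / d.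
Proof.
by move=> <- n0 r0 Z0 e0; field; rewrite n0 r0 Z0 e0.
Qed.

Lemma sum_slack (R : realType) (I : finType) (c : I -> R) (x : I -> R) u dl e1 B : (forall J, 0 <= x J) ->
  u + \sum_J c J * x J <= B -> dl * (\sum_J x J) <= e1 -> u + \sum_J (c J + dl) * x J + e1 <= B + 2 * e1.
Proof.
move=> x0 h hS; under eq_bigr => J _ do rewrite mulrDl.
rewrite big_split /= -mulr_sumr; move: h hS; move: (\sum_J _) (\sum_J x J) => a b; lra.
Qed.

Lemma ex_scale (R : realType) (a t1 t2 : R) : 0 <= a -> 0 < t1 -> 0 < t2 ->
  exists L, [/\ (1 < L)%N, a / L%:R <= t1 & a / L%:R <= t2].
Proof.
move=> a0 t10 t20; set b1 := Num.bound (a / t1); set b2 := Num.bound (a / t2).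
have H t L : 0 < t -> (0 < L)%N -> (Num.bound (a / t) <= L)%N -> a / L%:R <= t.
  move=> t0 L0 hb; rewrite ler_pdivrMr ?ltr0n // [t * _]mulrC -ler_pdivrMr //; apply: ltW.
  apply: lt_le_trans (archi_boundP _) _; first by rewrite divr_ge0 // ltW.
  by rewrite ler_nat.
exists (b1 + b2).+2; split=> //; apply: H => //; rewrite -/b1 -/b2; clear; lia.
Qed.

Section RealFacts.
Variable R : realType.
Implicit Types a b e t u v : R.
Lemma half_bounds : 0 < 1 / 2 :> R /\ 1 / 2 <= 1 :> R. Proof. by split; lra. Qed.
Lemma add_3e a e : a + e + 2 * e <= a + 3 * e. Proof. lra. Qed.
Lemma lt_3_72 : 3 < 7 / 2 :> R. Proof. lra. Qed.
Lemma lt_72_4 : 7 / 2 < 4 :> R. Proof. lra. Qed.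
Lemma add_quarter e t : t <= e / 4 -> e / 2 + t + e / 4 <= e. Proof. lra. Qed.
Lemma eighth_le a e t : 8 * a <= t * e -> a <= e / 8 * t. Proof. move=> h; have -> : e / 8 * t = t * e / 8 by ring. lra. Qed.
Lemma final_sum e u v : u <= e / 4 -> v <= e / 4 -> 3 * (e / 6) + (u + v) <= e. Proof. lra. Qed.
Lemma div_swap a t u : 0 < t -> 0 < u -> a / t <= u -> a / u <= t.
Proof. by move=> t0 u0; rewrite !ler_pdivrMr // mulrC. Qed.
End RealFacts.

(** Fixes all constants: first a nearly optimal [x] and the moment index [k], then the block length
    [L], then the thresholds, and only then a large [d]. *)
Lemma main_near (R : realType) (K : nat) (p : 'M[R]_K) (pi al : 'I_K -> R) (n : nat -> nat) (part : forall d : nat, 'I_d -> 'I_K) :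
  (0 < K)%N -> stochastic p -> irreducible_chain p -> equilibrium p pi ->
  (forall d : nat, (K <= d)%N -> forall k : 'I_K, exists i : 'I_d, part d i = k) ->
  (forall k, 0 < al k) ->
  (forall k : 'I_K, (fun d : nat => (block_size (part d) k)%:R / d%:R : R) @ \oo --> al k) ->
  (forall d : nat, (0 < n d)%N) ->
  (fun d : nat => d%:R * ln (d%:R : R) ^+ 4 / (n d)%:R) @ \oo --> (0 : R) ->
  forall e1 e : R, 0 < e1 -> 0 < e ->
  \forall d \near \oo, prob_event (n d) (part d) p pi (fun z => 8 * e1 < `| opnorm (Mmat (n d) (part d) p pi z) - frak_m al p pi |) <= e.
Proof.
move=> K0 hp irr hpi surj a0 hal n0 hn e1 e e10 e0.
have [C C0 hC] := Nc_var hp hpi irr.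
set M0 := frak_m al p pi; have M00 : 0 <= M0 := frak_m_ge0 al p pi.
have [x [x0 hx]] := frak_up al p pi e10.
(* [d] over a block size is eventually within 1 of the corresponding [(al k)^-1]. *)
pose kap := 1 + \sum_k (al k)^-1.
have kap1 : 1 <= kap by rewrite lerDl; apply: sumr_ge0 => k _; rewrite invr_ge0 ltW.
have kap0 : 0 < kap by apply: lt_le_trans kap1.
pose S := \sum_I x I; have S0 : 0 <= S by apply: sumr_ge0 => I _; apply: ltW.
(* Raising every coefficient by [d1] costs at most [e1]; with another [e1] as slack, the level
   [M0 + e1] of [x] becomes [M0 + 3 * e1]. *)
pose d1 := e1 / (S + 1).
have d10 : 0 < d1 by rewrite divr_gt0 // ltr_wpDl.
have d1S : d1 * S <= e1 by rewrite /d1 mulrAC ler_pdivrMr ?ltr_wpDl //; apply: ler_wpM2l; rewrite ?lerDl // ltW.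
have hlow : M0 - 4 * e1 < M0 by rewrite gtrBl mulr_gt0.
have [k [dl [dl0 LOW]]] := lower_unif_low a0 hp hpi hlow.
pose dm := Num.min d1 dl; have dm0 : 0 < dm by rewrite lt_min d10.
have dm1 : dm <= d1 by rewrite ge_min lexx. have dm2 : dm <= dl by rewrite ge_min lexx orbT.
have KK0 : 0 < (K + K)%:R :> R by rewrite ltr0n addn_gt0 K0.
pose c2 := e1 ^+ 2 / (8 * (K + K)%:R).
have c20 : 0 < c2 by rewrite divr_gt0 ?mulr_gt0 // exprn_gt0.
have dm80 : 0 < dm / 8 by rewrite divr_gt0.
have kap20 : 0 <= 2 * kap by rewrite mulr_ge0 // ltW.
have [L [L2 L_1 L_2]] := ex_scale kap20 dm80 c20.
pose del := dm / (8 * kap).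
have del0 : 0 < del by rewrite divr_gt0 // mulr_gt0.
have hdel : kap * del <= dm / 8 by rewrite le_eqVlt; apply/orP; left; apply/eqP; rewrite /del; field; rewrite gt_eqF.
pose eta := e / 6; have eta0 : 0 < eta by rewrite divr_gt0.
pose cb I J := ccoef al p pi I J + d1.
have hx1 I : (x I)^-1 + \sum_J cb I J * x J + e1 <= M0 + 3 * e1.
  apply: (le_trans (sum_slack (fun J => ltW (x0 J)) (hx I) d1S)); exact: add_3e.
have lam0 : 0 < M0 + 3 * e1 by rewrite ltr_wpDl // mulr_gt0.
have ml : M0 + 3 * e1 < M0 + 7 / 2 * e1 by rewrite ltrD2l ltr_pM2r // lt_3_72.
have mm : M0 + 7 / 2 * e1 < M0 + 4 * e1 by rewrite ltrD2l ltr_pM2r // lt_72_4.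
have [e01 e010 [q01 U1]] := @upper_unif R K L kap (M0 + 3 * e1) (M0 + 7 / 2 * e1) (M0 + 4 * e1) eta e1 cb x (ltW kap0) x0 lam0 e10 hx1 ml mm eta0.
(* For the dropped transitions a constant test point suffices: its inverse is [e1 / 2], and the
   choice of [L] keeps the linear term below [e1 / 4], leaving slack [e1 / 4]. *)
have x20 : forall I : 'I_(K + K), 0 < (fun=> 2 / e1) I by move=> I; rewrite divr_gt0.
have e40 : 0 < e1 / 4 by rewrite divr_gt0.
have hx2 (I : 'I_(K + K)) : (2 / e1)^-1 + \sum_(J < K + K) (2 * kap / L%:R) * (2 / e1) + e1 / 4 <= e1.
  rewrite sum_cst_I; have h : (K + K)%:R * (2 * kap / L%:R * (2 / e1)) <= e1 / 4.
    apply: (@le_trans _ _ ((K + K)%:R * (c2 * (2 / e1)))).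
      by apply: ler_wpM2l; [exact: ltW|apply: ler_wpM2r => //; rewrite divr_ge0 // ltW].
    rewrite le_eqVlt; apply/orP; left; apply/eqP; rewrite /c2; field.
    by rewrite (gt_eqF e10) -natrD (gt_eqF KK0).
  rewrite invf_div; exact: add_quarter h.
have ml2 : e1 < 2 * e1 by rewrite -{1}(mul1r e1) ltr_pM2r // ltr1n.
have mm2 : 2 * e1 < 3 * e1 by rewrite ltr_pM2r // ltr_nat.
have [e02 e020 [q02 U2]] := @upper_unif R K 1 kap e1 (2 * e1) (3 * e1) eta (e1 / 4) (fun _ _ => 2 * kap / L%:R) (fun=> 2 / e1) (ltW kap0) x20 e10 e40 hx2 ml2 mm2 eta0.
have [e03 e030 [q03 U3]] := LOW L kap (M0 + 3 * e1) eta e1 cb x (ltW kap0) x0 lam0 e10 hx1 eta0.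
pose e00 := Num.min e01 (Num.min e02 e03).
have e000 : 0 < e00 by rewrite !lt_min e010 e020.
have [le1 le2 le3] : [/\ e00 <= e01, e00 <= e02 & e00 <= e03] by rewrite /e00 !ge_min !lexx !orbT.
pose rho := (M0 + 3 * e1) / (M0 + 7 / 2 * e1).
have m10 : 0 < M0 + 7 / 2 * e1 by apply: lt_trans ml.
have rho0 : 0 <= rho by rewrite divr_ge0 // ltW.
have rho1 : rho < 1 by rewrite ltr_pdivrMr // mul1r.
have [h12 h12'] := half_bounds R.
have [B hB] := pow_small rho0 rho1 h12.
have hB1 : rho ^+ B.+1 <= 1 / 2 by rewrite exprS; apply: le_trans hB; apply: ler_piMl; [rewrite exprn_ge0|exact: ltW].
have hB2 : (e1 / (2 * e1)) ^+ B.+1 <= 1 / 2.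
  have -> : e1 / (2 * e1) = 1 / 2 by field; rewrite gt_eqF.
  by rewrite exprS; apply: ler_piMr; [exact: ltW|apply: exprn_ile1 => //; exact: ltW].
have hB20 : 0 <= e1 / (2 * e1) by rewrite divr_ge0 ?mulr_ge0 // ltW.
have halc : \forall d \near \oo, forall k0, `|d%:R / (block_size (part d) k0)%:R - (al k0)^-1| <= dm / 8 /\ `|d%:R / (block_size (part d) k0)%:R - (al k0)^-1| <= 1.
  apply: filter_forall => k0.
  have h : (fun d : nat => d%:R / (block_size (part d) k0)%:R : R) @ \oo --> (al k0)^-1.
    have -> : (fun d : nat => d%:R / (block_size (part d) k0)%:R : R) = (fun d : nat => ((block_size (part d) k0)%:R / d%:R)^-1).
      by apply/funext => d; rewrite invf_div.
    exact: cvgV (lt0r_neq0 (a0 k0)) (hal k0).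
  near=> d; split; rewrite distrC; near: d; [move/cvgrPdist_le: h; exact|move/cvgrPdist_le: h; exact].
(* Lower bounds required of the path length: two for the coefficients and one for the Markov bound
   at the threshold [del]. [A2] does the same for [d] and the threshold [t2]. *)
pose A1 : R := Num.max (8 * kap / dm) (Num.max (8 * (2 * kap * (L * k)%:R) / dm) (K%:R * K%:R * (C / del ^+ 2) / (e / 4))).
pose Z : R := kap ^+ 2 * (K%:R * K%:R).
pose A2 : R := K%:R * K%:R * (C * Z ^+ 2 / e1 ^+ 2) / (e / 4).
near=> d.
have d0 : (0 < d)%N by rewrite -(ltr_nat R); apply: (@lt_le_trans _ _ 1) => //; near: d; exact: near_nat.
have Kd : (K <= d)%N by rewrite -(ler_nat R); near: d; exact: near_nat.
have hA1 : A1 <= (n d)%:R.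
  apply: (@le_trans _ _ d%:R); first by near: d; exact: near_nat.
  by near: d; exact: d_le_n_near n0 hn.
have hA2 : A2 <= d%:R by near: d; exact: near_nat.
have ht : tiny d (Num.sqrt (d%:R / (n d)%:R)) (B.+1 * up_log 2 d).-1 e00 by near: d; apply: (tiny_near hn).
have hr1 : d%:R * rho ^+ ((B.+1 * up_log 2 d).-1.+1 + (B.+1 * up_log 2 d).-1.+1) <= e00 by near: d; apply: rho_near.
have hr2 : d%:R * (e1 / (2 * e1)) ^+ ((B.+1 * up_log 2 d).-1.+1 + (B.+1 * up_log 2 d).-1.+1) <= e00 by near: d; apply: rho_near.
have hq : (q01 + q02 + q03 <= (B.+1 * up_log 2 d).-1)%N by near: d; apply: (q_near R).
have hal2 : forall k0, `|d%:R / (block_size (part d) k0)%:R - (al k0)^-1| <= dm / 8 /\ `|d%:R / (block_size (part d) k0)%:R - (al k0)^-1| <= 1 by near: d.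
move: (B.+1 * up_log 2 d).-1 ht hr1 hr2 hq => q ht hr1 hr2 hq.
have hkap (I : 'I_(K + K)) : d%:R <= kap * bsz R (part d) I.
  rewrite bsz_un; have [_ h] := hal2 (un I); have [i hi] := surj d Kd (un I).
  have b0 : 0 < (block_size (part d) (un I))%:R :> R by rewrite ltr0n /block_size card_gt0; apply/set0Pn; exists i; rewrite inE hi.
  rewrite -ler_pdivrMr //; move: h => /ler_normlW h; apply: (@le_trans _ _ (1 + (al (un I))^-1)); first by rewrite -lerBlDr.
  by rewrite lerD2l (bigD1 (un I)) //= lerDl; apply: sumr_ge0 => j _; rewrite invr_ge0 ltW.
have := n0 d; move: hA1 ht; case: (n d) => [//|N] hA1 ht _.
have N0 : 0 < N.+1%:R :> R by [].
move: hA1; rewrite /A1 !ge_max => /and3P[a1 a2 a3].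
have dmp : 0 < dm by [].
have hn1 : kap * N.+1%:R^-1 <= dm / 8.
  by move: a1; rewrite ler_pdivrMr // => a1; rewrite ler_pdivrMr //; exact: eighth_le.
have hLk : 2 * kap * (L * k)%:R * N.+1%:R^-1 <= dm / 8.
  by move: a2; rewrite ler_pdivrMr // => a2; rewrite ler_pdivrMr //; exact: eighth_le.
have dR : 0 < d%:R :> R by rewrite ltr0n.
set r : R := Num.sqrt (d%:R / N.+1%:R) in ht.
have rp : 0 < r by rewrite sqrtr_gt0 divr_gt0.
have nr : N.+1%:R * r ^+ 2 = d%:R by rewrite sqr_sqrtr ?divr_ge0 // mulrCA divff ?mulr1.
have md1 : model L (part d) (@g1 N L) r kap by split => //; [exact: ltW|rewrite nr|exact: g1_lt].
have md2 : model 1 (part d) (@g2 N L) r kap by split => //; [exact: ltW|rewrite nr|exact: g2_lt].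
have K1 : 0 < K%:R :> R by rewrite ltr0n.
have Z0 : 0 < Z by rewrite /Z !mulr_gt0 // exprn_gt0.
(* The largest deviation for which the change of centring stays within [e1]. As [n * r ^ 2 = d], the
   corresponding Markov bound is of order [1 / d]. *)
pose t2 := e1 * d%:R / (r * Z).
have t20 : 0 < t2 by rewrite divr_gt0 // mulr_gt0.
have ht2 : r * kap ^+ 2 / d%:R * (K%:R * K%:R * t2) <= e1.
  rewrite le_eqVlt; apply/orP; left; apply/eqP; rewrite /t2 /Z; field.
  by rewrite (gt_eqF rp) (gt_eqF kap0) (gt_eqF K1) (gt_eqF dR).
have he8 : forall k0, `|d%:R / (block_size (part d) k0)%:R - (al k0)^-1| <= dm / 8 by move=> k0; have [] := hal2 k0.
have FB := @final_bound R K d N L (part d) p pi kap hp hpi d0 hkap M0 e1 eta C del t2 (fun a b => hC a b N).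
apply: (le_trans (FB _ _ _ ht2 t20 del0 (ltW eta0))).
- move=> s hs; apply: (U1 d N.+1 (part d) s (@nxt N) (@g1 N L) r (T1 N L) q md1 (good_T1 N L2)) => //.
  + move=> I J; have h : chat (part d) s (@nxt N) r (T1 N L) I J <= ccoef al p pi I J + dm := chat_T1 L hp hpi d0 hkap hs he8 hdel hn1 (ltW dm0) I J.
    by apply: (le_trans h); rewrite lerD2l.
  + exact: tiny_le le1 ht.
  + exact: le_trans hr1 le1.
  + by clear - hq; lia.
- move=> s hs; apply: (U2 d N.+1 (part d) s (@nxt N) (@g2 N L) r (T2 N L) q md2 (good_T2 N L2)) => //.
  + by move=> I J; exact (chat_T2 d0 hkap L2 s I J).
  + exact: tiny_le le2 ht.
  + exact: le_trans hr2 le2.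
  + by clear - hq; lia.
- move=> s hs; apply: (U3 d N.+1 (part d) s (@nxt N) (@g1 N L) r (T1 N L) q md1 (good_T1 N L2)) => //.
  + move=> I J; have h : chat (part d) s (@nxt N) r (T1 N L) I J <= ccoef al p pi I J + dm := chat_T1 L hp hpi d0 hkap hs he8 hdel hn1 (ltW dm0) I J.
    by apply: (le_trans h); rewrite lerD2l.
  + exact: tiny_le le3 ht.
  + by clear - hq; lia.
  + move=> T' I J sT cT.
    have h : ccoef al p pi I J - dm <= chat (part d) s (@nxt N) r T' I J := chat_T1_low hp hpi d0 hkap L2 hs he8 hdel hn1 L_1 hLk (ltW dm0) I J sT cT.
    by apply: le_trans h; rewrite lerD2l lerN2.
rewrite (ms_rem C nr) ?gt_eqF // mulrDr.
have b1 : K%:R * K%:R * (N.+1%:R * C / (del * N.+1%:R) ^+ 2) <= e / 4.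
  have -> : K%:R * K%:R * (N.+1%:R * C / (del * N.+1%:R) ^+ 2) = K%:R * K%:R * (C / del ^+ 2) / N.+1%:R.
    by field; rewrite (gt_eqF del0) gt_eqF.
  by apply: div_swap a3 => //; rewrite divr_gt0.
have b2 : K%:R * K%:R * (C * Z ^+ 2 / e1 ^+ 2 / d%:R) <= e / 4.
  by rewrite mulrA; apply: div_swap hA2 => //; rewrite divr_gt0.
exact: final_sum b1 b2.
Unshelve. all: by end_near.
Qed.
Lemma prob_event_ge0 (R : realType) (K d n : nat) (part : 'I_d -> 'I_K) (p : 'M[R]_K) (pi : 'I_K -> R) E :
  stochastic p -> equilibrium p pi -> 0 <= prob_event n part p pi E.
Proof.
move=> [p1 _] [q1 _]; apply: sumr_ge0 => z _; rewrite /path_prob mulr_ge0 //.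
  by apply: prodr_ge0 => s _; rewrite /block_init divr_ge0.
apply: prodr_ge0 => s _; apply: prodr_ge0 => t _; rewrite /block_trans divr_ge0 //.
by have /andP[] := p1 (part (z s)) (part (z t)).
Qed.

Unset Implicit Arguments.
Unset Strict Implicit.

Theorem theorem7 (R : realType) (K : nat) (p : 'M[R]_K) (pi : 'I_K -> R)
  (alpha : 'I_K -> rat) (n : nat -> nat) (part : forall d : nat, 'I_d -> 'I_K) :
  (0 < K)%N ->
  ergodic_chain p ->
  equilibrium p pi ->
  (forall d : nat, (K <= d)%N -> forall k : 'I_K, exists i : 'I_d, part d i = k) ->
  (forall k : 'I_K, 0 < alpha k) ->
  (forall k : 'I_K,
     (fun d : nat => (block_size (part d) k)%:R / d%:R : R) @ \oo --> (ratr (alpha k) : R)) ->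
  (forall d : nat, (0 < n d)%N) ->
  (fun d : nat => d%:R * ln (d%:R : R) ^+ 4 / (n d)%:R) @ \oo --> (0 : R) ->
  forall eps : R, 0 < eps ->
    (fun d : nat =>
       prob_event (n d) (part d) p pi
         (fun z => eps < `| opnorm (Mmat (n d) (part d) p pi z)
                            - frak_m (fun k => ratr (alpha k)) p pi |))
      @ \oo --> (0 : R).
Proof.
move=> K0 [hp [irr _]] hpi surj a0 hal n0 hn eps eps0.
apply/cvgrPdist_le => e e0.
have al0 k : 0 < ratr (alpha k) :> R by rewrite ltr0q.
have eps8 : 0 < eps / 8 by rewrite divr_gt0.
have := main_near K0 hp irr hpi surj al0 hal n0 hn eps8 e0; apply: filterS => d.
have -> : 8 * (eps / 8) = eps by field.
by rewrite sub0r normrN ger0_norm // prob_event_ge0.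
Qed.
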